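(* Assume that the initial positions are - either i.i.d. according to $m$, with $\int_{\mathbb R}\sqrt{F_0(x)(1-F_0(x))}\,dx<\infty$, - or optimal deterministic, with $\sup_{x\ge1}x\int_x^{+\infty}\left(F_0(-y)+1-F_0(y)\right)dy<\infty$. Then there exists $C<\infty$ such that for all $N\in\mathbb N^*$, $$\sup_{t\le T}\mathbb E\left[\mathcal W_1(\mu^{N,0}_t,\mu_t)\right]\le\frac C{\sqrt N}.$$ Moreover, if $\lambda$ is Lipschitz continuous, then there exists $C<\infty$ such that for all $N\in\mathbb N^*$ and all $h\in(0,T]$, $$\sup_{t\le T}\mathbb E\left[\mathcal W_1(\mu^{N,h}_t,\mu_t)\right]\le C\left(\frac1{\sqrt N}+h\right).$$
   Context: Fix $T>0$, $\sigma>0$, a $C^1$ function $\Lambda:[0,1]\to\mathbb R$ with derivative $\lambda$, and a probability measure $m$ on $\mathbb R$ with cumulative distribution function $F_0$ and quantile function $F_0^{-1}(u)=\inf\{x:F_0(x)\ge u\}$. Limit: $X$ is the unique strong solution of $X_t=X_0+\sigma W_t+\int_0^t\lambda(F(s,X_s))\,ds$ with $F(s,x)=\mathbb P(X_s\le x)$, where $X_0\sim m$ is independent of the Brownian motion $W$; $\mu_t$ is the law of $X_t$. Particles: $(W^i)_{i\ge1}$ are independent standard Brownian motions, independent of the initial positions. For $1\le i\le N$ let $\lambda^N(i)=N(\Lambda(i/N)-\Lambda((i-1)/N))$. For $h>0$ let $\tau^h_s=\lfloor s/h\rfloor h$, and $\tau^0_s=s$. For $h\in[0,T]$, $(X^{i,N,h})_{1\le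 i\le N}$ solves $$X^{i,N,h}_t=X^i_0+\sigma W^i_t+\int_0^t\lambda^N\Big(\sum_{j=1}^N\mathbf 1_{\{X^{j,N,h}_{\tau^h_s}\le X^{i,N,h}_{\tau^h_s}\}}\Big)ds$$ ($h=0$: the continuous-time particle system; $h>0$: its Euler discretization). Put $\mu^{N,h}_t=\frac1N\sum_{i=1}^N\delta_{X^{i,N,h}_t}$. Initial positions are ''optimal deterministic'' if $X^i_0=F_0^{-1}\left(\frac{2i-1}{2N}\right)$ for $1\le i\le N$; ''i.i.d. according to $m$'' means $(X^i_0)_{i\ge1}$ are i.i.d. with law $m$. $\mathcal W_1(\mu,\nu)$ is the Wasserstein distance of index $1$ on $\mathbb R$, equal to $\int_{\mathbb R}|F_\mu(x)-F_\nu(x)|dx$ for the cumulative distribution functions $F_\mu,F_\nu$. Constants do not depend on $N$, $h$. *)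

(* Defs.v *)
From HB Require Import structures.
From mathcomp Require Import all_boot all_order all_algebra finmap.
From mathcomp Require Import all_classical all_reals all_analysis.

Set Implicit Arguments.
Unset Strict Implicit.
Unset Printing Implicit Defensive.

Import Order.TTheory GRing.Theory Num.Theory.
Import numFieldNormedType.Exports.

Local Open Scope classical_set_scope.
Local Open Scope ring_scope.

(* [Lambda] is C^1 on the closed interval [0, 1] with derivative [lambda]; the
   derivative is one-sided at 0 and 1, and the values outside [0, 1] are
   irrelevant. *)
Definition C1_on01 (R : realType) (Lambda lambda : R -> R) : Prop :=
  (forall x, 0 <= x <= 1 ->
    (Lambda y - Lambda x) / (y - x) @[y --> within `[0, 1] x^'] --> lambda x) /\
  {within `[0, 1], continuous lambda}.

Section one_dimensional_laws.
Variable R : realType.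

Definition cdf_of (m : probability (measurableTypeR R) R) (x : R) : R :=
  fine (m `]-oo, x]%classic).

Definition quantile (m : probability (measurableTypeR R) R) (u : R) : R :=
  inf [set x | u <= cdf_of m x].

Definition is_coupling (mu nu : set (measurableTypeR R) -> \bar R)
    (pi : probability (measurableTypeR R * measurableTypeR R)%type R) : Prop :=
  forall A, measurable A ->
    pi (A `*` setT) = mu A /\ pi (setT `*` A) = nu A.

Definition wasserstein1 (mu nu : set (measurableTypeR R) -> \bar R) : \bar R :=
  ereal_inf [set (\int[pi]_z `|z.1 - z.2|%:E)%E
            | pi in [set pi | is_coupling mu nu pi]].

Definition empirical (N : nat) (x : 'I_N -> R) :
    set (measurableTypeR R) -> \bar R :=
  fun A => ((N%:R^-1)%:E * \sum_(i < N) \d_(x i) A)%E.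

End one_dimensional_laws.

Section independence.
Variables (R : realType) (d : measure_display) (Omega : measurableType d).
Variable P : probability Omega R.

Definition sigma_family (I : Type) (D : set I) (Z : I -> Omega -> R) :
    set (set Omega) :=
  <<s \bigcup_(i in D)
        preimage_set_system setT (Z i : Omega -> measurableTypeR R) measurable >>.

Definition sigma_rv (Z : Omega -> R) : set (set Omega) :=
  sigma_family [set: unit] (fun=> Z).

Definition independent2 (F G : set (set Omega)) : Prop :=
  forall A B, F A -> G B -> P (A `&` B) = (P A * P B)%E.

Definition mutually_independent (I : choiceType) (F : I -> set (set Omega)) :
    Prop :=
  forall (J : {fset I}) (E : I -> set Omega),
    (forall i, i \in J -> F i (E i)) ->
    P (\bigcap_(i in [set` J]) E i) = (\prod_(i <- J) P (E i))%E.

End independence.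

Section processes.
Variables (R : realType) (d : measure_display) (Omega : measurableType d).
Variable P : probability Omega R.

(* Time runs over [0, +oo[; the values at negative times are irrelevant. *)

Definition is_filtration (G : R -> set (set Omega)) : Prop :=
  [/\ forall t, 0 <= t -> sigma_algebra setT (G t),
      forall t, 0 <= t -> G t `<=` measurable
    & forall s t, 0 <= s -> s <= t -> G s `<=` G t].

Definition standard_brownian_motion (W : R -> {RV P >-> R}) : Prop :=
  [/\ {ae P, forall w, W 0 w = 0},
      {ae P, forall w, {within `[0, +oo[, continuous (fun t => W t w)}},
      forall s t, 0 <= s -> s < t -> forall A : set (measurableTypeR R),
        measurable A ->
        P ((fun w => W t w - W s w) @^-1` A) = normal_prob 0 (Num.sqrt (t - s)) A
    & forall s t, 0 <= s -> s < t ->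
        independent2 P (sigma_rv (fun w => W t w - W s w))
                       (sigma_family `[0, s] (fun u => W u))].

(* The P-completed filtration generated by an initial position and a driving
   process. *)
Definition completed_filtration (X0 : {RV P >-> R}) (W : R -> {RV P >-> R})
    (t : R) : set (set Omega) :=
  <<s sigma_rv X0 `|` sigma_family `[0, t] (fun u => W u)
      `|` [set A | measurable A /\ P A = 0%E] >>.

(* Strong solution on [0, T] of
     X_t = X0 + sigma W_t + int_0^t lambda (F (s, X_s)) ds,
   where F (s, .) is the cumulative distribution function of X_s. *)
Record limit_solution (T sigma : R) (lambda : R -> R)
    (m : probability (measurableTypeR R) R)
    (X0 : {RV P >-> R}) (W X : R -> {RV P >-> R}) : Prop := {
  limit_noise : standard_brownian_motion W ;
  limit_init : forall A, measurable A -> distribution P X0 A = m A ;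
  limit_indep :
    independent2 P (sigma_rv X0) (sigma_family `[0, +oo[ (fun t => W t)) ;
  limit_adapted : forall t, 0 <= t <= T ->
    sigma_rv (X t) `<=` completed_filtration X0 W t ;
  limit_continuous :
    {ae P, forall w, {within `[0, T], continuous (fun t => X t w)}} ;
  limit_eq : {ae P, forall w, forall t, 0 <= t <= T ->
    X t w = X0 w + sigma * W t w +
      \int[lebesgue_measure]_(s in `[0, t]) lambda (fine (cdf (X s) (X s w)))} }.

Definition lambdaN (Lambda : R -> R) (N k : nat) : R :=
  N%:R * (Lambda (k%:R / N%:R) - Lambda ((k%:R - 1) / N%:R)).

Definition tau (h s : R) : R :=
  if h == 0 then s else (Num.floor (s / h))%:~R * h.

(* Solution on [0, T], with respect to the filtration [G], of the system of [N]
   particles; [h = 0] is the continuous-time system and [h > 0] its Euler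
   discretization. *)
Record particle_solution (T sigma : R) (Lambda : R -> R) (N : nat) (h : R)
    (G : R -> set (set Omega)) (xi : 'I_N -> {RV P >-> R})
    (W X : 'I_N -> R -> {RV P >-> R}) : Prop := {
  particle_filtration : is_filtration G ;
  particle_init : forall i, sigma_rv (xi i) `<=` G 0 ;
  particle_noise_adapted : forall i t, 0 <= t -> sigma_rv (W i t) `<=` G t ;
  particle_noise_increments : forall s t, 0 <= s -> s < t ->
    independent2 P
      (sigma_family [set: 'I_N] (fun i w => W i t w - W i s w)) (G s) ;
  particle_adapted : forall i t, 0 <= t <= T -> sigma_rv (X i t) `<=` G t ;
  particle_continuous : forall i,
    {ae P, forall w, {within `[0, T], continuous (fun t => X i t w)}} ;
  particle_eq : forall i, {ae P, forall w, forall t, 0 <= t <= T ->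
    X i t w = xi i w + sigma * W i t w +
      \int[lebesgue_measure]_(s in `[0, t])
        lambdaN Lambda N
          (\sum_(j < N) (X j (tau h s) w <= X i (tau h s) w)%R)%N} }.

(* The Brownian motions are independent, and independent of all the initial
   positions [xi N i] jointly (index [None]). *)
Definition independent_noise (xi : forall N, 'I_N -> {RV P >-> R})
    (W : nat -> R -> {RV P >-> R}) : Prop :=
  (forall i, standard_brownian_motion (W i)) /\
  mutually_independent P (fun k : option nat =>
    if k is Some i then sigma_family `[0, +oo[ (fun t => W i t)
    else sigma_family [set: {N : nat & 'I_N}]
           (fun p => xi (projT1 p) (projT2 p))).

Definition iid_init (m : probability (measurableTypeR R) R)
    (xi : forall N, 'I_N -> {RV P >-> R}) : Prop :=
  exists Z : nat -> {RV P >-> R},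
    [/\ mutually_independent P (fun i => sigma_rv (Z i)),
        forall i A, measurable A -> distribution P (Z i) A = m A
      & forall N (i : 'I_N) w, xi N i w = Z i w].

(* Particles are numbered from 0, so the i-th midpoint (2 i - 1) / (2 N) of the
   1-based numbering becomes (2 i + 1) / (2 N). *)
Definition optimal_init (m : probability (measurableTypeR R) R)
    (xi : forall N, 'I_N -> {RV P >-> R}) : Prop :=
  forall N (i : 'I_N) w,
    xi N i w = quantile m ((2 * i + 1)%N%:R / (2 * N)%N%:R).

End processes.

Section error.
Variables (R : realType).
Variables (d' : measure_display) (Omega' : measurableType d').
Variable P' : probability Omega' R.
Variables (d : measure_display) (Omega : measurableType d).
Variable P : probability Omega R.

(* sup_{t <= T} E [W_1 (mu^N_t, mu_t)], with mu^N_t the empirical measure of the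
   particles [Y] and mu_t the law of [X_t]. *)
Definition sup_error (T : R) (X : R -> {RV P' >-> R}) (N : nat)
    (Y : 'I_N -> R -> {RV P >-> R}) : \bar R :=
  ereal_sup [set (\int[P]_w wasserstein1 (empirical (fun i => Y i t w))
                                         (distribution P' (X t)))%E
            | t in `[0, T]].

End error.

(* Main.v *)
Require Import Defs.
From HB Require Import structures.
From mathcomp Require Import all_boot all_order all_algebra finmap.
From mathcomp Require Import all_classical all_reals all_analysis.
From mathcomp Require Import measurable_realfun real_interval ring lra zify.

Set Implicit Arguments.
Unset Strict Implicit.
Unset Printing Implicit Defensive.

Import Order.TTheory GRing.Theory Num.Theory.
Import numFieldNormedType.Exports.

Local Open Scope classical_set_scope.
Local Open Scope ring_scope.

(* The empirical distribution function of the particles and the distribution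
   function F of the limit satisfy, up to an error that is small in L^1(dx), the
   same discrete mild equation
     F_t = heat_t F_0 - sum_k delta * dconv_(t - k delta) (Lambda o F_(k delta)),
   where heat and dconv are the convolutions with a centred Gaussian law and with
   the derivative of its density. It is obtained by telescoping
   Phi_(t - t_k) (x - X_(t_k)) along a time grid, Phi_s being the Gaussian
   distribution function of variance sigma^2 s. For the particles, the telescoped
   sum contains orthogonal martingale increments, whose average over the N
   particles is O(1 / sqrt N) in a weighted L^2 norm, hence in L^1; and averaging
   the rank drift gives Lambda at the empirical distribution function, as there
   are no ties at positive times. The mean L^1 distance of the two distribution
   functions, which controls W_1, then satisfies an inequality with kernel
   1 / sqrt (t - s), closed by a singular Gronwall lemma.

   For the Euler scheme one uses the grid of the scheme: the particles then carry
   no freezing error, and the limit satisfies the coarse mild equation up to O(h)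
   when lambda is Lipschitz, because F_t has a density of order 1 / sqrt t, so
   that the heat flow over a time r commutes with Lambda up to O(r / sqrt t). *)

(** * L^1 norms and Tonelli *)

(** The limit and the particles live on unrelated probability spaces, so trajectories are not
    coupled: only the deterministic function F is compared with the empirical distribution function.
    Bounding the variances of the martingale increments one by one would meet singular kernels;
    instead the squares of Phi telescope, and what remains, up to drift errors, is Phi (1 - Phi) at
    time 0, which is integrable against the weight (1 + |x|)^(3/2). The inverse of this weight is
    integrable, which turns weighted L^2 into L^1, and its moments follow from a quadratic decay of
    the tails, which both assumptions on the initial positions entail. For the continuous-time
    system N is fixed while the grid step tends to 0: the freezing errors depend on N but vanish, so
    continuity of lambda is enough. For the Euler scheme the grid step remains h, and errors of
    order h are kept on both sides. The drifts are not assumed measurable in time, so their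
    integrals enter through bounds on increments. *)

Section L1.
Context d (T : measurableType d) (R : realType).
Variable m : {measure set T -> \bar R}.

Implicit Types (f g : T -> R).

Definition L1 (f : T -> R) : \bar R := (\int[m]_x `|f x|%:E)%E.

Lemma L1_ge0 f : (0 <= L1 f)%E.
Proof. by apply: integral_ge0 => x _; rewrite lee_fin. Qed.

(* The integral of a nonnegative function, measurable or not, is a supremum over its simple minorants. *)
Lemma ge0_le_integral_nomeas (f g : T -> \bar R) :
  (forall x, (0 <= f x)%E) -> (forall x, (f x <= g x)%E) ->
  (\int[m]_x f x <= \int[m]_x g x)%E.
Proof.
move=> f0 fg; have g0 x : (0 <= g x)%E by apply: le_trans (fg x).
rewrite !ge0_integralTE//; apply: ereal_sup_le => _ [h hf <-].
by exists h => //= x; apply: le_trans (fg x).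
Qed.

Lemma le_L1 f g : (forall x, `|f x| <= `|g x|) -> (L1 f <= L1 g)%E.
Proof. by move=> fg; apply: ge0_le_integral_nomeas => x; rewrite lee_fin. Qed.

Lemma L1D f g : measurable_fun setT f -> measurable_fun setT g ->
  (L1 (fun x => f x + g x)%R <= L1 f + L1 g)%E.
Proof.
move=> mf mg; rewrite /L1 -ge0_integralD//=; last 2 first.
- by apply/measurable_EFinP; apply: measurableT_comp.
- by apply/measurable_EFinP; apply: measurableT_comp.
by apply: ge0_le_integral_nomeas => x; rewrite -?EFinD lee_fin// ler_normD.
Qed.

Lemma L1B f g : measurable_fun setT f -> measurable_fun setT g ->
  (L1 (fun x => f x - g x)%R <= L1 f + L1 g)%E.
Proof.
move=> mf mg; have := @L1D f (fun x => - g x) mf (measurable_funN mg).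
by rewrite /L1 (_ : (fun x => `|- g x|%:E) = (fun x => `|g x|%:E))//; apply/funext => x; rewrite normrN.
Qed.

Lemma L1Z c f : measurable_fun setT f -> L1 (fun x => (c * f x)%R) = (`|c|%:E * L1 f)%E.
Proof.
move=> mf; rewrite /L1 -ge0_integralZl_EFin//.
- by apply: eq_integral => x _; rewrite -EFinM normrM.
- by apply/measurable_EFinP; apply: measurableT_comp.
Qed.

Lemma L1_sum (I : Type) (s : seq I) (f : I -> T -> R) :
  (forall i, measurable_fun setT (f i)) ->
  (L1 (fun x => \sum_(i <- s) f i x)%R <= \sum_(i <- s) L1 (f i))%E.
Proof.
move=> mf; elim: s => [|i s ih].
  rewrite big_nil /L1 (_ : (fun x => _) = cst 0%E) ?integral0//.
  by apply/funext => x; rewrite big_nil normr0.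
rewrite big_cons (_ : (fun x => \sum_(j <- i :: s) f j x) = (fun x => f i x + \sum_(j <- s) f j x)).
  apply: le_trans (L1D _ _) _ => //; last exact: leeD.
  by apply: measurable_sum.
by apply/funext => x; rewrite big_cons.
Qed.

Lemma L1_sum_ord n (f : 'I_n -> T -> R) :
  (forall i, measurable_fun setT (f i)) ->
  (L1 (fun x => (\sum_(i < n) f i x)%R) <= \sum_(i < n) L1 (f i))%E.
Proof. by move=> mf; exact: L1_sum. Qed.

End L1.
Arguments L1 {d T R} m f.

Section lebesgue_affine.
Variable R : realType.
Notation mu := (@lebesgue_measure R).
Implicit Types (f : R -> \bar R).

(** Uniqueness of Lebesgue measure: c times its image under x -> c x gives ]a, b] its length. *)
Lemma ge0_integral_scale (c : R) f : 0 < c ->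
  measurable_fun [set: R] f -> (forall x, (0 <= f x)%E) ->
  (\int[mu]_x f x = c%:E * \int[mu]_x f (c * x)%R)%E.
Proof.
move=> c0 mf f0.
pose h (x : R) : measurableTypeR R := c * x.
have mh : measurable_fun setT h by exact: mulrl_measurable.
have <- : (\int[pushforward mu h]_y f y = \int[mu]_x f (c * x)%R)%E.
  by rewrite ge0_integral_pushforward.
have -> : (c = (NngNum (ltW c0))%:num) by [].
rewrite -ge0_integral_mscale//; apply: eq_measure_integral => A mA _.
apply: lebesgue_measure_unique => // _ [[a b] _ <-].
transitivity (c%:E * mu (h @^-1` `]a, b]%classic))%E; last by [].
have -> : h @^-1` `]a, b]%classic = `]a / c, b / c]%classic.
  apply/seteqP; split => x /=; rewrite !in_itv/= /h ltr_pdivrMr// ler_pdivlMr// (mulrC c)//.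
rewrite !lebesgue_measure_itv/= !lte_fin ltr_pM2r ?invr_gt0//.
case: ifPn => _; last by rewrite mule0.
by rewrite -!EFinB -EFinM -mulrBl mulrC divfK// gt_eqF.
Qed.

Lemma ge0_integral_shift (a : R) f :
  measurable_fun [set: R] f -> (forall x, (0 <= f x)%E) ->
  (\int[mu]_x f (x + a)%R = \int[mu]_x f x)%E.
Proof.
move=> mf f0.
pose h (x : R) : measurableTypeR R := x + a.
have mh : measurable_fun setT h by exact: measurable_funD.
have -> : (\int[mu]_x f (x + a)%R = \int[pushforward mu h]_y f y)%E.
  by rewrite ge0_integral_pushforward.
apply: eq_measure_integral => A mA _.
apply/esym/lebesgue_measure_unique => // _ [[u v] _ <-].
transitivity (mu (h @^-1` `]u, v]%classic)); last by [].
have -> : h @^-1` `]u, v]%classic = `]u - a, v - a]%classic.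
  by apply/seteqP; split => x /=; rewrite !in_itv/= /h ltrBlDr lerBrDr.
rewrite !lebesgue_measure_itv/= !lte_fin ltrD2r.
by case: ifPn => // _; rewrite -!EFinB; congr EFin; ring.
Qed.

Lemma ge0_integral_reflect f :
  measurable_fun [set: R] f -> (forall x, (0 <= f x)%E) ->
  (\int[mu]_x f (- x)%R = \int[mu]_x f x)%E.
Proof.
move=> mf f0.
have -> : (\int[mu]_x f (- x)%R = \int[pushforward mu (-%R : _ -> measurableTypeR R)]_y f y)%E.
  by rewrite ge0_integral_pushforward.
by apply: eq_measure_integral => A mA _; exact: lebesgue_measureN.
Qed.

Lemma ge0_integral_subl (a : R) f :
  measurable_fun [set: R] f -> (forall x, (0 <= f x)%E) ->
  (\int[mu]_x f (a - x)%R = \int[mu]_x f x)%E.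
Proof.
move=> mf f0; rewrite -(@ge0_integral_reflect f)//.
rewrite -(@ge0_integral_shift (- a) (fun x => f (- x)%R))//.
  by apply: eq_integral => x _; rewrite opprD opprK addrC.
exact: measurableT_comp.
Qed.

End lebesgue_affine.

Section tonelli.
Context d1 d2 (T1 : measurableType d1) (T2 : measurableType d2) (R : realType).
Variables (m1 : {sigma_finite_measure set T1 -> \bar R}) (m2 : {sigma_finite_measure set T2 -> \bar R}).

Lemma measurable_fun_curry1 d3 (T3 : measurableType d3) (f : T1 * T2 -> T3) x :
  measurable_fun setT f -> measurable_fun setT (fun y => f (x, y)).
Proof. by move=> mf; apply: measurableT_comp => //; exact: pair1_measurable. Qed.

Lemma measurable_fun_curry2 d3 (T3 : measurableType d3) (f : T1 * T2 -> T3) y :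
  measurable_fun setT f -> measurable_fun setT (fun x => f (x, y)).
Proof. by move=> mf; apply: measurableT_comp => //; exact: pair2_measurable. Qed.

Lemma measurable_fun_Rintegral (f : T1 * T2 -> R) : measurable_fun setT f ->
  measurable_fun setT (fun x => \int[m2]_y f (x, y)).
Proof.
move=> mf; apply: measurableT_comp; first exact: fine_measurable.
rewrite (_ : (fun x => _) = (fun x => \int[m2]_y ((EFin \o f)^\+ (x, y)) - \int[m2]_y ((EFin \o f)^\- (x, y)))%E).
  apply: emeasurable_funB.
    by apply: measurable_fun_fubini_tonelli_F => //; apply: measurable_funepos; apply/measurable_EFinP.
  by apply: measurable_fun_fubini_tonelli_F => //; apply: measurable_funeneg; apply/measurable_EFinP.
by apply/funext => x; rewrite [LHS]integralE; congr (_ - _)%E; apply: eq_integral => y _; rewrite !(funeposE, funenegE).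
Qed.

(* Minkowski's integral inequality for kernels applied to one variable. *)
Lemma L1_Rintegral_le (f : T1 * T2 -> R) : measurable_fun setT f ->
  (forall x, m2.-integrable setT (fun y => (f (x, y))%:E)) ->
  (L1 m1 (fun x => (\int[m2]_y f (x, y))%R) <= \int[m2]_y L1 m1 (fun x => f (x, y)))%E.
Proof.
move=> mf fi.
have -> : (\int[m2]_y L1 m1 (fun x => f (x, y)) = \int[m1]_x \int[m2]_y `|f (x, y)|%:E)%E.
  rewrite (@fubini_tonelli _ _ _ _ _ m1 m2 (fun z => `|f z|%:E))//=.
  by apply/measurable_EFinP; apply: measurableT_comp.
apply: ge0_le_integral_nomeas => x; first by rewrite lee_fin.
rewrite EFin_normr_Rintegral//; last exact: fi.
exact: (le_abse_integral m2 measurableT (measurable_int m2 (fi x))).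
Qed.

End tonelli.

(** * Gaussian kernels *)

Section density.
Context d (T : measurableType d) (R : realType).
Variables (mu nu : {measure set T -> \bar R}) (p : T -> R).
Hypotheses (p0 : forall x, 0 <= p x) (mp : measurable_fun setT p).
Hypothesis nuE : forall A, measurable A -> nu A = (\int[mu]_(x in A) (p x)%:E)%E.

Import HBNNSimple.

Let density_indic E : measurable E ->
  (\int[nu]_x (\1_E x)%:E = \int[mu]_x ((\1_E x)%:E * (p x)%:E))%E.
Proof.
move=> mE; rewrite integral_indic//= setIT nuE// integral_mkcond.
apply: eq_integral => x _; rewrite patchE indicE; case: ifPn => _; last by rewrite mul0e.
by rewrite mul1e.
Qed.

Let density_nnsfun (f : {nnsfun T >-> R}) :
  (\int[nu]_x (f x)%:E = \int[mu]_x ((f x)%:E * (p x)%:E))%E.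
Proof.
under [LHS]eq_integral do rewrite fimfunE -fsumEFin//.
rewrite [LHS]ge0_integral_fsum//; last 2 first.
  - by move=> r; exact/measurable_EFinP/measurableT_comp.
  - by move=> n x _; rewrite EFinM nnfun_muleindic_ge0.
transitivity (\int[mu]_x (\sum_(k \in range f) ((k * \1_(f @^-1` [set k]) x)%:E * (p x)%:E)))%E; last first.
  apply: eq_integral => x _; rewrite [in RHS]fimfunE -fsumEFin// ge0_mule_fsuml//.
  by move=> r; rewrite EFinM nnfun_muleindic_ge0.
rewrite [RHS]ge0_integral_fsum//; last 2 first.
  - move=> r; apply: emeasurable_funM; last exact/measurable_EFinP.
    exact/measurable_EFinP/measurableT_comp.
  - by move=> n x _; apply: mule_ge0; rewrite ?lee_fin// -lee_fin EFinM nnfun_muleindic_ge0.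
apply: eq_fsbigr => r _; rewrite integralZl_indic_nnsfun//= density_indic//.
have [r0|r0] := ltP r 0.
  rewrite preimage_nnfun0// !integral0_eq ?mule0// => x _.
    by rewrite indicE in_set0 mulr0 mul0e.
  by rewrite indicE in_set0 mul0e.
rewrite -ge0_integralZl//.
- by apply: eq_integral => x _; rewrite EFinM muleA.
- apply: emeasurable_funM; last exact/measurable_EFinP.
  exact/measurable_EFinP.
- by move=> x _; rewrite mule_ge0// lee_fin.
Qed.

(** Indicators, then simple functions, then monotone limits. *)
Lemma ge0_integral_density (f : T -> \bar R) :
  measurable_fun setT f -> (forall x, 0 <= f x)%E ->
  (\int[nu]_x f x = \int[mu]_x (f x * (p x)%:E))%E.
Proof.
move=> mf f0.
pose f_ := nnsfun_approx measurableT mf.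
transitivity (lim (\int[nu]_x (f_ n x)%:E @[n --> \oo])%E).
  rewrite -monotone_convergence//=.
  - apply: eq_integral => ? /[!inE] xD; apply/esym/cvg_lim => //=.
    exact: cvg_nnsfun_approx.
  - by move=> n; exact/measurable_EFinP/measurable_funTS.
  - by move=> n ? _; rewrite lee_fin.
  - by move=> ? _ ? ? mn; rewrite lee_fin; exact/lefP/nd_nnsfun_approx.
rewrite (_ : (\int[mu]_x (f x * (p x)%:E))%E = lim
    (\int[mu]_x ((f_ n x)%:E * (p x)%:E) @[n --> \oo])%E); last first.
  rewrite -monotone_convergence//=.
  - apply: eq_integral => x /[!inE] xD; apply/esym/cvg_lim => //.
    by apply: cvgeZr => //; exact: cvg_nnsfun_approx.
  - move=> n; apply: emeasurable_funM; last exact/measurable_EFinP.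
    exact/measurable_EFinP/measurable_funTS.
  - by move=> n ? _; rewrite mule_ge0 ?lee_fin.
  - by move=> ? _ ? ? ?; rewrite lee_wpmul2r ?lee_fin//; exact/lefP/nd_nnsfun_approx.
by apply: congr_lim; apply/funext => n /=; exact: density_nnsfun.
Qed.

End density.

(** * A polynomial weight of order 3/2 *)

Section weight.
Variable R : realType.
Notation mu := (@lebesgue_measure R).

(** The power (1 + |z|)^(3/2). An exponent above 1 makes the inverse integrable, an exponent below 2
    has finite moments under tails of order 1 / y^2; 3/2 meets both requirements. *)
Definition weight (z : R) : R := (1 + `|z|) * Num.sqrt (1 + `|z|).

Lemma weight_ge1 z : 1 <= weight z.
Proof.
rewrite /weight -[leLHS]mulr1 ler_pM ?lerDl//.
by rewrite -[leLHS]sqrtr1 ler_wsqrtr// lerDl.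
Qed.

Lemma weight_ge0 z : 0 <= weight z.
Proof. by apply: le_trans (weight_ge1 z). Qed.
Hint Resolve weight_ge0 : core.

Lemma weight_gt0 z : 0 < weight z.
Proof. by apply: lt_le_trans (weight_ge1 z). Qed.

Lemma le_weight y z : `|y| <= `|z| -> weight y <= weight z.
Proof.
move=> yz; rewrite /weight ler_pM ?addr_ge0 ?sqrtr_ge0 ?lerD2l//.
by rewrite ler_wsqrtr// lerD2l.
Qed.

Lemma weightM y z : weight (y * z) <= weight y * weight z.
Proof.
rewrite /weight mulrACA -sqrtrM ?addr_ge0//.
have h : 1 + `|y * z| <= (1 + `|y|) * (1 + `|z|).
  rewrite normrM mulrDl mul1r mulrDr mulr1.
  have := normr_ge0 y; have := normr_ge0 z; lra.
by rewrite ler_pM ?addr_ge0 ?sqrtr_ge0// ler_wsqrtr.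
Qed.

(** The argument of larger modulus dominates, and doubling it multiplies the weight by at most
    2^(3/2), rounded up to 4. *)
Lemma weightD y z : weight (y + z) <= 4 * (weight y + weight z).
Proof.
wlog yz : y z / `|y| <= `|z|.
  by move=> H; have /orP[/H//|/H] := le_total `|y| `|z|; rewrite addrC (addrC (weight z)).
apply: (@le_trans _ _ (weight (2 * z))).
  apply: le_weight; rewrite normrM (@ger0_norm _ 2)// mulr_natl mulr2n.
  by rewrite (le_trans (ler_normD _ _))// lerD2r.
apply: (@le_trans _ _ (4 * weight z)); last by rewrite ler_pM2l// lerDr.
rewrite /weight normrM (@ger0_norm _ 2)//.
have h : 1 + 2 * `|z| <= 2 ^+ 2 * (1 + `|z|) by have := normr_ge0 z; lra.
have h' : 1 + 2 * `|z| <= 2 * (1 + `|z|) by have := normr_ge0 z; lra.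
have -> : 4 * ((1 + `|z|) * Num.sqrt (1 + `|z|)) = (2 * (1 + `|z|)) * (2 * Num.sqrt (1 + `|z|)) :> R by ring.
rewrite ler_pM ?addr_ge0 ?mulr_ge0 ?sqrtr_ge0//.
apply: le_trans (ler_wsqrtr h) _.
by rewrite sqrtrM ?exprn_ge0// sqrtr_sqr ger0_norm.
Qed.


(** The weight increases with the modulus, so over [a, b] it is largest at an endpoint. *)
Lemma weight_between x a b : a <= x <= b -> weight x <= weight a + weight b.
Proof.
move=> /andP[ax xb]; have [x0|x0] := leP 0 x.
  apply: (@le_trans _ _ (weight b)); last by rewrite lerDr.
  by apply: le_weight; rewrite !ger0_norm//; apply: le_trans xb.
apply: (@le_trans _ _ (weight a)); last by rewrite lerDl.
apply: le_weight; rewrite (ltr0_norm x0) ltr0_norm ?lerN2//.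
exact: le_lt_trans ax x0.
Qed.

Lemma continuous_weight : continuous weight.
Proof.
have h : continuous (fun z : R => 1 + `|z|).
  by move=> z; apply: cvgD; [exact: cvg_cst|exact: (@norm_continuous _ R^o)].
move=> z; apply: cvgM; first exact: h.
by apply: (@cvg_comp _ _ _ (fun z : R => 1 + `|z|) Num.sqrt _ _ _ (h z)); exact: sqrt_continuous.
Qed.

Lemma measurable_weight : measurable_fun setT weight.
Proof. by apply: continuous_measurable_fun; exact: continuous_weight. Qed.

(** By parity this is twice the integral over [0, +oo[, where - 2 / sqrt (1 + y) is a primitive; 4
    is the exact value. *)
Lemma integral_inv_weight : (\int[mu]_z ((weight z)^-1)%:E <= 4%:E)%E.
Proof.
have cV : continuous (fun z => (weight z)^-1).
  by move=> z; apply: cvgV; [rewrite gt_eqF ?weight_gt0|exact: continuous_weight].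
rewrite ge0_symfun_integralT//; first last.
- by move=> z; rewrite /weight/= normrN.
- by move=> z; rewrite invr_ge0.
have -> : [set x : R | 0 <= x] = `[0, +oo[%classic.
  by apply/seteqP; split => x /=; rewrite in_itv/= andbT.
pose F (y : R) : R := - 2 * (Num.sqrt (1 + y))^-1.
have dF (y : R) : 0 < 1 + y -> is_derive y 1 F ((1 + y) * Num.sqrt (1 + y))^-1.
  move=> y0.
  have s0 : Num.sqrt (1 + y) != 0 by rewrite gt_eqF// sqrtr_gt0.
  have h1 : is_derive y 1 (fun y : R => 1 + y) 1.
    by rewrite -[X in is_derive _ _ _ X]add0r; apply: is_deriveD.
  have h2 : is_derive y 1 (fun y : R => Num.sqrt (1 + y)) ((2 * Num.sqrt (1 + y))^-1).
    have := @is_derive1_comp R (@Num.sqrt R) (fun y : R => 1 + y) y _ _ (is_derive1_sqrt y0) h1.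
    by rewrite mulr1.
  have h3 := @is_deriveV R (fun y : R => Num.sqrt (1 + y)) y _ _ s0 h2.
  have h4 := is_deriveZ (-2) h3.
  apply: (is_derive_eq h4); rewrite /GRing.scale/=.
  rewrite -[X in _ = (X * _)^-1](@sqr_sqrtr _ (1 + y)) ?ltW//; field.
  by rewrite s0.
have -> : (\int[mu]_(x in `[0%R, +oo[) ((weight x)^-1)%:E = 0%:E - (F 0)%:E)%E; last first.
  by rewrite /F addr0 sqrtr1 invr1 -EFinB -EFinM lee_fin; lra.
apply: ge0_continuous_FTC2y.
- by move=> x _; rewrite invr_ge0.
- exact: continuous_subspaceT.
- rewrite /F -[X in _ --> X](mulr0 (- 2)); apply: cvgM; first exact: cvg_cst.
  apply/gtr0_cvgV0.
    by near=> x; rewrite sqrtr_gt0 ltr_wpDr//; near: x; exact: nbhs_pinfty_ge.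
  apply/cvgryPge => A; near=> x.
  have x0 : 0 <= x by near: x; exact: nbhs_pinfty_ge.
  apply: (@le_trans _ _ (Num.sqrt (A ^+ 2))); first by rewrite sqrtr_sqr ler_norm.
  apply: ler_wsqrtr; apply: (@le_trans _ _ x); last by rewrite lerDr.
  by near: x; apply: nbhs_pinfty_ge; exact: num_real.
- by move=> x x0; have [] := dF x; rewrite // ltr_wpDr// ltW.
- apply: cvg_at_right_filter; apply: differentiable_continuous.
  by apply/derivable1_diffP; have [] := dF 0; rewrite // addr0.
- move=> x; rewrite in_itv/= andbT => x0; rewrite derive1E.
  have := dF x; rewrite ltr_wpDr ?ltW// => /(_ isT) [_ ->].
  by rewrite /weight ger0_norm ?ltW.
Unshelve. all: by end_near. Qed.

End weight.

Section gaussian.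
Variable R : realType.
Notation mu := (@lebesgue_measure R).

Definition phi : R -> R := normal_pdf 0 1.
Definition gam : probability (measurableTypeR R) R := normal_prob 0 1.
Definition peak : R := normal_peak 1.

Lemma phiE (v : R) : phi v = peak * expR (- (v ^+ 2 / 2)).
Proof.
rewrite /phi normal_pdfE ?oner_eq0// /peak /normal_fun subr0 expr1n; congr (_ * expR _).
by rewrite mulNr -[1 *+ 2]/(2%:R).
Qed.

Lemma peak_gt0 : 0 < peak. Proof. by apply: normal_peak_gt0; rewrite oner_eq0. Qed.

Lemma phi_ge0 v : 0 <= phi v. Proof. exact: normal_pdf_ge0. Qed.

Lemma phi_le_peak v : phi v <= peak.
Proof. by apply: normal_pdf_ub; rewrite oner_eq0. Qed.

Lemma continuous_phi : continuous phi.
Proof. by apply: continuous_normal_pdf; rewrite oner_eq0. Qed.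

Lemma measurable_phi : measurable_fun [set: R] phi.
Proof. exact: measurable_normal_pdf. Qed.

Lemma gamE (f : R -> \bar R) : measurable_fun [set: R] f -> (forall x, (0 <= f x)%E) ->
  (\int[gam]_v f v = \int[mu]_v (f v * (phi v)%:E))%E.
Proof.
move=> mf f0; apply: ge0_integral_density => //.
- exact: phi_ge0.
- exact: measurable_phi.
Qed.

Lemma peak_le1 : peak <= 1.
Proof.
rewrite /peak /normal_peak expr1n mul1r invf_le1.
  rewrite -[leLHS]sqrtr1 ler_wsqrtr// mulr2n.
  have := @pi_ge2 R; lra.
by rewrite sqrtr_gt0 mulrn_wgt0// pi_gt0.
Qed.

(** From 1 + u <= exp u at u = v^2 / 4 one gets (1 + |v|)^2 <= 8 exp (v^2 / 4); the square of this
    bound is absorbed by the Gaussian factor. *)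
Lemma poly_phi_le v : (1 + `|v|) ^+ 4 * phi v <= 64.
Proof.
rewrite phiE.
have e1 : (1 + `|v|) ^+ 2 <= 2 * (1 + v ^+ 2).
  have := sqr_ge0 (1 - `|v|); rewrite sqrrB sqrrD real_normK ?num_real// expr1n; lra.
have e2 : 1 + v ^+ 2 / 4 <= expR (v ^+ 2 / 4) by exact: expR_ge1Dx.
have v0 : 0 <= v ^+ 2 by exact: sqr_ge0.
have e3 : 1 + v ^+ 2 <= 4 * expR (v ^+ 2 / 4) by lra.
have e4 : (1 + `|v|) ^+ 2 <= 8 * expR (v ^+ 2 / 4) by lra.
have e5 : (1 + `|v|) ^+ 4 <= 64 * expR (v ^+ 2 / 2).
  rewrite (_ : 4%N = (2 * 2)%N)// exprM.
  apply: (@le_trans _ _ ((8 * expR (v ^+ 2 / 4)) ^+ 2)).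
    by rewrite ler_pXn2r// nnegrE ?exprn_ge0// ?addr_ge0// mulr_ge0// expR_ge0.
  rewrite exprMn -expRM_natl.
  have -> : 8 ^+ 2 = 64 :> R by ring.
  by rewrite ler_pM2l// ler_expR; lra.
apply: (@le_trans _ _ (64 * expR (v ^+ 2 / 2) * (1 * expR (- (v ^+ 2 / 2))))).
  by rewrite ler_pM ?exprn_ge0 ?addr_ge0 ?mulr_ge0 ?expR_ge0 ?(ltW peak_gt0)// ler_pM ?expR_ge0 ?peak_le1 ?(ltW peak_gt0).
by rewrite mul1r -mulrA -expRD subrr expR0 mulr1.
Qed.

(** As (1 + |v|) times the square of the weight is (1 + |v|)^4, the integrand is at most 64 / weight
    by [poly_phi_le]; 256 is 64 times the 4 of [integral_inv_weight]. *)
Lemma gam_moment : (\int[gam]_v ((1 + `|v|) * weight v)%:E <= 256%:E)%E.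
Proof.
have mf : measurable_fun [set: R] (fun v : R => (1 + `|v|) * weight v).
  apply: measurable_funM; last exact: measurable_weight.
  by apply: measurable_funD => //; exact: measurableT_comp.
rewrite gamE//; last first.
- by move=> x; rewrite lee_fin mulr_ge0 ?weight_ge0 ?addr_ge0.
- exact/measurable_EFinP.
apply: (@le_trans _ _ (\int[mu]_v (64%:E * ((weight v)^-1)%:E))%E).
  apply: ge0_le_integral_nomeas => v.
    by rewrite -EFinM lee_fin !mulr_ge0 ?weight_ge0 ?addr_ge0 ?phi_ge0.
  rewrite -!EFinM lee_fin ler_pdivlMr ?weight_gt0//.
  apply: le_trans (poly_phi_le v).
  rewrite mulrAC ler_wpM2r ?phi_ge0// -mulrA (exprS _ 3) ler_wpM2l ?addr_ge0//.
  rewrite /weight mulrACA -!expr2 sqr_sqrtr ?addr_ge0//.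
  by rewrite -exprSr.
rewrite ge0_integralZl_EFin//.
- have -> : 256%:E = (64%:E * 4%:E)%E :> \bar R by rewrite -EFinM; congr EFin; ring.
  by rewrite lee_wpmul2l ?lee_fin// integral_inv_weight.
- by move=> x _; rewrite lee_fin invr_ge0 weight_ge0.
- apply/measurable_EFinP; apply: continuous_measurable_fun => z.
  by apply: cvgV; [rewrite gt_eqF ?weight_gt0|exact: continuous_weight].
Qed.

(** As a function of its second argument, the distribution function of the Dirac mass at the first
    one. *)
Definition ind (a b : R) : R := ((a <= b)%R : bool)%:R.

Lemma ind01 a b : 0 <= ind a b <= 1.
Proof. by rewrite /ind; case: (a <= b); rewrite ?lexx ?ler01. Qed.

Lemma ind_ge0 a b : 0 <= ind a b. Proof. by case/andP: (ind01 a b). Qed.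
Lemma ind_le1 a b : ind a b <= 1. Proof. by case/andP: (ind01 a b). Qed.

Lemma measurable_ind d (T : measurableType d) (f g : T -> R) :
  measurable_fun setT f -> measurable_fun setT g ->
  measurable_fun setT (fun x => ind (f x) (g x)).
Proof.
move=> mf mg.
have mb : measurable_fun [set: T] (fun x => f x <= g x) by exact: measurable_fun_ler.
by rewrite /ind; apply: (@measurableT_comp _ _ _ _ _ _ (fun b : bool => b%:R : R)).
Qed.

(** The two indicators differ only between a and b, where w is at most w a + w b. *)
Lemma weighted_ind_diff (w : R -> R) (a b : R) :
  measurable_fun [set: R] w ->
  (forall x, 0 <= w x) -> (forall x a b, a <= x <= b -> w x <= w a + w b) ->
  (\int[mu]_x (w x * `|ind a x - ind b x|)%:E <= (`|a - b| * (w a + w b))%:E)%E.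
Proof.
move=> mw w0 wb; wlog ab : a b / a <= b.
  move=> H; have /orP[/H//|/H] := le_total a b.
  rewrite distrC (addrC (w b)); apply: le_trans.
  by apply: ge0_le_integral_nomeas => x; rewrite lee_fin ?mulr_ge0// distrC.
apply: (@le_trans _ _ (\int[mu]_(x in `[a, b]) (w a + w b)%:E)%E).
  rewrite [leRHS]integral_mkcond; apply: ge0_le_integral_nomeas => x.
    by rewrite lee_fin mulr_ge0.
  rewrite patchE; case: ifPn => [|].
    rewrite inE/= in_itv/= => /wb; rewrite lee_fin; apply: le_trans.
    rewrite ler_piMr// ler_norml; have := ind01 a x; have := ind01 b x; lra.
  rewrite notin_setE/= in_itv/= => /negP; rewrite negb_and -!ltNge => h.
  rewrite lee_fin /ind; case/orP: h => h.
    by rewrite (lt_geF h) (lt_geF (lt_le_trans h ab)) subrr normr0 mulr0.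
  by rewrite (ltW h) (ltW (le_lt_trans ab h)) subrr normr0 mulr0.
rewrite integral_cst//= lebesgue_measure_itv/= lte_fin.
case: ifPn => abl; last by rewrite mule0 lee_fin mulr_ge0// addr_ge0.
by rewrite -EFinB -EFinM lee_fin mulrC distrC ger0_norm// subr_ge0.
Qed.

(** Distribution function of the centred Gaussian of standard deviation s, written as a mean under
    the standard Gaussian so that s = 0 is covered: [Phi 0] is the Heaviside function, reached at
    the end of each grid. *)
Definition Phi (s z : R) : R := \int[gam]_v ind (s * v) z.

Lemma measurable_ind_gam (s z : R) : measurable_fun [set: R] (fun v => ind (s * v) z).
Proof. by apply: measurable_ind => //; exact: mulrl_measurable. Qed.

Lemma bounded_integrable d (T : measurableType d) (P : probability T R) (f : T -> R) (C : R) :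
  measurable_fun setT f -> (forall x, `|f x| <= C) -> P.-integrable setT (EFin \o f).
Proof.
move=> mf fC; apply: measurable_bounded_integrable => //.
  by rewrite fin_num_fun_lty//; exact: fin_num_measure.
exists `|C|; split; first exact: num_real.
by move=> M CM x _ /=; apply: le_trans (fC x) _; apply: le_trans (ler_norm _) (ltW CM).
Qed.

Lemma integrable_ind_gam (s z : R) : gam.-integrable setT (EFin \o (fun v => ind (s * v) z)).
Proof.
apply: (@bounded_integrable _ _ gam _ 1); first exact: measurable_ind_gam.
by move=> x; rewrite ger0_norm ?ind_ge0 ?ind_le1.
Qed.

Lemma PhiE s z : (Phi s z)%:E = (\int[gam]_v (ind (s * v) z)%:E)%E.
Proof. by rewrite /Phi /Rintegral fineK//; apply: integrable_fin_num => //; exact: integrable_ind_gam. Qed.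

Lemma Phi_ge0 s z : 0 <= Phi s z.
Proof. by apply: Rintegral_ge0 => v _; exact: ind_ge0. Qed.

Lemma Phi_le1 s z : Phi s z <= 1.
Proof.
rewrite -lee_fin PhiE; apply: (@le_trans _ _ (\int[gam]_v (cst 1%:E v))%E).
  by apply: ge0_le_integral_nomeas => v; rewrite lee_fin ?ind_ge0 ?ind_le1.
by rewrite integral_cst//= probability_setT mule1.
Qed.

Lemma Phi0 z : Phi 0 z = ind 0 z.
Proof.
rewrite /Phi; under eq_Rintegral do rewrite mul0r.
by rewrite Rintegral_cst//= probability_setT mulr1.
Qed.

Lemma le_Phi s a b : a <= b -> Phi s a <= Phi s b.
Proof.
move=> ab; apply: le_Rintegral => //; try exact: integrable_ind_gam.
move=> v _; rewrite /ind; have [h|//] := leP (s * v) a.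
by rewrite (le_trans h ab).
Qed.

Lemma measurable_Phi s : measurable_fun [set: R] (Phi s).
Proof.
apply: (@measurable_fun_Rintegral _ _ (measurableTypeR R) (measurableTypeR R) R gam (fun z => ind (s * z.2) z.1)).
by apply: measurable_ind => //; apply: measurable_funM.
Qed.

Lemma Phi_diff_le s a b :
  (`|Phi s a - Phi s b|%:E <= \int[gam]_v `|ind (s * v) a - ind (s * v) b|%:E)%E.
Proof.
rewrite /Phi -RintegralB//; try exact: integrable_ind_gam.
rewrite EFin_normr_Rintegral//; last first.
  by have := integrableB measurableT (integrable_ind_gam s a) (integrable_ind_gam s b).
apply: le_abse_integral => //; apply/measurable_EFinP.
by apply: measurable_funB; exact: measurable_ind_gam.
Qed.


Definition dphi (v : R) : R := - (v * phi v).
(** The density of the centred Gaussian of standard deviation s; [dgk s] is its derivative. *)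
Definition gk (s z : R) : R := s^-1 * phi (z / s).
Definition dgk (s z : R) : R := s^-1 ^+ 2 * dphi (z / s).

Lemma is_derive_phi (v : R) : is_derive v 1 phi (dphi v).
Proof.
have -> : phi = (fun v : R => peak * expR (- (v ^+ 2 / 2))) by apply/funext => u; exact: phiE.
have h1 : is_derive v 1 (fun v : R => - (v ^+ 2 / 2)) (- v).
  have h : is_derive v 1 (fun v : R => v ^+ 2) (2 * v).
    rewrite (_ : (fun v : R => v ^+ 2) = (@id R * @id R)); last by apply/funext => u; rewrite expr2.
    apply: (is_derive_eq (is_deriveM (is_derive_id v (1 : R)) (is_derive_id v (1 : R)))).
    by rewrite /GRing.scale/= mulr1 mulr_natl mulr2n.
  have h' := is_deriveN (is_deriveZ (2^-1) h).
  rewrite (_ : (fun v : R => - (v ^+ 2 / 2)) = (- (2^-1 \*: (fun v : R => v ^+ 2)))%R); last first.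
    by apply/funext => u /=; rewrite /GRing.scale/= mulrC.
  by apply: (is_derive_eq h'); rewrite /GRing.scale/=; field.
have h2 := @is_derive1_comp R expR (fun v : R => - (v ^+ 2 / 2)) v _ _ (is_derive_expR _) h1.
have h3 := is_deriveZ peak h2.
apply: (is_derive_eq h3); rewrite /dphi phiE /GRing.scale/=; ring.
Qed.

Lemma continuous_dphi : continuous dphi.
Proof. by move=> v; apply: cvgN; apply: cvgM; [exact: cvg_id|exact: continuous_phi]. Qed.

Lemma measurable_dphi : measurable_fun [set: R] dphi.
Proof. by apply: continuous_measurable_fun; exact: continuous_dphi. Qed.

(** |v| is dominated by the integrand of [gam_moment]. This crude bound is the source of the 256 in
    the estimates on the derivative kernel. *)
Lemma L1_dphi : (L1 mu dphi <= 256%:E)%E.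
Proof.
apply: le_trans gam_moment.
rewrite gamE; last first.
- by move=> x; rewrite lee_fin mulr_ge0 ?weight_ge0 ?addr_ge0.
- apply/measurable_EFinP; apply: measurable_funM; last exact: measurable_weight.
  by apply: measurable_funD => //; exact: measurableT_comp.
apply: ge0_le_integral_nomeas => v; first by rewrite lee_fin.
rewrite -EFinM lee_fin /dphi normrN normrM (ger0_norm (phi_ge0 v)) ler_wpM2r ?phi_ge0//.
rewrite -[leLHS]mulr1 ler_pM ?weight_ge1// lerDr//.
Qed.

Lemma cvg_phiy : phi x @[x --> +oo] --> (0 : R).
Proof.
apply/cvgrPdist_le => e e0; near=> x.
have x0 : 1 <= x by near: x; exact: nbhs_pinfty_ge.
have xe : 64 / e <= x by near: x; apply: nbhs_pinfty_ge; exact: num_real.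
rewrite sub0r normrN ger0_norm ?phi_ge0//.
have := poly_phi_le x; rewrite ger0_norm; last by lra.
move=> h; rewrite -(@ler_pM2l _ x); last by lra.
apply: le_trans (_ : 64 <= _); last by rewrite mulrC -ler_pdivrMl// mulrC.
apply: le_trans h; rewrite ler_wpM2r ?phi_ge0//.
apply: (@le_trans _ _ (1 + x)); first by rewrite lerDr.
by rewrite -[leLHS]expr1 ler_eXn2l//; lra.
Unshelve. all: by end_near. Qed.

Lemma is_derive_gk (s z : R) : 0 < s -> is_derive z 1 (gk s) (dgk s z).
Proof.
move=> s0.
have h1 : is_derive z 1 (fun z : R => z / s) (s^-1).
  rewrite (_ : (fun z : R => z / s) = (s^-1 \*: (@id R))); last first.
    by apply/funext => u /=; rewrite /GRing.scale/= mulrC.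
  by have := is_deriveZ (s^-1) (is_derive_id z (1 : R)); rewrite /GRing.scale/= mulr1.
have h2 := @is_derive1_comp R phi (fun z : R => z / s) z _ _ (is_derive_phi _) h1.
have h3 := is_deriveZ s^-1 h2.
apply: (is_derive_eq h3); rewrite /dgk /GRing.scale/=; ring.
Qed.

Lemma continuous_dgk s : continuous (dgk s).
Proof.
move=> z; apply: cvgM; first exact: cvg_cst.
apply: (@cvg_comp _ _ _ (fun z : R => z / s) dphi _ (nbhs (z / s))); last exact: continuous_dphi.
by apply: cvgM; [exact: cvg_id|exact: cvg_cst].
Qed.

Lemma continuous_gk s : continuous (gk s).
Proof.
move=> z; apply: cvgM; first exact: cvg_cst.
apply: (@cvg_comp _ _ _ (fun z : R => z / s) phi _ (nbhs (z / s))); last exact: continuous_phi.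
by apply: cvgM; [exact: cvg_id|exact: cvg_cst].
Qed.

Lemma measurable_gk s : measurable_fun [set: R] (gk s).
Proof. by apply: continuous_measurable_fun; exact: continuous_gk. Qed.

Lemma measurable_dgk s : measurable_fun [set: R] (dgk s).
Proof. by apply: continuous_measurable_fun; exact: continuous_dgk. Qed.

Lemma gk_ge0 s z : 0 <= s -> 0 <= gk s z.
Proof. by move=> s0; rewrite mulr_ge0 ?invr_ge0 ?phi_ge0. Qed.

Lemma gk_le s z : 0 < s -> gk s z <= s^-1.
Proof.
move=> s0; rewrite /gk ler_piMr ?invr_ge0 ?(ltW s0)//.
exact: le_trans (phi_le_peak _) peak_le1.
Qed.

Lemma L1_dgk s : 0 < s -> (L1 mu (dgk s) <= (256 / s)%:E)%E.
Proof.
move=> s0; rewrite /L1 (@ge0_integral_scale _ s)//; last first.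
  by apply/measurable_EFinP; apply: measurableT_comp => //; exact: measurable_dgk.
under eq_integral.
  move=> x _; rewrite /dgk (mulrC s) mulfK ?gt_eqF// normrM ger0_norm ?exprn_ge0 ?invr_ge0 ?(ltW s0)// EFinM.
  over.
rewrite ge0_integralZl_EFin ?exprn_ge0 ?invr_ge0 ?(ltW s0)//; last first.
  by apply/measurable_EFinP; apply: measurableT_comp => //; exact: measurable_dphi.
rewrite muleA -EFinM expr2 mulrA divff ?gt_eqF// mul1r [X in (_ <= X%:E)%E]mulrC EFinM.
by apply: lee_wpmul2l; [rewrite lee_fin invr_ge0 (ltW s0)|exact: L1_dphi].
Qed.

Lemma integral_gk s : 0 < s -> (\int[mu]_x (gk s x)%:E = 1)%E.
Proof.
move=> s0; rewrite (@ge0_integral_scale _ s)//; last first.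
- by move=> x; rewrite lee_fin gk_ge0// ltW.
- by apply/measurable_EFinP; exact: measurable_gk.
under eq_integral.
  move=> x _; rewrite /gk (mulrC s) mulfK ?gt_eqF// EFinM.
  over.
rewrite ge0_integralZl_EFin ?invr_ge0 ?(ltW s0)//; last 2 first.
- by move=> x _; rewrite lee_fin phi_ge0.
- by apply/measurable_EFinP; exact: measurable_phi.
by rewrite muleA -EFinM divff ?gt_eqF// mul1e integral_normal_pdf.
Qed.

(* The centred Gaussian of standard deviation [s] is the image of [gam] by scaling. *)
Lemma gam_scale s (f : R -> \bar R) : 0 < s -> measurable_fun [set: R] f ->
  (forall x, (0 <= f x)%E) ->
  (\int[gam]_v f (s * v)%R = \int[mu]_x (f x * (gk s x)%:E))%E.
Proof.
move=> s0 mf f0.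
rewrite gamE//; last by apply: measurableT_comp => //; exact: mulrl_measurable.
rewrite [RHS](@ge0_integral_scale _ s)//; last first.
- by move=> x; rewrite mule_ge0// lee_fin gk_ge0// ltW.
- by apply: emeasurable_funM => //; apply/measurable_EFinP; exact: measurable_gk.
rewrite -ge0_integralZl_EFin ?(ltW s0)//; last 2 first.
- by move=> x _; rewrite mule_ge0// lee_fin gk_ge0// ltW.
- apply: emeasurable_funM; first by apply: measurableT_comp => //; exact: mulrl_measurable.
  apply/measurable_EFinP; apply: measurableT_comp; [exact: measurable_gk|exact: mulrl_measurable].
apply: eq_integral => x _; rewrite muleCA -EFinM; congr (_ * _%:E)%E.
by rewrite /gk (mulrC s x) mulfK ?gt_eqF// mulrA divff ?gt_eqF// mul1r.
Qed.

Lemma PhiB s a b : 0 < s -> a <= b ->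
  ((Phi s b - Phi s a)%:E = \int[mu]_(x in `]a, b]) (gk s x)%:E)%E.
Proof.
move=> s0 ab; rewrite /Phi -RintegralB//; try exact: integrable_ind_gam.
rewrite /Rintegral fineK; last first.
  apply: integrable_fin_num => //.
  by have := integrableB measurableT (integrable_ind_gam s b) (integrable_ind_gam s a).
transitivity (\int[gam]_v ((\1_`]a, b]) (s * v))%:E)%E.
  apply: eq_integral => v _; congr EFin; rewrite indicE /ind mem_setE in_itv/=.
  have [h|h] := leP (s * v) a; last by rewrite subr0.
  by rewrite (le_trans h ab) subrr.
rewrite (@gam_scale s (fun x => (\1_`]a, b] x)%:E))//; last first.
  by apply/measurable_EFinP; exact: measurable_indic.
rewrite [RHS]integral_mkcond; apply: eq_integral => x _.
by rewrite patchE indicE; case: ifPn => _; rewrite ?mul1e ?mul0e.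
Qed.

Lemma gkB s a b : 0 < s -> a <= b ->
  ((gk s b - gk s a)%:E = \int[mu]_(x in `[a, b]) (dgk s x)%:E)%E.
Proof.
move=> s0; rewrite le_eqVlt => /predU1P[<-|ab].
  by rewrite subrr set_itv1 integral_set1.
rewrite (@continuous_FTC2 _ _ (gk s))//.
- by apply: continuous_subspaceT; exact: continuous_dgk.
- split.
  + by move=> x _; have [] := is_derive_gk x s0.
  + by apply: cvg_at_right_filter; exact: continuous_gk.
  + by apply: cvg_at_left_filter; exact: continuous_gk.
- by move=> x _; rewrite derive1E; have [_ ->] := is_derive_gk x s0.
Qed.

Lemma Phi_lipschitz s a b : 0 < s -> a <= b -> Phi s b - Phi s a <= (b - a) / s.
Proof.
move=> s0 ab; rewrite -lee_fin PhiB//.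
apply: (@le_trans _ _ (\int[mu]_(x in `]a, b]) (cst (s^-1)%:E x))%E).
  rewrite integral_mkcond [leRHS]integral_mkcond.
  by apply: ge0_le_integral_nomeas => x; rewrite !patchE; case: ifPn => _ //; rewrite lee_fin ?gk_ge0 ?gk_le// ltW.
rewrite integral_cst//= lebesgue_measure_itv/= lte_fin.
case: ifPn => abl; first by rewrite -EFinB -EFinM mulrC.
by rewrite mule0 lee_fin divr_ge0 ?subr_ge0// ltW.
Qed.

Lemma gk_osc s a b t c : 0 < s -> a <= t <= b -> a <= c <= b ->
  (`|gk s t - gk s c|%:E <= \int[mu]_(x in `[a, b]) `|dgk s x|%:E)%E.
Proof.
move=> s0; wlog ct : t c / c <= t.
  move=> H; have /orP[/H//|/H H'] := le_total c t.
  by move=> h1 h2; rewrite distrC; exact: H'.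
move=> /andP[at_ tb] /andP[ac cb].
have md : measurable_fun `[c, t] (fun x => (dgk s x)%:E).
  by apply: measurable_funTS; apply/measurable_EFinP; exact: measurable_dgk.
have -> : `|gk s t - gk s c|%:E = `|(gk s t - gk s c)%:E|%E by [].
rewrite gkB//; apply: le_trans (le_abse_integral mu _ md) _; first by [].
apply: ge0_subset_integral => //.
- by apply: measurable_funTS; apply/measurable_EFinP; apply: measurableT_comp => //; exact: measurable_dgk.
- by apply: subset_itv; rewrite bnd_simp.
Qed.

(** The increment of Phi is the integral of [gk s] over ]a, b], where the density deviates from its
    value at c by at most the integral of |dgk s|. *)
Lemma Phi_taylor s a b c : 0 < s -> a <= c <= b ->
  (`|Phi s b - Phi s a - (b - a) * gk s c|%:E <=
   (b - a)%:E * \int[mu]_(x in `[a, b]) `|dgk s x|%:E)%E.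
Proof.
move=> s0 acb; have ab : a <= b by case/andP: acb => h1 h2; exact: le_trans h1 h2.
have fin : (\int[mu]_(x in `]a, b]) (cst (gk s c)%:E x) = ((b - a) * gk s c)%:E)%E.
  rewrite integral_cst//= lebesgue_measure_itv/= lte_fin.
  case: ifPn => abl; first by rewrite -EFinB -EFinM mulrC.
  have -> : b - a = 0 by apply/eqP; rewrite subr_eq0 eq_le ab leNgt abl.
  by rewrite mule0 mul0r.
have int1 : mu.-integrable `]a, b] (fun x => (gk s x)%:E).
  apply/integrableP; split; first by apply: measurable_funTS; apply/measurable_EFinP; exact: measurable_gk.
  under eq_integral do rewrite /= ger0_norm ?gk_ge0 ?(ltW s0)//.
  by rewrite -PhiB// ltry.
have int2 : mu.-integrable `]a, b] (fun x => (gk s c)%:E).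
  apply/integrableP; split; first exact: measurable_cst.
  rewrite integral_cst//= lebesgue_measure_itv/= lte_fin.
  by case: ifPn => _; rewrite ?mule0 -?EFinB -?EFinM ?ltry.
rewrite (_ : (Phi s b - Phi s a - (b - a) * gk s c)%R = fine ((Phi s b - Phi s a)%:E - ((b - a) * gk s c)%:E)%E)//.
rewrite PhiB// -fin -integralB//.
set I := (\int[mu]_(x in `[a, b]) _)%E.
have -> : forall x : \bar R, x \is a fin_num -> `|fine x|%:E = `|x|%E by move=> x /fineK {2}<-.
  apply: le_trans (le_abse_integral _ _ _) _ => //.
    by apply: emeasurable_funB; [exact: (measurable_int mu)|exact: measurable_cst].
  apply: (@le_trans _ _ (\int[mu]_(x in `]a, b]) cst I x)%E).
    rewrite integral_mkcond [leRHS]integral_mkcond.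
    apply: ge0_le_integral_nomeas => x; rewrite !patchE; case: ifPn => //.
    rewrite inE/= in_itv/= => /andP[ax xb].
    by have := @gk_osc s a b x c s0; rewrite xb (ltW ax) => /(_ isT acb).
  rewrite integral_cst//= lebesgue_measure_itv/= lte_fin.
  case: ifPn => abl; first by rewrite -EFinB muleC.
  rewrite mule0 mule_ge0 ?lee_fin ?subr_ge0// /I.
  by apply: integral_ge0 => x _; rewrite lee_fin.
by apply: integrable_fin_num => //; exact: integrableB.
Qed.

(* Second-order expansion of the heat flow of an indicator in L^1(dx). *)
Lemma L1_Phi_taylor s y dl : 0 < s ->
  (L1 mu (fun x => (Phi s (x - (y + dl)) - Phi s (x - y) + dl * gk s (x - y))%R)
   <= (512 * dl ^+ 2 / s)%:E)%E.
Proof.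
move=> s0.
have pt x : (`|Phi s (x - (y + dl)) - Phi s (x - y) + dl * gk s (x - y)|%:E <=
    `|dl|%:E * \int[mu]_t (`|dgk s t| * ind `|x - y - t| `|dl|)%:E)%E.
  have -> : (\int[mu]_t (`|dgk s t| * ind `|x - y - t| `|dl|)%:E =
             \int[mu]_(t in `[(x - y - `|dl|)%R, (x - y + `|dl|)%R]) `|dgk s t|%:E)%E.
    rewrite [RHS]integral_mkcond; apply: eq_integral => t _; rewrite patchE mem_setE in_itv/= /ind.
    rewrite ler_distlC andbC; case: ifPn => /andP.
    - by move=> _; rewrite mulr1.
    - by move=> _; rewrite mulr0.
  have sub a b : x - y - `|dl| <= a -> b <= x - y + `|dl| ->
     (\int[mu]_(t in `[a, b]) `|dgk s t|%:E <= \int[mu]_(t in `[(x - y - `|dl|)%R, (x - y + `|dl|)%R]) `|dgk s t|%:E)%E.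
    move=> ha hb; apply: ge0_subset_integral => //.
      by apply: measurable_funTS; apply/measurable_EFinP; apply: measurableT_comp => //; exact: measurable_dgk.
    by apply: subset_itv; rewrite bnd_simp.
  have [d0|d0] := leP 0 dl.
    have := @Phi_taylor s (x - (y + dl)) (x - y) (x - y) s0; rewrite lexx andbT.
    have -> : x - (y + dl) <= x - y by lra.
    move=> /(_ isT); rewrite (_ : x - y - (x - (y + dl)) = dl); last by ring.
    rewrite -normrN (_ : - (_ - _ - _) = Phi s (x - (y + dl)) - Phi s (x - y) + dl * gk s (x - y)); last by ring.
    move=> /le_trans; apply; rewrite (ger0_norm d0); apply: lee_wpmul2l; first by rewrite lee_fin.
    by move: sub; rewrite (ger0_norm d0); apply; lra.
  have := @Phi_taylor s (x - y) (x - (y + dl)) (x - y) s0; rewrite lexx/=.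
  have -> : x - y <= x - (y + dl) by lra.
  move=> /(_ isT); rewrite (_ : (x - (y + dl) - (x - y)) = - dl); last by ring.
  rewrite mulNr opprK => /le_trans; apply; rewrite ltr0_norm//; apply: lee_wpmul2l; first by rewrite lee_fin; lra.
  by move: sub; rewrite (ltr0_norm d0); apply; lra.
apply: (@le_trans _ _ (\int[mu]_x (`|dl|%:E * \int[mu]_t (`|dgk s t| * ind `|x - y - t| `|dl|)%:E))%E).
  by apply: ge0_le_integral_nomeas => x; [rewrite lee_fin|exact: pt].
have mJ : measurable_fun [set: R * R] (fun z : measurableTypeR R * measurableTypeR R => (`|dgk s z.2| * ind `|z.1 - y - z.2| `|dl|)%:E).
  apply/measurable_EFinP; apply: measurable_funM.
    apply: measurableT_comp => //; apply: measurableT_comp => //; exact: measurable_dgk.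
  apply: measurable_ind => //; apply: measurableT_comp => //; apply: measurable_funB => //.
  by apply: measurable_funB.
rewrite ge0_integralZl_EFin//; last first.
- by apply: (@measurable_fun_fubini_tonelli_F _ _ _ _ _ mu _ mJ) => z; rewrite lee_fin mulr_ge0 ?ind_ge0.
- by move=> x _; apply: integral_ge0 => t _; rewrite lee_fin mulr_ge0 ?ind_ge0.
(* With x integrated first, the constraint |x - y - t| <= |dl| selects for fixed t an interval of
   length 2 |dl|: this supplies the second factor |dl|. *)
rewrite (@fubini_tonelli _ _ _ _ _ mu mu _ mJ)/=; last by move=> z; rewrite lee_fin mulr_ge0 ?ind_ge0.
apply: (@le_trans _ _ (`|dl|%:E * \int[mu]_t ((2 * `|dl|)%:E * `|dgk s t|%:E))%E).
  apply: lee_wpmul2l; first by rewrite lee_fin.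
  apply: ge0_le_integral_nomeas => t.
    by apply: integral_ge0 => x _; rewrite lee_fin mulr_ge0 ?ind_ge0.
  under eq_integral do rewrite EFinM.
  rewrite ge0_integralZl_EFin//; last first.
  - by apply/measurable_EFinP; apply: measurable_ind => //; apply: measurableT_comp => //; apply: measurable_funB => //; apply: measurable_funB.
  - by move=> x _; rewrite lee_fin ind_ge0.
  rewrite muleC; apply: lee_wpmul2r; first by rewrite lee_fin.
  apply: (@le_trans _ _ (\int[mu]_(x in `[(y + t - `|dl|)%R, (y + t + `|dl|)%R]) cst 1%:E x)%E).
    rewrite [leRHS]integral_mkcond; apply: ge0_le_integral_nomeas => x; first by rewrite lee_fin ind_ge0.
    rewrite patchE mem_setE in_itv/= /ind ler_norml.
    case: ifPn => [_|/negP h]; first by rewrite lee_fin; case: (_ && _); rewrite ?ler01.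
    rewrite (_ : _ && _ = false)//; apply/negP => /andP[h1 h2]; apply: h; apply/andP; split; lra.
  rewrite integral_cst//= mul1e lebesgue_measure_itv/= lte_fin.
  case: ifPn => _; last by rewrite lee_fin mulr_ge0.
  by rewrite -EFinB lee_fin; lra.
rewrite ge0_integralZl_EFin ?mulr_ge0//; last first.
  by apply/measurable_EFinP; apply: measurableT_comp => //; exact: measurable_dgk.
rewrite muleA -EFinM.
apply: (@le_trans _ _ ((`|dl| * (2 * `|dl|))%:E * (256 / s)%:E)%E).
  by apply: lee_wpmul2l; [rewrite lee_fin !mulr_ge0|exact: L1_dgk].
have e : `|dl| * (2 * `|dl|) = 2 * dl ^+ 2 by rewrite mulrCA -expr2 real_normK ?num_real.
rewrite e -EFinM lee_fin.
by rewrite (_ : 2 * dl ^+ 2 * (256 / s) = 512 * dl ^+ 2 / s)//; ring.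
Qed.

End gaussian.

Section gaussian2.
Variable R : realType.
Notation mu := (@lebesgue_measure R).
Notation gam := (@gam R).

Lemma indB (a b x : R) : ind a (x - b) = ind (b + a) x.
Proof. by rewrite /ind lerBrDl. Qed.

Lemma measurable_weight_comp d (T : measurableType d) (f : T -> R) :
  measurable_fun setT f -> measurable_fun setT (fun x => weight (f x)).
Proof. by move=> mf; apply: measurableT_comp => //; exact: measurable_weight. Qed.

Lemma gam_weight : (\int[gam]_v (weight v)%:E <= 256%:E)%E.
Proof.
apply: le_trans (@gam_moment R); apply: ge0_le_integral_nomeas => v; rewrite lee_fin ?weight_ge0//.
by rewrite ler_peMl ?weight_ge0// lerDl.
Qed.

Lemma Phi_diff_weighted (w : R -> R) (s y y' : R) :
  measurable_fun [set: R] w ->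
  (forall x, 0 <= w x) -> (forall x a b, a <= x <= b -> w x <= w a + w b) ->
  (\int[mu]_x (w x * `|Phi s (x - y) - Phi s (x - y')|)%:E <=
   `|y - y'|%:E * \int[gam]_v (w (y + s * v) + w (y' + s * v))%:E)%E.
Proof.
move=> mw w0 wb.
have mJ : measurable_fun [set: R * R] (fun z : measurableTypeR R * measurableTypeR R =>
    (w z.1 * `|ind (y + s * z.2) z.1 - ind (y' + s * z.2) z.1|)%:E).
  apply/measurable_EFinP; apply: measurable_funM; first exact: measurableT_comp.
  apply: measurableT_comp => //; apply: measurable_funB; apply: measurable_ind => //;
  by apply: measurable_funD => //; apply: measurable_funM.
have J0 (z : R * R) : (0 <= (w z.1 * `|ind (y + s * z.2) z.1 - ind (y' + s * z.2) z.1|)%:E)%E.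
  by rewrite lee_fin mulr_ge0.
apply: (@le_trans _ _ (\int[mu]_x \int[gam]_v (w x * `|ind (y + s * v) x - ind (y' + s * v) x|)%:E)%E).
  apply: ge0_le_integral_nomeas => x; first by rewrite lee_fin mulr_ge0.
  under eq_integral do rewrite EFinM.
  rewrite ge0_integralZl_EFin//; last first.
    apply/measurable_EFinP; apply: measurableT_comp => //; apply: measurable_funB; apply: measurable_ind => //;
    by apply: measurable_funD => //; exact: mulrl_measurable.
  rewrite EFinM; apply: lee_wpmul2l; first by rewrite lee_fin.
  by apply: le_trans (Phi_diff_le _ _ _) _; apply: ge0_le_integral_nomeas => v; rewrite lee_fin// !indB.
rewrite (@fubini_tonelli _ _ _ _ _ mu gam _ mJ J0)/=.
rewrite -ge0_integralZl_EFin//; last first.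
- apply/measurable_EFinP; apply: measurable_funD; apply: measurableT_comp => //; apply: measurable_funD => //; exact: mulrl_measurable.
- by move=> v _; rewrite lee_fin addr_ge0.
apply: ge0_le_integral_nomeas => v; first by apply: integral_ge0 => x _; rewrite lee_fin mulr_ge0.
apply: le_trans (weighted_ind_diff _ _ _ _ _) _ => //.
by rewrite -EFinM (_ : y + s * v - (y' + s * v) = y - y')//; ring.
Qed.

Lemma L1_Phi_diff (s y y' : R) :
  (L1 mu (fun x => (Phi s (x - y) - Phi s (x - y'))%R) <= (2 * `|y - y'|)%:E)%E.
Proof.
have := @Phi_diff_weighted (fun=> 1) s y y' (measurable_cst _) (fun=> ler01) .
move=> /(_ _)/le_trans H.
apply: le_trans (H _ _ _).
- by apply: ge0_le_integral_nomeas => x; rewrite lee_fin// mul1r.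
- by move=> *; rewrite lerDl.
by rewrite integral_cst//= probability_setT mule1 -EFinM lee_fin mulrC.
Qed.

(** [weightD] at both shifted points gives 4 weight y + 4 weight y' plus 8 weight (s v); 2048 is 8
    times the Gaussian moment bound 256. *)
Lemma L1w_Phi_diff (s S y y' : R) : 0 <= s <= S ->
  (\int[mu]_x (weight x * `|Phi s (x - y) - Phi s (x - y')|)%:E <=
   (`|y - y'| * (4 * weight y + 4 * weight y' + 2048 * weight S))%:E)%E.
Proof.
move=> /andP[s0 sS].
apply: le_trans (Phi_diff_weighted _ _ _ _ _ _) _.
- exact: measurable_weight.
- exact: weight_ge0.
- exact: weight_between.
rewrite EFinM; apply: lee_wpmul2l; first by rewrite lee_fin.
have ws v : weight (s * v) <= weight S * weight v.
  apply: le_trans (weightM _ _) _; rewrite ler_wpM2r ?weight_ge0//.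
  by apply: le_weight; rewrite !ger0_norm//; exact: le_trans sS.
apply: (@le_trans _ _ (\int[gam]_v ((4 * weight y + 4 * weight y')%:E + (8 * weight S)%:E * (weight v)%:E))%E).
  apply: ge0_le_integral_nomeas => v; first by rewrite lee_fin addr_ge0 ?weight_ge0.
  rewrite -EFinM -EFinD lee_fin.
  have := weightD y (s * v); have := weightD y' (s * v); have := ws v; lra.
have mw : measurable_fun [set: R] (fun v => (weight v)%:E) by apply/measurable_EFinP; exact: measurable_weight.
rewrite ge0_integralD//; last first.
- exact: measurable_funeM.
- by move=> v _; rewrite -EFinM lee_fin !mulr_ge0 ?weight_ge0.
- by move=> v _; rewrite lee_fin addr_ge0 ?mulr_ge0 ?weight_ge0.
rewrite integral_cst//= probability_setT mule1 ge0_integralZl_EFin ?mulr_ge0 ?weight_ge0//; last first.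
- by move=> v _; rewrite lee_fin weight_ge0.
apply: (@le_trans _ _ ((4 * weight y + 4 * weight y')%:E + (8 * weight S)%:E * 256%:E)%E).
  by apply: leeD2l; apply: lee_wpmul2l; [rewrite lee_fin mulr_ge0 ?weight_ge0|exact: gam_weight].
by rewrite -EFinM -EFinD lee_fin; lra.
Qed.

(** Smoothing moves the jump from y to y + s v. The displacement |s v| is the reason for the factor
    1 + |v| in [gam_moment], and 2304 is 9 times 256, where 9 = 4 + 4 + 1 comes from [weightD] at
    the moved point and the weight at y. *)
Lemma L1w_Phi_ind (s S y : R) : 0 <= s <= S ->
  (\int[mu]_x (weight x * `|Phi s (x - y) - ind y x|)%:E <=
   (2304 * S * weight S * weight y)%:E)%E.
Proof.
move=> /andP[s0 sS].
have mJ : measurable_fun [set: R * R] (fun z : measurableTypeR R * measurableTypeR R =>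
    (weight z.1 * `|ind (y + s * z.2) z.1 - ind y z.1|)%:E).
  apply/measurable_EFinP; apply: measurable_funM; first exact: measurable_weight_comp.
  apply: measurableT_comp => //; apply: measurable_funB; apply: measurable_ind => //.
  by apply: measurable_funD => //; apply: measurable_funM.
have J0 (z : R * R) : (0 <= (weight z.1 * `|ind (y + s * z.2) z.1 - ind y z.1|)%:E)%E.
  by rewrite lee_fin mulr_ge0 ?weight_ge0.
apply: (@le_trans _ _ (\int[mu]_x \int[gam]_v (weight x * `|ind (y + s * v) x - ind y x|)%:E)%E).
  apply: ge0_le_integral_nomeas => x; first by rewrite lee_fin mulr_ge0 ?weight_ge0.
  under eq_integral do rewrite EFinM.
  rewrite ge0_integralZl_EFin ?weight_ge0//; last first.
    apply/measurable_EFinP; apply: measurableT_comp => //; apply: measurable_funB => //; apply: measurable_ind => //.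
    by apply: measurable_funD => //; exact: mulrl_measurable.
  rewrite EFinM; apply: lee_wpmul2l; first by rewrite lee_fin weight_ge0.
  have e : ind y x = \int[gam]_v ind y x by rewrite Rintegral_cst//= probability_setT mulr1.
  have iy : gam.-integrable setT (EFin \o (fun=> ind y x)).
    by apply: (@bounded_integrable _ _ _ gam _ 1) => // z; rewrite ger0_norm ?ind_ge0 ?ind_le1.
  rewrite [X in `|_ - X|]e /Phi -RintegralB//; try exact: integrable_ind_gam.
  rewrite EFin_normr_Rintegral//; last first.
    by have := integrableB measurableT (integrable_ind_gam s (x - y)) iy.
  apply: le_trans (le_abse_integral _ _ _) _ => //.
    by apply/measurable_EFinP; apply: measurable_funB => //; exact: measurable_ind_gam.
  by apply: ge0_le_integral_nomeas => v; rewrite /= lee_fin// indB.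
rewrite (@fubini_tonelli _ _ _ _ _ mu gam _ mJ J0)/=.
apply: (@le_trans _ _ (\int[gam]_v ((9 * S * weight S * weight y)%:E * ((1 + `|v|) * weight v)%:E))%E).
  apply: ge0_le_integral_nomeas => v; first by apply: integral_ge0 => x _; rewrite lee_fin mulr_ge0 ?weight_ge0.
  apply: le_trans (weighted_ind_diff _ _ _ _ _) _.
  - exact: measurable_weight.
  - exact: weight_ge0.
  - exact: weight_between.
  rewrite -EFinM lee_fin (_ : y + s * v - y = s * v); last by ring.
  have ws : weight (s * v) <= weight S * weight v.
    apply: le_trans (weightM _ _) _; rewrite ler_wpM2r ?weight_ge0//.
    by apply: le_weight; rewrite !ger0_norm//; exact: le_trans sS.
  have wd := weightD y (s * v).
  have h1 : weight y <= weight y * (weight S * weight v).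
    by rewrite ler_peMr ?weight_ge0// -[leLHS]mulr1 ler_pM ?weight_ge1.
  have h2 : weight S * weight v <= weight y * (weight S * weight v).
    by rewrite ler_peMl ?mulr_ge0 ?weight_ge0// weight_ge1.
  have h3 : weight (y + s * v) + weight y <= 9 * (weight y * (weight S * weight v)) by lra.
  rewrite normrM (ger0_norm s0).
  have -> : 9 * S * weight S * weight y * ((1 + `|v|) * weight v) =
     (S * (1 + `|v|)) * (9 * (weight y * (weight S * weight v))) by ring.
  by rewrite ler_pM ?addr_ge0 ?mulr_ge0 ?weight_ge0// ler_pM// lerDr.
have S0 := le_trans s0 sS.
rewrite ge0_integralZl_EFin ?mulr_ge0 ?weight_ge0//; last first.
- apply/measurable_EFinP; apply: measurable_funM; last exact: measurable_weight.
  by apply: measurable_funD => //; exact: measurableT_comp.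
- by move=> v _; rewrite lee_fin mulr_ge0 ?weight_ge0 ?addr_ge0.
apply: (@le_trans _ _ ((9 * S * weight S * weight y)%:E * 256%:E)%E).
  by apply: lee_wpmul2l; [rewrite lee_fin !mulr_ge0 ?weight_ge0|exact: gam_moment].
by rewrite -EFinM lee_fin; lra.
Qed.

Lemma integral_subl (a : R) (f : R -> R) : measurable_fun [set: R] f ->
  \int[mu]_x f (a - x) = \int[mu]_x f x.
Proof.
move=> mf; congr fine; rewrite integralE [RHS]integralE; congr (_ - _)%E.
  transitivity (\int[mu]_x ((EFin \o f)^\+ (a - x)%R))%E.
    by apply: eq_integral => x _; rewrite !funeposE.
  apply: ge0_integral_subl; last by move=> x; exact: funepos_ge0.
  by apply: measurable_funepos; exact/measurable_EFinP.
transitivity (\int[mu]_x ((EFin \o f)^\- (a - x)%R))%E.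
  by apply: eq_integral => x _; rewrite !funenegE.
apply: ge0_integral_subl; last by move=> x; exact: funeneg_ge0.
by apply: measurable_funeneg; exact/measurable_EFinP.
Qed.

Lemma integrable_dgk (s : R) : 0 < s -> mu.-integrable setT (EFin \o dgk s).
Proof.
move=> s0; apply/integrableP; split; first by apply/measurable_EFinP; exact: measurable_dgk.
by apply: le_lt_trans (L1_dgk s0) _; rewrite ltry.
Qed.

Lemma cvg_gkNy (s z : R) : 0 < s -> gk s (z - n%:R) @[n --> \oo] --> (0 : R).
Proof.
move=> s0; rewrite -[X in _ --> X](mulr0 s^-1); apply: cvgM; first exact: cvg_cst.
have phiN v : phi (- v) = phi v :> R by rewrite !phiE sqrrN.
rewrite (_ : (fun x : nat => phi ((z - x%:R) / s)) = (fun x : nat => phi ((x%:R - z) / s))); last first.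
  by apply/funext => n; rewrite -phiN -mulNr opprB.
apply: (@cvg_comp _ _ _ (fun n : nat => (n%:R - z) / s) (@phi R) _ (+oo)%R); last exact: cvg_phiy.
apply/cvgryPge => A; near=> n.
rewrite ler_pdivlMr// lerBrDr.
by near: n; apply: nbhs_infty_ger; exact: num_real.
Unshelve. all: by end_near. Qed.

(** Fundamental theorem of calculus on [z - n, z], where the value at the lower end vanishes as n
    grows; the limit is taken by domination with |dgk s|. *)
Lemma Rintegral_dgk (s z : R) : 0 < s -> \int[mu]_t (dgk s t * ind t z) = gk s z.
Proof.
move=> s0.
have md : measurable_fun [set: R] (fun t => dgk s t) := @measurable_dgk R s.
pose f_ (n : nat) (t : R) := (dgk s t * \1_`[z - n%:R, z] t)%:E.
have mf_ n : measurable_fun [set: R] (f_ n).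
  by apply/measurable_EFinP; apply: measurable_funM => //; exact: measurable_indic.
have mf : measurable_fun [set: R] (fun t => (dgk s t * ind t z)%:E).
  by apply/measurable_EFinP; apply: measurable_funM => //; exact: measurable_ind.
have cf : {ae mu, forall t, [set: R] t -> f_ n t @[n --> \oo] --> (dgk s t * ind t z)%:E}.
  apply: aeW => t _; apply: cvg_near_cst; near=> n.
  rewrite /f_ indicE mem_setE in_itv/= /ind.
  rewrite (_ : z - n%:R <= t = true)//.
  rewrite lerBlDr -lerBlDl.
  by near: n; apply: nbhs_infty_ger; exact: num_real.
have dom : {ae mu, forall t n, [set: R] t -> (`|f_ n t| <= `|dgk s t|%:E)%E}.
  apply: aeW => t n _; rewrite /f_ /= lee_fin normrM ler_piMr//.
  by rewrite indicE; case: (_ \in _); rewrite ?normr0 ?normr1.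
have ig : mu.-integrable [set: R] (fun t => `|dgk s t|%:E).
  by have := integrable_norm (integrable_dgk s0).
have [_ _ H] := @dominated_convergence _ _ _ mu setT measurableT f_ _ _ mf_ mf cf ig dom.
have Hn n : (\int[mu]_t f_ n t = (gk s z - gk s (z - n%:R))%:E)%E.
  rewrite gkB// ?lerBlDr ?lerDl// [RHS]integral_mkcond; apply: eq_integral => t _.
  by rewrite /f_ patchE indicE; case: ifPn => _; rewrite ?mulr1 ?mulr0.
have H2 : (\int[mu]_t f_ n t)%E @[n --> \oo] --> (gk s z)%:E.
  rewrite (_ : (fun n => _) = (fun n => (gk s z - gk s (z - n%:R))%:E)); last by apply/funext.
  apply: cvg_EFin; first exact: nearW.
  rewrite -[X in _ --> X]subr0; apply: cvgB; [exact: cvg_cst|exact: cvg_gkNy].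
by rewrite /Rintegral (cvg_unique _ H H2).
Unshelve. all: by end_near. Qed.

Lemma integrable_dgk_ind (s x a : R) : 0 < s ->
  mu.-integrable setT (fun y => (dgk s (x - y) * ind a y)%:E).
Proof.
move=> s0; have md : measurable_fun [set: R] (fun y : R => dgk s (x - y)).
  by apply: measurableT_comp; [exact: measurable_dgk|exact: measurable_funB].
apply/integrableP; split.
  by apply/measurable_EFinP; apply: measurable_funM => //; exact: measurable_ind.
apply: (@le_lt_trans _ _ (L1 mu (dgk s))); last by apply: le_lt_trans (L1_dgk s0) _; rewrite ltry.
rewrite /L1 -(@ge0_integral_subl _ x (fun y => `|dgk s y|%:E))//.
  apply: ge0_le_integral_nomeas => y; rewrite lee_fin// normrM ler_piMr//.
  by rewrite ger0_norm ?ind_ge0 ?ind_le1.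
by apply/measurable_EFinP; apply: measurableT_comp => //; exact: measurable_dgk.
Qed.

(* [gk s] is the convolution of its derivative with a Heaviside function. *)
Lemma Rintegral_dgk_ind (s x a : R) : 0 < s ->
  \int[mu]_y (dgk s (x - y) * ind a y) = gk s (x - a).
Proof.
move=> s0; rewrite -Rintegral_dgk//.
rewrite -(@integral_subl x (fun t => dgk s t * ind t (x - a))).
  by apply: eq_Rintegral => y _; congr (_ * _); rewrite /ind lerD2l lerN2.
by apply: measurable_funM; [exact: measurable_dgk|exact: measurable_ind].
Qed.

(** Completing the square in v: with c^2 = a^2 + b^2, the product of the two densities is [gk c z]
    times a Gaussian density of standard deviation a / c centred at z b / c^2, whose mass is 1. *)
Lemma gk_semigroup (a b z : R) : 0 < a ->
  (\int[gam]_v (gk a (z - b * v))%:E = (gk (Num.sqrt (a ^+ 2 + b ^+ 2)) z)%:E)%E.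
Proof.
move=> a0; set c := Num.sqrt _.
have ab0 : 0 < a ^+ 2 + b ^+ 2 by rewrite ltr_wpDr ?sqr_ge0// exprn_gt0.
have c0 : 0 < c by rewrite sqrtr_gt0.
have c2 : c ^+ 2 = a ^+ 2 + b ^+ 2 by rewrite sqr_sqrtr ?ltW.
have mg : measurable_fun [set: R] (fun v : R => gk a (z - b * v)).
  apply: measurableT_comp; first exact: measurable_gk.
  by apply: measurable_funB => //; exact: mulrl_measurable.
rewrite gamE//; last first.
- by move=> v; rewrite lee_fin gk_ge0 ?(ltW a0).
- exact/measurable_EFinP.
transitivity (\int[mu]_v ((gk c z)%:E * (gk (a / c) (v - z * b / c ^+ 2))%:E))%E.
  apply: eq_integral => v _; rewrite -!EFinM; congr EFin.
  rewrite /gk !phiE.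
  have alg (p X1 X2 X3 X4 ia ic iac : R) : X1 * X2 = X3 * X4 -> ia = ic * iac ->
      ia * (p * X1) * (p * X2) = ic * (p * X3) * (iac * (p * X4)).
    by move=> e ->; transitivity (ic * iac * p ^+ 2 * (X1 * X2)); [ring|rewrite e; ring].
  apply: alg; last by rewrite invfM invrK mulrCA mulVf ?mulr1 ?gt_eqF.
  rewrite -!expRD; congr expR.
  have cn0 : c != 0 by rewrite gt_eqF.
  have an0 : a != 0 by rewrite gt_eqF.
  have e : b ^+ 2 = c ^+ 2 - a ^+ 2 by rewrite c2; ring.
  apply: (mulfI (_ : 2 * a ^+ 2 * c ^+ 2 != 0)); first by rewrite !mulf_neq0 ?expf_neq0.
  have -> : 2 * a ^+ 2 * c ^+ 2 * (- (((z - b * v) / a) ^+ 2 / 2) - v ^+ 2 / 2) =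
     - c ^+ 2 * (z ^+ 2 - 2 * z * b * v + b ^+ 2 * v ^+ 2) - a ^+ 2 * c ^+ 2 * v ^+ 2 by field.
  have -> : 2 * a ^+ 2 * c ^+ 2 * (- ((z / c) ^+ 2 / 2) - ((v - z * b / c ^+ 2) / (a / c)) ^+ 2 / 2) =
     - a ^+ 2 * z ^+ 2 - c ^+ 4 * v ^+ 2 + 2 * c ^+ 2 * v * z * b - z ^+ 2 * b ^+ 2 by field; rewrite cn0 an0.
  by rewrite e; ring.
rewrite ge0_integralZl_EFin ?gk_ge0 ?(ltW c0)//; last first.
- apply/measurable_EFinP; apply: measurableT_comp; first exact: measurable_gk.
  exact: measurable_funB.
- by move=> v _; rewrite lee_fin gk_ge0// divr_ge0// ltW.
rewrite (@ge0_integral_shift R (- (z * b / c ^+ 2)) (fun v => (gk (a / c) v)%:E)).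
- by rewrite integral_gk ?divr_gt0// mule1.
- by apply/measurable_EFinP; exact: measurable_gk.
- by move=> v; rewrite lee_fin gk_ge0// divr_ge0// ltW.
Qed.

(** For a > 0 this is [gk_semigroup] integrated over ]-oo, z]. The case a = 0, where the claim
    reduces to the definition of Phi, serves the last step of a grid, after which no noise is
    left. *)
Lemma Phi_semigroup (a b z : R) : 0 <= a -> 0 <= b ->
  (\int[gam]_v (Phi a (z - b * v))%:E = (Phi (Num.sqrt (a ^+ 2 + b ^+ 2)) z)%:E)%E.
Proof.
rewrite le_eqVlt => /predU1P[<-|a0] b0.
  rewrite expr0n/= add0r sqrtr_sqr ger0_norm// PhiE.
  by apply: eq_integral => v _; rewrite Phi0 indB addr0.
set c := Num.sqrt _.
have ab0 : 0 < a ^+ 2 + b ^+ 2 by rewrite ltr_wpDr ?sqr_ge0// exprn_gt0.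
have c0 : 0 < c by rewrite sqrtr_gt0.
have PhiG (s x : R) : 0 < s -> ((Phi s x)%:E = \int[mu]_t ((ind t x)%:E * (gk s t)%:E))%E.
  move=> s0; rewrite PhiE (@gam_scale _ s (fun t => (ind t x)%:E))//.
  - by apply/measurable_EFinP; exact: measurable_ind.
  - by move=> t; rewrite lee_fin ind_ge0.
have mJ : measurable_fun [set: R * R] (fun w : measurableTypeR R * measurableTypeR R =>
   ((ind w.1 z)%:E * (gk a (w.1 - b * w.2))%:E)%E).
  apply: emeasurable_funM; apply/measurable_EFinP; first exact: measurable_ind.
  apply: measurableT_comp; first exact: measurable_gk.
  by apply: measurable_funB => //; apply: measurable_funM.
have J0 (w : R * R) : (0 <= (ind w.1 z)%:E * (gk a (w.1 - b * w.2))%:E)%E.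
  by rewrite mule_ge0 ?lee_fin ?ind_ge0 ?gk_ge0 ?(ltW a0).
have mg x : measurable_fun [set: R] (fun v : R => (gk a (x - b * v))%:E).
  apply/measurable_EFinP; apply: measurableT_comp; first exact: measurable_gk.
  by apply: measurable_funB => //; exact: mulrl_measurable.
rewrite PhiG//.
transitivity (\int[mu]_t \int[gam]_v ((ind t z)%:E * (gk a (t - b * v))%:E))%E; last first.
  apply: eq_integral => t _; rewrite ge0_integralZl_EFin ?ind_ge0//; last 2 first.
    - by move=> v _; rewrite lee_fin gk_ge0 ?(ltW a0).
    - exact: mg.
  by rewrite gk_semigroup.
rewrite (@fubini_tonelli _ _ _ _ _ mu gam _ mJ J0)/=.
apply: eq_integral => v _; rewrite (PhiG _ _ a0).
rewrite -(@ge0_integral_shift _ (- (b * v)) (fun t => ((ind t (z - b * v))%:E * (gk a t)%:E)%E)).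
- by apply: eq_integral => t _; rewrite /ind lerD2r.
- by apply: emeasurable_funM; apply/measurable_EFinP; [exact: measurable_ind|exact: measurable_gk].
- by move=> t; rewrite mule_ge0 ?lee_fin ?ind_ge0 ?gk_ge0 ?(ltW a0).
Qed.

Lemma normal_probE (s : R) (A : set R) : 0 < s -> measurable A ->
  normal_prob 0 s A = (\int[gam]_v (\1_A (s * v))%:E)%E.
Proof.
move=> s0 mA; rewrite (@gam_scale _ s (fun x => (\1_A x)%:E))//; last first.
  by apply/measurable_EFinP; exact: measurable_indic.
rewrite /normal_prob integral_mkcond; apply: eq_integral => x _.
rewrite patchE indicE; case: ifPn => _; rewrite ?mul0e// mul1e; congr EFin.
rewrite normal_pdfE ?gt_eqF// /gk phiE /normal_peak /normal_fun /peak /normal_peak subr0 expr1n mul1r.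
rewrite mulrA; congr (_ * expR _).
  by rewrite -mulrnAr sqrtrM ?sqr_ge0// sqrtr_sqr (ger0_norm (ltW s0)) invfM.
by rewrite -(mulr_natr (s ^+ 2)); field; rewrite gt_eqF.
Qed.

(** Increments of Phi measure half-open intervals, so the closed ball is enlarged to ]- 2 r, r], of
    length 3 r. *)
Lemma gam_small_ball (s A r : R) : 0 < s -> 0 < r ->
  (\int[gam]_v (ind `|A + s * v| r)%:E <= (3 * r / s)%:E)%E.
Proof.
move=> s0 r0.
apply: (@le_trans _ _ ((Phi s (r - A) - Phi s (- (2 * r) - A))%:E)).
  rewrite /Phi -RintegralB//; try exact: integrable_ind_gam.
  rewrite /Rintegral fineK; last first.
    apply: integrable_fin_num => //.
    by have := integrableB measurableT (integrable_ind_gam s (r - A)) (integrable_ind_gam s (- (2 * r) - A)).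
  apply: ge0_le_integral_nomeas => v; first by rewrite lee_fin ind_ge0.
  rewrite lee_fin !indB /ind.
  have [h|h] := leP `|A + s * v| r; last first.
    by rewrite subr_ge0 ler_nat; case: (leP (A + s * v) (- (2 * r))) => // h'; rewrite (_ : A + s * v <= r)//; lra.
  move: h; rewrite ler_norml => /andP[h1 h2]; rewrite h2.
  by rewrite (_ : A + s * v <= - (2 * r) = false) ?subr0//; apply/negP => h3; lra.
rewrite lee_fin; apply: le_trans (Phi_lipschitz s0 _) _; first by lra.
by rewrite ler_pM2r ?invr_gt0//; lra.
Qed.

End gaussian2.

(** * Heat steps and martingale increments *)

Ltac pos := repeat first
  [ exact: ler0n | exact: ler01 | assumption | exact: weight_ge0
  | match goal with
    | |- is_true (0 <= _ * _) => apply: mulr_ge0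
    | |- is_true (0 <= _ + _) => apply: addr_ge0
    | |- is_true (0 <= _ ^-1) => rewrite invr_ge0
    | |- is_true (0 <= _ ^+ 2) => exact: sqr_ge0
    | |- is_true (0 <= _ ^+ _) => apply: exprn_ge0
    | |- is_true (0 <= `|_|) => apply: normr_ge0
    end ].

Section ge0_real.
Context d (T : measurableType d) (R : realType) (P : {measure set T -> \bar R}).

Lemma ge0_integral_cmul (k : R) (f : T -> R) : 0 <= k -> measurable_fun setT f -> (forall x, 0 <= f x) ->
  (\int[P]_x (k * f x)%:E = k%:E * \int[P]_x (f x)%:E)%E.
Proof.
move=> k0 mf f0; under eq_integral do rewrite EFinM.
by rewrite ge0_integralZl_EFin//; first [exact/measurable_EFinP|move=> x _; rewrite lee_fin].
Qed.

Lemma ge0_integral_add (f g : T -> R) : measurable_fun setT f -> (forall x, 0 <= f x) ->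
  measurable_fun setT g -> (forall x, 0 <= g x) ->
  (\int[P]_x (f x + g x)%:E = \int[P]_x (f x)%:E + \int[P]_x (g x)%:E)%E.
Proof.
move=> mf f0 mg g0; under eq_integral do rewrite EFinD.
by rewrite ge0_integralD//; first [exact/measurable_EFinP|move=> x _; rewrite lee_fin].
Qed.

End ge0_real.

Section bounded.
Context d (T : measurableType d) (R : realType).
Implicit Types f g : T -> R.

(** Bounded measurable functions are stable under the algebra used below and integrable for every
    probability, so their real-valued means can be handled linearly. *)
Definition bm f := measurable_fun setT f /\ exists C, forall x, `|f x| <= C.

Lemma bmD f g : bm f -> bm g -> bm (fun x => f x + g x).
Proof.
move=> [mf [C fC]] [mg [C' gC]]; split; first exact: measurable_funD.
by exists (C + C') => x; apply: le_trans (ler_normD _ _) _; exact: lerD.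
Qed.

Lemma bmN f : bm f -> bm (fun x => - f x).
Proof.
move=> [mf [C fC]]; split; first exact: measurable_funN.
by exists C => x; rewrite normrN.
Qed.

Lemma bmB f g : bm f -> bm g -> bm (fun x => f x - g x).
Proof. by move=> bf bg; apply: bmD => //; exact: bmN. Qed.

Lemma bmM f g : bm f -> bm g -> bm (fun x => f x * g x).
Proof.
move=> [mf [C fC]] [mg [C' gC]]; split; first exact: measurable_funM.
by exists (C * C') => x; rewrite normrM ler_pM.
Qed.

Lemma bmX f n : bm f -> bm (fun x => f x ^+ n).
Proof.
move=> [mf [C fC]]; split; first exact: measurable_funX.
by exists (C ^+ n) => x; rewrite normrX lerXn2r// nnegrE (le_trans _ (fC x)).
Qed.

Lemma bm_norm f : bm f -> bm (fun x => `|f x|).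
Proof.
move=> [mf [C fC]]; split; first exact: measurableT_comp.
by exists C => x; rewrite normr_id.
Qed.

Lemma bm_cst c : bm (fun=> c).
Proof. by split => //; exists `|c|. Qed.

Lemma bm_sum (I : Type) (s : seq I) (F : I -> T -> R) :
  (forall i, bm (F i)) -> bm (fun x => \sum_(i <- s) F i x).
Proof.
move=> bF; elim: s => [|i s ih].
  by rewrite (_ : (fun x => _) = fun=> 0); [exact: bm_cst|apply/funext => x; rewrite big_nil].
rewrite (_ : (fun x => _) = fun x => F i x + \sum_(j <- s) F j x); first exact: bmD.
by apply/funext => x; rewrite big_cons.
Qed.

Lemma bm_Phi (s : R) f : measurable_fun setT f -> bm (fun x => Phi s (f x)).
Proof.
move=> mf; split; first by apply: measurableT_comp => //; exact: measurable_Phi.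
by exists 1 => x; rewrite ger0_norm ?Phi_ge0 ?Phi_le1.
Qed.

Lemma bm_Phi_sub (s x : R) f : measurable_fun setT f -> bm (fun w => Phi s (x - f w)).
Proof. by move=> mf; apply: bm_Phi; exact: measurable_funB. Qed.

Lemma bm_ind f g : measurable_fun setT f -> measurable_fun setT g -> bm (fun x => ind (f x) (g x)).
Proof.
move=> mf mg; split; first exact: measurable_ind.
by exists 1 => x; rewrite ger0_norm ?ind_ge0 ?ind_le1.
Qed.

Variable P : probability T R.

Lemma bm_integrable f : bm f -> P.-integrable setT (EFin \o f).
Proof. by move=> [mf [C fC]]; exact: (bounded_integrable P mf fC). Qed.

Lemma ExD f g : bm f -> bm g -> \int[P]_x (f x + g x) = \int[P]_x f x + \int[P]_x g x.
Proof. by move=> bf bg; apply: RintegralD => //; exact: bm_integrable. Qed.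

Lemma ExB f g : bm f -> bm g -> \int[P]_x (f x - g x) = \int[P]_x f x - \int[P]_x g x.
Proof. by move=> bf bg; apply: RintegralB => //; exact: bm_integrable. Qed.

Lemma ExZ c f : bm f -> \int[P]_x (c * f x) = c * \int[P]_x f x.
Proof. by move=> bf; apply: RintegralZl => //; exact: bm_integrable. Qed.

Lemma Ex_cst c : \int[P]_x c = c.
Proof. by rewrite Rintegral_cst//= probability_setT mulr1. Qed.

Lemma Ex_le f g : bm f -> bm g -> (forall x, f x <= g x) -> \int[P]_x f x <= \int[P]_x g x.
Proof. by move=> bf bg fg; apply: le_Rintegral => //; exact: bm_integrable. Qed.

Lemma Ex_norm f : bm f -> `|\int[P]_x f x| <= \int[P]_x `|f x|.
Proof. by move=> bf; apply: le_normr_Rintegral => //; exact: bm_integrable. Qed.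

Lemma Ex_sum (I : Type) (s : seq I) (F : I -> T -> R) : (forall i, bm (F i)) ->
  \int[P]_x (\sum_(i <- s) F i x) = \sum_(i <- s) \int[P]_x F i x.
Proof.
move=> bF; elim: s => [|i s ih].
  by rewrite big_nil -[RHS](Ex_cst 0); apply: eq_Rintegral => x _; rewrite big_nil.
rewrite big_cons -ih -ExD//; last exact: bm_sum.
by apply: eq_Rintegral => x _; rewrite big_cons.
Qed.

Lemma ExE f : bm f -> (\int[P]_x (f x)%:E = (\int[P]_x f x)%:E)%E.
Proof. by move=> bf; rewrite /Rintegral fineK//; apply: integrable_fin_num => //; exact: bm_integrable. Qed.

Lemma Ex_sqr_sum (I : finType) (M : I -> T -> R) : (forall i, bm (M i)) ->
  (forall i j, i != j -> \int[P]_x (M i x * M j x) = 0) ->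
  \int[P]_x ((\sum_i M i x) ^+ 2) = \sum_i \int[P]_x (M i x ^+ 2).
Proof.
move=> bM orth.
transitivity (\int[P]_x (\sum_i \sum_j (M i x * M j x))).
  by apply: eq_Rintegral => x _; rewrite expr2 mulr_suml; apply: eq_bigr => i _; rewrite mulr_sumr.
rewrite Ex_sum; last by move=> i; apply: bm_sum => j; exact: bmM.
apply: eq_bigr => i _; rewrite Ex_sum; last by move=> j; exact: bmM.
rewrite (bigD1 i)//= big1 ?addr0; last by move=> j ji; rewrite orth// eq_sym.
by apply: eq_Rintegral => x _; rewrite expr2.
Qed.

End bounded.

(** * Independence, freezing and the heat step *)

Section independence_tools.
Context d (Omega : measurableType d) (R : realType) (P : probability Omega R).

Lemma g_sigma_sub (A G : set (set Omega)) : A `<=` <<s G >> -> <<s A >> `<=` <<s G >>.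
Proof. by move=> AG; apply: smallest_sub => //; exact: smallest_sigma_algebra. Qed.

(** The measures S -> P (S and C) and S -> P S P C agree on a class closed under intersection, to
    which the whole space is adjoined; they agree on the generated sigma-algebra by uniqueness of
    measures. *)
Lemma indep_generated (A : set (set Omega)) (C : set Omega) :
  setI_closed A -> A `<=` measurable -> measurable C ->
  (forall S, A S -> P (S `&` C) = (P S * P C)%E) ->
  forall S, <<s A >> S -> P (S `&` C) = (P S * P C)%E.
Proof.
move=> AI Am mC H S sS.
pose G := A `|` [set setT].
have GS : <<s G >> S by apply: g_sigma_sub sS => X AX; apply: sub_sigma_algebra; left.
have Gm : G `<=` measurable by move=> X [/Am//|->].
have pC0 : 0 <= fine (P C) by rewrite fine_ge0.
rewrite muleC -[X in (X * _)%E]fineK ?fin_num_measure//.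
apply: (@g_sigma_algebra_measure_unique _ _ _ G Gm (fun=> setT) _ _ (mrestr P mC) (mscale (NngNum pC0) P)) => //.
- by move=> n; right.
- by rewrite bigcup_const.
- move=> X Y [AX|->] [AY|->]; [by left; exact: AI|by rewrite setIT; left|by rewrite setTI; left|by rewrite setIT; right].
- move=> X GX; transitivity ((fine (P C))%:E * P X)%E; last by [].
  transitivity (P (X `&` C)); first by [].
  rewrite fineK ?fin_num_measure// muleC; case: GX => [AX|->]; first exact: H.
  by rewrite setTI probability_setT mul1e.
- move=> k; have := le_lt_trans (probability_le1 P mC) (ltry 1%R).
  suff -> : P C = mrestr P mC [set: Omega] by [].
  by transitivity (P (setT `&` C)); [rewrite setTI|].
Qed.

(** The intersections of an event of A and an event of B form a class closed under intersection that
    generates the join. *)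
Lemma indep_join (A B : set (set Omega)) (C : set Omega) :
  setI_closed A -> setI_closed B -> A setT -> B setT ->
  A `<=` measurable -> B `<=` measurable -> measurable C ->
  (forall S S', A S -> B S' -> P (S `&` S' `&` C) = (P (S `&` S') * P C)%E) ->
  forall S, <<s A `|` B >> S -> P (S `&` C) = (P S * P C)%E.
Proof.
move=> AI BI AT BT Am Bm mC H S sS.
apply: (@indep_generated [set Q | exists S S', [/\ A S, B S' & Q = S `&` S']] C) => //.
- move=> _ _ [S1 [S1' [A1 B1 ->]]] [S2 [S2' [A2 B2 ->]]].
  by exists (S1 `&` S2), (S1' `&` S2'); split; [exact: AI|exact: BI|rewrite setIACA].
- by move=> _ [S1 [S1' [/Am A1 /Bm B1 ->]]]; exact: measurableI.
- by move=> _ [S1 [S1' [A1 B1 ->]]]; exact: H.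
- apply: g_sigma_sub sS => X [AX|BX]; apply: sub_sigma_algebra.
    by exists X, setT; rewrite setIT.
  by exists setT, X; rewrite setTI.
Qed.

Definition indep_of (G : set (set Omega)) (B : Omega -> R) :=
  forall S (C : set (measurableTypeR R)), <<s G >> S -> measurable C ->
    P (S `&` B @^-1` C) = (P S * P (B @^-1` C))%E.

(** Measurability for the sigma-algebra generated by G, obtained by retyping the domain, so that the
    closure properties of measurable functions apply verbatim. *)
Definition gmeas (G : set (set Omega)) d' (T : measurableType d') (f : Omega -> T) :=
  measurable_fun setT (f : g_sigma_algebraType G -> T).

Lemma gmeas_sub (G G' : set (set Omega)) d' (T : measurableType d') (f : Omega -> T) :
  <<s G >> `<=` <<s G' >> -> gmeas G f -> gmeas G' f.
Proof. by move=> GG mf _ B mB; apply: GG; exact: mf. Qed.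

Lemma gmeas_measurable (G : set (set Omega)) d' (T : measurableType d') (f : Omega -> T) :
  <<s G >> `<=` measurable -> gmeas G f -> measurable_fun setT f.
Proof. by move=> GG mf _ B mB; apply: GG; exact: mf. Qed.

(** The pair of B and the identity map into Omega with the sigma-algebra of G has a product law by
    independence; Tonelli for this product freezes the first component. *)
Lemma freezing (G : set (set Omega)) (B : Omega -> R)
    (f : g_sigma_algebraType G * measurableTypeR R -> \bar R) :
  <<s G >> `<=` measurable -> measurable_fun setT B -> indep_of G B ->
  measurable_fun setT f -> (forall z, (0 <= f z)%E) ->
  (\int[P]_w f (w, B w) = \int[P]_w \int[P]_w' f (w, B w'))%E.
Proof.
move=> Gm mB ind mf f0.
pose TG := g_sigma_algebraType G.
have mh : measurable_fun setT (idfun : Omega -> TG).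
  by move=> _ X mX; rewrite setTI; exact: Gm.
pose mid : {mfun Omega >-> TG} := HB.pack (idfun : Omega -> TG) (isMeasurableFun.Build _ _ _ _ _ mh).
have mB' : measurable_fun setT (B : Omega -> measurableTypeR R) := mB.
pose mBf : {mfun Omega >-> measurableTypeR R} := HB.pack (B : Omega -> measurableTypeR R) (isMeasurableFun.Build _ _ _ _ _ mB').
pose H (w : Omega) : TG * measurableTypeR R := (w, B w).
have mH : measurable_fun setT H by apply: measurable_fun_pair.
pose m1 := distribution P mid; pose m2 := distribution P mBf.
transitivity (\int[pushforward P H]_z f z)%E.
  by rewrite ge0_integral_pushforward.
transitivity (\int[(m1 \x m2)%E]_z f z)%E.
  apply: eq_measure_integral => X mX _; apply/esym; apply: product_measure_unique => // X1 X2 mX1 mX2.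
rewrite fubini_tonelli1// /fubini_F.
rewrite ge0_integral_distribution//.
- apply: eq_integral => w _ /=; rewrite ge0_integral_distribution//.
  by apply: (@measurable_fun_curry1 _ _ TG (measurableTypeR R) _ _ f w).
- exact: measurable_fun_fubini_tonelli_F.
- by move=> w; exact: integral_ge0.
Qed.

Definition gauss_law (B : Omega -> R) (b : R) :=
  forall C : set (measurableTypeR R), measurable C ->
    P (B @^-1` C) = (\int[@gam R]_v (\1_C (b * v))%:E)%E.

Lemma gauss_law_integral (B : Omega -> R) (b : R) (f : R -> \bar R) :
  measurable_fun setT B -> gauss_law B b ->
  measurable_fun [set: R] f -> (forall x, (0 <= f x)%E) ->
  (\int[P]_w f (B w) = \int[@gam R]_v f (b * v)%R)%E.
Proof.
move=> mB lB mf f0.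
pose h (v : measurableTypeR R) : measurableTypeR R := b * v.
have mh : measurable_fun setT h by exact: mulrl_measurable.
transitivity (\int[pushforward P (B : Omega -> measurableTypeR R)]_y f y)%E.
  by rewrite ge0_integral_pushforward.
transitivity (\int[pushforward (@gam R) h]_y f y)%E; last first.
  by rewrite ge0_integral_pushforward.
apply: eq_measure_integral => C mC _.
transitivity (P (B @^-1` C)); first by [].
transitivity ((@gam R) (h @^-1` C)); last by [].
rewrite lB// -(setIT (h @^-1` C)) -integral_indic//.
by rewrite -[X in measurable X]setTI; exact: mh.
Qed.

Lemma freezing_gauss (G : set (set Omega)) (B : Omega -> R) (b : R)
    (f : g_sigma_algebraType G * measurableTypeR R -> \bar R) :
  <<s G >> `<=` measurable -> measurable_fun setT B -> indep_of G B -> gauss_law B b ->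
  measurable_fun setT f -> (forall z, (0 <= f z)%E) ->
  (\int[P]_w f (w, B w) = \int[P]_w \int[@gam R]_v f (w, (b * v)%R))%E.
Proof.
move=> Gm mB ind lB mf f0; rewrite (freezing Gm mB ind mf f0).
apply: eq_integral => w _.
apply: (@gauss_law_integral B b (fun v => f (w, v))) => //.
by apply: (@measurable_fun_curry1 _ _ (g_sigma_algebraType G) (measurableTypeR R) _ _ f w).
Qed.

(** Nonnegative version, to which Tonelli applies. The range [0, 2] is that of U + 1 when |U| <= 1;
    the signed case follows by subtracting the statement for the constant 1. *)
Let heat_step0 (G : set (set Omega)) (B U Z : Omega -> R) (a b : R) :
  <<s G >> `<=` measurable -> measurable_fun setT B -> indep_of G B -> gauss_law B b ->
  0 <= a -> 0 <= b -> gmeas G U -> gmeas G Z -> (forall w, 0 <= U w <= 2) ->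
  \int[P]_w (U w * Phi a (Z w - B w)) = \int[P]_w (U w * Phi (Num.sqrt (a ^+ 2 + b ^+ 2)) (Z w)).
Proof.
move=> Gm mB ind lB a0 b0 mU mZ U2.
have mf : measurable_fun setT (fun z : g_sigma_algebraType G * measurableTypeR R => (U z.1 * Phi a (Z z.1 - z.2))%:E).
  apply/measurable_EFinP; apply: measurable_funM.
    exact: (measurableT_comp mU).
  apply: measurableT_comp; first exact: measurable_Phi.
  by apply: measurable_funB => //; exact: (measurableT_comp mZ).
have f0 (z : g_sigma_algebraType G * measurableTypeR R) : (0 <= (U z.1 * Phi a (Z z.1 - z.2))%:E)%E.
  by rewrite lee_fin mulr_ge0 ?Phi_ge0//; case/andP: (U2 z.1).
congr fine; rewrite (freezing_gauss Gm mB ind lB mf f0)/=.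
apply: eq_integral => w _.
under eq_integral do rewrite EFinM.
rewrite ge0_integralZl_EFin//; last first.
- by case/andP: (U2 w).
- apply/measurable_EFinP; apply: measurableT_comp; first exact: measurable_Phi.
  by apply: measurable_funB => //; exact: mulrl_measurable.
- by move=> v _; rewrite lee_fin Phi_ge0.
by rewrite Phi_semigroup// EFinM.
Qed.

(* Conditioning on [G], adding an independent Gaussian increment to the argument amounts to a step of the heat semigroup. *)
Lemma heat_step (G : set (set Omega)) (B U Z : Omega -> R) (a b : R) :
  <<s G >> `<=` measurable -> measurable_fun setT B -> indep_of G B -> gauss_law B b ->
  0 <= a -> 0 <= b -> gmeas G U -> gmeas G Z -> (forall w, `|U w| <= 1) ->
  \int[P]_w (U w * Phi a (Z w - B w)) = \int[P]_w (U w * Phi (Num.sqrt (a ^+ 2 + b ^+ 2)) (Z w)).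
Proof.
move=> Gm mB ind lB a0 b0 mU mZ U1.
have mU' := gmeas_measurable Gm mU; have mZ' := gmeas_measurable Gm mZ.
have bU : bm U by split => //; exists 1.
have bP1 : bm (fun w => Phi a (Z w - B w)) by apply: bm_Phi; exact: measurable_funB.
have bP2 : bm (fun w => Phi (Num.sqrt (a ^+ 2 + b ^+ 2)) (Z w)) by exact: bm_Phi.
have e1 : \int[P]_w ((U w + 1) * Phi a (Z w - B w)) = \int[P]_w ((U w + 1) * Phi (Num.sqrt (a ^+ 2 + b ^+ 2)) (Z w)).
  apply: (@heat_step0 G) => //.
    by apply: measurable_funD.
  by move=> w; have := U1 w; rewrite ler_norml => /andP[h1 h2]; apply/andP; split; lra.
have e2 : \int[P]_w (1 * Phi a (Z w - B w)) = \int[P]_w (1 * Phi (Num.sqrt (a ^+ 2 + b ^+ 2)) (Z w)).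
  apply: (@heat_step0 G _ (fun=> 1) Z a b Gm mB ind lB a0 b0 _ mZ); first exact: measurable_cst.
  by move=> w; rewrite ler01 ler1n.
have split_ (f : Omega -> R) : bm f -> \int[P]_w (U w * f w) = \int[P]_w ((U w + 1) * f w) - \int[P]_w (1 * f w).
  move=> bf; have h1 := bmM (bmD bU (bm_cst _ 1)) bf; have h2 := bmM (bm_cst _ 1) bf.
  rewrite -(ExB P h1 h2).
  by apply: eq_Rintegral => w _; ring.
by rewrite (split_ _ bP1) e1 e2 -(split_ _ bP2).
Qed.

End independence_tools.

(** * Orthogonal increments on a time grid and their variance *)

Section martingale.
Context d (Omega : measurableType d) (R : realType) (P : probability Omega R).
Variables (N n : nat) (c : nat -> R) (b : nat -> R) (a : nat -> R).
Variables (G : nat -> set (set Omega)) (X Z B : 'I_N -> nat -> Omega -> R).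
(* [a k] is the standard deviation of the noise between the times [k] and [n], and [b k] that of the increment [k]. *)
Hypothesis a_ge0 : forall k, 0 <= a k.
Hypothesis b_ge0 : forall k, 0 <= b k.
Hypothesis aE : forall k, (k < n)%N -> a k = Num.sqrt (a k.+1 ^+ 2 + b k ^+ 2).
Hypothesis an : a n = 0.
Hypothesis Gm : forall k, <<s G k >> `<=` measurable.
Hypothesis Gmono : forall k l, (k <= l)%N -> <<s G k >> `<=` <<s G l >>.
Hypothesis mX : forall i k, measurable_fun setT (X i k).
Hypothesis mZ : forall i k, gmeas (G k) (Z i k).
Hypothesis mB : forall i k, gmeas (G k.+1) (B i k).
Hypothesis indB : forall i k, (k < n)%N -> indep_of P (G k) (B i k).
Hypothesis indBB : forall i j k, (k < n)%N -> i != j ->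
  indep_of P (G k `|` preimage_set_system setT (B i k : Omega -> measurableTypeR R) measurable) (B j k).
Hypothesis lawB : forall i k, (k < n)%N -> gauss_law P (B i k) (b k).

(** [Z i k] is known at time k: the position with the drift of the step already added. Revealing the
    noise of the step while lowering the remaining deviation from a k to a k.+1 preserves the
    conditional mean, by [heat_step]. *)
Definition incr i k (x : R) w := Phi (a k.+1) (x - Z i k w - B i k w) - Phi (a k) (x - Z i k w).

Let mZ' i k : measurable_fun setT (Z i k). Proof. exact: (gmeas_measurable (@Gm k) (@mZ i k)). Qed.
Let mB' i k : measurable_fun setT (B i k). Proof. exact: (gmeas_measurable (@Gm k.+1) (@mB i k)). Qed.

Let mxZ i k x : measurable_fun setT (fun w => x - Z i k w).
Proof. by apply: measurable_funB => //; exact: mZ'. Qed.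
Let mxZB i k x : measurable_fun setT (fun w => x - Z i k w - B i k w).
Proof. by apply: measurable_funB; [exact: mxZ|exact: mB']. Qed.

Lemma gmeas_incr i k x : gmeas (G k.+1) (incr i k x).
Proof.
have mZ2 := gmeas_sub (@Gmono k k.+1 (leqnSn k)) (@mZ i k).
apply: measurable_funB; (apply: measurableT_comp; first exact: measurable_Phi).
  by apply: measurable_funB; [apply: measurable_funB|exact: mB].
by apply: measurable_funB.
Qed.

Lemma incr_le1 i k x w : `|incr i k x w| <= 1.
Proof.
rewrite ler_norml /incr.
have := @Phi_ge0 R (a k.+1) (x - Z i k w - B i k w); have := @Phi_le1 R (a k.+1) (x - Z i k w - B i k w).
have := @Phi_ge0 R (a k) (x - Z i k w); have := @Phi_le1 R (a k) (x - Z i k w).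
by move=> h1 h2 h3 h4; apply/andP; split; lra.
Qed.

Lemma bm_incr i k x : bm (incr i k x).
Proof. by split; [exact: (gmeas_measurable (@Gm k.+1) (@gmeas_incr i k x))|exists 1 => w; exact: incr_le1]. Qed.

Let gmB (H : set (set Omega)) i k x : gmeas H (Z i k) -> gmeas H (fun w => x - Z i k w).
Proof. by move=> h; apply: measurable_funB. Qed.

(** H is either the past G k or, to treat two particles over the same step, the past enlarged by the
    noise of the other particle. *)
Lemma incr_orth_gen (H : set (set Omega)) (U : Omega -> R) i k x :
  (k < n)%N -> <<s H >> `<=` measurable -> indep_of P H (B i k) ->
  gmeas H U -> gmeas H (Z i k) -> (forall w, `|U w| <= 1) ->
  \int[P]_w (U w * incr i k x w) = 0.
Proof.
move=> kn Hm ind mU mZH U1.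
have bU : bm U by split; [exact: gmeas_measurable Hm mU|exists 1].
have b1 : bm (fun w => Phi (a k.+1) (x - Z i k w - B i k w)).
  by apply: bm_Phi; exact: mxZB.
have b2 : bm (fun w => Phi (a k) (x - Z i k w)) by apply: bm_Phi; exact: mxZ.
rewrite (_ : (fun w => _) = (fun w => U w * Phi (a k.+1) (x - Z i k w - B i k w) - U w * Phi (a k) (x - Z i k w))); last first.
  by apply/funext => w; rewrite /incr mulrBr.
rewrite ExB; [|exact: bmM|exact: bmM].
rewrite (heat_step Hm (@mB' i k) ind (@lawB i k kn) (a_ge0 k.+1) (b_ge0 k) mU (gmB x mZH) U1).
by rewrite (aE kn) subrr.
Qed.

(** At different steps the earlier increment belongs to the past of the later one. At the same step
    the noise of particle i is put into the past, from which the noise of j remains independent. *)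
Lemma incr_orth i k j l x : (k < n)%N -> (l < n)%N -> (i, k) != (j, l) ->
  \int[P]_w (incr i k x w * incr j l x w) = 0.
Proof.
move=> kn ln; wlog kl : i j k l kn ln / (k <= l)%N.
  move=> H; have /orP[/H|/H] := leq_total k l; first exact.
  move=> H' ne; transitivity (\int[P]_w (incr j l x w * incr i k x w)).
    by apply: eq_Rintegral => w _; rewrite mulrC.
  by apply: H' => //; rewrite eq_sym.
move: kl; rewrite leq_eqVlt => /predU1P[<-|kl].
  rewrite xpair_eqE eqxx andbT => ij.
  apply: (@incr_orth_gen (G k `|` preimage_set_system setT (B i k : Omega -> measurableTypeR R) measurable)) => //.
  - apply: smallest_sub; first exact: sigma_algebra_measurable.
    move=> S [GS|[C mC <-]]; first by apply: (@Gm k); exact: sub_sigma_algebra.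
    exact: mB'.
  - exact: indBB.
  - have sub : <<s G k >> `<=` <<s G k `|` preimage_set_system setT (B i k : Omega -> measurableTypeR R) measurable >>.
      by apply: g_sigma_sub => S GS; apply: sub_sigma_algebra; left.
    apply: measurable_funB; (apply: measurableT_comp; first exact: measurable_Phi).
      apply: measurable_funB; first by apply: measurable_funB => //; exact: (gmeas_sub sub (@mZ i k)).
      by move=> _ C mC; apply: sub_sigma_algebra; right; exists C.
    by apply: measurable_funB => //; exact: (gmeas_sub sub (@mZ i k)).
  - apply: (gmeas_sub _ (@mZ j k)); apply: g_sigma_sub => S GS; apply: sub_sigma_algebra; by left.
  - by move=> w; exact: incr_le1.
move=> _; apply: (@incr_orth_gen (G l)) => //.
- exact: indB.
- exact: (gmeas_sub (@Gmono _ _ kl) (@gmeas_incr i k x)).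
- by move=> w; exact: incr_le1.
Qed.

Lemma incr_mean i k x : (k < n)%N -> \int[P]_w incr i k x w = 0.
Proof.
move=> kn; rewrite -(@incr_orth_gen (G k) (fun=> 1) i k x kn (@Gm k) (@indB i k kn)) => //.
- by apply: eq_Rintegral => w _; rewrite mul1r.
- exact: measurable_cst.
- by move=> w; rewrite normr1.
Qed.

(** The cross term with the earlier value has mean zero, so the variance of the increment is the
    increment of the mean square. *)
Lemma incr_sqr i k x : (k < n)%N ->
  \int[P]_w (incr i k x w ^+ 2) =
  \int[P]_w (Phi (a k.+1) (x - Z i k w - B i k w) ^+ 2) - \int[P]_w (Phi (a k) (x - Z i k w) ^+ 2).
Proof.
move=> kn.
have b1 : bm (fun w => Phi (a k.+1) (x - Z i k w - B i k w)).
  by apply: bm_Phi; exact: mxZB.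
have b2 : bm (fun w => Phi (a k) (x - Z i k w)) by apply: bm_Phi; exact: mxZ.
have h : \int[P]_w (Phi (a k) (x - Z i k w) * incr i k x w) = 0.
  apply: (@incr_orth_gen (G k)) => //.
  - exact: indB.
  - by apply: measurableT_comp; [exact: measurable_Phi|exact: gmB].
  - by move=> w; rewrite ger0_norm ?Phi_ge0 ?Phi_le1.
have bV : bm (fun w => Phi (a k) (x - Z i k w) * incr i k x w) by apply: bmM => //; exact: bm_incr.
have bV2 := bmM (bm_cst _ 2) bV.
transitivity (\int[P]_w ((Phi (a k.+1) (x - Z i k w - B i k w) ^+ 2 - Phi (a k) (x - Z i k w) ^+ 2) -
    2 * (Phi (a k) (x - Z i k w) * incr i k x w))).
  by apply: eq_Rintegral => w _; rewrite /incr; ring.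
by rewrite (ExB P (bmB (bmX 2 b1) (bmX 2 b2)) bV2) (ExZ P 2 bV) h mulr0 subr0 (ExB P (bmX 2 b1) (bmX 2 b2)).
Qed.

Lemma sqr_diff_le (u v : R) : 0 <= u <= 1 -> 0 <= v <= 1 -> u ^+ 2 - v ^+ 2 <= 2 * `|u - v|.
Proof.
move=> /andP[u0 u1] /andP[v0 v1]; rewrite subr_sqr mulrC.
apply: le_trans (ler_norm _) _; rewrite normrM ler_wpM2r// ger0_norm ?addr_ge0//; lra.
Qed.

(** The mean squares telescope up to drift errors E, with a factor 2. The final mean square is at
    most the final mean, which is the initial mean up to another E; hence the 3. What is left is the
    mean of Phi (1 - Phi) at time 0, bounded by the distance of Phi to the indicator: no singular
    kernel appears. *)
Lemma incr_sqr_sum i x :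
  \sum_(k < n) \int[P]_w (incr i k x w ^+ 2) <=
  \int[P]_w `|Phi (a 0%N) (x - X i 0%N w) - ind (X i 0%N w) x| +
  3 * \sum_(k < n) \int[P]_w (`|Phi (a k) (x - X i k w) - Phi (a k) (x - Z i k w)| +
     `|Phi (a k.+1) (x - Z i k w - B i k w) - Phi (a k.+1) (x - X i k.+1 w)|).
Proof.
pose V k w := Phi (a k) (x - X i k w).
pose V1 k w := Phi (a k) (x - Z i k w).
pose V2 k w := Phi (a k.+1) (x - Z i k w - B i k w).
have bV k : bm (V k) by apply: bm_Phi; exact: measurable_funB.
have bV1 k : bm (V1 k) by apply: bm_Phi; exact: mxZ.
have bV2 k : bm (V2 k) by apply: bm_Phi; exact: mxZB.
pose e k := \int[P]_w (`|V k w - V1 k w| + `|V2 k w - V k.+1 w|).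
pose F k := \int[P]_w (V k w ^+ 2).
pose H k := \int[P]_w V k w.
have be k : bm (fun w => `|V k w - V1 k w| + `|V2 k w - V k.+1 w|).
  by apply: bmD; apply: bm_norm; exact: bmB.
have V01 k w : 0 <= V k w <= 1 by rewrite /V Phi_ge0 Phi_le1.
have V101 k w : 0 <= V1 k w <= 1 by rewrite /V1 Phi_ge0 Phi_le1.
have V201 k w : 0 <= V2 k w <= 1 by rewrite /V2 Phi_ge0 Phi_le1.
have step k : (k < n)%N -> \int[P]_w (incr i k x w ^+ 2) <= F k.+1 - F k + 2 * e k.
  move=> kn; rewrite incr_sqr// /F /e.
  have bb := bmD (bmB (bmX 2 (bV k.+1)) (bmX 2 (bV k))) (bmM (bm_cst _ 2) (be k)).
  have b1 := bmB (bmX 2 (bV2 k)) (bmX 2 (bV1 k)); have b2 := bmB (bmX 2 (bV k.+1)) (bmX 2 (bV k)).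
  apply: (le_trans (_ : _ <= \int[P]_w (V2 k w ^+ 2 - V1 k w ^+ 2))).
    by rewrite (ExB P (bmX 2 (bV2 k)) (bmX 2 (bV1 k))).
  apply: (le_trans (Ex_le P b1 bb _)); last first.
    by rewrite (ExD P b2 (bmM (bm_cst _ 2) (be k))) (ExB P (bmX 2 (bV k.+1)) (bmX 2 (bV k))) (ExZ P 2 (be k)).
  move=> w; have := sqr_diff_le (V201 k w) (V01 k.+1 w); have := sqr_diff_le (V01 k w) (V101 k w).
  rewrite /V /V1 /V2; lra.
have stepH k : (k < n)%N -> H k.+1 - H k <= e k.
  move=> kn; rewrite /H /e.
  have bi : bm (incr i k x) by exact: bm_incr.
  have -> : \int[P]_w V k.+1 w - \int[P]_w V k w = \int[P]_w (V k.+1 w - V k w - incr i k x w).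
    by rewrite (ExB P (bmB (bV k.+1) (bV k)) bi) incr_mean// subr0 (ExB P (bV k.+1) (bV k)).
  apply: (Ex_le P (bmB (bmB (bV k.+1) (bV k)) bi) (be k)).
  move=> w; have := ler_norm (- (V k w - V1 k w)); have := ler_norm (- (V2 k w - V k.+1 w)).
  rewrite !normrN /incr /V /V1 /V2; lra.
have tel (f g : nat -> R) m : (m <= n)%N -> (forall k, (k < n)%N -> f k.+1 - f k <= g k) -> f m - f 0%N <= \sum_(k < m) g k.
  move=> + fg; elim: m => [|m ih] mn; first by rewrite subrr big_ord0.
  rewrite big_ord_recr/=; have := ih (ltnW mn); have := fg m mn; lra.
have alg1 (S I Fm F0 Fm1 E e' : R) : S <= Fm - F0 + 2 * E -> I <= Fm1 - Fm + 2 * e' ->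
    S + I <= Fm1 - F0 + 2 * (E + e') by lra.
have alg2 (S Hn H0 Fn F0 D E : R) : Hn - H0 <= E -> S <= Fn - F0 + 2 * E -> Fn <= Hn ->
    H0 - F0 <= D -> S <= D + 3 * E by lra.
have h1 := tel H e n (leqnn n) stepH.
have h2 : \sum_(k < n) \int[P]_w (incr i k x w ^+ 2) <= F n - F 0%N + 2 * \sum_(k < n) e k.
  have : forall m, (m <= n)%N -> \sum_(k < m) \int[P]_w (incr i k x w ^+ 2) <= F m - F 0%N + 2 * \sum_(k < m) e k.
    elim=> [|m ih] mn; first by rewrite !big_ord0 subrr mulr0 addr0.
    rewrite !big_ord_recr/=; exact: alg1 (ih (ltnW mn)) (step m mn).
  exact.
have h3 : F n <= H n.
  apply: (Ex_le P (bmX 2 (bV n)) (bV n)).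
  by move=> w; have /andP[u0 u1] := V01 n w; rewrite expr2 ler_piMr.
have h4 : H 0%N - F 0%N <= \int[P]_w `|V 0%N w - ind (X i 0%N w) x|.
  have bi : bm (fun w => ind (X i 0%N w) x) by apply: bm_ind.
  rewrite /H /F -(ExB P (bV 0%N) (bmX 2 (bV 0%N))).
  apply: (Ex_le P (bmB (bV 0%N) (bmX 2 (bV 0%N))) (bm_norm (bmB (bV 0%N) bi))).
  move=> w; have /andP[u0 u1] := V01 0%N w.
  have e0 : V 0%N w - V 0%N w ^+ 2 = V 0%N w * (1 - V 0%N w) by ring.
  rewrite e0 /ind; case: (X i 0%N w <= x)%R => /=.
    by rewrite distrC ger0_norm ?subr_ge0// ler_piMl// subr_ge0.
  by rewrite subr0 ger0_norm// ler_piMr// gerBl.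
exact: alg2 h1 h2 h3 h4.
Qed.

Lemma Ex_sum_incr_sqr x :
  \int[P]_w ((\sum_(i < N) \sum_(k < n) incr i k x w) ^+ 2) =
  \sum_(i < N) \sum_(k < n) \int[P]_w (incr i k x w ^+ 2).
Proof.
pose M (p : 'I_N * 'I_n) w := incr p.1 p.2 x w.
transitivity (\int[P]_w ((\sum_p M p w) ^+ 2)).
  by apply: eq_Rintegral => w _; rewrite pair_bigA.
rewrite Ex_sqr_sum.
- by rewrite pair_bigA.
- by move=> [i k]; exact: bm_incr.
- by move=> [i k] [j l] ne; apply: incr_orth.
Qed.


Notation mu := (@lebesgue_measure R).

(** Tonelli in a form adapted to almost sure bounds: an estimate of the dx-integral off a null set
    passes to the mean. *)
Lemma swap_bound (h : measurableTypeR R * Omega -> R) (q : Omega -> R) :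
  measurable_fun setT h -> (forall z, 0 <= h z) -> (forall x, bm (fun w => h (x, w))) ->
  measurable_fun setT q -> (forall w, 0 <= q w) ->
  {ae P, forall w, (\int[mu]_x (h (x, w))%:E <= (q w)%:E)%E} ->
  (L1 mu (fun x => (\int[P]_w h (x, w))%R) <= \int[P]_w (q w)%:E)%E.
Proof.
move=> mh h0 bh mq q0 hq.
have mh' : measurable_fun setT (fun z : measurableTypeR R * Omega => (h z)%:E) by exact/measurable_EFinP.
have h0' (z : measurableTypeR R * Omega) : (0 <= (h z)%:E)%E by rewrite lee_fin.
apply: (@le_trans _ _ (\int[mu]_x \int[P]_w (h (x, w))%:E)%E).
  apply: ge0_le_integral_nomeas => x; first by rewrite lee_fin.
  by rewrite (ExE P (bh x)) ger0_norm// Rintegral_ge0.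
rewrite (@fubini_tonelli _ _ _ _ _ mu P _ mh' h0')/=.
apply: ae_ge0_le_integral => //.
- by move=> w _; exact: integral_ge0.
- exact: (@measurable_fun_fubini_tonelli_G _ _ _ _ _ mu _ mh' h0').
- by move=> w _; rewrite lee_fin.
- exact/measurable_EFinP.
- by apply: filterS hq => w ? _.
Qed.

Variables (be Tt S : R) (dt : nat -> R) (Mi : 'I_N -> R).
Hypothesis be_ge0 : 0 <= be.
Hypothesis dt_ge0 : forall k, 0 <= dt k.
Hypothesis dt_sum : \sum_(k < n) dt k <= Tt.
Hypothesis aS : forall k, a k <= S.
Hypothesis hzx : forall i k, (k < n)%N -> {ae P, forall w, `|X i k w - Z i k w| <= be * dt k}.
Hypothesis hxz : forall i k, (k < n)%N -> {ae P, forall w, `|Z i k w + B i k w - X i k.+1 w| <= 2 * be * dt k}.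
Hypothesis momX : forall i k, (k <= n)%N -> (\int[P]_w (weight (X i k w))%:E <= (Mi i)%:E)%E.
Hypothesis momZ : forall i k, (k < n)%N -> (\int[P]_w (weight (Z i k w))%:E <= (Mi i)%:E)%E.
Hypothesis momZB : forall i k, (k < n)%N -> (\int[P]_w (weight (Z i k w + B i k w))%:E <= (Mi i)%:E)%E.

(** The first term is the initial smoothing error of [L1w_Phi_ind]. In the second, 18504 = 3 * 3 *
    2056: the 3 of [incr_sqr_sum], the drift errors be dt and 2 be dt of a step, and 2056 = 4 + 4 +
    2048 from [L1w_Phi_diff]. *)
Definition martingale_cst : R := 2304 * S * weight S + 18504 * be * Tt * weight S.

Let S0 : 0 <= S. Proof. exact: le_trans (a_ge0 0%N) (aS 0%N). Qed.

Let Tt0 : 0 <= Tt.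
Proof. by apply: le_trans dt_sum; apply: sumr_ge0 => k _; exact: dt_ge0. Qed.

Let Mi1 i : 1 <= Mi i.
Proof.
rewrite -lee_fin; apply: le_trans (momX i (leq0n n)).
rewrite (_ : 1%E = (\int[P]_w (cst 1%:E w))%E); last by rewrite integral_cst//= probability_setT mule1.
by apply: ge0_le_integral_nomeas => w; rewrite lee_fin ?weight_ge1.
Qed.

Let L1_term (s : R) (U V : Omega -> R) (M c0 : R) : 0 <= s <= S -> 0 <= c0 -> 1 <= M ->
  measurable_fun setT U -> measurable_fun setT V ->
  {ae P, forall w, `|U w - V w| <= c0} ->
  (\int[P]_w (weight (U w))%:E <= M%:E)%E -> (\int[P]_w (weight (V w))%:E <= M%:E)%E ->
  (L1 mu (fun x => (\int[P]_w (weight x * `|Phi s (x - U w) - Phi s (x - V w)|))%R) <= (c0 * (2056 * weight S * M))%:E)%E.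
Proof.
move=> s0 c00 M1 mU mV UV hU hV.
have mw (W : Omega -> R) : measurable_fun setT W -> measurable_fun setT (fun w => weight (W w)).
  by move=> mW; apply: measurableT_comp mW; exact: measurable_weight.
have mxU (W : Omega -> R) : measurable_fun setT W -> measurable_fun setT (fun z : measurableTypeR R * Omega => Phi s (z.1 - W z.2)).
  move=> mW; apply: measurableT_comp; first exact: measurable_Phi.
  by apply: measurable_funB => //; exact: (measurableT_comp mW).
apply: le_trans (@swap_bound (fun z => weight z.1 * `|Phi s (z.1 - U z.2) - Phi s (z.1 - V z.2)|)
   (fun w => c0 * (4 * weight (U w) + 4 * weight (V w) + 2048 * weight S)) _ _ _ _ _ _) _.
- apply: measurable_funM; first by apply: (@measurableT_comp _ _ _ _ _ _ (@weight R)); [exact: measurable_weight|exact: measurable_fst].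
  by apply: measurableT_comp => //; apply: measurable_funB; exact: mxU.
- by move=> z; rewrite mulr_ge0 ?weight_ge0.
- move=> x; have bW (V0 : Omega -> R) (mV0 : measurable_fun setT V0) : bm (fun w => Phi s (x - V0 w)).
    exact: bm_Phi_sub.
  exact: (bmM (bm_cst Omega (weight x)) (bm_norm (bmB (bW U mU) (bW V mV)))).
- apply: measurable_funM => //; apply: measurable_funD => //.
  by apply: measurable_funD; apply: measurable_funM => //; exact: mw.
- by move=> w; pos.
- apply: filterS UV => w UVw /=; apply: le_trans (L1w_Phi_diff _ _ s0) _.
  rewrite lee_fin; apply: ler_wpM2r; last exact: UVw.
  have w4 (k : nat) y : 0 <= k%:R * weight y by apply: mulr_ge0; [exact: ler0n|exact: weight_ge0].
  by apply: addr_ge0; [apply: addr_ge0|]; exact: w4.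
have h : (\int[P]_w (c0 * (4 * weight (U w) + 4 * weight (V w) + 2048 * weight S))%:E =
   c0%:E * (4%:E * \int[P]_w (weight (U w))%:E + 4%:E * \int[P]_w (weight (V w))%:E + (2048 * weight S)%:E))%E.
  have mwc (k : R) (W : Omega -> R) : measurable_fun setT W -> measurable_fun setT (fun w => k * weight (W w)).
    by move=> mW; apply: measurable_funM; [exact: measurable_cst|exact: mw].
  have w4 (k : nat) y : 0 <= k%:R * weight y :> R by apply: mulr_ge0; [exact: ler0n|exact: weight_ge0].
  have m8 := measurable_funD (mwc 4 U mU) (mwc 4 V mV).
  have p8 w : 0 <= 4 * weight (U w) + 4 * weight (V w) by apply: addr_ge0; exact: w4.
  have mS : measurable_fun setT (fun w : Omega => 2048 * weight S) by exact: measurable_cst.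
  have m9 := measurable_funD m8 mS.
  have p9 w : 0 <= 4 * weight (U w) + 4 * weight (V w) + 2048 * weight S by apply: addr_ge0; [exact: p8|exact: w4].
  rewrite (ge0_integral_cmul P c00 m9 p9) (ge0_integral_add P m8 p8 mS (fun w => w4 2048%N S)).
  rewrite (ge0_integral_add P (mwc 4 U mU) (fun w => w4 4%N _) (mwc 4 V mV) (fun w => w4 4%N _)).
  rewrite (ge0_integral_cmul P (ler0n R 4) (mw U mU) (fun w => weight_ge0 _)).
  rewrite (ge0_integral_cmul P (ler0n R 4) (mw V mV) (fun w => weight_ge0 _)).
  by rewrite integral_cst//= probability_setT mule1.
rewrite h.
apply: (@le_trans _ _ (c0%:E * (4%:E * M%:E + 4%:E * M%:E + (2048 * weight S)%:E))%E).
  apply: lee_wpmul2l; first by rewrite lee_fin.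
  by apply: leeD => //; apply: leeD; apply: lee_wpmul2l.
rewrite -[X in (X <= _)%E]/((c0 * (4 * M + 4 * M + 2048 * weight S))%:E) lee_fin; apply: ler_wpM2l => //.
have w1 := weight_ge1 S.
have : weight S <= weight S * M by rewrite ler_peMr ?weight_ge0.
have : M <= weight S * M by rewrite ler_peMl// (le_trans _ M1).
by move: (weight S * M) (weight S) w1 => wM wS h1 h2 h3; lra.
Qed.

Lemma L1w_incr_sqr i :
  (L1 mu (fun x => (weight x * \sum_(k < n) \int[P]_w (incr i k x w ^+ 2))%R) <= (martingale_cst * Mi i)%:E)%E.
Proof.
pose f0 x := \int[P]_w (weight x * `|Phi (a 0%N) (x - X i 0%N w) - ind (X i 0%N w) x|).
pose f1 (k : nat) x := \int[P]_w (weight x * `|Phi (a k) (x - X i k w) - Phi (a k) (x - Z i k w)|).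
pose f2 (k : nat) x := \int[P]_w (weight x * `|Phi (a k.+1) (x - (Z i k w + B i k w)) - Phi (a k.+1) (x - X i k.+1 w)|).
have bP s (U : Omega -> R) x : measurable_fun setT U -> bm (fun w => Phi s (x - U w)).
  by move=> mU; exact: bm_Phi_sub.
have mZB k : measurable_fun setT (fun w => Z i k w + B i k w) by apply: measurable_funD; [exact: mZ'|exact: mB'].
have mw1 : measurable_fun setT (fun z : measurableTypeR R * Omega => weight z.1).
  by apply: (@measurableT_comp _ _ _ _ _ _ (@weight R)); [exact: measurable_weight|exact: measurable_fst].
have mPhi2 s (W : Omega -> R) : measurable_fun setT W -> measurable_fun setT (fun z : measurableTypeR R * Omega => Phi s (z.1 - W z.2)).
  move=> mW; apply: measurableT_comp; first exact: measurable_Phi.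
  by apply: measurable_funB => //; exact: (measurableT_comp mW).
have mh1 s (U V : Omega -> R) : measurable_fun setT U -> measurable_fun setT V ->
    measurable_fun setT (fun z : measurableTypeR R * Omega => weight z.1 * `|Phi s (z.1 - U z.2) - Phi s (z.1 - V z.2)|).
  by move=> mU mV; apply: measurable_funM => //; apply: measurableT_comp => //; apply: measurable_funB; exact: mPhi2.
have mh0 : measurable_fun setT (fun z : measurableTypeR R * Omega => weight z.1 * `|Phi (a 0%N) (z.1 - X i 0%N z.2) - ind (X i 0%N z.2) z.1|).
  apply: measurable_funM => //; apply: measurableT_comp => //; apply: measurable_funB; first exact: mPhi2.
  by apply: measurable_ind => //; exact: (measurableT_comp (@mX i 0%N)).
have mf0 : measurable_fun [set: R] f0 by exact: (@measurable_fun_Rintegral _ _ (measurableTypeR R) Omega R P _ mh0).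
have mf1 k : measurable_fun [set: R] (f1 k).
  exact: (@measurable_fun_Rintegral _ _ (measurableTypeR R) Omega R P _ (mh1 (a k) (X i k) (Z i k) (@mX i k) (@mZ' i k))).
have mf2 k : measurable_fun [set: R] (f2 k).
  exact: (@measurable_fun_Rintegral _ _ (measurableTypeR R) Omega R P _ (mh1 (a k.+1) _ (X i k.+1) (mZB k) (@mX i k.+1))).
have pt x : weight x * \sum_(k < n) \int[P]_w (incr i k x w ^+ 2) <= f0 x + 3 * \sum_(k < n) (f1 k x + f2 k x).
  have := @incr_sqr_sum i x; move=> /(ler_wpM2l (weight_ge0 x)) /le_trans; apply.
  rewrite mulrDr mulrCA mulr_sumr; apply: lerD.
    have b0 := bm_norm (bmB (bP (a 0%N) _ x (@mX i 0%N)) (bm_ind (@mX i 0%N) (measurable_cst x))).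
    by rewrite /f0 (ExZ P _ b0).
  apply: ler_wpM2l; first exact: ler0n.
  apply: ler_sum => k _.
  have b1 := bm_norm (bmB (bP (a k) _ x (@mX i k)) (bP (a k) _ x (@mZ' i k))).
  have b2 := bm_norm (bmB (bP (a k.+1) _ x (mZB k)) (bP (a k.+1) _ x (@mX i k.+1))).
  rewrite /f1 /f2 (ExZ P _ b1) (ExZ P _ b2) -mulrDr -(ExD P b1 b2).
  apply: ler_wpM2l; first exact: weight_ge0.
  rewrite le_eqVlt; apply/orP; left; apply/eqP; apply: eq_Rintegral => w _.
  by rewrite opprD addrA.
have f0_ge0 x : 0 <= f0 x by apply: Rintegral_ge0 => w _; rewrite mulr_ge0 ?weight_ge0.
apply: (@le_trans _ _ (L1 mu (fun x => (f0 x + 3 * \sum_(k < n) (f1 k x + f2 k x))%R))).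
  apply: le_L1 => x; rewrite ger0_norm; last first.
    apply: mulr_ge0; first exact: weight_ge0.
    apply: sumr_ge0 => k _; apply: Rintegral_ge0 => w _; exact: sqr_ge0.
  exact: le_trans (pt x) (ler_norm _).
have m12 k : measurable_fun [set: R] (fun x => f1 k x + f2 k x) by exact: (measurable_funD (mf1 k) (mf2 k)).
have msum : measurable_fun [set: R] (fun x => \sum_(k < n) (f1 k x + f2 k x)) by apply: measurable_sum.
apply: le_trans (L1D _ _ _) _ => //; first by apply: measurable_funM.
rewrite (L1Z mu 3 msum) ger0_norm//.
have B0 : (L1 mu f0 <= (2304 * S * weight S * Mi i)%:E)%E.
  apply: le_trans (@swap_bound _ (fun w => 2304 * S * weight S * weight (X i 0%N w)) mh0 _ _ _ _ _) _.
  - by move=> z; rewrite mulr_ge0 ?weight_ge0.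
  - move=> x; have b0 := bm_norm (bmB (bP (a 0%N) _ x (@mX i 0%N)) (bm_ind (@mX i 0%N) (measurable_cst x))).
    exact: (bmM (bm_cst Omega (weight x)) b0).
  - apply: measurable_funM => //; apply: (@measurableT_comp _ _ _ _ _ _ (@weight R)); [exact: measurable_weight|exact: mX].
  - by move=> w; pos.
  - have a0S : 0 <= a 0%N <= S by rewrite a_ge0 aS.
    by apply: aeW => w; exact: (L1w_Phi_ind (X i 0%N w) a0S).
  have mwX : measurable_fun setT (fun w => weight (X i 0%N w)).
    by apply: (@measurableT_comp _ _ _ _ _ _ (@weight R)); [exact: measurable_weight|exact: mX].
  have k0 : 0 <= 2304 * S * weight S by pos.
  rewrite (ge0_integral_cmul P k0 mwX (fun w => weight_ge0 _)).
  have -> : (2304 * S * weight S * Mi i)%:E = ((2304 * S * weight S)%:E * (Mi i)%:E)%E by [].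
  by apply: lee_wpmul2l; [rewrite lee_fin|exact: momX].
have B12 (k : 'I_n) : (L1 mu (fun x => (f1 k x + f2 k x)%R) <= ((3 * be * dt k) * (2056 * weight S * Mi i))%:E)%E.
  apply: (@le_trans _ _ (L1 mu (f1 k) + L1 mu (f2 k))%E); first exact: (@L1D _ _ _ mu (f1 k) (f2 k) (mf1 k) (mf2 k)).
  have kn := ltn_ord k.
  have bd0 : 0 <= be * dt k by rewrite mulr_ge0.
  have bd2 : 0 <= 2 * be * dt k by rewrite -mulrA mulr_ge0.
  have t1 := @L1_term (a k) _ _ (Mi i) (be * dt k) _ bd0 (Mi1 i) (@mX i k) (@mZ' i k) (@hzx i k kn) (@momX i k (ltnW kn)) (@momZ i k kn).
  have t2 := @L1_term (a k.+1) _ _ (Mi i) (2 * be * dt k) _ bd2 (Mi1 i) (mZB k) (@mX i k.+1) (@hxz i k kn) (@momZB i k kn) (@momX i k.+1 kn).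
  apply: le_trans (leeD (t1 _) (t2 _)) _; try by rewrite a_ge0 aS.
  rewrite -EFinD lee_fin -mulrDl; apply: ler_wpM2r; last by rewrite le_eqVlt; apply/orP; left; apply/eqP; ring.
  have Mi0 : 0 <= Mi i by exact: le_trans (Mi1 i).
  by pos.
have B3 : (L1 mu (fun x => (\sum_(k < n) (f1 k x + f2 k x))%R) <= ((3 * be * Tt) * (2056 * weight S * Mi i))%:E)%E.
  apply: le_trans (L1_sum_ord mu _) _; first by move=> k; exact: m12.
  apply: le_trans (lee_sum _ (fun k _ => B12 k)) _.
  have Mi0 : 0 <= Mi i by exact: le_trans (Mi1 i).
  rewrite sumEFin lee_fin -mulr_suml; apply: ler_wpM2r; first by pos.
  by rewrite -mulr_sumr; apply: ler_wpM2l => //; pos.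
apply: (@le_trans _ _ ((2304 * S * weight S * Mi i)%:E + 3%:E * ((3 * be * Tt) * (2056 * weight S * Mi i))%:E)%E).
  by apply: leeD => //; apply: lee_wpmul2l.
by rewrite -EFinM -EFinD lee_fin /martingale_cst le_eqVlt; apply/orP; left; apply/eqP; ring.
Qed.

Variable M : R.
Hypothesis Mi_sum : \sum_(i < N) Mi i <= N%:R * M.
Hypothesis N0 : (0 < N)%N.

(** With S the double sum, |S| / N <= (w S^2 / N + 1 / w) / (2 sqrt N). By orthogonality the mean of
    S^2 is a sum of N bounded contributions, and 1 / w integrates to at most 4. *)
Lemma L1_martingale :
  (L1 (P \x mu)%E (fun z : Omega * measurableTypeR R => (N%:R^-1 * \sum_(i < N) \sum_(k < n) incr i k z.2 z.1)%R)
    <= ((martingale_cst * M + 4) / 2 / Num.sqrt N%:R)%:E)%E.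
Proof.
have NR : 0 < N%:R :> R by rewrite ltr0n.
pose rN : R := Num.sqrt N%:R.
have rN0 : 0 < rN by rewrite sqrtr_gt0.
have rN2 : rN ^+ 2 = N%:R by rewrite sqr_sqrtr ?ltW.
pose Sm (x : R) w := \sum_(i < N) \sum_(k < n) incr i k x w.
have bS x : bm (Sm x).
  by apply: bm_sum => i; apply: bm_sum => k; exact: bm_incr.
have mPhi2 s (W : Omega -> R) : measurable_fun setT W -> measurable_fun setT (fun z : Omega * measurableTypeR R => Phi s (z.2 - W z.1)).
  move=> mW; apply: measurableT_comp; first exact: measurable_Phi.
  by apply: measurable_funB => //; exact: (measurableT_comp mW).
have mS : measurable_fun setT (fun z : Omega * measurableTypeR R => Sm z.2 z.1).
  apply: measurable_sum => i; apply: measurable_sum => k; apply: measurable_funB; last by apply: mPhi2; exact: mZ'.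
  rewrite (_ : (fun z => _) = (fun z : Omega * measurableTypeR R => Phi (a k.+1) (z.2 - (Z i k z.1 + B i k z.1)))).
    by apply: (mPhi2 _ (fun w => Z i k w + B i k w)); apply: measurable_funD; [exact: mZ'|exact: mB'].
  by apply/funext => z; rewrite opprD addrA.
have mw2 : measurable_fun setT (fun z : Omega * measurableTypeR R => weight z.2).
  by apply: (@measurableT_comp _ _ _ _ _ _ (@weight R)); [exact: measurable_weight|exact: measurable_snd].
have miw : measurable_fun [set: R] (fun x : R => (weight x)^-1).
  by apply: continuous_measurable_fun => z; apply: cvgV; [rewrite gt_eqF ?weight_gt0|exact: continuous_weight].
pose F (z : Omega * measurableTypeR R) := ((2 * rN)^-1 * (weight z.2 * (N%:R^-1 * Sm z.2 z.1 ^+ 2) + (weight z.2)^-1))%:E.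
have F0 z : (0 <= F z)%E.
  by rewrite lee_fin; have := ltW rN0 => rN0'; have := ltW NR => NR'; pos.
have mF : measurable_fun setT F.
  apply/measurable_EFinP; apply: measurable_funM => //; apply: measurable_funD.
    by apply: measurable_funM => //; apply: measurable_funM => //; exact: measurable_funX.
  by apply: (@measurableT_comp _ _ _ _ _ _ (fun x : R => (weight x)^-1)); [exact: miw|exact: measurable_snd].
apply: (@le_trans _ _ (\int[(P \x mu)%E]_z F z)%E).
  apply: ge0_le_integral_nomeas => z; rewrite lee_fin//.
  rewrite -/(Sm z.2 z.1) normrM (ger0_norm (_ : 0 <= N%:R^-1)) ?invr_ge0 ?(ltW NR)//.
  have w0 := weight_gt0 z.2; move: (weight z.2) w0 => v v0.
  set u := `|Sm z.2 z.1|.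
  have -> : Sm z.2 z.1 ^+ 2 = u ^+ 2 by rewrite real_normK ?num_real.
  rewrite -rN2 -subr_ge0.
  (* The gap in the arithmetic-geometric inequality, as an explicit square. *)
  have -> : (2 * rN)^-1 * (v * ((rN ^+ 2)^-1 * u ^+ 2) + v^-1) - (rN ^+ 2)^-1 * u = (2 * rN)^-1 * v^-1 * (v * (u / rN) - 1) ^+ 2.
    by field; rewrite !gt_eqF.
  by apply: mulr_ge0 (sqr_ge0 _); have := ltW rN0 => ?; have := ltW v0 => ?; pos.
rewrite (@fubini_tonelli2 _ _ _ _ _ P mu _ mF F0) /fubini_G.
pose H x := (weight x * (N%:R^-1 * \sum_(i < N) \sum_(k < n) \int[P]_w (incr i k x w ^+ 2))).
have inner x : (\int[P]_w F (w, x) = (2 * rN)^-1%:E * ((H x)%:E + ((weight x)^-1)%:E))%E.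
  have bb := bmD (bmM (bm_cst _ (weight x)) (bmM (bm_cst _ N%:R^-1) (bmX 2 (bS x)))) (bm_cst _ (weight x)^-1).
  rewrite /F/= (ExE P (bmM (bm_cst _ (2 * rN)^-1) bb)) (ExZ P _ bb).
  rewrite (ExD P (bmM (bm_cst _ (weight x)) (bmM (bm_cst _ N%:R^-1) (bmX 2 (bS x)))) (bm_cst _ (weight x)^-1)).
  rewrite (ExZ P _ (bmM (bm_cst _ N%:R^-1) (bmX 2 (bS x)))) (ExZ P _ (bmX 2 (bS x))) Ex_cst.
  by rewrite Ex_sum_incr_sqr EFinM EFinD.
under eq_integral do rewrite inner.
have mH : measurable_fun [set: R] H.
  have mIS : measurable_fun [set: R] (fun x : R => \int[P]_w (Sm x w ^+ 2)).
    apply: (@measurable_fun_Rintegral _ _ (measurableTypeR R) Omega R P (fun z => Sm z.1 z.2 ^+ 2)).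
    apply: measurable_funX; exact: (measurableT_comp mS (@measurable_swap _ _ _ _)).
  rewrite (_ : H = fun x => weight x * (N%:R^-1 * \int[P]_w (Sm x w ^+ 2))).
    by apply: measurable_funM; [exact: measurable_weight|exact: measurable_funM].
  by apply/funext => x; rewrite /H Ex_sum_incr_sqr.
have H0 x : 0 <= H x.
  apply: mulr_ge0; first exact: weight_ge0.
  apply: mulr_ge0; first by rewrite invr_ge0 ltW.
  apply: sumr_ge0 => i _; apply: sumr_ge0 => k _.
  by apply: Rintegral_ge0 => w _; exact: sqr_ge0.
rewrite ge0_integralZl_EFin ?invr_ge0 ?mulr_ge0 ?(ltW rN0)//; last first.
- by apply: emeasurable_funD; exact/measurable_EFinP.
- by move=> x _; rewrite -EFinD lee_fin addr_ge0// invr_ge0 weight_ge0.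
rewrite ge0_integralD//; last first.
- exact/measurable_EFinP.
- by move=> x _; rewrite lee_fin invr_ge0 weight_ge0.
- exact/measurable_EFinP.
- by move=> x _; rewrite lee_fin.
have LH : (\int[mu]_x (H x)%:E <= (martingale_cst * M)%:E)%E.
  pose h i x := weight x * \sum_(k < n) \int[P]_w (incr i k x w ^+ 2).
  have mh i : measurable_fun [set: R] (h i).
    apply: measurable_funM; first exact: measurable_weight.
    apply: measurable_sum => k.
    apply: (@measurable_fun_Rintegral _ _ (measurableTypeR R) Omega R P (fun z => incr i k z.1 z.2 ^+ 2)).
    apply: measurable_funX.
    have mi : measurable_fun setT (fun z : Omega * measurableTypeR R => incr i k z.2 z.1).
      apply: measurable_funB; last by apply: mPhi2; exact: mZ'.
      rewrite (_ : (fun z => _) = (fun z : Omega * measurableTypeR R => Phi (a k.+1) (z.2 - (Z i k z.1 + B i k z.1)))).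
        by apply: (mPhi2 _ (fun w => Z i k w + B i k w)); apply: measurable_funD; [exact: mZ'|exact: mB'].
      by apply/funext => z; rewrite opprD addrA.
    exact: (measurableT_comp mi (@measurable_swap _ _ _ _)).
  have HE x : H x = N%:R^-1 * \sum_(i < N) h i x by rewrite /H mulrCA mulr_sumr.
  apply: (@le_trans _ _ (L1 mu (fun x => (N%:R^-1 * \sum_(i < N) h i x)%R))).
    by apply: ge0_le_integral_nomeas => x; rewrite lee_fin// -HE ler_norm.
  rewrite L1Z; last by apply: measurable_sum.
  rewrite ger0_norm ?invr_ge0 ?(ltW NR)//.
  apply: (@le_trans _ _ (N%:R^-1%:E * (\sum_(i < N) (martingale_cst * Mi i))%:E)%E).
    apply: lee_wpmul2l; first by rewrite lee_fin invr_ge0 ltW.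
    apply: le_trans (L1_sum_ord mu _) _ => //.
    by rewrite -sumEFin; apply: lee_sum => i _; exact: L1w_incr_sqr.
  rewrite -EFinM lee_fin -mulr_sumr ler_pdivrMl// mulrCA ler_wpM2l//.
  by rewrite /martingale_cst; pos.
apply: (@le_trans _ _ ((2 * rN)^-1%:E * ((martingale_cst * M)%:E + 4%:E))%E).
  apply: lee_wpmul2l; first by rewrite lee_fin invr_ge0 mulr_ge0 ?(ltW rN0).
  by apply: leeD => //; exact: integral_inv_weight.
by rewrite -EFinD -EFinM lee_fin -/rN invfM le_eqVlt; apply/orP; left; apply/eqP; ring.
Qed.

End martingale.

(** * A singular Gronwall lemma *)

Section gronwall.
Variable R : realType.
Implicit Types (c A B d T : R) (k n : nat).

Let s k : R := (Num.sqrt k%:R)^-1.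

Let s_ge0 k : 0 <= s k. Proof. by rewrite invr_ge0. Qed.

(** Each term 1 / sqrt (k + 1) is at most 2 (sqrt (k + 1) - sqrt k). *)
Lemma sum_inv_sqrt k : \sum_(1 <= j < k.+1) (Num.sqrt j%:R)^-1 <= 2 * Num.sqrt k%:R :> R.
Proof.
elim: k => [|k ih]; first by rewrite big_nil sqrtr0 mulr0.
rewrite big_nat_recr//=; apply: le_trans (lerD ih (lexx _)) _.
have a0 : 0 <= Num.sqrt (k%:R : R) by [].
have b0 : 0 < Num.sqrt (k.+1%:R : R) by rewrite sqrtr_gt0 ltr0n.
have ab : Num.sqrt (k%:R : R) <= Num.sqrt k.+1%:R by rewrite ler_wsqrtr// ler_nat.
have a2 : Num.sqrt (k%:R : R) ^+ 2 = k%:R by rewrite sqr_sqrtr.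
have b2 : Num.sqrt (k.+1%:R : R) ^+ 2 = k%:R + 1 by rewrite sqr_sqrtr// -natr1.
move: (Num.sqrt _) (Num.sqrt _) a0 b0 ab a2 b2 => b a a0 b0 ab a2 b2.
rewrite -(ler_pM2r b0) mulrDl mulVf ?gt_eqF//.
by have := sqr_ge0 (b - a); rewrite sqrrB a2 b2 -!mulrA -expr2 b2 mulrC -mulr_natl; lra.
Qed.

Lemma sum_inv_sqrt_lt k : \sum_(1 <= j < k) (Num.sqrt j%:R)^-1 <= 2 * Num.sqrt k%:R :> R.
Proof.
case: k => [|k]; first by rewrite big_geq// sqrtr0 mulr0.
by apply: le_trans (sum_inv_sqrt k) _; rewrite ler_wpM2l// ler_wsqrtr// ler_nat.
Qed.

Lemma sum_inv_sqrt_rev k : \sum_(1 <= j < k) (Num.sqrt (k - j)%:R)^-1 <= 2 * Num.sqrt k%:R :> R.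
Proof.
apply: le_trans (sum_inv_sqrt_lt k); rewrite big_nat_rev/=.
apply: ler_sum_nat => j /andP[j1 jk]; by rewrite add1n subSS subnA ?subnn ?add0n// ltnW.
Qed.

(** A discrete Beta integral with both parameters 1/2. Since sqrt (a + b) <= sqrt a + sqrt b, the
    product 1 / sqrt (a b) is at most (1 / sqrt a + 1 / sqrt b) / sqrt (a + b), and each of the two
    sums is at most 2 sqrt k. *)
Lemma beta_sum k : \sum_(1 <= j < k) (Num.sqrt (k - j)%:R)^-1 * (Num.sqrt j%:R)^-1 <= 4 :> R.
Proof.
have [k1|k1] := leqP k 1; first by rewrite big_geq.
have k0 : 0 < Num.sqrt (k%:R : R) by rewrite sqrtr_gt0 ltr0n; case: k k1.
have h j : (1 <= j < k)%N -> s (k - j) * s j <= (Num.sqrt k%:R)^-1 * (s j + s (k - j)).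
  move=> /andP[j1 jk].
  have a0 : 0 < Num.sqrt (j%:R : R) by rewrite sqrtr_gt0 ltr0n.
  have b0 : 0 < Num.sqrt ((k - j)%:R : R) by rewrite sqrtr_gt0 ltr0n subn_gt0.
  have a2 : Num.sqrt (j%:R : R) ^+ 2 = j%:R by rewrite sqr_sqrtr.
  have b2 : Num.sqrt ((k - j)%:R : R) ^+ 2 = k%:R - j%:R by rewrite sqr_sqrtr// natrB// ltnW.
  have c2 : Num.sqrt (k%:R : R) ^+ 2 = k%:R by rewrite sqr_sqrtr.
  rewrite /s; move: (Num.sqrt j%:R) (Num.sqrt (k - j)%:R) (Num.sqrt k%:R) a0 b0 k0 a2 b2 c2 => a b c a0 b0 c0 a2 b2 c2.
  have cab : c <= a + b.
    by rewrite -ler_sqr ?nnegrE ?addr_ge0 ?(ltW a0) ?(ltW b0) ?(ltW c0)//; nra.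
  rewrite -subr_ge0.
  have -> : c^-1 * (a^-1 + b^-1) - b^-1 * a^-1 = (a + b - c) / (a * b * c) by field; rewrite !gt_eqF.
  by rewrite divr_ge0 ?subr_ge0// !mulr_ge0 ?(ltW a0) ?(ltW b0) ?(ltW c0).
apply: le_trans (ler_sum_nat h) _.
rewrite -mulr_sumr ler_pdivrMl// big_split/=.
by apply: le_trans (lerD (sum_inv_sqrt_lt k) (sum_inv_sqrt_rev k)) _; lra.
Qed.

Lemma triangle_sum k (f : nat -> nat -> R) :
  \sum_(1 <= j < k) \sum_(1 <= i < j) f j i = \sum_(1 <= i < k) \sum_(i.+1 <= j < k) f j i.
Proof.
elim: k => [|k ih]; first by rewrite !big_geq.
have [k0|k0] := posnP k; first by rewrite k0 !big_geq.
rewrite [LHS]big_nat_recr//= [RHS]big_nat_recr//= ih [X in _ = _ + X]big_geq// addr0 -big_split/=.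
by apply: eq_big_nat => i /andP[i1 ik]; rewrite big_nat_recr.
Qed.

(** 4 c^2 is the kernel after one iteration, by [beta_sum], and its exponential the resulting growth
    factor. The first product is the iterated constant term with its amplification; the last term
    amplifies the singular part A / sqrt t, whose integral is of order sqrt T. *)
Definition gronwall_cst c T : R :=
  ((1 + 2 * c * Num.sqrt T) + 4 * c) * (1 + 4 * c ^+ 2 * T * expR (4 * c ^+ 2 * T))
  + 8 * c ^+ 2 * Num.sqrt T * expR (4 * c ^+ 2 * T).

(* Iterating the inequality once replaces the singular kernel [1 / sqrt (t - s)] by its self-convolution, which is bounded by [beta_sum]. *)
Lemma gronwall c A B d T n (u : nat -> R) :
  0 <= c -> 0 <= A -> 0 <= B -> 0 < d -> n%:R * d <= T -> (forall k, 0 <= u k) ->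
  (forall k, (0 < k <= n)%N ->
    u k <= A / Num.sqrt (k%:R * d) + B + c * \sum_(1 <= j < k) d / Num.sqrt ((k - j)%:R * d) * u j) ->
  forall k, (0 < k <= n)%N -> u k <= A / Num.sqrt (k%:R * d) + gronwall_cst c T * (A + B).
Proof.
move=> c0 A0 B0 d0 ndT u0 hu.
pose r := Num.sqrt d.
have r0 : 0 < r by rewrite sqrtr_gt0.
have r2 : r ^+ 2 = d by rewrite sqr_sqrtr ?ltW.
have sE k : (Num.sqrt (k%:R * d))^-1 = r^-1 * s k by rewrite sqrtrM// invfM mulrC.
have drE : d * r^-1 = r by rewrite -r2 expr2 mulfK// gt_eqF.
have T0 : 0 <= T by apply: le_trans ndT; rewrite mulr_ge0// ltW.
pose a := A / r; pose ka := c * r.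
have a0 : 0 <= a by rewrite divr_ge0// ltW.
have ka0 : 0 <= ka by rewrite mulr_ge0// ltW.
have hu1 k : (0 < k <= n)%N -> u k <= a * s k + B + ka * \sum_(1 <= j < k) s (k - j) * u j.
  move=> kn; have := hu k kn; rewrite sE mulrA; congr (_ <= _ + _).
  rewrite -mulrA !mulr_sumr; apply: eq_bigr => j _.
  by rewrite sE (mulrA d) drE !mulrA.
have sq k : (k <= n)%N -> r * Num.sqrt k%:R <= Num.sqrt T.
  move=> kn; rewrite /r -(sqrtrM _ (ltW d0)) ler_wsqrtr// mulrC; apply: le_trans ndT.
  by rewrite ler_pM2r// ler_nat.
pose Bc := B * (1 + 2 * c * Num.sqrt T) + 4 * c * A.
have Bc0 : 0 <= Bc by rewrite addr_ge0 ?mulr_ge0 ?addr_ge0 ?mulr_ge0.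
pose S k := \sum_(1 <= j < k) u j.
have S0 k : 0 <= S k by apply: sumr_ge0.
have hu2 k : (0 < k <= n)%N -> u k <= a * s k + Bc + 4 * ka ^+ 2 * S k.
  move=> kn; have /andP[k0 kn'] := kn.
  apply: le_trans (hu1 k kn) _.
  have step j : (1 <= j < k)%N -> s (k - j) * u j <=
      a * (s (k - j) * s j) + B * s (k - j) + ka * (\sum_(1 <= i < j) s (k - j) * (s (j - i) * u i)).
    move=> /andP[j1 jk].
    have jn : (0 < j <= n)%N by rewrite j1 (leq_trans (ltnW jk)).
    apply: le_trans (ler_wpM2l (s_ge0 _) (hu1 j jn)) _.
    by rewrite -mulr_sumr le_eqVlt; apply/orP; left; apply/eqP; ring.
  have tri : \sum_(1 <= j < k) \sum_(1 <= i < j) s (k - j) * (s (j - i) * u i) <= 4 * S k.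
    rewrite triangle_sum /S mulr_sumr; apply: ler_sum_nat => i /andP[i1 ik].
    rewrite (eq_bigr (fun j => (s (k - j) * s (j - i)) * u i)); last by move=> j _; rewrite mulrA.
    rewrite -mulr_suml ler_wpM2r// -[i.+1]addn1 addnC big_addn.
    apply: le_trans (beta_sum (k - i)).
    by apply: ler_sum_nat => j /andP[j1 jk]; rewrite addnK addnC subnDA.
  have := ler_sum_nat step; rewrite !big_split/= -!mulr_sumr => h.
  have h1 := beta_sum k; have h2 := sum_inv_sqrt_rev k.
  have kn2 : ka * Num.sqrt k%:R <= c * Num.sqrt T by rewrite -mulrA ler_wpM2l ?sq.
  have e1 : ka * a = c * A by rewrite /ka /a; field; rewrite gt_eqF.
  set X := \sum_(1 <= j < k) s (k - j) * u j in h *.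
  set Y := \sum_(1 <= j < k) \sum_(1 <= i < j) _ in h tri.
  have h1' := ler_wpM2l a0 h1; have h2' := ler_wpM2l B0 h2.
  have h3 := ler_wpM2l ka0 (le_trans h (lerD (lerD h1' h2') (ler_wpM2l ka0 tri))).
  have h4 := ler_wpM2l B0 kn2.
  rewrite /Bc -!addrA lerD2l -[X in B + X <= _]addr0.
  have -> : B * (1 + 2 * c * Num.sqrt T) + (4 * c * A + 4 * ka ^+ 2 * S k) =
     B + (2 * (B * (c * Num.sqrt T)) + 4 * (c * A) + 4 * ka ^+ 2 * S k) by ring.
  rewrite addr0 lerD2l; apply: le_trans h3 _.
  have -> : ka * (a * 4 + B * (2 * Num.sqrt k%:R) + ka * (4 * S k)) =
     2 * (B * (ka * Num.sqrt k%:R)) + 4 * (ka * a) + 4 * ka ^+ 2 * S k by ring.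
  by rewrite e1; apply: lerD => //; apply: lerD => //; rewrite ler_pM2l.
pose q := 4 * ka ^+ 2.
have q0 : 0 <= q by rewrite mulr_ge0// sqr_ge0.
have qE : q = 4 * c ^+ 2 * d by rewrite /q /ka exprMn r2 mulrA.
(* Ordinary discrete Gronwall for the partial sums, the iterated kernel being the constant q. *)
have hS k : (k <= n)%N -> S k.+1 <= (1 + q) ^+ k * \sum_(1 <= j < k.+1) (a * s j + Bc).
  elim: k => [|k ih] kn; first by rewrite /S !big_geq// mulr0.
  have kn' : (0 < k.+1 <= n)%N by [].
  rewrite /S big_nat_recr//= -/(S k.+1).
  have h := hu2 k.+1 kn'; have hh := ih (ltnW kn).
  rewrite [X in _ * X]big_nat_recr//= mulrDr.
  have q1 : 1 <= 1 + q by rewrite lerDl.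
  apply: (@le_trans _ _ ((1 + q) * S k.+1 + (a * s k.+1 + Bc))).
    by move: h; rewrite -/q; lra.
  apply: lerD.
    by rewrite exprS -mulrA ler_wpM2l// (le_trans _ q1).
  by rewrite ler_peMl ?exprn_ege1// addr_ge0// mulr_ge0.
move=> k kn; have /andP[k0 kn'] := kn.
pose E := expR (4 * c ^+ 2 * T).
have E0 : 0 <= E by exact: expR_ge0.
have qkE : (1 + q) ^+ k <= E.
  apply: (@le_trans _ _ (expR q ^+ k)).
    by apply: lerXn2r; rewrite ?nnegrE ?expR_ge0 ?addr_ge0// expR_ge1Dx.
  rewrite -expRM_natl ler_expR qE mulrCA ler_wpM2l ?mulr_ge0 ?sqr_ge0//.
  by apply: le_trans ndT; rewrite ler_pM2r// ler_nat.
have hS1 : q * S k <= 8 * c ^+ 2 * Num.sqrt T * E * A + 4 * c ^+ 2 * T * E * Bc.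
  have Sk : S k <= S k.+1 by rewrite /S big_nat_recr//= lerDl.
  have h3 : \sum_(1 <= j < k.+1) (a * s j + Bc) <= a * (2 * Num.sqrt k%:R) + k%:R * Bc.
    rewrite big_split/= -mulr_sumr sumr_const_nat subSS subn0 -[Bc *+ k]mulr_natl.
    by apply: lerD => //; apply: ler_wpM2l => //; exact: sum_inv_sqrt.
  have h4 : S k <= E * (a * (2 * Num.sqrt k%:R) + k%:R * Bc).
    apply: le_trans Sk _; apply: le_trans (hS k kn') _.
    apply: ler_pM => //; first by rewrite exprn_ge0 ?addr_ge0.
    by apply: sumr_ge0 => j _; apply: addr_ge0 => //; exact: mulr_ge0.
  apply: le_trans (ler_wpM2l q0 h4) _.
  rewrite qE.
  have -> : 4 * c ^+ 2 * d * (E * (a * (2 * Num.sqrt k%:R) + k%:R * Bc)) =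
     8 * c ^+ 2 * E * (d * a * Num.sqrt k%:R) + 4 * c ^+ 2 * E * Bc * (k%:R * d) by ring.
  have -> : d * a * Num.sqrt k%:R = A * (r * Num.sqrt k%:R) by rewrite /a -[in LHS]r2; field; rewrite gt_eqF.
  have g1 : k%:R * d <= T by apply: le_trans ndT; rewrite ler_pM2r// ler_nat.
  have g2 := sq k kn'.
  have -> : 8 * c ^+ 2 * Num.sqrt T * E * A = 8 * c ^+ 2 * E * (A * Num.sqrt T) by ring.
  have -> : 4 * c ^+ 2 * T * E * Bc = 4 * c ^+ 2 * E * Bc * T by ring.
  by apply: lerD; rewrite ler_wpM2l ?mulr_ge0 ?sqr_ge0// ler_wpM2l.
apply: le_trans (hu2 k kn) _.
have -> : A / Num.sqrt (k%:R * d) = a * s k by rewrite sE mulrA.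
rewrite -addrA lerD2l; apply: le_trans (lerD (lexx Bc) hS1) _.
rewrite /gronwall_cst -/E.
set tT := Num.sqrt T.
have tT0 : 0 <= tT by exact: sqrtr_ge0.
have G0 : 0 <= c * tT by rewrite mulr_ge0.
have BcE : Bc <= ((1 + 2 * c * tT) + 4 * c) * (A + B).
  by rewrite /Bc -/tT; have := mulr_ge0 c0 B0; have := mulr_ge0 G0 A0; lra.
set J := 4 * c ^+ 2 * T * E.
have J0 : 0 <= J by rewrite !mulr_ge0 ?sqr_ge0.
set H := 8 * c ^+ 2 * tT * E.
have H0 : 0 <= H by rewrite !mulr_ge0 ?sqr_ge0.
have J1 : 0 <= 1 + J by rewrite addr_ge0.
have := ler_wpM2l J1 BcE; have := mulr_ge0 H0 B0.
have -> : ((1 + 2 * c * tT + 4 * c) * (1 + J) + H) * (A + B) = (1 + J) * ((1 + 2 * c * tT + 4 * c) * (A + B)) + H * A + H * B by ring.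
by move: ((1 + J) * (_ * _)) (H * A) (H * B) => W1 W2 W3 h1; rewrite mulrDl mul1r; lra.
Qed.

End gronwall.

(** * The drift on [0, 1] *)

Section uniform_continuity.
Variable R : realType.

(** Heine's theorem, from the covering form of compactness applied to the filter of small positive
    moduli. *)
Lemma within_continuous_unif (f : R -> R) (a b e : R) : {within `[a, b], continuous f} -> 0 < e ->
  exists2 dl : R, 0 < dl & forall x y, a <= x <= b -> a <= y <= b -> `|x - y| <= dl -> `|f x - f y| <= e.
Proof.
move=> /subspace_continuousP cf e0.
have /compact_near_coveringP/(_ R (0^'+) (fun dl x => forall y, a <= x <= b -> a <= y <= b -> `|x - y| <= dl -> `|f x - f y| <= e)) := @segment_compact R a b.
case.
  move=> x abx; have /cvgrPdist_lt/(_ (e / 2)) := cf x abx.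
  rewrite divr_gt0// => /(_ isT); rewrite near_withinE => -[r /= r0 hr].
  exists (ball x (r / 2), [set dl | dl < r / 2]) => /=.
    split; first by exists (r / 2) => //=; rewrite divr_gt0.
    by apply: nbhs_right_lt; rewrite divr_gt0.
  move=> [x' dl] /= [xx' dr] y abx' aby x'y.
  have h1 : `|f x - f x'| < e / 2.
    by apply: hr => /=; [apply: lt_trans xx' _; lra|rewrite in_itv].
  have h2 : `|f x - f y| < e / 2.
    apply: hr => /=; last by rewrite in_itv.
    rewrite (splitr r) -(subrKA x'); apply: le_lt_trans (ler_normD _ _) _.
    by apply: ltrD => //; exact: le_lt_trans dr.
  rewrite -(subrKA (f x)) (splitr e); apply: le_trans (ler_normD _ _) _.
  by rewrite distrC; apply: lerD; exact: ltW.
move=> r /= r0 hr.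
exists (r / 2); first by rewrite divr_gt0.
move=> x y abx aby xy; apply: (hr (r / 2)) => //=.
- by rewrite sub0r normrN ger0_norm ?divr_ge0 ?(ltW r0)//; lra.
- by rewrite divr_gt0.
Qed.

End uniform_continuity.

Section C1_extension.
Variable R : realType.
Implicit Types (x y u v e : R).

(** [Lambda] and [lambda] are arbitrary outside [0, 1]. Composing them with this projection makes
    them globally continuous and keeps their values at distribution functions and normalized
    ranks. *)
Definition clip x : R := if x <= 0 then 0 else if 1 <= x then 1 else x.

Lemma clip01 x : 0 <= clip x <= 1.
Proof.
rewrite /clip; case: (leP x 0) => h; first by rewrite lexx ler01.
by case: (leP 1 x) => h1; [rewrite ler01 lexx|rewrite !ltW].
Qed.

Lemma clip_id x : 0 <= x <= 1 -> clip x = x.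
Proof.
move=> /andP[x0 x1]; rewrite /clip; case: (leP x 0) => h; first by apply/eqP; rewrite eq_le x0 h.
by case: (leP 1 x) => h1 //; apply/eqP; rewrite eq_le x1 h1.
Qed.

Lemma clip_nonexpansive x y : `|clip x - clip y| <= `|x - y|.
Proof.
wlog xy : x y / x <= y.
  move=> H; have /orP[/H//|/H] := le_total x y; by rewrite distrC (distrC x).
rewrite !(distrC x) (distrC (clip x)) [X in _ <= X]ger0_norm ?subr_ge0// ger0_norm.
  by rewrite /clip; case: (leP x 0); case: (leP y 0); case: (leP 1 x); case: (leP 1 y); lra.
by rewrite /clip; case: (leP x 0); case: (leP y 0); case: (leP 1 x); case: (leP 1 y); lra.
Qed.

Lemma continuous_eps (f : R -> R) :
  (forall x e, 0 < e -> exists2 dl : R, 0 < dl & forall y, `|x - y| < dl -> `|f x - f y| <= e) -> continuous f.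
Proof.
move=> H x; apply/cvgrPdist_le => e e0; have [dl d0 h] := H x e e0.
by near=> y; apply: h; near: y; exact: cvgr_dist_lt.
Unshelve. all: by end_near. Qed.

Variables Lambda lambda : R -> R.
Hypothesis HC1 : C1_on01 Lambda lambda.

Let derivE x e : 0 <= x <= 1 -> 0 < e ->
  exists2 dl : R, 0 < dl & forall y, 0 <= y <= 1 -> y != x -> `|x - y| < dl ->
    `|lambda x - (Lambda y - Lambda x) / (y - x)| <= e.
Proof.
move=> x01 e0; have [/(_ x x01) h _] := HC1.
move/cvgrPdist_le : h => /(_ e e0); rewrite !near_withinE => -[dl /= d0 h].
by exists dl => // y y01 yx xy; apply: h => //=; rewrite in_itv.
Qed.

Let contE x e : 0 <= x <= 1 -> 0 < e ->
  exists2 dl : R, 0 < dl & forall y, 0 <= y <= 1 -> `|x - y| < dl -> `|lambda x - lambda y| <= e.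
Proof.
move=> x01 e0; have [_ /subspace_continuousP/(_ x)] := HC1.
rewrite /= in_itv/= => /(_ x01) /cvgrPdist_le /(_ e e0); rewrite !near_withinE => -[dl /= d0 h].
by exists dl => // y y01 xy; apply: h => //=; rewrite in_itv.
Qed.

Definition cliplam x := lambda (clip x).
Definition clipLam x := Lambda (clip x).

Lemma continuous_cliplam : continuous cliplam.
Proof.
apply: continuous_eps => x e e0; have [dl d0 h] := contE (clip01 x) e0.
exists dl => // y xy; apply: h; first exact: clip01.
exact: le_lt_trans (clip_nonexpansive _ _) xy.
Qed.

Lemma continuous_clipLam : continuous clipLam.
Proof.
apply: continuous_eps => x e e0; have [dl d0 h] := derivE (clip01 x) ltr01.
pose M := `|lambda (clip x)| + 1.
have M0 : 0 < M by rewrite ltr_wpDl.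
exists (Num.min dl (e / M)); first by rewrite lt_min d0 divr_gt0.
move=> y; rewrite lt_min => /andP[xy xy2].
rewrite /clipLam; have [->|ne] := eqVneq (clip y) (clip x); first by rewrite subrr normr0 ltW.
have cxy := clip_nonexpansive x y.
have := h _ (clip01 y) ne (le_lt_trans cxy xy).
set A := Lambda (clip y) - _; set b := clip y - clip x => hA.
have b0 : b != 0 by rewrite subr_eq0.
have AM : `|A / b| <= M.
  rewrite /M -[A / b](subKr (lambda (clip x))); apply: le_trans (ler_normB _ _) _; exact: lerD.
rewrite distrC -/A -(divfK b0 A) normrM.
apply: le_trans (ler_pM _ _ AM (_ : `|b| <= e / M)) _ => //.
  by rewrite distrC; apply: le_trans cxy (ltW _).
by rewrite mulrC divfK// gt_eqF.
Qed.

(** The mean value theorem asks for a derivative inside ]u, v[ only, where the one-sided limits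
    within [0, 1] are two-sided, and for continuity at the ends. *)
Lemma clipLam_mvt u v : 0 <= u -> u <= v -> v <= 1 ->
  exists2 c : R, u <= c <= v & clipLam v - clipLam u = cliplam c * (v - u).
Proof.
move=> u0 uv v1.
suff dL x : x \in `]u, v[%R -> is_derive x 1 clipLam (cliplam x).
  have [c cuv hc] := MVT_segment uv dL (continuous_subspaceT continuous_clipLam).
  by exists c => //; move: cuv; rewrite in_itv.
rewrite in_itv/= => /andP[ux xv].
have x0 : 0 < x by exact: le_lt_trans ux.
have x1 : x < 1 by exact: lt_le_trans v1.
have x01 : 0 <= x <= 1 by rewrite !ltW.
have cv : h^-1 *: ((clipLam \o shift x) (h *: 1) - clipLam x) @[h --> 0^'] --> cliplam x.
  apply/cvgrPdist_le => e e0.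
  have [dl d0 h] := derivE x01 e0.
  rewrite near_withinE; near=> k => k0.
  have kd : `|k| < dl by near: k; apply: cvgr0_norm_lt => //; exact: cvg_id.
  have kx : `|k| < x by near: k; apply: cvgr0_norm_lt => //; exact: cvg_id.
  have k1 : `|k| < 1 - x by near: k; apply: cvgr0_norm_lt; [exact: cvg_id|rewrite subr_gt0].
  have kx01 : 0 <= k + x <= 1.
    move: kx k1; rewrite !ltr_norml => /andP[h1 h2] /andP[h3 h4]; apply/andP; split; lra.
  rewrite /= /clipLam /cliplam clip_id// [k%:A]mulr1 clip_id// /GRing.scale/= mulrC.
  have := h _ kx01; rewrite addrK; apply; last by rewrite opprD addrCA subrr addr0 normrN.
  by rewrite -subr_eq0 addrK.
apply: DeriveDef; first by apply/cvg_ex; exists (cliplam x).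
exact: cvg_lim.
Unshelve. all: by end_near. Qed.

Lemma cliplam_bounded : exists2 B : R, 0 <= B & forall x, `|cliplam x| <= B.
Proof.
have cn : continuous (fun x => `|cliplam x|) by move=> x; apply: cvg_norm; exact: continuous_cliplam.
have [c _ hc] := @EVT_max R (fun x => `|cliplam x|) 0 1 ler01 (continuous_subspaceT cn).
exists `|cliplam c| => // x.
have := hc (clip x); rewrite in_itv/= clip01 => /(_ isT).
by rewrite /cliplam (clip_id (clip01 x)).
Qed.

Lemma cliplam_unif e : 0 < e ->
  exists2 dl : R, 0 < dl & forall x y, `|x - y| <= dl -> `|cliplam x - cliplam y| <= e.
Proof.
move=> e0.
have [_ cl] := HC1; have [dl d0 hdl] := within_continuous_unif cl e0.
by exists dl => // x y xy; apply: hdl (clip01 x) (clip01 y) (le_trans (clip_nonexpansive _ _) xy).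
Qed.

Lemma clipLam_lipschitz B : (forall x, `|cliplam x| <= B) -> forall x y, `|clipLam x - clipLam y| <= B * `|x - y|.
Proof.
move=> lB; have B0 : 0 <= B by apply: le_trans (lB 0).
have key u v : 0 <= u <= 1 -> 0 <= v <= 1 -> `|clipLam u - clipLam v| <= B * `|u - v|.
  wlog uv : u v / u <= v.
    move=> H u01 v01; have /orP[/H|/H] := le_total u v; first exact.
    by rewrite distrC (distrC u); exact.
  move=> /andP[u0 _] /andP[_ v1]; have [c _ h] := clipLam_mvt u0 uv v1.
  by rewrite distrC h normrM distrC ler_wpM2r.
move=> x y; have e z : clipLam z = clipLam (clip z) by rewrite /clipLam (clip_id (clip01 z)).
rewrite (e x) (e y); apply: le_trans (key _ _ (clip01 x) (clip01 y)) _.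
by apply: ler_wpM2l => //; exact: clip_nonexpansive.
Qed.

End C1_extension.

(** * Distribution functions and the Wasserstein distance *)

Section quantile_coupling.
Variable R : realType.
Notation mu := (@lebesgue_measure R).
Implicit Types (m : probability (measurableTypeR R) R) (u x y : R).

Let idR : measurableTypeR R -> R := idfun.
Let mid : measurable_fun setT idR. Proof. exact: measurable_id. Qed.
HB.instance Definition _ := isMeasurableFun.Build _ _ _ _ idR mid.

Let cdfE m x : cdf (idR : {RV m >-> R}) x = (cdf_of m x)%:E.
Proof. by rewrite /cdf_of fineK// fin_num_measure. Qed.

Lemma cdf_of01 m x : 0 <= cdf_of m x <= 1.
Proof. by rewrite -!lee_fin -cdfE cdf_ge0 cdf_le1. Qed.

Lemma le_cdf_of m x y : x <= y -> cdf_of m x <= cdf_of m y.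
Proof. by move=> xy; rewrite -lee_fin -!cdfE cdf_nondecreasing. Qed.

Lemma measurable_cdf_of m : measurable_fun [set: R] (cdf_of m).
Proof. by apply: nondecreasing_measurable => // x y; exact: le_cdf_of. Qed.

Lemma cdf_of_y1 m : cdf_of m x @[x --> +oo] --> (1 : R).
Proof.
have := @cvg_cdfy1 _ _ _ m (idR : {RV m >-> R}); rewrite (_ : cdf _ = fun x => (cdf_of m x)%:E); last first.
  by apply/funext => x; rewrite cdfE.
exact: fine_cvg.
Qed.

Lemma cdf_of_Ny0 m : cdf_of m x @[x --> -oo] --> (0 : R).
Proof.
have := @cvg_cdfNy0 _ _ _ m (idR : {RV m >-> R}); rewrite (_ : cdf _ = fun x => (cdf_of m x)%:E); last first.
  by apply/funext => x; rewrite cdfE.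
exact: fine_cvg.
Qed.

Lemma cdf_of_right_continuous m x : cdf_of m y @[y --> x^'+] --> cdf_of m x.
Proof.
have := @cdf_right_continuous _ _ _ m (idR : {RV m >-> R}) x; rewrite (_ : cdf _ = fun x => (cdf_of m x)%:E); last first.
  by apply/funext => y; rewrite cdfE.
exact: fine_cvg.
Qed.

(** Right continuity of the distribution function makes the infimum attained; for u in ]0, 1[ the
    set is nonempty and bounded below. *)
Lemma quantile_galois m u x : 0 < u < 1 -> (quantile m u <= x) = (u <= cdf_of m x).
Proof.
move=> /andP[u0 u1].
have lb : has_lbound [set x | u <= cdf_of m x].
  have := @cdf_of_Ny0 m; move/cvgr_lt => /(_ u u0) [M [_ hM]].
  exists (M - 1) => y /= uy; rewrite leNgt; apply/negP => yM.
  have := hM (M - 1) (_ : M - 1 < M); rewrite gtrBl ltr01 => /(_ isT); rewrite ltNge => /negP; apply.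
  by apply: le_trans uy _; exact: le_cdf_of (ltW yM).
have ne : [set x | u <= cdf_of m x] !=set0.
  have := @cdf_of_y1 m; move/cvgr_ge => /(_ u u1) [M [_ hM]].
  by exists (M + 1) => /=; apply: hM; rewrite ltrDl.
apply/idP/idP => [qx|ux]; last exact: ge_inf.
rewrite leNgt; apply/negP => Fu.
have := @cdf_of_right_continuous m x; move/cvgr_lt => /(_ u Fu) [r /= r0 hr].
have r20 : 0 < r / 2 by rewrite divr_gt0.
have Fr : cdf_of m (x + r / 2) < u.
  apply: hr => /=; last by rewrite ltrDl.
  by rewrite opprD addNKr normrN gtr0_norm//; lra.
have : x + r / 2 <= quantile m u.
  apply: lb_le_inf => // y /= uy; rewrite leNgt; apply/negP => /ltW /(le_cdf_of m) h.
  by have := le_lt_trans (le_trans uy h) Fr; rewrite ltxx.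
by move/le_trans => /(_ _ qx); rewrite leNgt ltrDl r20.
Qed.

(* [quantile] is only used on ]0, 1[: outside, the infimum may be over an empty or unbounded set. *)
Definition quantile01 m u : R := if (0 < u < 1) then quantile m u else 0.

Lemma measurable_quantile01 m : measurable_fun [set: R] (quantile01 m).
Proof.
have -> : quantile01 m = (quantile m) \_ `]0, 1[.
  apply/funext => u; rewrite /quantile01 patchE; case: ifPn => h; first by rewrite mem_set//= in_itv.
  by rewrite memNset//= in_itv/=; exact/negP.
apply/measurable_restrict => //; rewrite setTI.
apply: (measurability (@RGenOInfty.G R)) => [|/= _ [_] [x] -> <-].
  exact: RGenOInfty.measurableE.
rewrite (_ : _ `&` _ = `]0, 1[ `&` `]cdf_of m x, +oo[); first by apply: measurableI; exact: measurable_itv.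
apply/seteqP; split => u /=; rewrite !in_itv/= !andbT => -[u01 h]; split => //; move: h;
  by rewrite !ltNge quantile_galois.
Qed.

Lemma prob_eq_cdf m1 m2 : (forall x, cdf_of m1 x = cdf_of m2 x) ->
  forall A, measurable A -> m1 A = m2 A.
Proof.
move=> H A mA.
have mray x : measurable (`]x, +oo[%classic : set (measurableTypeR R)).
  exact: measurable_itv.
apply: (@g_sigma_algebra_measure_unique _ _ (measurableTypeR R) (@RGenOInfty.G R) _ (fun n => `]- n%:R, +oo[%classic)) => //.
- by move=> _ [x ->].
- by move=> n; exists (- n%:R).
- rewrite -subTset => x _; exists (Num.truncn `|x|).+1 => //=; rewrite in_itv/= andbT.
  by rewrite ltrNl; apply: le_lt_trans (ler_norm _) _; rewrite normrN truncnS_gt.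
- move=> _ _ [x ->] [y ->]; exists (Num.max x y); apply/seteqP; split => z /=; rewrite !in_itv/= !andbT gt_max.
    by move=> [-> ->].
  by move=> /andP[].
- move=> _ [x ->]; have pc (m : probability (measurableTypeR R) R) : m `]x, +oo[%classic = (1 - (cdf_of m x)%:E)%E.
    by rewrite -setCitvl; have := @probability_setC _ _ _ m `]-oo, x]%classic (measurable_itv _) => ->; rewrite /cdf_of fineK// fin_num_measure.
  by apply: (etrans (pc m1)); rewrite H; exact: esym (pc m2).
- by move=> n; apply: le_lt_trans (probability_le1 _ _) (ltry _).
- suff : (@RGenOInfty.G R).-sigma.-measurable A by [].
  by rewrite -RGenOInfty.measurableE.
Qed.

Lemma le_norm_integral_ind a b : (`|a - b|%:E <= \int[mu]_x `|ind a x - ind b x|%:E)%E.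
Proof.
wlog ab : a b / a <= b.
  move=> H; have /orP[/H//|/H] := le_total a b.
  by rewrite distrC; under eq_integral do rewrite distrC.
apply: (@le_trans _ _ (\int[mu]_(x in `[a, b[) (cst 1%:E x))%E).
  rewrite integral_cst//= mul1e lebesgue_measure_itv/= lte_fin.
  case: (ltP a b) => [ab'|ba]; first by rewrite -EFinB lee_fin distrC ger0_norm// subr_ge0.
  by rewrite lee_fin (_ : a = b) ?subrr ?normr0//; apply/eqP; rewrite eq_le ab ba.
rewrite [leLHS]integral_mkcond; apply: ge0_le_integral_nomeas => x; rewrite patchE.
  by case: ifP => _; rewrite lee_fin.
case: ifPn => [|_]; last by rewrite lee_fin.
by rewrite inE/= in_itv/= => /andP[ax xb]; rewrite lee_fin /ind ax (lt_geF xb)/= subr0 normr1.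
Qed.

(** The integration variable is the threshold here; a reflection brings it back to the other
    argument. The 2 is the loss of [weighted_ind_diff] with weight 1. *)
Lemma integral_ind_diff_level a b : (\int[mu]_u `|ind u a - ind u b|%:E <= (2 * `|a - b|)%:E)%E.
Proof.
have mf : measurable_fun [set: R] (fun u : R => `|ind u a - ind u b|%:E).
  by apply/measurable_EFinP; apply: measurableT_comp => //; apply: measurable_funB; exact: measurable_ind.
have f0 u : (0 <= `|ind u a - ind u b|%:E)%E by rewrite lee_fin.
rewrite -(ge0_integral_reflect mf f0).
apply: (@le_trans _ _ (\int[mu]_x (1 * `|ind (- a) x - ind (- b) x|)%:E)%E).
  apply: ge0_le_integral_nomeas => x; first by rewrite lee_fin.
  by rewrite mul1r lee_fin /ind !(lerNl x).
apply: le_trans (@weighted_ind_diff R (fun=> 1) _ _ _ _ _) _ => //.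
  by move=> *; rewrite lerDl ler01.
by rewrite -opprD normrN lee_fin mulrC.
Qed.

(** Quantile coupling: both quantile functions are applied to one uniform variable u. Their distance
    is the integral in x of the difference of the indicators of u <= F1 x and u <= F2 x, and Tonelli
    integrates u first. An upper bound suffices, so the factor 2 is harmless. *)
Lemma wasserstein1_le_cdf m1 m2 :
  (wasserstein1 m1 m2 <= 2%:E * \int[mu]_x `|cdf_of m1 x - cdf_of m2 x|%:E)%E.
Proof.
pose U := uniform_prob (@ltr01 R).
pose q m (u : measurableTypeR R) : measurableTypeR R := quantile01 m u.
have mq m : measurable_fun setT (q m) := measurable_quantile01 m.
pose qq (u : measurableTypeR R) := (q m1 u, q m2 u).
have mqq : measurable_fun [set: measurableTypeR R] qq by apply: measurable_fun_pair; exact: mq.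
pose Qq : {mfun measurableTypeR R >-> (measurableTypeR R * measurableTypeR R)%type} := HB.pack qq (isMeasurableFun.Build _ _ _ _ _ mqq).
have Uint (f : R -> \bar R) : measurable_fun [set: R] f -> (forall x, (0 <= f x)%E) ->
    (\int[U]_u f u = \int[mu]_(u in `]0%R, 1%R[) f u)%E.
  move=> mf f0; rewrite /U integral_uniform// subr0 invr1 mul1e.
  by apply: integral_itv_bndoo; exact: measurable_funTS.
have Uset (S : set R) : measurable S -> U S = (\int[mu]_(u in `]0%R, 1%R[) (\1_S u)%:E)%E.
  move=> mS; rewrite -Uint; last 2 first.
  - by apply/measurable_EFinP; exact: measurable_indic.
  - by move=> u; rewrite lee_fin.
  by rewrite integral_indic// setIT.
have Ucdf m x : U (q m @^-1` `]-oo, x]) = (cdf_of m x)%:E.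
  have mS : measurable (q m @^-1` `]-oo, x]) by rewrite -[X in measurable X]setTI; apply: mq.
  have /andP[F0 F1] := cdf_of01 m x.
  rewrite Uset//.
  transitivity (\int[mu]_(u in `]0%R, 1%R[) (\1_(`]-oo, cdf_of m x]) u)%:E)%E.
    apply: eq_integral => u; rewrite inE/= in_itv/= => u01; congr EFin.
    have qu : q m u = quantile m u by rewrite /q /quantile01 u01.
    have e : (u \in q m @^-1` `]-oo, x]) = (u \in `]-oo, cdf_of m x]%classic).
      by apply/idP/idP; rewrite !inE/= !in_itv/= qu (quantile_galois m x u01).
    by rewrite !indicE e.
  rewrite integral_indic//.
  have [F1'|F1'] := ltP (cdf_of m x) 1.
    have -> : `]-oo, cdf_of m x] `&` `]0, 1[ = `]0, cdf_of m x]%classic.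
      apply/seteqP; split => u /=; rewrite !in_itv/=; first by move=> [-> /andP[->]].
      by move=> /andP[-> h]; split => //; exact: le_lt_trans F1'.
    by apply: (etrans (lebesgue_measure_itv _)); rewrite /= lte_fin; case: ltgtP F0 => // [_ _|<- _//]; rewrite sube0.
  have -> : cdf_of m x = 1 by apply/eqP; rewrite eq_le F1 F1'.
  have -> : `]-oo, 1] `&` `]0, 1[ = `]0, 1[%classic :> set R.
    apply/seteqP; split => u /=; rewrite !in_itv/=; first by move=> [].
    by move=> h; split => //; case/andP: h => _ /ltW.
  by apply: (etrans (lebesgue_measure_itv _)); rewrite /= lte_fin ltr01 sube0.
pose pi := distribution U Qq.
have marg m A : measurable A -> U (q m @^-1` A) = m A.
  move=> mA.
  pose mqf : {mfun measurableTypeR R >-> measurableTypeR R} := HB.pack (q m) (isMeasurableFun.Build _ _ _ _ _ (mq m)).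
  apply: (@prob_eq_cdf (distribution U mqf)) => // x.
  have h : fine (U (q m @^-1` `]-oo, x])) = cdf_of m x by rewrite Ucdf.
  exact: h.
apply: (@le_trans _ _ (\int[pi]_z `|z.1 - z.2|%:E)%E).
  apply: ereal_inf_lbound; exists pi => // A mA; split.
    by rewrite -[LHS]/(U (qq @^-1` (A `*` setT))) -(marg m1)//; congr (U _); apply/seteqP; split => u //= [].
  by rewrite -[LHS]/(U (qq @^-1` (setT `*` A))) -(marg m2)//; congr (U _); apply/seteqP; split => u //= [].
have mabs : measurable_fun [set: measurableTypeR R * measurableTypeR R] (fun z : measurableTypeR R * measurableTypeR R => `|z.1 - z.2|%:E).
  by apply/measurable_EFinP; apply: measurableT_comp => //; apply: measurable_funB.
rewrite /pi ge0_integral_distribution//.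
have mq' m : measurable_fun [set: R] (fun u : R => quantile01 m u) := measurable_quantile01 m.
rewrite (Uint (fun u => `|quantile01 m1 u - quantile01 m2 u|%:E)); last 2 first.
- by apply/measurable_EFinP; apply: measurableT_comp => //; exact: measurable_funB.
- by move=> u; rewrite lee_fin.
apply: (@le_trans _ _ (\int[mu]_u \int[mu]_x (`|ind u (cdf_of m1 x) - ind u (cdf_of m2 x)|%:E))%E).
  rewrite integral_mkcond; apply: ge0_le_integral_nomeas => u; rewrite patchE.
    by case: ifP => _; rewrite ?lee_fin.
  case: ifPn => [|_]; last by apply: integral_ge0 => x _; rewrite lee_fin.
  rewrite inE/= in_itv/= => u01; apply: le_trans (le_norm_integral_ind _ _) _.
  apply: ge0_le_integral_nomeas => x; first by rewrite lee_fin.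
  by rewrite lee_fin /ind /quantile01 u01 !quantile_galois.
have mz : measurable_fun setT (fun z : measurableTypeR R * measurableTypeR R => `|ind z.1 (cdf_of m1 z.2) - ind z.1 (cdf_of m2 z.2)|%:E).
  apply/measurable_EFinP; apply: measurableT_comp => //; apply: measurable_funB; apply: measurable_ind => //;
    by apply: (@measurableT_comp _ _ _ _ _ _ (cdf_of _)); [exact: measurable_cdf_of|exact: measurable_snd].
rewrite (@fubini_tonelli _ _ _ _ _ mu mu _ mz)/=; last by move=> z; rewrite lee_fin.
rewrite -ge0_integral_cmul//; last first.
  by apply: measurableT_comp => //; apply: measurable_funB; exact: measurable_cdf_of.
apply: ge0_le_integral_nomeas => x; first by apply: integral_ge0 => u _; rewrite lee_fin.
exact: integral_ind_diff_level.
Qed.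

End quantile_coupling.

(** * Convolution with Gaussian kernels *)

Section fubini_real.
Context d1 d2 (T1 : measurableType d1) (T2 : measurableType d2) (R : realType).
Variables (m1 : {sigma_finite_measure set T1 -> \bar R}) (m2 : {sigma_finite_measure set T2 -> \bar R}).

Lemma Rintegral_swap (f : T1 * T2 -> R) : measurable_fun setT f ->
  (\int[m2]_y \int[m1]_x `|f (x, y)|%:E < +oo)%E ->
  (forall x, m2.-integrable setT (fun y => (f (x, y))%:E)) ->
  (forall y, m1.-integrable setT (fun x => (f (x, y))%:E)) ->
  \int[m1]_x \int[m2]_y f (x, y) = \int[m2]_y \int[m1]_x f (x, y).
Proof.
move=> mf ff i2 i1.
have mf' : measurable_fun setT (EFin \o f) by exact/measurable_EFinP.
have fi : (m1 \x m2)%E.-integrable setT (EFin \o f) by exact/integrable21ltyP.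
have h := Fubini fi; rewrite /Rintegral.
have e2 x : (\int[m2]_y (EFin \o f) (x, y) = (fine (\int[m2]_y (f (x, y))%:E))%:E)%E.
  by rewrite fineK//; apply: integrable_fin_num => //; exact: i2.
have e1 y : (\int[m1]_x (EFin \o f) (x, y) = (fine (\int[m1]_x (f (x, y))%:E))%:E)%E.
  by rewrite fineK//; apply: integrable_fin_num => //; exact: i1.
congr fine; transitivity (\int[m1]_x \int[m2]_y (EFin \o f) (x, y))%E.
  by apply: eq_integral => x _; rewrite e2.
by rewrite h; apply: eq_integral => y _; rewrite e1.
Qed.

End fubini_real.

Section kernel_convolution.
Variable R : realType.
Notation mu := (@lebesgue_measure R).
Implicit Types (s x y : R) (f : R -> R).

(** The space derivative of the heat flow of f. It is put on the kernel, since f need not be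
    differentiable. *)
Definition dconv s f x : R := \int[mu]_y (dgk s (x - y) * f y).

Lemma integrable_dgk_mul s x f : 0 < s -> bm (f : measurableTypeR R -> R) ->
  mu.-integrable setT (fun y => (dgk s (x - y) * f y)%:E).
Proof.
move=> s0 [mf [C fC]]; have md : measurable_fun [set: R] (fun y : R => dgk s (x - y)).
  by apply: measurableT_comp; [exact: measurable_dgk|exact: measurable_funB].
have mda : measurable_fun [set: R] (fun y : R => `|dgk s y|%:E).
  by apply/measurable_EFinP; apply: measurableT_comp => //; exact: measurable_dgk.
have C0 : 0 <= C by apply: le_trans (fC 0).
apply/integrableP; split.
  by apply/measurable_EFinP; apply: measurable_funM.
apply: (@le_lt_trans _ _ (C%:E * L1 mu (dgk s))%E); last first.
  apply: le_lt_trans (lee_wpmul2l _ (L1_dgk s0)) _; first by rewrite lee_fin.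
  by rewrite -EFinM ltry.
rewrite /L1 -(@ge0_integral_subl _ x (fun y => `|dgk s y|%:E))//.
have md' : measurable_fun [set: R] (fun y : R => `|dgk s (x - y)|) by apply: measurableT_comp.
rewrite -(ge0_integral_cmul mu C0 md') => //.
by apply: ge0_le_integral_nomeas => y; rewrite lee_fin// normrM mulrC ler_wpM2r.
Qed.

Lemma measurable_dgk_mul s f : measurable_fun [set: R] f ->
  measurable_fun setT (fun z : measurableTypeR R * measurableTypeR R => dgk s (z.1 - z.2) * f z.2).
Proof.
move=> mf; apply: measurable_funM.
  by apply: (@measurableT_comp _ _ _ _ _ _ (dgk s)); [exact: measurable_dgk|exact: measurable_funB].
by apply: (@measurableT_comp _ _ _ _ _ _ f).
Qed.

Lemma measurable_dconv s f : measurable_fun [set: R] f -> measurable_fun [set: R] (dconv s f).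
Proof.
move=> mf.
exact: (@measurable_fun_Rintegral _ _ (measurableTypeR R) (measurableTypeR R) R mu _ (measurable_dgk_mul s mf)).
Qed.

Lemma dconvB s f g x : 0 < s -> bm (f : measurableTypeR R -> R) -> bm (g : measurableTypeR R -> R) ->
  dconv s (fun y => f y - g y) x = dconv s f x - dconv s g x.
Proof.
move=> s0 bf bg; rewrite /dconv -RintegralB//; try exact: integrable_dgk_mul.
by apply: eq_Rintegral => y _; rewrite mulrBr.
Qed.

(** Young's inequality for the kernel [dgk s], with the norm bound of [L1_dgk]. *)
Lemma L1_dconv s f : 0 < s -> bm (f : measurableTypeR R -> R) ->
  (L1 mu (dconv s f) <= (256 / s)%:E * L1 mu f)%E.
Proof.
move=> s0 bf; have [mf _] := bf.
apply: le_trans (@L1_Rintegral_le _ _ (measurableTypeR R) (measurableTypeR R) R mu mu _ (measurable_dgk_mul s mf) _) _.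
  by move=> x; exact: integrable_dgk_mul.
have mda : measurable_fun [set: R] (fun y : R => `|dgk s y|).
  by apply: measurableT_comp => //; exact: measurable_dgk.
have k0 : 0 <= 256 / s by apply: divr_ge0; [exact: ler0n|exact: ltW].
have mfa : measurable_fun [set: R] (fun y : R => `|f y|) by apply: measurableT_comp.
rewrite /L1 -(ge0_integral_cmul mu k0 mfa) => //.
apply: ge0_le_integral_nomeas => y; first exact: integral_ge0.
have -> : (\int[mu]_x `|dgk s (x - y) * f y|%:E = `|f y|%:E * \int[mu]_x `|dgk s (x + - y)|%:E)%E.
  rewrite -ge0_integral_cmul//.
    by apply: eq_integral => x _; rewrite normrM mulrC.
  by apply: measurableT_comp => //; apply: measurableT_comp; [exact: measurable_dgk|exact: measurable_funD].
rewrite (@ge0_integral_shift _ (- y) (fun x => `|dgk s x|%:E))//; last exact/measurable_EFinP.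
by rewrite mulrC EFinM; apply: lee_wpmul2l; [rewrite lee_fin|exact: L1_dgk].
Qed.

Lemma dconv_le s f C x : 0 < s -> bm (f : measurableTypeR R -> R) -> (forall y, `|f y| <= C) ->
  `|dconv s f x| <= 256 / s * C.
Proof.
move=> s0 bf fC; have fi := integrable_dgk_mul x s0 bf.
have C0 : 0 <= C by apply: le_trans (fC 0).
have mda : measurable_fun [set: R] (fun y : R => `|dgk s y|).
  by apply: measurableT_comp => //; exact: measurable_dgk.
have md' : measurable_fun [set: R] (fun y : R => `|dgk s (x - y)|).
  by apply: measurableT_comp => //; apply: measurableT_comp; [exact: measurable_dgk|exact: measurable_funB].
rewrite -lee_fin; apply: (@le_trans _ _ (\int[mu]_y (C * `|dgk s (x - y)|)%:E)%E).
  rewrite EFin_normr_Rintegral//.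
  apply: le_trans (le_abse_integral mu measurableT (measurable_int mu fi)) _.
  apply: ge0_le_integral_nomeas => y; first exact: abse_ge0.
  by rewrite /= lee_fin normrM mulrC ler_wpM2r.
rewrite (ge0_integral_cmul mu C0 md')//.
rewrite (@ge0_integral_subl _ x (fun y => `|dgk s y|%:E))//; last exact/measurable_EFinP.
by rewrite mulrC EFinM; apply: lee_wpmul2l; [rewrite lee_fin|exact: L1_dgk].
Qed.

Lemma bm_gk d (T : measurableType d) s (f : T -> R) : 0 < s -> measurable_fun setT f -> bm (fun w => gk s (f w)).
Proof.
move=> s0 mf; split; first by apply: measurableT_comp => //; exact: measurable_gk.
by exists s^-1 => w; rewrite ger0_norm ?gk_ge0 ?(ltW s0)// gk_le.
Qed.

(* Both sides equal the integral of [c(w) dgk s (x - y) ind (X w) y] over all [(w, y)]. *)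
Lemma dconv_weighted_cdf d (T : measurableType d) (P : probability T R) (c X : T -> R) s x :
  0 < s -> bm c -> measurable_fun setT X ->
  dconv s (fun y => \int[P]_w (c w * ind (X w) y)) x = \int[P]_w (c w * gk s (x - X w)).
Proof.
move=> s0 [mc [C cC]] mX.
have C0 : 0 <= C by apply: le_trans (cC point).
pose f (z : measurableTypeR R * T) := dgk s (x - z.1) * (c z.2 * ind (X z.2) z.1).
have mf : measurable_fun setT f.
  apply: measurable_funM.
    by apply: (@measurableT_comp _ _ _ _ _ _ (dgk s)); [exact: measurable_dgk|exact: measurable_funB].
  apply: measurable_funM; first exact: (measurableT_comp mc).
  by apply: measurable_ind => //; exact: (measurableT_comp mX).
have bci w : bm ((fun y => c w * ind (X w) y) : measurableTypeR R -> R).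
  by apply: bmM; [exact: bm_cst|apply: bm_ind].
have bcy y : bm (fun w => c w * ind (X w) y) by apply: bmM; [split => //; exists C|apply: bm_ind].
transitivity (\int[mu]_y \int[P]_w f (y, w)).
  by apply: eq_Rintegral => y _; rewrite /f/= (ExZ P _ (bcy y)).
have fd w : (\int[mu]_y `|f (y, w)|%:E <= (256 / s * C)%:E)%E.
  have mda : measurable_fun [set: R] (fun y : R => `|dgk s y|).
    by apply: measurableT_comp => //; exact: measurable_dgk.
  have md' : measurable_fun [set: R] (fun y : R => `|dgk s (x - y)|).
    by apply: measurableT_comp => //; apply: measurableT_comp; [exact: measurable_dgk|exact: measurable_funB].
  apply: (@le_trans _ _ (\int[mu]_y (C * `|dgk s (x - y)|)%:E)%E).
    apply: ge0_le_integral_nomeas => y; rewrite lee_fin//= /f !normrM mulrC ler_wpM2r//.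
    by apply: le_trans (cC w); rewrite ler_piMr// ger0_norm ?ind_ge0 ?ind_le1.
  rewrite (ge0_integral_cmul mu C0 md')//.
  rewrite (@ge0_integral_subl _ x (fun y => `|dgk s y|%:E))//; last exact/measurable_EFinP.
  by rewrite mulrC EFinM; apply: lee_wpmul2l; [rewrite lee_fin|exact: L1_dgk].
rewrite (@Rintegral_swap _ _ (measurableTypeR R) T R mu P f mf); first last.
- by move=> w; exact: (integrable_dgk_mul x s0 (bci w)).
- move=> y; apply: (bm_integrable P (f := fun w => f (y, w))).
  exact: (bmM (bm_cst T (dgk s (x - y))) (bcy y)).
- apply: (@le_lt_trans _ _ (\int[P]_w (cst (256 / s * C)%:E w))%E).
    apply: ge0_le_integral_nomeas => w; last exact: fd.
    by apply: integral_ge0 => y _; rewrite lee_fin.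
  by rewrite integral_cst//= probability_setT mule1 ltry.
apply: eq_Rintegral => w _; rewrite -(Rintegral_dgk_ind x (X w) s0).
rewrite -RintegralZl//; last exact: integrable_dgk_ind.
by apply: eq_Rintegral => y _; rewrite /f/= mulrCA.
Qed.

End kernel_convolution.

Section fubini_bounded.
Variable R : realType.

Lemma Rintegral_swap_bm d1 d2 (T1 : measurableType d1) (T2 : measurableType d2)
    (P1 : probability T1 R) (P2 : probability T2 R) (f : T1 * T2 -> R) : bm f ->
  \int[P1]_x \int[P2]_y f (x, y) = \int[P2]_y \int[P1]_x f (x, y).
Proof.
move=> [mf [C fC]]; apply: Rintegral_swap => //.
- apply: (@le_lt_trans _ _ (\int[P2]_y (cst C%:E y))%E); last first.
    by rewrite integral_cst//= probability_setT mule1 ltry.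
  apply: ge0_le_integral_nomeas => y; first by apply: integral_ge0 => x _; rewrite lee_fin.
  apply: (@le_trans _ _ (\int[P1]_x (cst C%:E x))%E).
    by apply: ge0_le_integral_nomeas => x; rewrite lee_fin.
  by rewrite integral_cst//= probability_setT mule1.
- by move=> x; apply: (bm_integrable P2 (f := fun w : T2 => f (x, w))); split; [exact: measurable_fun_curry1|exists C].
- by move=> y; apply: (bm_integrable P1 (f := fun w : T1 => f (w, y))); split; [exact: measurable_fun_curry2|exists C].
Qed.

End fubini_bounded.

(** * The heat flow *)

Section heat.
Variable R : realType.
Notation mu := (@lebesgue_measure R).
Implicit Types (s x y b : R) (f : R -> R).

Definition heat b f x : R := \int[@gam R]_v f (x - b * v).

Let meas_shift b f : measurable_fun [set: R] f ->
  measurable_fun setT (fun z : measurableTypeR R * measurableTypeR R => f (z.1 - b * z.2)).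
Proof.
move=> mf; apply: (@measurableT_comp _ _ _ _ _ _ f) => //.
by apply: measurable_funB => //; apply: measurable_funM.
Qed.

Let bm_shift b f x : bm (f : measurableTypeR R -> R) -> bm ((fun v => f (x - b * v)) : measurableTypeR R -> R).
Proof.
move=> [mf [C fC]]; split; last by exists C.
by apply: measurableT_comp => //; apply: measurable_funB => //; exact: measurable_funM.
Qed.

Lemma bm_heat b f : bm (f : measurableTypeR R -> R) -> bm (heat b f : measurableTypeR R -> R).
Proof.
move=> bf; have [mf [C fC]] := bf; split.
  exact: (@measurable_fun_Rintegral _ _ (measurableTypeR R) (measurableTypeR R) R (@gam R) _ (meas_shift b mf)).
exists C => x; apply: le_trans (Ex_norm (@gam R) (bm_shift b x bf)) _.
rewrite -[leRHS](Ex_cst (@gam R)); apply: Ex_le => //; last exact: bm_cst.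
exact: (bm_norm (bm_shift b x bf)).
Qed.

Lemma heatB b f g x : bm (f : measurableTypeR R -> R) -> bm (g : measurableTypeR R -> R) ->
  heat b (fun y => f y - g y) x = heat b f x - heat b g x.
Proof. by move=> bf bg; rewrite /heat (ExB (@gam R) (bm_shift b x bf) (bm_shift b x bg)). Qed.

Lemma L1_heat b f : bm (f : measurableTypeR R -> R) -> (L1 mu (heat b f) <= L1 mu f)%E.
Proof.
move=> bf; have [mf _] := bf.
apply: le_trans (@L1_Rintegral_le _ _ (measurableTypeR R) (measurableTypeR R) R mu (@gam R) _ (meas_shift b mf) _) _.
  by move=> x; exact: (bm_integrable (@gam R) (bm_shift b x bf)).
apply: (@le_trans _ _ (\int[@gam R]_v (cst (L1 mu f) v))%E); last by rewrite integral_cst//= probability_setT mule1.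
apply: ge0_le_integral_nomeas => v /=; first exact: L1_ge0.
rewrite /L1 (@ge0_integral_shift _ (- (b * v)) (fun x => `|f x|%:E))//.
by apply/measurable_EFinP; apply: measurableT_comp.
Qed.

Lemma heat_weighted_cdf d (T : measurableType d) (P : probability T R) (c X : T -> R) s x :
  bm c -> measurable_fun setT X ->
  \int[P]_w (c w * Phi s (x - X w)) = heat s (fun y => \int[P]_w (c w * ind (X w) y)) x.
Proof.
move=> bc mX; have [mc [C cC]] := bc.
have ie w v : ind (s * v) (x - X w) = ind (X w) (x - s * v) by rewrite /ind !lerBrDr addrC.
rewrite /heat -(@Rintegral_swap_bm _ _ _ T (measurableTypeR R) P (@gam R) (fun z => c z.1 * ind (X z.1) (x - s * z.2))).
  apply: eq_Rintegral => w _; rewrite -ExZ; last by apply: bm_ind; [exact: measurable_funM|exact: measurable_cst].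
  by apply: eq_Rintegral => v _; rewrite ie.
have bc2 : bm (fun z : T * measurableTypeR R => c z.1) by split; [exact: (measurableT_comp mc)|exists C].
apply: bmM => //; apply: bm_ind; first exact: (measurableT_comp mX).
by apply: measurable_funB => //; exact: measurable_funM.
Qed.

Lemma integral_shift a f : measurable_fun [set: R] f -> \int[mu]_x f (x + a) = \int[mu]_x f x.
Proof.
move=> mf; rewrite -(integral_subl 0 mf).
have mg : measurable_fun [set: R] (fun y : R => f (0 - y)) by apply: measurableT_comp => //; exact: measurable_funB.
rewrite -[RHS](integral_subl (- a) mg).
by apply: eq_Rintegral => y _; congr f; ring.
Qed.

(** Translation invariance moves the shift by b v from x to the argument of f; Fubini then exchanges
    the two convolutions. *)
Lemma heat_dconv a b f x : 0 < a -> bm (f : measurableTypeR R -> R) ->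
  heat b (dconv a f) x = dconv a (heat b f) x.
Proof.
move=> a0 bf; have [mf [C fC]] := bf.
pose h (z : measurableTypeR R * measurableTypeR R) := dgk a (x - z.1) * f (z.1 - b * z.2).
have mh : measurable_fun setT h.
  apply: measurable_funM; last exact: meas_shift.
  by apply: (@measurableT_comp _ _ _ _ _ _ (dgk a)); [exact: measurable_dgk|exact: measurable_funB].
have C0 : 0 <= C by apply: le_trans (fC 0).
have bsh v : bm ((fun y => f (y - b * v)) : measurableTypeR R -> R).
  by split; [apply: measurableT_comp => //; exact: measurable_funB|exists C].
transitivity (\int[@gam R]_v \int[mu]_y h (y, v)).
  apply: eq_Rintegral => v _; rewrite /dconv /h/=.
  rewrite -(@integral_shift (- (b * v)) (fun y => dgk a (x - b * v - y) * f y)); last first.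
    by apply: measurable_funM => //; apply: measurableT_comp; [exact: measurable_dgk|exact: measurable_funB].
  by apply: eq_Rintegral => y _; congr (dgk a _ * f _); ring.
rewrite -(@Rintegral_swap _ _ (measurableTypeR R) (measurableTypeR R) R mu (@gam R) h mh).
- apply: eq_Rintegral => y _; rewrite /h/= ExZ//; exact: (bm_shift b y bf).
- apply: (@le_lt_trans _ _ (\int[@gam R]_v (cst (256 / a * C)%:E v))%E); last first.
    by rewrite integral_cst//= probability_setT mule1 ltry.
  apply: ge0_le_integral_nomeas => v; first by apply: integral_ge0 => y _; rewrite lee_fin.
  have md' : measurable_fun [set: R] (fun y : R => `|dgk a (x - y)|).
    by apply: measurableT_comp => //; apply: measurableT_comp; [exact: measurable_dgk|exact: measurable_funB].
  apply: (@le_trans _ _ (\int[mu]_y (C * `|dgk a (x - y)|)%:E)%E).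
    by apply: ge0_le_integral_nomeas => y; rewrite lee_fin//= /h normrM mulrC ler_wpM2r.
  rewrite (ge0_integral_cmul mu C0 md')//.
  rewrite (@ge0_integral_subl _ x (fun y => `|dgk a y|%:E))//; last first.
    by apply/measurable_EFinP; apply: measurableT_comp => //; exact: measurable_dgk.
  by rewrite /cst mulrC EFinM; apply: lee_wpmul2l; [rewrite lee_fin|exact: L1_dgk].
- move=> y; apply: (bm_integrable (@gam R) (f := (fun v => h (y, v)) : measurableTypeR R -> R)).
  exact: (bmM (bm_cst (measurableTypeR R) (dgk a (x - y))) (bm_shift b y bf)).
- by move=> v; exact: (integrable_dgk_mul x a0 (bsh v)).
Qed.

(** For weighted distribution functions both sides become means of Gaussian densities through
    [dconv_weighted_cdf], where [gk_semigroup] applies pointwise. *)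
Lemma dconv_semigroup d (T : measurableType d) (P : probability T R) (c X : T -> R) a b x :
  0 < a -> bm c -> measurable_fun setT X ->
  dconv (Num.sqrt (a ^+ 2 + b ^+ 2)) (fun y => \int[P]_w (c w * ind (X w) y)) x =
  dconv a (heat b (fun y => \int[P]_w (c w * ind (X w) y))) x.
Proof.
move=> a0 bc mX; have [mc [C cC]] := bc.
set F := fun y : R => _.
have bF : bm (F : measurableTypeR R -> R).
  have mz : measurable_fun setT (fun z : measurableTypeR R * T => c z.2 * ind (X z.2) z.1).
    apply: measurable_funM; first exact: (measurableT_comp mc).
    by apply: measurable_ind => //; exact: (measurableT_comp mX).
  split; first exact: (@measurable_fun_Rintegral _ _ (measurableTypeR R) T R P _ mz).
  exists C => y.
  have bci : bm (fun w => c w * ind (X w) y) by apply: bmM => //; apply: bm_ind.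
  apply: le_trans (Ex_norm P bci) _; rewrite -[leRHS](Ex_cst P).
  apply: (Ex_le P (bm_norm bci) (bm_cst _ C)) => w.
  by rewrite normrM; apply: le_trans (cC w); rewrite ler_piMr// ger0_norm ?ind_ge0 ?ind_le1.
have s0 : 0 < Num.sqrt (a ^+ 2 + b ^+ 2) by rewrite sqrtr_gt0 ltr_pwDl ?exprn_gt0 ?sqr_ge0.
rewrite (dconv_weighted_cdf P x s0 bc mX) -(heat_dconv b x a0 bF) /heat.
transitivity (\int[P]_w \int[@gam R]_v (c w * gk a (x - X w - b * v))).
  apply: eq_Rintegral => w _.
  have bg : bm ((fun v => gk a (x - X w - b * v)) : measurableTypeR R -> R).
    by apply: bm_gk => //; apply: measurable_funB => //; exact: measurable_funM.
  rewrite (ExZ (@gam R) _ bg); congr (_ * _); apply: EFin_inj.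
  by rewrite -(gk_semigroup b (x - X w) a0) (ExE (@gam R) bg).
rewrite (@Rintegral_swap_bm _ _ _ T (measurableTypeR R) P (@gam R) (fun z => c z.1 * gk a (x - X z.1 - b * z.2))).
  apply: eq_Rintegral => v _; rewrite (dconv_weighted_cdf P (x - b * v) a0 bc mX).
  by apply: eq_Rintegral => w _; rewrite addrAC.
have bc2 : bm (fun z : T * measurableTypeR R => c z.1) by split; [exact: (measurableT_comp mc)|exists C].
apply: bmM => //; apply: bm_gk => //; apply: measurable_funB; last exact: measurable_funM.
by apply: measurable_funB => //; exact: (measurableT_comp mX).
Qed.

End heat.

(** * Composition of Lambda with a continuous distribution function *)

Section level_identity.
Context d (T : measurableType d) (R : realType) (P : probability T R).
Variables (lam L : R -> R) (B : R) (X : T -> R).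
Hypothesis mlam : measurable_fun [set: R] lam.
Hypothesis lamB : forall x, `|lam x| <= B.
Hypothesis lamU : forall e, 0 < e -> exists2 dl : R, 0 < dl & forall x y, `|x - y| <= dl -> `|lam x - lam y| <= e.
Hypothesis Lmvt : forall u v, 0 <= u -> u <= v -> v <= 1 -> exists2 c : R, u <= c <= v & L v - L u = lam c * (v - u).
Hypothesis mX : measurable_fun setT X.

Let F (y : R) := \int[P]_w ind (X w) y.
Hypothesis cF : continuous F.
Hypothesis FNy : forall e : R, 0 < e -> exists y, F y < e.

Lemma bm_indX y : bm (fun w => ind (X w) y). Proof. by apply: bm_ind. Qed.

Lemma le_Ex_ind (x y : R) : x <= y -> F x <= F y.
Proof.
move=> xy; apply: Ex_le; [exact: bm_indX|exact: bm_indX|move=> w].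
by rewrite /ind ler_nat; case: (leP (X w) x) => // /le_trans/(_ xy) ->.
Qed.

Lemma Ex_ind01 (y : R) : 0 <= F y <= 1.
Proof.
apply/andP; split; first by apply: Rintegral_ge0 => w _; exact: ind_ge0.
by rewrite -(Ex_cst P 1); apply: (Ex_le P (bm_indX y) (bm_cst _ 1)) => w; exact: ind_le1.
Qed.

Let mF : measurable_fun [set: R] F. Proof. exact: continuous_measurable_fun. Qed.

Let bl : bm (fun w => lam (F (X w))).
Proof. by split; [apply: measurableT_comp => //; exact: measurableT_comp|exists B]. Qed.

Let G (y : R) := \int[P]_w (lam (F (X w)) * ind (X w) y).

Let incr_bound (c e a b : R) : 0 <= e ->
  (forall w, a < X w <= b -> `|lam (F (X w)) - c| <= e) -> a <= b ->
  `|G b - G a - c * (F b - F a)| <= e * (F b - F a).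
Proof.
move=> e0 he ab.
have bi y := bm_indX y.
have b1 y := bmM bl (bi y).
have b2 := bmM bl (bmB (bi b) (bi a)).
have b3 := bmM (bm_cst _ c) (bmB (bi b) (bi a)).
have b4 := bmM (bm_cst _ e) (bmB (bi b) (bi a)).
have -> : G b - G a - c * (F b - F a) =
    \int[P]_w (lam (F (X w)) * (ind (X w) b - ind (X w) a) - c * (ind (X w) b - ind (X w) a)).
  rewrite (ExB P b2 b3) (ExZ P _ (bmB (bi b) (bi a))) (ExB P (bi b) (bi a)) /G -(ExB P (b1 b) (b1 a)).
  by congr (_ - _); apply: eq_Rintegral => w _; rewrite mulrBr.
apply: le_trans (Ex_norm P (bmB b2 b3)) _.
rewrite -(ExB P (bi b) (bi a)) -(ExZ P _ (bmB (bi b) (bi a))).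
apply: (Ex_le P (bm_norm (bmB b2 b3)) b4) => w.
rewrite -mulrBl normrM /ind.
case: (leP (X w) a) => Xa; first by rewrite (le_trans Xa ab) subrr normr0 !mulr0.
case: (leP (X w) b) => Xb; last by rewrite subrr normr0 !mulr0.
by rewrite subr0 normr1 !mulr1; apply: he; rewrite Xa.
Qed.

(** The change of variables by which F (X) is uniform, proved without densities: ]-oo, y] is cut
    into slices over which F grows by at most dl; on each of them [lam] varies by at most e and the
    mean value theorem for L gives the contribution. *)
Lemma Ex_level (y : R) : \int[P]_w (lam (F (X w)) * ind (X w) y) = L (F y) - L 0.
Proof.
rewrite -/(G y); apply/eqP; rewrite -subr_eq0 -normr_le0; apply/ler_addgt0Pr => e e0; rewrite add0r.
have [dl d0 hdl] := lamU e0.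
have [FB _] : (forall z, 0 <= F z) /\ (forall z, F z <= 1) by split=> z; case/andP: (Ex_ind01 z).
have F1 z : F z <= 1 by case/andP: (Ex_ind01 z).
(* Induction on the number of levels of height dl below F z. The error of a slice is proportional to
   its mass, so the total is e F z whatever the number of slices. *)
have key n : forall z, F z <= n.+1%:R * dl -> `|G z - (L (F z) - L 0)| <= e * F z.
  elim: n => [|n ih] z.
    rewrite mul1r => Fz.
    have [c /andP[c0 cF'] ->] := Lmvt (lexx 0) (FB z) (F1 z).
    rewrite subr0.
    have bi := bm_indX z; have b1 := bmM bl bi; have b3 := bmM (bm_cst _ c) bi.
    have b3' := bmM (bm_cst T (lam c)) bi.
    rewrite /G -[lam c * F z](ExZ P _ bi) -(ExB P b1 b3') -(ExZ P e bi).
    apply: le_trans (Ex_norm P (bmB b1 b3')) _.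
    apply: (Ex_le P (bm_norm (bmB b1 b3')) (bmM (bm_cst _ e) bi)) => w.
    rewrite -mulrBl normrM /ind; case: (leP (X w) z) => Xz; last by rewrite normr0 !mulr0.
    rewrite normr1 !mulr1; apply: hdl; have := le_Ex_ind Xz; have := FB (X w).
    by rewrite ler_norml => h1 h2; apply/andP; split; lra.
  move=> Fz; have [Fz1|Fz1] := leP (F z) (n.+1%:R * dl); first exact: ih.
  have pos_ : 0 < F z - dl.
    by rewrite subr_gt0; apply: le_lt_trans Fz1; rewrite ler_peMl ?(ltW d0)// ler1n.
  have [z0 hz0] := FNy pos_.
  have z0z : z0 <= z.
    rewrite leNgt; apply/negP => /ltW/le_Ex_ind h; have := le_lt_trans h hz0; lra.
  (* Continuity provides a point exactly one level lower, which an atom of X could skip. *)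
  have [a + Fa] : exists2 a, a \in `[z0, z] & F a = F z - dl.
    apply: IVT => //; first by apply: continuous_subspaceT.
    by rewrite minEle maxEle (le_Ex_ind z0z) (ltW hz0)/= gerBl ltW.
  rewrite in_itv/= => /andP[_ az].
  have Fa' : F a <= n.+1%:R * dl by rewrite Fa; move: Fz; rewrite -[n.+2]addn1 natrD mulrDl mul1r; lra.
  have h1 := ih a Fa'.
  have FaFz : F a <= F z by exact: le_Ex_ind.
  have [c /andP[ca cz] hc] := Lmvt (FB a) FaFz (F1 z).
  have h2 : `|G z - G a - lam c * (F z - F a)| <= e * (F z - F a).
    apply: (incr_bound (ltW e0)) => // w /andP[/ltW aX Xz]; apply: hdl.
    have := le_Ex_ind aX; have := le_Ex_ind Xz.
    by move: ca cz; rewrite ler_norml Fa => h3 h4 h5 h6; apply/andP; split; lra.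
  have -> : G z - (L (F z) - L 0) = (G a - (L (F a) - L 0)) + (G z - G a - lam c * (F z - F a)).
    by rewrite -hc; ring.
  by apply: le_trans (ler_normD _ _) _; apply: le_trans (lerD h1 h2) _; rewrite -mulrDr addrC subrK.
apply: le_trans (key (Num.truncn (1 / dl)) y _) _.
  apply: le_trans (F1 y) _; rewrite -ler_pdivrMr//; apply/ltW; exact: truncnS_gt.
by rewrite ler_piMr ?(ltW e0).
Qed.

End level_identity.

(** * Sums over ranks *)

Section ranks.
Variable R : realType.

(** Without ties, the ranks of the n particles at or below y are exactly 1, ..., n, each taken once:
    they are distinct, lie in this range and have the right number. *)
Lemma sum_rank N (x : 'I_N -> R) (f : nat -> R) (y : R) : injective x ->
  \sum_(i < N) f (\sum_(j < N) (x j <= x i)%R)%N * ind (x i) y =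
  \sum_(1 <= k < (\sum_(j < N) (x j <= y)%R)%N.+1) f k.
Proof.
move=> xI; pose r i := (\sum_(j < N) (x j <= x i)%R)%N; pose n := (\sum_(j < N) (x j <= y)%R)%N.
have cE z : (\sum_(j < N) (x j <= z)%R)%N = #|[pred j | x j <= z]|.
  by rewrite -sum1_card [RHS]big_mkcond/=; apply: eq_bigr => j _; rewrite inE; case: (x j <= z).
have r_lt i j : x i < x j -> (r i < r j)%N.
  move=> ij; rewrite /r !cE; apply: proper_card; apply/properP; split.
    by apply/fintype.subsetP => k; rewrite !inE => /le_trans; apply; exact: ltW.
  by exists j; rewrite !inE ?lexx// -ltNge.
have rI : injective r.
  move=> i j; have [/r_lt|/r_lt|/xI//] := ltgtP (x i) (x j); by move=> /[swap] ->; rewrite ltnn.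
transitivity (\sum_(i <- enum [pred j | x j <= y]) f (r i)).
  rewrite big_enum_cond/= [RHS]big_mkcond/=; apply: eq_bigr => i _.
  by rewrite /ind inE; case: (x i <= y); rewrite ?mulr1 ?mulr0.
rewrite -(big_map r predT f)/= -/n; apply: perm_big.
apply: uniq_perm; first by rewrite map_inj_uniq// enum_uniq.
  by rewrite iota_uniq.
have sub : {subset [seq r i | i <- enum [pred j | x j <= y]] <= index_iota 1 n.+1}.
  move=> k /mapP[i]; rewrite mem_enum inE => xi ->; rewrite mem_index_iota ltnS; apply/andP; split.
    by rewrite /r (bigD1 i)//= lexx.
  rewrite /r /n; apply: leq_sum => j _; case: (leP (x j) (x i)) => // h; by rewrite (le_trans h xi).
have uE : uniq [seq r i | i <- enum [pred j | x j <= y]] by rewrite map_inj_uniq// enum_uniq.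
have sz : (size (index_iota 1 n.+1) <= size [seq r i | i <- enum [pred j | (x j <= y)%R]])%N.
  by rewrite size_iota size_map -cardE -cE subSS subn0.
by have [_ h] := uniq_min_size uE sub sz.
Qed.

Lemma sum_lambdaN (L : R -> R) N n : (0 < N)%N ->
  N%:R^-1 * \sum_(1 <= k < n.+1) lambdaN L N k = L (n%:R / N%:R) - L 0.
Proof.
move=> N0; have NR : N%:R != 0 :> R by rewrite pnatr_eq0 -lt0n.
elim: n => [|n ih]; first by rewrite big_geq// mulr0 mul0r subrr.
rewrite big_nat_recr//= mulrDr ih /lambdaN mulrA mulVf// mul1r -natr1 addrK; ring.
Qed.

End ranks.

(** * Telescoping along a path *)

Lemma sum_inner_nat (R : realType) n (f : nat -> R) :
  \sum_(1 <= k < n) f k = \sum_(k < n.+1) (if (0 < k < n)%N then f k else 0).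
Proof.
rewrite -big_mkcond/= -(big_mkord (fun k => (0 < k < n)%N)) (big_nat_widenl 1 0)// (big_nat_widen _ _ n.+1)//=.
Qed.

Section path_remainder.
Variable R : realType.
Notation mu := (@lebesgue_measure R).
Variables (n : nat) (a dt X c B : nat -> R).
Hypothesis an : a n.+1 = 0.
Hypothesis a_gt0 : forall k, (0 < k < n)%N -> 0 < a k.

Let Z k := X k + dt k * c k.

(** What a single path leaves of the mild equation once the increments of [incr] are removed; [n.+1]
    is the final index. The drift sum omits step 0, where ties or atoms may occur, and step n, whose
    length to the final time may be arbitrarily small and its kernel arbitrarily singular. *)
Definition path_remainder (x : R) : R :=
  ind (X n.+1) x - Phi (a 0%N) (x - X 0%N) + \sum_(1 <= k < n) dt k * (c k * gk (a k) (x - X k))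
  - \sum_(k < n.+1) (Phi (a k.+1) (x - Z k - B k) - Phi (a k) (x - Z k)).

Let meas_Phi_sub s y : measurable_fun [set: R] (fun x : R => Phi s (x - y)).
Proof. by apply: measurableT_comp; [exact: measurable_Phi|exact: measurable_funB]. Qed.

(** Each step contributes its displacement error, plus a second-order Taylor remainder for the steps
    of the drift sum and a first-order bound for the two omitted ones. *)
Lemma L1_path_remainder :
  (L1 mu path_remainder <=
   (\sum_(k < n.+1) (2 * `|X k.+1 - (Z k + B k)| +
     (if (0 < k < n)%N then 512 * (dt k * c k) ^+ 2 / a k else 2 * `|dt k * c k|)))%:E)%E.
Proof.
pose V k x := Phi (a k) (x - X k).
pose r1 k x := V k.+1 x - Phi (a k.+1) (x - (Z k + B k)).
pose r2 k x := Phi (a k) (x - Z k) - V k x + (if (0 < k < n)%N then dt k * c k * gk (a k) (x - X k) else 0).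
have E x : path_remainder x = \sum_(k < n.+1) (r1 k x + r2 k x).
  have tel : ind (X n.+1) x - Phi (a 0%N) (x - X 0%N) = \sum_(k < n.+1) (V k.+1 x - V k x).
    rewrite -(big_mkord xpredT (fun k => V k.+1 x - V k x)) telescope_sumr// /V an Phi0; congr (_ - _).
    by rewrite /ind subr_ge0.
  rewrite /path_remainder tel sum_inner_nat -big_split/= -sumrB; apply: eq_bigr => k _.
  have zb : x - (Z k + B k) = x - Z k - B k by rewrite opprD addrA.
  by rewrite /r1 /r2 zb /V; case: ifP => _; ring.
have m1 k : measurable_fun [set: R] (r1 k) by apply: measurable_funB; exact: meas_Phi_sub.
have m2 k : measurable_fun [set: R] (r2 k).
  apply: measurable_funD; first by apply: measurable_funB; exact: meas_Phi_sub.
  case: (0 < k < n)%N; last exact: measurable_cst.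
  by apply: measurable_funM => //; apply: measurableT_comp; [exact: measurable_gk|exact: measurable_funB].
rewrite (_ : path_remainder = fun x => \sum_(k < n.+1) (r1 k x + r2 k x)); last exact/funext.
apply: le_trans (L1_sum_ord mu (f := fun (k : 'I_n.+1) x => r1 k x + r2 k x) _) _.
  by move=> k; exact: (measurable_funD (m1 k) (m2 k)).
rewrite -sumEFin; apply: lee_sum => k _.
apply: le_trans (L1D mu (m1 k) (m2 k)) _.
rewrite EFinD; apply: leeD; first exact: L1_Phi_diff.
rewrite /r2; case: ifPn => [kn|_].
  have := @L1_Phi_taylor R (a k) (X k) (dt k * c k) (a_gt0 kn); exact.
apply: (@le_trans _ _ (L1 mu (fun x => Phi (a k) (x - Z k) - V k x))).
  by apply: le_L1 => x; rewrite addr0.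
apply: le_trans (L1_Phi_diff _ _ _) _.
by rewrite /Z addrAC subrr add0r.
Qed.

End path_remainder.

(** * Time grids ending at a given time *)

Section grid.
Variable R : realType.
Variables (sigma delta t T : R) (n : nat).
Hypothesis sigma_gt0 : 0 < sigma.
Hypothesis delta_gt0 : 0 < delta.
Hypothesis nt : n%:R * delta < t.
Hypothesis tn : t <= n.+1%:R * delta.
Hypothesis tT : t <= T.

(** n full steps, then a last step from n delta to t, of length at most delta; constant from there
    on. *)
Definition tk k : R := if (k <= n)%N then k%:R * delta else t.
Definition dtk k := tk k.+1 - tk k.
(** Standard deviation of the noise still to come between the k-th grid time and t; [bk k] is that
    of step k alone. *)
Definition ak k := sigma * Num.sqrt (t - tk k).
Definition bk k := sigma * Num.sqrt (dtk k).

Lemma tkE k : (k <= n)%N -> tk k = k%:R * delta.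
Proof. by rewrite /tk => ->. Qed.

Lemma tk0 : tk 0 = 0. Proof. by rewrite tkE// mul0r. Qed.

Lemma tkt k : (n < k)%N -> tk k = t.
Proof. by rewrite /tk ltnNge => /negbTE ->. Qed.

Lemma dtkE k : (k < n)%N -> dtk k = delta.
Proof. by move=> kn; rewrite /dtk !tkE// ?(ltnW kn)// -natr1 mulrDl mul1r addrAC subrr add0r. Qed.

Lemma dtk_gt0 k : (k < n.+1)%N -> 0 < dtk k.
Proof.
rewrite ltnS leq_eqVlt => /predU1P[->|/dtkE->//].
by rewrite /dtk tkt// tkE// subr_gt0.
Qed.

Lemma dtk_ge0 k : 0 <= dtk k.
Proof.
have [kn|kn] := ltnP k n.+1; first exact/ltW/dtk_gt0.
by rewrite /dtk !tkt ?subrr// (leq_trans kn).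
Qed.

Lemma dtk_le k : dtk k <= delta.
Proof.
have [/dtkE->//|] := ltnP k n; rewrite leq_eqVlt => /predU1P[<-|kn].
  by rewrite /dtk tkt// tkE//; move: tn; rewrite -natr1 mulrDl mul1r; lra.
by rewrite /dtk !tkt ?subrr ?(ltW delta_gt0)// ltnW.
Qed.

Lemma tk_le k l : (k <= l)%N -> tk k <= tk l.
Proof.
elim: l => [|l ih]; first by rewrite leqn0 => /eqP ->.
rewrite leq_eqVlt => /predU1P[->//|kl]; apply: le_trans (ih kl) _.
by rewrite -subr_ge0; exact: dtk_ge0.
Qed.

Lemma tk_ge0 k : 0 <= tk k. Proof. by rewrite -tk0 tk_le. Qed.

Lemma tk_let k : tk k <= t.
Proof. by rewrite -(@tkt (maxn k n.+1)) ?tk_le ?leq_maxl// leq_maxr. Qed.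

Lemma sum_dtk : \sum_(k < n.+1) dtk k = t.
Proof. by rewrite -(big_mkord xpredT dtk) telescope_sumr// tk0 subr0 tkt. Qed.

Lemma ak_ge0 k : 0 <= ak k.
Proof. by rewrite mulr_ge0 ?(ltW sigma_gt0). Qed.

Lemma ak_le k : ak k <= sigma * Num.sqrt T.
Proof. by rewrite ler_pM2l// ler_wsqrtr//; have := tk_ge0 k; move: tT; lra. Qed.

Lemma ak_end : ak n.+1 = 0.
Proof. by rewrite /ak tkt// subrr sqrtr0 mulr0. Qed.

Lemma bk_ge0 k : 0 <= bk k.
Proof. by rewrite mulr_ge0 ?(ltW sigma_gt0). Qed.

Lemma akE k : ak k = Num.sqrt (ak k.+1 ^+ 2 + bk k ^+ 2).
Proof.
have s0 l : 0 <= t - tk l by rewrite subr_ge0 tk_let.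
rewrite /ak /bk !exprMn !sqr_sqrtr ?dtk_ge0// -mulrDr sqrtrM ?sqr_ge0//.
by rewrite sqrtr_sqr gtr0_norm// /dtk addrA subrK.
Qed.

Lemma ak_ge k : (k < n)%N -> sigma * Num.sqrt ((n - k)%:R * delta) <= ak k.
Proof.
move=> kn; rewrite /ak ler_pM2l// ler_wsqrtr// natrB ?(ltnW kn)// mulrBl tkE ?(ltnW kn)//.
by move: nt; lra.
Qed.

Lemma ak_gt0 k : (k < n)%N -> 0 < ak k.
Proof.
move=> kn; apply: lt_le_trans (ak_ge kn).
by rewrite mulr_gt0// sqrtr_gt0 mulr_gt0// ltr0n subn_gt0.
Qed.

Let T0 : 0 < T.
Proof. by apply: lt_le_trans tT; apply: le_lt_trans nt; rewrite mulr_ge0// ltW. Qed.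

(** A Riemann sum of 1 / sqrt (t - s): a factor sqrt delta comes out, and [sum_inv_sqrt_rev] leaves
    2 sqrt (n delta). *)
Lemma sum_singular : \sum_(1 <= k < n) delta / Num.sqrt ((n - k)%:R * delta) <= 2 * Num.sqrt T.
Proof.
have d0 : 0 <= Num.sqrt delta by [].
rewrite (eq_bigr (fun k => Num.sqrt delta * (Num.sqrt (n - k)%:R)^-1)); last first.
  move=> k _; rewrite sqrtrM// invfM mulrCA mulrC; congr (_ * _).
  have q0 : Num.sqrt delta != 0 by rewrite gt_eqF// sqrtr_gt0.
  by apply: (mulIf q0); rewrite divfK// -expr2 sqr_sqrtr// ltW.
rewrite -mulr_sumr; apply: le_trans (ler_wpM2l d0 (sum_inv_sqrt_rev R n)) _.
rewrite mulrCA ler_pM2l// -sqrtrM ?(ltW delta_gt0)// ler_wsqrtr//.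
by rewrite mulrC; apply: ltW; exact: lt_le_trans tT.
Qed.

Lemma sum_dtk_before (theta : R) : 0 <= theta ->
  \sum_(k < n.+1) dtk k * ((tk k < theta)%R : bool)%:R <= theta + delta.
Proof.
move=> th0; suff h m : \sum_(k < m) dtk k * ((tk k < theta)%R : bool)%:R <= Num.min (tk m) (theta + delta).
  by apply: le_trans (h n.+1) _; rewrite ge_min lexx orbT.
elim: m => [|m ih]; first by rewrite big_ord0 le_min tk_ge0 addr_ge0 ?(ltW delta_gt0).
rewrite big_ord_recr/=; move: ih; rewrite !le_min => /andP[h1 h2].
have e : tk m.+1 = tk m + dtk m by rewrite /dtk addrC subrK.
have := dtk_ge0 m; have := dtk_le m; case: (ltP (tk m) theta) => tm; rewrite ?mulr1 ?mulr0 e => g1 g2.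
  by apply/andP; split; lra.
by apply/andP; split; lra.
Qed.

(** 4 be is twice 2 be, for the first and last steps; 1024 is the Taylor constant 512 times the 2 of
    [sum_singular]. *)
Definition path_cst (be : R) : R := 4 * be + 1024 * be ^+ 2 / sigma * Num.sqrt T.

Lemma path_cst_ge0 (be : R) : 0 <= be -> 0 <= path_cst be.
Proof.
move=> be0; apply: addr_ge0; first by apply: mulr_ge0; [exact: ler0n|exact: be0].
apply: mulr_ge0; last exact: sqrtr_ge0.
by apply: divr_ge0; [apply: mulr_ge0; [exact: ler0n|exact: sqr_ge0]|exact: ltW].
Qed.

Lemma L1_path_remainder_grid (be : R) (X c B : nat -> R) : (forall k, `|c k| <= be) ->
  (L1 (@lebesgue_measure R) (path_remainder n ak dtk X c B) <=
   (2 * \sum_(k < n.+1) `|X k.+1 - (X k + dtk k * c k + B k)| + path_cst be * delta)%:E)%E.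
Proof.
move=> cb; have be0 : 0 <= be by apply: le_trans (cb 0%N).
have dc k : `|dtk k * c k| <= delta * be.
  by rewrite normrM ger0_norm ?dtk_ge0//; apply: ler_pM; rewrite ?dtk_ge0 ?dtk_le.
apply: le_trans (L1_path_remainder dtk X c B ak_end _) _.
  by move=> k /andP[_ kn]; exact: ak_gt0.
rewrite lee_fin big_split/= -mulr_sumr lerD2l.
have [K K0 KE] : exists2 K : R, 0 <= K & K = 512 by exists 512%:R; [exact: ler0n|reflexivity].
have d0 := ltW delta_gt0; have s0 := ltW sigma_gt0.
pose J := delta * be.
have J0 : 0 <= J by exact: mulr_ge0.
have J20 : 0 <= 2 * J by apply: mulr_ge0.
pose f k := if (0 < k < n)%N then K * (be ^+ 2 / sigma * delta) * (delta / Num.sqrt ((n - k)%:R * delta)) else 0.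
(* When n = 0 the first and the last step coincide, and the step is counted twice. *)
pose g k := (if k == 0%N then 2 * J else 0) + (if k == n then 2 * J else 0).
rewrite -KE; apply: (@le_trans _ _ (\sum_(k < n.+1) (f k + g k))).
  apply: ler_sum => k _; rewrite /f /g.
  case: ifPn => [/andP[k0 kn]|].
    rewrite (gtn_eqF k0) (ltn_eqF kn) !addr0.
    have s1 := ak_ge kn; have s2 := ak_gt0 kn.
    have r0 : 0 < Num.sqrt ((n - k)%:R * delta) by rewrite sqrtr_gt0 mulr_gt0// ltr0n subn_gt0.
    have -> : K * (be ^+ 2 / sigma * delta) * (delta / Num.sqrt ((n - k)%:R * delta)) =
       K * J ^+ 2 / (sigma * Num.sqrt ((n - k)%:R * delta)) by rewrite /J; field; rewrite !gt_eqF.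
    have dJ : (dtk k * c k) ^+ 2 <= J ^+ 2.
      rewrite -[leLHS]real_normK ?num_real//; apply: lerXn2r; rewrite ?nnegrE//; exact: dc.
    have h1 : K * (dtk k * c k) ^+ 2 <= K * J ^+ 2 by exact: ler_wpM2l.
    have h2 : (ak k)^-1 <= (sigma * Num.sqrt ((n - k)%:R * delta))^-1 by rewrite lef_pV2 ?posrE// mulr_gt0.
    apply: (ler_pM _ _ h1 h2); last by rewrite invr_ge0 ltW.
    by apply: (mulr_ge0 K0); exact: sqr_ge0.
  have dck : 2 * `|dtk k * c k| <= 2 * J by rewrite ler_pM2l//; exact: dc.
  rewrite negb_and -!leqNgt leqn0 add0r => /orP[/eqP k0|nk].
    have -> : (k == 0 :> nat) = true by rewrite k0.
    by apply: le_trans dck _; rewrite lerDl; case: ifP.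
  have -> : (k == n :> nat) = true by rewrite eqn_leq nk -ltnS ltn_ord.
  by apply: le_trans dck _; rewrite lerDr; case: ifP.
rewrite big_split/=.
rewrite -(sum_inner_nat n (fun k => K * (be ^+ 2 / sigma * delta) * (delta / Num.sqrt ((n - k)%:R * delta)))) -mulr_sumr.
have -> : \sum_(k < n.+1) g k = 4 * be * delta.
  by rewrite big_split/= -!big_mkcond/= (big_pred1 ord0)// (big_pred1 ord_max)// /J; ring.
have k0 : 0 <= K * (be ^+ 2 / sigma * delta).
  by apply: (mulr_ge0 K0); apply: mulr_ge0 => //; apply: divr_ge0 => //; exact: sqr_ge0.
apply: le_trans (lerD (ler_wpM2l k0 sum_singular) (lexx _)) _.
by rewrite /path_cst KE le_eqVlt; apply/orP; left; apply/eqP; ring.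
Qed.

End grid.

(** * Empirical measures *)

Section empirical.
Variable R : realType.
Notation mu := (@lebesgue_measure R).

Lemma empirical_probability N (x : 'I_N -> R) : (0 < N)%N ->
  exists2 m : probability (measurableTypeR R) R,
    (forall A, measurable A -> m A = empirical x A)
    & forall y, cdf_of m y = N%:R^-1 * \sum_(i < N) ind (x i) y.
Proof.
move=> N0; have N1 : 0 <= N%:R^-1 :> R by rewrite invr_ge0.
(* The points as a sequence over all integers; the default 0 is never reached, since only indices
   below N are summed. *)
pose x' (k : nat) : measurableTypeR R := odflt (0 : R) (omap x (insub k)).
have x'E (i : 'I_N) : x' i = x i by rewrite /x' valK.
pose m0 := mscale (NngNum N1) (msum (fun k => \d_(x' k)) N).
have m0E A : m0 A = empirical x A.
  by congr (_ * _)%E; rewrite /msum; apply: eq_bigr => i _; rewrite x'E.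
have m01 : m0 setT = 1%E.
  rewrite m0E /empirical (eq_bigr (fun=> 1%:E)); last by move=> i _; rewrite diracT.
  rewrite sumEFin sumr_const card_ord -EFinM mulVf//.
  by rewrite pnatr_eq0 -lt0n.
pose m : probability (measurableTypeR R) R := HB.pack m0 (@Measure_isProbability.Build _ _ R m0 m01).
exists m; first by move=> A _; exact: m0E.
move=> y; rewrite /cdf_of -[m _]/(m0 _) m0E /empirical.
rewrite (eq_bigr (fun i => (ind (x i) y)%:E)); last first.
  by move=> i _; rewrite diracE /ind; congr ((_ %:R)%:E); rewrite mem_setE/= in_itv.
by rewrite sumEFin -EFinM.
Qed.

Lemma wasserstein1_empirical N (x : 'I_N -> R) (nu : probability (measurableTypeR R) R) : (0 < N)%N ->
  (wasserstein1 (empirical x) nu <=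
   2%:E * L1 mu (fun y => (N%:R^-1 * \sum_(i < N) ind (x i) y - cdf_of nu y)%R))%E.
Proof.
move=> N0; have [m mE cE] := empirical_probability x N0.
have -> : wasserstein1 (empirical x) nu = wasserstein1 m nu.
  (* Couplings test marginals on measurable sets only, where the two measures agree. *)
  congr ereal_inf; apply/seteqP; split => _ [pi ppi <-]; exists pi => // A mA;
    by have [h1 h2] := ppi A mA; split => //; rewrite h1 mE.
apply: le_trans (wasserstein1_le_cdf m nu) _.
apply: lee_wpmul2l => //.
by apply: ge0_le_integral_nomeas => y; rewrite lee_fin// cE.
Qed.

End empirical.

(** * Time integrals of possibly nonmeasurable drifts *)

Section nonmeasurable_increments.
Import HBNNSimple.
Variable R : realType.
Notation mu := (@lebesgue_measure R).

(* [f] is not assumed measurable: the integral is then a lower integral, which is still additive over disjoint intervals. *)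
Lemma integral_itv_increment (f : R -> \bar R) (u s l h : R) : 0 <= u -> u <= s -> 0 <= l -> 0 <= h ->
  (forall r, (0 <= f r)%E) -> (forall r, u < r <= s -> (l%:E <= f r <= h%:E)%E) ->
  (\int[mu]_(r in `[0%R, u]) f r + (l * (s - u))%:E <= \int[mu]_(r in `[0%R, s]) f r)%E /\
  (\int[mu]_(r in `[0%R, s]) f r <= \int[mu]_(r in `[0%R, u]) f r + (h * (s - u))%:E)%E.
Proof.
move=> u0 us l0 h0 f0 lfh.
have disj (r : R) : `]u, s]%classic r -> ~ `[0, u]%classic r.
  by rewrite /= !in_itv/= => /andP[ur _] /andP[_]; rewrite leNgt ur.
have cup : `[0, s]%classic = `[0, u] `|` `]u, s] :> set R.
  apply/seteqP; split => r /=; rewrite !in_itv/=.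
    by move=> /andP[r0 rs]; have [ru|ru] := leP r u; [left|right]; apply/andP.
  by move=> [/andP[-> /le_trans]|/andP[ur ->]]; [apply|rewrite (le_trans u0 (ltW ur))].
have mus : mu `]u, s]%classic = (s - u)%:E.
  apply: (etrans (lebesgue_measure_itv _)); rewrite /= lte_fin.
  by case: ltP us => // su us; rewrite (_ : s = u) ?subrr//; apply/eqP; rewrite eq_le su us.
have cst_int (c : R) : (\int[mu]_(r in `]u, s]) c%:E = (c * (s - u))%:E)%E.
  rewrite integral_cst//=; transitivity (c%:E * (s - u)%:E)%E => //.
  by congr (_ * _)%E; exact: mus.
have split_int (g : R -> \bar R) : measurable_fun [set: R] g -> (forall r, (0 <= g r)%E) ->
    (\int[mu]_(r in `[0%R, s]) g r = \int[mu]_(r in `[0%R, u]) g r + \int[mu]_(r in `]u, s]) g r)%E.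
  move=> mg g0; rewrite cup ge0_integral_setU//; first exact: measurable_funTS.
  by apply/disj_setPS => r [h1 h2]; exact: (disj r).
have suprep (D : set R) : (\int[mu]_(r in D) f r = ereal_sup [set sintegral mu k | k in [set k : {nnsfun (measurableTypeR R) >-> R} | forall x : measurableTypeR R, ((k x)%:E <= (f \_ D) x)%E]])%E.
  rewrite integral_mkcond ge0_integralTE//.
  by move=> x; rewrite patchE; case: ifP.
have mono (D : set R) (g1 g2 : R -> \bar R) : (forall r, (0 <= g1 r)%E) -> (forall r, D r -> (g1 r <= g2 r)%E) ->
    (\int[mu]_(r in D) g1 r <= \int[mu]_(r in D) g2 r)%E.
  move=> g0 g12; rewrite integral_mkcond [leRHS]integral_mkcond; apply: ge0_le_integral_nomeas => r; rewrite !patchE.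
    by case: ifP.
  by case: ifPn => // /set_mem; exact: g12.
have supp (D : set R) (k : {nnsfun (measurableTypeR R) >-> R}) : (forall x : measurableTypeR R, ((k x)%:E <= (f \_ D) x)%E) ->
    (\int[mu]_r (k r)%:E <= \int[mu]_(r in D) (k r)%:E)%E.
  move=> hk; rewrite [leRHS]integral_mkcond; apply: ge0_le_integral_nomeas => r; first by rewrite lee_fin.
  by have := hk r; rewrite !patchE; case: ifP => // _; rewrite lee_fin => ?; rewrite lee_fin.
have mk (k : {nnsfun (measurableTypeR R) >-> R}) : measurable_fun [set: R] (fun r : R => (k r)%:E).
  by apply/measurable_EFinP; exact: (@measurable_funPT _ _ _ _ k).
split.
- rewrite -leeBrDr//; rewrite [leLHS]suprep; apply: ge_ereal_sup => _ [k hk <-].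
  rewrite leeBrDr// -integralT_nnsfun.
  (* A simple minorant on [0, u], continued by the constant l, is a measurable minorant on
     [0, s]. *)
  pose g (r : R) : \bar R := if r <= u then (k r)%:E else l%:E.
  have mg : measurable_fun [set: R] g by apply: measurable_fun_ifT => //; exact: measurable_fun_ler.
  have g0 r : (0 <= g r)%E by rewrite /g; case: ifP; rewrite lee_fin.
  apply: (@le_trans _ _ (\int[mu]_(r in `[0%R, s]) g r)%E); last first.
    apply: mono => // r /=; rewrite in_itv/= => /andP[r0 rs]; rewrite /g; case: ifPn => [ru|].
      by have := hk r; rewrite patchE mem_set//= in_itv/= r0 ru.
    by rewrite -ltNge => ur; case/andP: (lfh r (introT andP (conj ur rs))).
  rewrite (split_int g mg g0); apply: leeD.
    apply: le_trans (supp _ _ hk) _; apply: mono => // [r|r /=]; first by rewrite lee_fin.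
    by rewrite in_itv/= => /andP[_ ru]; rewrite /g ru.
  rewrite -cst_int; apply: mono => // r /=; rewrite in_itv/= => /andP[ur _].
  by rewrite /g (lt_geF ur).
- rewrite [leLHS]suprep; apply: ge_ereal_sup => _ [k hk <-].
  rewrite -integralT_nnsfun; apply: le_trans (supp _ _ hk) _.
  rewrite (split_int _ (mk k)) => [|r]; last by rewrite lee_fin.
  apply: leeD.
    apply: mono => [r|r /=]; first by rewrite lee_fin.
    rewrite in_itv/= => /andP[r0 ru]; have := hk r.
    by rewrite patchE mem_set//= in_itv/= r0 (le_trans ru us).
  rewrite -cst_int; apply: mono => [r|r /=]; first by rewrite lee_fin.
  rewrite in_itv/= => urs; have := hk r; rewrite patchE mem_set/=; last first.
    by rewrite /= in_itv/=; case/andP: urs => ur ->; rewrite (le_trans u0 (ltW ur)).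
  by move=> /le_trans; apply; case/andP: (lfh r urs).
Qed.

(** The positive and negative parts are treated separately, with the corresponding parts of l and h
    as bounds; boundedness of f keeps the difference of the two integrals meaningful. *)
Lemma Rintegral_increment (f : R -> R) (B u s l h : R) : 0 <= u -> u <= s ->
  (forall r, 0 <= r <= s -> `|f r| <= B) -> (forall r, u < r <= s -> l <= f r <= h) ->
  l * (s - u) <= \int[mu]_(r in `[0%R, s]) f r - \int[mu]_(r in `[0%R, u]) f r <= h * (s - u).
Proof.
move=> u0 us fB lfh.
have su0 : 0 <= s - u by rewrite subr_ge0.
pose fp r := (Num.max (f r) 0)%:E; pose fn r := (Num.max (- f r) 0)%:E.
have fp0 r : (0 <= fp r)%E by rewrite lee_fin le_max lexx orbT.
have fn0 r : (0 <= fn r)%E by rewrite lee_fin le_max lexx orbT.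
have IE (v : R) : (\int[mu]_(r in `[0%R, v]) (f r)%:E = \int[mu]_(r in `[0%R, v]) fp r - \int[mu]_(r in `[0%R, v]) fn r)%E.
  by rewrite integralE; congr (_ - _)%E; apply: eq_integral => r _; rewrite ?funeposE ?funenegE /fp /fn EFin_max.
have B0 : 0 <= B by apply: le_trans (fB 0 _); rewrite ?lexx ?(le_trans u0 us).
have fin (g : R -> \bar R) v : 0 <= v -> v <= s -> (forall r, (0 <= g r)%E) -> (forall r, 0 <= r <= s -> (g r <= B%:E)%E) ->
    (\int[mu]_(r in `[0%R, v]) g r)%E \is a fin_num.
  move=> v0 vs g0 gB; rewrite ge0_fin_numE; last exact: integral_ge0.
  apply: (@le_lt_trans _ _ (\int[mu]_(r in `[0%R, v]) (cst B%:E r))%E).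
    rewrite [leLHS]integral_mkcond [leRHS]integral_mkcond.
    apply: ge0_le_integral_nomeas => r; rewrite !patchE; first by case: ifP.
    by case: ifPn => // /set_mem/=; rewrite in_itv/= => /andP[r0 rv]; apply: gB; rewrite r0 (le_trans rv).
  rewrite integral_cst//=; apply: lte_mul_pinfty => //; apply: (@le_lt_trans _ _ (v - 0)%:E); last exact: ltry.
  rewrite [leLHS](lebesgue_measure_itv `[0%R, v])/= lte_fin; case: ifP => _; first by rewrite -EFinB.
  by rewrite lee_fin subr0.
have pB r : 0 <= r <= s -> (fp r <= B%:E)%E.
  by move=> /fB; rewrite lee_fin ge_max B0 andbT; apply: le_trans (ler_norm _).
have nB r : 0 <= r <= s -> (fn r <= B%:E)%E.
  by move=> /fB; rewrite lee_fin ge_max B0 andbT -normrN; apply: le_trans (ler_norm _).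
have m0 (x : R) : 0 <= Num.max x 0 by rewrite le_max lexx orbT.
have mono (x y : R) : x <= y -> Num.max x 0 <= Num.max y 0.
  by move=> xy; rewrite ge_max m0 le_max xy.
have [|p1 p2] := @integral_itv_increment fp u s (Num.max l 0) (Num.max h 0) u0 us (m0 l) (m0 h) fp0.
  by move=> r /lfh /andP[lf fh]; rewrite !lee_fin !mono.
have [|n1 n2] := @integral_itv_increment fn u s (Num.max (- h) 0) (Num.max (- l) 0) u0 us (m0 _) (m0 _) fn0.
  by move=> r /lfh /andP[lf fh]; rewrite !lee_fin !mono// lerN2.
rewrite /Rintegral !IE.
move: p1 p2 n1 n2.
rewrite -(fineK (fin fp u u0 us fp0 pB)) -(fineK (fin fp s (le_trans u0 us) (lexx s) fp0 pB)).
rewrite -(fineK (fin fn u u0 us fn0 nB)) -(fineK (fin fn s (le_trans u0 us) (lexx s) fn0 nB)).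
rewrite -!EFinB -!EFinD !lee_fin/= => p1 p2 n1 n2.
have mE (x : R) : x = Num.max x 0 - Num.max (- x) 0.
  by have [x0|x0] := leP x 0; have [y0|y0] := leP (- x) 0; rewrite ?subr0 ?sub0r ?opprK//; lra.
rewrite {1}(mE l) {1}(mE h).
by rewrite !mulrBl; apply/andP; split; lra.
Qed.

End nonmeasurable_increments.

(** * Oscillation, small balls and filtrations *)

Section oscillation.
Context d (Omega : measurableType d) (R : realType) (P : probability Omega R).
Variables (T : R) (X : R -> Omega -> R).
Hypothesis T_gt0 : 0 < T.
Hypothesis mX : forall t, measurable_fun setT (X t).
Hypothesis cX : {ae P, forall w, {within `[0, T], continuous (fun t => X t w)}}.

Let rq (q : rat) : R := ratr q.

Let rat_near (s r : R) : 0 <= s <= T -> 0 < r -> exists2 q : rat, 0 <= rq q <= T & `|s - rq q| <= r.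
Proof.
move=> /andP[s0 sT] r0.
have [|q] := @rat_in_itvoo R (Num.max 0 (s - r)) (Num.min T (s + r)).
  by rewrite lt_min !gt_max T_gt0 ltr_pwDr//= (lt_le_trans _ sT) ?gtrBl//= ltrBlDr -addrA ltrDl addr_gt0.
rewrite in_itv/= -/(rq q) gt_max lt_min => /andP[/andP[q0 q1] /andP[q2 q3]]; exists q; first by rewrite !ltW.
by rewrite ler_norml; apply/andP; split; lra.
Qed.

(** The event that two rational times at distance at most 1 / (m + 1) see a gap above eta / 2 is
    measurable and decreases with m to a null event, by uniform continuity of almost every path.
    Continuity then extends the bound to real times at the cost of another eta / 2. *)
Lemma small_oscillation (eta e : R) : 0 < eta -> 0 < e ->
  exists2 dl : R, 0 < dl & exists O : set Omega, [/\ measurable O, (P O <= e%:E)%E &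
    forall w, ~ O w -> forall s s' : R, 0 <= s <= T -> 0 <= s' <= T -> `|s - s'| <= dl -> `|X s w - X s' w| <= eta].
Proof.
move=> eta0 e0; have [Nl [mN PN hN]] := cX.
pose cond (m : nat) (q q' : rat) := [&& 0 <= rq q <= T, 0 <= rq q' <= T & `|rq q - rq q'| <= m.+1%:R^-1 :> R].
pose A (q q' : rat) := [set w | eta / 2 < `|X (rq q) w - X (rq q') w|].
pose D m := \bigcup_q \bigcup_q' (if cond m q q' then A q q' else set0).
have mA q q' : measurable (A q q').
  rewrite -[A q q']setTI; have -> : A q q' = (fun w => `|X (rq q) w - X (rq q') w|) @^-1` `]eta / 2, +oo[.
    by apply/seteqP; split => w /=; rewrite in_itv/= andbT.
  have mf : measurable_fun setT (fun w => `|X (rq q) w - X (rq q') w|).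
    by apply: measurableT_comp => //; exact: measurable_funB.
  by apply: mf => //; exact: measurable_itv.
have mD m : measurable (D m).
  by apply: bigcupT_measurable_rat => q; apply: bigcupT_measurable_rat => q'; case: ifP.
have unif w : ~ Nl w -> {within `[0, T], continuous (fun t => X t w)}.
  by move=> nN; apply: contrapT => h; apply: nN; exact: hN.
have capN : \bigcap_m D m `<=` Nl.
  move=> w Dw; apply: contrapT => /unif cw.
  have e20 : 0 < eta / 2 by rewrite divr_gt0.
  have [dl d0 hdl] := within_continuous_unif cw e20.
  have [q _ [q' _]] := Dw (Num.truncn dl^-1) I; case: ifPn => // /and3P[q1 q2 q3].
  rewrite /A/= ltNge => /negP; apply; apply: hdl => //; apply: le_trans q3 _.
  by rewrite -[leRHS]invrK lef_pV2 ?posrE ?invr_gt0//; apply/ltW; exact: truncnS_gt.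
have cap0 : P (\bigcap_m D m) = 0%E.
  apply/eqP; rewrite eq_le measure_ge0 andbT -PN; apply: le_measure => //; rewrite inE//.
  by apply: bigcap_measurable.
have cvD : P (D m) @[m --> \oo] --> (0 : \bar R)%E.
  rewrite -cap0; apply: nonincreasing_cvg_mu => //.
  - by apply: le_lt_trans (probability_le1 _ _) (ltry _).
  - by apply: bigcap_measurable.
  - move=> m m' mm'; apply/subsetPset => w [q _ [q' _ h]]; exists q => //; exists q' => //.
    move: h; case: ifPn => // /and3P[q1 q2 q3]; rewrite /cond q1 q2/= ifT//.
    by apply: le_trans q3 _; rewrite lef_pV2 ?posrE// ler_nat ltnS.
have [m Pm] : exists m, (P (D m) <= e%:E)%E.
  have /fine_cvgP[_ /cvgr_le/(_ e e0)] := cvD.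
  case=> m _ /(_ m (leqnn m))/= h; exists m.
  by rewrite -[P (D m)]fineK ?fin_num_measure// lee_fin.
have m0 : 0 < m.+1%:R^-1 :> R by rewrite invr_gt0.
exists (m.+1%:R^-1 / 2); first by rewrite divr_gt0.
exists (D m `|` Nl); split.
- exact: measurableU.
- apply: le_trans (measureU2 _ _ _) _ => //.
  by rewrite [X in (_ + X)%E]PN adde0.
move=> w /not_orP[nD nN] s s' sT s'T ss'.
have cw := unif w nN.
have e40 : 0 < eta / 4 by rewrite divr_gt0.
have [dl d0 hdl] := within_continuous_unif cw e40.
have r0 : 0 < Num.min dl (m.+1%:R^-1 / 4) by rewrite lt_min d0 divr_gt0.
have [q qT sq] := rat_near sT r0; have [q' q'T s'q'] := rat_near s'T r0.
move: sq s'q'; rewrite !le_min => /andP[sq sq2] /andP[s'q' s'q2].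
have qq' : `|rq q - rq q'| <= m.+1%:R^-1.
  move: sq2 s'q2 ss'; move: (m.+1%:R^-1 : R) => v; rewrite !ler_norml => /andP[h1 h2] /andP[h3 h4] /andP[h5 h6]; apply/andP; split; lra.
have A0 : `|X (rq q) w - X (rq q') w| <= eta / 2.
  rewrite leNgt; apply/negP => h; apply: nD; exists q => //; exists q' => //.
  by rewrite /cond qT q'T qq'.
have h1 := hdl _ _ sT qT sq; have h2 := hdl _ _ s'T q'T s'q'.
move: h1 h2 A0; rewrite !ler_norml => /andP[h1 h2] /andP[h3 h4] /andP[h5 h6]; apply/andP; split; lra.
Qed.

End oscillation.

Section small_ball.
Context d (Omega : measurableType d) (R : realType).

Lemma bm_indic (S : set Omega) : measurable S -> bm (fun w => \1_S w : R).
Proof.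
move=> mS; split; first exact: measurable_indic.
by exists 1 => w; rewrite indicE; case: (_ \in _); rewrite ?normr1 ?normr0.
Qed.

Variable P : probability Omega R.

(** Given G, the sum is Gaussian of deviation b with an arbitrary centre, and the bound on the ball
    does not see the centre. *)
Lemma small_ball (G : set (set Omega)) (A B : Omega -> R) (b r : R) :
  <<s G >> `<=` measurable -> measurable_fun setT B -> indep_of P G B -> gauss_law P B b ->
  gmeas G A -> 0 < b -> 0 < r -> \int[P]_w ind `|A w + B w| r <= 3 * r / b.
Proof.
move=> Gm mB ind_ lB mA b0 r0; have mA' := gmeas_measurable Gm mA.
have bi : bm (fun w => ind `|A w + B w| r).
  by apply: bm_ind; [apply: measurableT_comp => //; exact: measurable_funD|exact: measurable_cst].
rewrite -lee_fin -(ExE P bi).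
have mf : measurable_fun setT (fun z : g_sigma_algebraType G * measurableTypeR R => (ind `|A z.1 + z.2| r)%:E).
  apply/measurable_EFinP; apply: measurable_ind; last exact: measurable_cst.
  by apply: measurableT_comp => //; apply: measurable_funD => //; exact: (measurableT_comp mA).
rewrite (freezing_gauss Gm mB ind_ lB mf) => [|z]; last by rewrite lee_fin ind_ge0.
apply: (@le_trans _ _ (\int[P]_w (cst (3 * r / b)%:E w))%E); last by rewrite integral_cst//= probability_setT mule1.
apply: ge0_le_integral_nomeas => w /=; last exact: (gam_small_ball (A w) b0 r0).
by apply: integral_ge0 => v _; rewrite lee_fin ind_ge0.
Qed.

Lemma Ex_indE (X : Omega -> R) (y : R) : measurable_fun setT X ->
  P (X @^-1` `]-oo, y]) = (\int[P]_w ind (X w) y)%:E.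
Proof.
move=> mX; rewrite -(ExE P (bm_indX mX y)).
have mS : measurable (X @^-1` `]-oo, y]).
  by rewrite -[X in measurable X]setTI; apply: mX => //; exact: measurable_itv.
rewrite -[X @^-1` _]setIT -integral_indic//; apply: eq_integral => w _.
have e : (w \in X @^-1` `]-oo, y]) = (X w <= y) by apply/idP/idP; rewrite inE/= in_itv.
by rewrite indicE /ind e.
Qed.

Lemma Ex_indic (S : set Omega) : measurable S -> \int[P]_w (\1_S w : R) = fine (P S).
Proof. by move=> mS; rewrite /Rintegral integral_indic// setIT. Qed.

End small_ball.

(** * Sigma-algebras and laws of the noise *)

Section noise.
Context d (Omega : measurableType d) (R : realType).

Lemma gmeas_sigma_rv (G : set (set Omega)) (Z : Omega -> R) : sigma_rv Z `<=` <<s G >> -> gmeas G Z.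
Proof.
move=> ZG _ C mC; rewrite setTI; apply: ZG; apply: sub_sigma_algebra.
by exists tt => //; exists C => //; rewrite setTI.
Qed.

Definition generators (I : Type) (D : set I) (Z : I -> Omega -> R) : set (set Omega) :=
  \bigcup_(i in D) preimage_set_system setT (Z i : Omega -> measurableTypeR R) measurable.

Lemma gmeas_generators (I : Type) (D : set I) (Z : I -> Omega -> R) i : D i -> gmeas (generators D Z) (Z i).
Proof.
move=> Di _ C mC; rewrite setTI; apply: sub_sigma_algebra.
by exists i => //; exists C => //; rewrite setTI.
Qed.

Lemma sub_sigma_family (G : set (set Omega)) (I : Type) (D : set I) (Z : I -> Omega -> R) :
  (forall i, D i -> gmeas G (Z i)) -> sigma_family D Z `<=` <<s G >>.
Proof.
move=> mZ; apply: smallest_sub; first exact: smallest_sigma_algebra.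
by move=> _ [i Di [C mC <-]]; apply: mZ.
Qed.

Lemma sigma_family_measurable (I : Type) (D : set I) (Z : I -> Omega -> R) :
  (forall i, D i -> measurable_fun setT (Z i)) -> sigma_family D Z `<=` measurable.
Proof.
move=> mZ; apply: smallest_sub; first exact: sigma_algebra_measurable.
by move=> _ [i Di [C mC <-]]; apply: mZ.
Qed.

Lemma sigma_algebra_setI_closed (G : set (set Omega)) : setI_closed <<s G >>.
Proof. by move=> A B GA GB; exact: (@measurableI _ (g_sigma_algebraType G) A B). Qed.

Lemma sigma_algebra_setT (G : set (set Omega)) : <<s G >> setT.
Proof. exact: (@measurableT _ (g_sigma_algebraType G)). Qed.

Lemma scaled_preimage_sigma_rv (Z : Omega -> R) (c : R) (C : set (measurableTypeR R)) : measurable C ->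
  sigma_rv Z ((fun w => c * Z w) @^-1` C).
Proof.
move=> mC; apply: sub_sigma_algebra; exists tt => //=.
exists ((fun x : measurableTypeR R => (c * x : measurableTypeR R)) @^-1` C); last by rewrite setTI.
by rewrite -[X in measurable X]setTI; exact: mulrl_measurable.
Qed.

Lemma brownian_gauss_law (P : probability Omega R) (W : R -> {RV P >-> R}) (sigma u s : R) : standard_brownian_motion W ->
  0 <= u -> u < s -> gauss_law P (fun w => sigma * (W s w - W u w)) (sigma * Num.sqrt (s - u)).
Proof.
move=> [_ _ law _] u0 us C mC.
pose C' := (fun x : measurableTypeR R => (sigma * x : measurableTypeR R)) @^-1` C.
have mC' : measurable C' by rewrite -[X in measurable X]setTI; exact: mulrl_measurable.
have s0 : 0 < Num.sqrt (s - u) by rewrite sqrtr_gt0 subr_gt0.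
rewrite -[X in P X]/((fun w => W s w - W u w) @^-1` C') (law u s u0 us C' mC') normal_probE//.
apply: eq_integral => v _; congr EFin; rewrite !indicE -mulrA.
by congr (_ %:R); apply/idP/idP; rewrite !inE.
Qed.

End noise.

(** * The noise of the limit is independent of its past *)

Section limit_filtration.
Context d (Omega : measurableType d) (R : realType) (P : probability Omega R).
Variables (T sigma : R) (lambda : R -> R) (m : probability (measurableTypeR R) R).
Variables (X0 : {RV P >-> R}) (W X : R -> {RV P >-> R}).
Hypothesis Hsol : limit_solution T sigma lambda m X0 W X.

Definition limit_generators (t : R) : set (set Omega) :=
  sigma_rv X0 `|` sigma_family `[0, t] (fun u => W u) `|` [set A | measurable A /\ P A = 0%E].

Lemma limit_generators_measurable t : <<s limit_generators t >> `<=` measurable.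
Proof.
apply: smallest_sub; first exact: sigma_algebra_measurable.
move=> A [[|]|[]//].
  by apply: sigma_family_measurable => _ _; exact: measurable_funPT.
by apply: sigma_family_measurable => u _; exact: measurable_funPT.
Qed.

Lemma gmeas_limit t : 0 <= t <= T -> gmeas (limit_generators t) (X t).
Proof. by move=> tT; apply: gmeas_sigma_rv; exact: (limit_adapted Hsol). Qed.

(** Two joins: the initial position with the past of the noise, where X0 is independent of the whole
    noise and the increment of its past; then the null events, together with the whole space, for
    which both sides vanish or the first join applies. *)
Lemma indep_limit_noise u t : 0 <= u -> u < t ->
  indep_of P (limit_generators u) (fun w => sigma * (W t w - W u w)).
Proof.
move=> u0 ut S C GS mC.
pose dW w := W t w - W u w.
pose C' := (fun w => sigma * dW w) @^-1` C.
have C'rv : sigma_rv dW C' by exact: scaled_preimage_sigma_rv.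
have [_ _ _ indW] := limit_noise Hsol.
have gW v : 0 <= v -> gmeas (generators `[0, +oo[ (fun u => W u)) (W v).
  by move=> v0; apply: (@gmeas_generators _ _ _ _ `[0, +oo[ (fun u => W u)); rewrite /= in_itv/= v0.
have C'W : sigma_family `[0, +oo[ (fun u => W u) C'.
  apply: (sub_sigma_family (G := generators `[0, +oo[ (fun u => W u)) _ C'rv) => _ _.
  by apply: measurable_funB; apply: gW => //; exact: le_trans (ltW ut).
have mC' : measurable C'.
  apply: (sigma_family_measurable (D := `[0, +oo[) (Z := fun u => W u)) C'W => v _; exact: measurable_funPT.
have mA : sigma_rv X0 `<=` measurable by apply: sigma_family_measurable => _ _; exact: measurable_funPT.
have mB : sigma_family `[0, u] (fun u => W u) `<=` measurable.
  by apply: sigma_family_measurable => v _; exact: measurable_funPT.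
have BW : sigma_family `[0, u] (fun u => W u) `<=` sigma_family `[0, +oo[ (fun u => W u).
  apply: (sub_sigma_family (G := generators `[0, +oo[ (fun u => W u))) => v; rewrite /= in_itv/= => /andP[v0 _].
  exact: gW.
pose AB := sigma_rv X0 `|` sigma_family `[0, u] (fun u => W u).
have mAB : <<s AB >> `<=` measurable.
  by apply: smallest_sub; [exact: sigma_algebra_measurable|move=> A [/mA|/mB]].
have step1 : forall S, <<s AB >> S -> P (S `&` C') = (P S * P C')%E.
  apply: indep_join => //; try exact: sigma_algebra_setI_closed; try exact: sigma_algebra_setT.
  move=> S1 S2 h1 h2.
  have e1 := limit_indep Hsol h1 (BW _ h2).
  have e2 := indW u t u0 ut _ _ C'rv h2.
  have e3 : P (S1 `&` (S2 `&` C')) = (P S1 * P (S2 `&` C'))%E.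
    by apply: (limit_indep Hsol) => //; apply: sigma_algebra_setI_closed => //; exact: BW.
  by rewrite -setIA e3 e1 setIC e2 -muleA (muleC (P S2)).
pose Nl : set (set Omega) := [set A | (measurable A /\ P A = 0%E) \/ A = setT].
apply: (@indep_join _ _ _ P <<s AB >> Nl) => //.
- exact: sigma_algebra_setI_closed.
- move=> A1 A2 [[m1 p1]|->] [[m2 p2]|->]; rewrite ?setIT ?setTI; [left|by left|by left|by right].
  split; first exact: measurableI.
  by apply/eqP; rewrite eq_le measure_ge0 andbT -p1; apply: le_measure; rewrite ?inE//; first [exact: measurableI|exact: subIsetl].
- exact: sigma_algebra_setT.
- by right.
- by move=> A [[]//|->].
- move=> S1 S2 h1 [[m2 p2]|->]; last by rewrite setIT; exact: step1.
  have z A : measurable A -> P (S1 `&` S2 `&` A) = 0%E.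
    move=> mA'; apply/eqP; rewrite eq_le measure_ge0 andbT -p2; apply: le_measure; rewrite ?inE//.
      by apply: measurableI => //; apply: measurableI => //; exact: mAB.
    by move=> w [[]].
  by rewrite z// -(setIT (S1 `&` S2)) z// mul0e.
- apply: g_sigma_sub GS => A [h|h]; apply: sub_sigma_algebra; first by left; apply: sub_sigma_algebra.
  by right; left.
Qed.

End limit_filtration.

(** * The mild equation of the limit *)

Section bounded_path_remainder.
Context d (T : measurableType d) (R : realType).
Variables (n : nat) (a dt : nat -> R) (x : T -> R) (X c B : nat -> T -> R).
Hypothesis a_gt0 : forall k, (0 < k < n)%N -> 0 < a k.
Hypothesis mx : measurable_fun setT x.
Hypothesis mX : forall k, measurable_fun setT (X k).
Hypothesis bc : forall k, bm (c k).
Hypothesis mB : forall k, measurable_fun setT (B k).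

Lemma bm_path_remainder : bm (fun z => path_remainder n a dt (X^~ z) (c^~ z) (B^~ z) (x z)).
Proof.
have mZ k : measurable_fun setT (fun z => X k z + dt k * c k z).
  by apply: measurable_funD => //; apply: measurable_funM => //; case: (bc k).
apply: bmB.
  apply: bmD.
    by apply: bmB; [apply: bm_ind|apply: bm_Phi; exact: measurable_funB].
  rewrite (_ : (fun z => _) = (fun z => \sum_(k < n.+1) (if (0 < k < n)%N then dt k * (c k z * gk (a k) (x z - X k z)) else 0))).
    apply: bm_sum => k; case: (boolP (0 < k < n)%N) => [kn|_]; last exact: bm_cst.
    apply: bmM; first exact: bm_cst.
    by apply: bmM => //; apply: bm_gk; [exact: a_gt0|exact: measurable_funB].
  by apply/funext => z; rewrite sum_inner_nat.
apply: bm_sum => k; apply: bmB; apply: bm_Phi; last exact: measurable_funB.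
by apply: measurable_funB => //; exact: measurable_funB.
Qed.

End bounded_path_remainder.

Section drifted_process.
Context d (Omega : measurableType d) (R : realType) (P : probability Omega R).
Variables (T sigma B : R) (X0 : Omega -> R) (W X b : R -> Omega -> R).
Hypothesis bB : forall s w, 0 <= s <= T -> `|b s w| <= B.
Hypothesis Xeq : {ae P, forall w, forall t, 0 <= t <= T ->
  X t w = X0 w + sigma * W t w + \int[lebesgue_measure]_(s in `[0, t]) b s w}.

(** The exceptional null set is that of the equation, hence common to all times and bounds. *)
Lemma drift_increment : {ae P, forall w, forall u s l h, 0 <= u -> u <= s -> s <= T ->
  (forall r, u < r <= s -> l <= b r w <= h) ->
  l * (s - u) <= X s w - X u w - sigma * (W s w - W u w) <= h * (s - u)}.
Proof.
apply: filterS Xeq => w Xw u s l h u0 us sT lbh.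
rewrite Xw ?(le_trans u0 us)// Xw ?u0 ?(le_trans us)//.
have := @Rintegral_increment R (b^~ w) B u s l h u0 us _ lbh.
rewrite (_ : _ - _ - _ = \int[lebesgue_measure]_(r in `[0%R, s]) b r w - \int[lebesgue_measure]_(r in `[0%R, u]) b r w).
  by apply=> r /andP[r0 rs]; apply: bB; rewrite r0 (le_trans rs).
by move: (\int[_]_(_ in _) _) (\int[_]_(_ in _) _) => I J; ring.
Qed.

Lemma drift_increment_norm : {ae P, forall w, forall u s, 0 <= u -> u <= s -> s <= T ->
  `|X s w - X u w - sigma * (W s w - W u w)| <= B * (s - u)}.
Proof.
apply: filterS drift_increment => w H u s u0 us sT.
rewrite ler_norml -mulNr; apply: H => // r /andP[ur rs]; rewrite -ler_norml; apply: bB.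
by rewrite (le_trans u0 (ltW ur)) (le_trans rs).
Qed.

End drifted_process.

Section expectation_ae.
Context d (Omega : measurableType d) (R : realType) (P : probability Omega R).

Lemma Ex_le_ae (f g : Omega -> R) : bm f -> bm g -> (forall w, 0 <= f w) -> (forall w, 0 <= g w) ->
  {ae P, forall w, f w <= g w} -> \int[P]_w f w <= \int[P]_w g w.
Proof.
move=> bf bg f0 g0 fg; rewrite -lee_fin -(ExE P bf) -(ExE P bg).
apply: ae_ge0_le_integral => //.
- by move=> w _; rewrite lee_fin.
- by apply/measurable_EFinP; case: bf.
- by move=> w _; rewrite lee_fin.
- by apply/measurable_EFinP; case: bg.
- by apply: filterS fg => w ? _; rewrite lee_fin.
Qed.

Lemma ind_diff_le (z x y r : R) : `|x - y| <= r -> `|ind z x - ind z y| <= ind `|z - y| r.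
Proof.
rewrite ler_norml /ind => /andP[h1 h2].
case: (leP z x) => zx; case: (leP z y) => zy; rewrite ?subrr ?normr0 ?ler0n//.
  by rewrite subr0 normr1 (_ : `|z - y| <= r)//; rewrite ler_norml; apply/andP; split; lra.
by rewrite sub0r normrN normr1 (_ : `|z - y| <= r)//; rewrite ler_norml; apply/andP; split; lra.
Qed.

Lemma Ex_ind_diff (X : Omega -> R) (x y r : R) : measurable_fun setT X -> `|x - y| <= r ->
  `|\int[P]_w ind (X w) x - \int[P]_w ind (X w) y| <= \int[P]_w ind `|X w - y| r.
Proof.
move=> mX xy; have bx := bm_indX mX x; have by_ := bm_indX mX y.
rewrite -(ExB P bx by_); apply: le_trans (Ex_norm P (bmB bx by_)) _.
apply: (Ex_le P (bm_norm (bmB bx by_))).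
  by apply: bm_ind; [apply: measurableT_comp => //; exact: measurable_funB|exact: measurable_cst].
by move=> w; exact: ind_diff_le.
Qed.

(** The distribution of Z with its values retyped in [measurableTypeR R], as [cdf_of] expects. *)
Definition law (Z : {RV P >-> R}) : probability (measurableTypeR R) R :=
  distribution P (HB.pack_for {mfun Omega >-> measurableTypeR R} (Z : Omega -> measurableTypeR R)
    (@isMeasurableFun.Build _ _ _ (measurableTypeR R) (Z : Omega -> measurableTypeR R) (measurable_funPT Z))).

Lemma cdf_of_law (Z : {RV P >-> R}) y : cdf_of (law Z) y = \int[P]_w ind (Z w) y.
Proof.
have mZ : measurable_fun setT Z := measurable_funPT Z.
by have h : cdf_of (law Z) y = fine (P (Z @^-1` `]-oo, y])) by []; rewrite h (Ex_indE P y mZ).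
Qed.

End expectation_ae.

Section limit_process.
Context d (Omega : measurableType d) (R : realType) (P : probability Omega R).
Variables (T sigma B : R) (Lambda lambda : R -> R) (m : probability (measurableTypeR R) R).
Variables (X0 : {RV P >-> R}) (W X : R -> {RV P >-> R}).
Hypothesis T_gt0 : 0 < T.
Hypothesis sigma_gt0 : 0 < sigma.
Hypothesis HC1 : C1_on01 Lambda lambda.
Hypothesis lamB : forall x, `|cliplam lambda x| <= B.
Hypothesis Hsol : limit_solution T sigma lambda m X0 W X.

Notation lam := (cliplam lambda).
Notation L := (clipLam Lambda).
Notation mu := (@lebesgue_measure R).

Definition marginal_cdf s y := \int[P]_w ind (X s w) y.
Notation F := marginal_cdf.

Let B_ge0 : 0 <= B. Proof. exact: le_trans (lamB 0). Qed.

Let mX s : measurable_fun setT (X s). Proof. exact: measurable_funPT. Qed.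

Lemma marginal_cdfE s y : fine (cdf (X s) y) = F s y.
Proof. by rewrite [cdf _ _](Ex_indE P y (@mX s)). Qed.

Lemma le_marginal_cdf s x y : x <= y -> F s x <= F s y.
Proof. exact: (le_Ex_ind P (@mX s)). Qed.

Lemma marginal_cdf01 s y : 0 <= F s y <= 1.
Proof. exact: (Ex_ind01 P (@mX s)). Qed.

Lemma measurable_marginal_cdf s : measurable_fun [set: R] (F s).
Proof. by apply: nondecreasing_measurable => // x y; exact: le_marginal_cdf. Qed.

Lemma bm_marginal_cdf s : bm (F s : measurableTypeR R -> R).
Proof.
split; first exact: measurable_marginal_cdf.
by exists 1 => y; case/andP: (marginal_cdf01 s y) => h0 h1; rewrite ger0_norm.
Qed.

Lemma marginal_cdf_Ny s e : 0 < e -> exists y, F s y < e.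
Proof.
move=> e0; have := @cdf_of_Ny0 R (law (X s)); move/cvgr_lt => /(_ e e0) [M [_ hM]].
by exists (M - 1); rewrite -[F s _]cdf_of_law; apply: hM; rewrite gtrBl.
Qed.

Let drift s w := lam (F s (X s w)).

Let driftB s w : `|drift s w| <= B. Proof. exact: lamB. Qed.

Let mlam : measurable_fun [set: R] lam.
Proof. by apply: continuous_measurable_fun; exact: (continuous_cliplam HC1). Qed.

Let gmeas_drift G s : gmeas G (X s) -> gmeas G (drift s).
Proof.
move=> gX; apply: (@measurableT_comp _ _ _ _ _ _ lam) => //.
by apply: (@measurableT_comp _ _ _ _ _ _ (F s)) => //; exact: measurable_marginal_cdf.
Qed.

Let bm_drift s : bm (drift s).
Proof.
split; last by exists B => w; exact: driftB.
apply: (@measurableT_comp _ _ _ _ _ _ lam) => //.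
by apply: (@measurableT_comp _ _ _ _ _ _ (F s)) => //; exact: measurable_marginal_cdf.
Qed.

Let eqX : {ae P, forall w, forall t, 0 <= t <= T ->
  X t w = X0 w + sigma * W t w + \int[mu]_(s in `[0, t]) drift s w}.
Proof.
apply: filterS (limit_eq Hsol) => w H t tT; rewrite H//; congr (_ + _).
by apply: eq_Rintegral => s _; rewrite marginal_cdfE /drift /cliplam clip_id ?marginal_cdf01.
Qed.

Let incN := drift_increment_norm (fun s w _ => driftB s w) eqX.
Let inc := drift_increment (fun s w _ => driftB s w) eqX.

(** Over the last dl before s, X is a known position plus an independent Gaussian of deviation sigma
    sqrt dl, up to a drift of at most B dl, which is absorbed into the radius. *)
Lemma limit_small_ball s y r dl : 0 < dl -> dl <= s -> s <= T -> 0 < r ->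
  \int[P]_w ind `|X s w - y| r <= 3 * (r + B * dl) / (sigma * Num.sqrt dl).
Proof.
move=> d0 ds sT r0; have sd0 : 0 <= s - dl by rewrite subr_ge0.
have sds : s - dl < s by rewrite gtrBl.
have sdl : s - (s - dl) = dl by ring.
pose Bn w := sigma * (W s w - W (s - dl) w).
have mBn : measurable_fun setT Bn by apply: measurable_funM => //; apply: measurable_funB; exact: measurable_funPT.
have lB := brownian_gauss_law sigma (limit_noise Hsol) sd0 sds.
have rB0 : 0 < r + B * dl by rewrite ltr_pwDl// mulr_ge0// ltW.
have sdT : 0 <= s - dl <= T by rewrite sd0 (le_trans (ltW sds)).
have gA : gmeas (limit_generators X0 W (s - dl)) (fun w => X (s - dl) w - y).
  by apply: measurable_funB; [exact: (gmeas_limit Hsol)|exact: measurable_cst].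
have b0 : 0 < sigma * Num.sqrt dl by rewrite mulr_gt0// sqrtr_gt0.
rewrite sdl in lB.
have sb := small_ball (@limit_generators_measurable _ _ _ _ X0 W (s - dl)) mBn (indep_limit_noise Hsol sd0 sds) lB gA b0 rB0.
apply: le_trans sb.
apply: Ex_le_ae => [| | | |]; try (by move=> w; exact: ind_ge0).
- by apply: bm_ind; [apply: measurableT_comp => //; exact: measurable_funB|exact: measurable_cst].
- apply: bm_ind; last exact: measurable_cst.
  by apply: measurableT_comp => //; apply: measurable_funD => //; exact: measurable_funB.
apply: filterS incN => w /(_ (s - dl) s sd0 (ltW sds) sT); rewrite sdl -/(Bn w) => h.
rewrite /ind ler_nat; case: (leP `|X s w - y| r) => // h1.
rewrite (_ : (_ <= _)%R = true)//.
have -> : X (s - dl) w - y + Bn w = (X s w - y) - (X s w - X (s - dl) w - Bn w) by ring.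
by apply: le_trans (ler_normB _ _) _; exact: lerD.
Qed.

(* [limit_small_ball] with [dl = eta] and [r = 2 eta]. *)
Let ballQ (eta : R) := 3 * (2 + B) * Num.sqrt eta / sigma.

Let ball2 s y eta : 0 < eta -> eta <= s -> s <= T -> \int[P]_w ind `|X s w - y| (2 * eta) <= ballQ eta.
Proof.
move=> e0 es sT; have e20 : 0 < 2 * eta by rewrite mulr_gt0.
apply: le_trans (limit_small_ball y e0 es sT e20) _.
rewrite le_eqVlt; apply/orP; left; apply/eqP; rewrite /ballQ -mulrDl.
have q0 : Num.sqrt eta != 0 by rewrite gt_eqF// sqrtr_gt0.
rewrite -[in LHS](sqr_sqrtr (ltW e0)) sqrtr_sqr ger0_norm//.
by field; rewrite q0 gt_eqF.
Qed.

Let ballQ_small e : 0 < e -> exists2 eta0 : R, 0 < eta0 & forall eta, 0 < eta -> eta <= eta0 -> ballQ eta <= e.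
Proof.
move=> e0; have k0 : 0 < 3 * (2 + B) / sigma.
  by rewrite divr_gt0// mulr_gt0// ltr_pwDl.
exists ((e / (3 * (2 + B) / sigma)) ^+ 2); first by rewrite exprn_gt0// divr_gt0.
move=> eta h0 h1; rewrite /ballQ mulrAC -ler_pdivlMl// mulrC.
by rewrite -[leRHS]ger0_norm -?sqrtr_sqr ?ler_wsqrtr// divr_ge0// ltW.
Qed.

Lemma continuous_marginal_cdf s : 0 < s -> s <= T -> continuous (F s).
Proof.
move=> s0 sT; apply: continuous_eps => x e e0; have [eta0 he0 hQ] := ballQ_small e0.
have h0 : 0 < Num.min eta0 s by rewrite lt_min he0.
exists (Num.min eta0 s) => // y xy.
apply: le_trans (Ex_ind_diff P (@mX s) (_ : `|x - y| <= 2 * Num.min eta0 s)) _.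
  by apply: le_trans (ltW xy) _; rewrite ler_peMl ?(ltW h0)// ler1n.
apply: le_trans (ball2 _ h0 _ sT) _; first by rewrite ge_min lexx orbT.
by apply: hQ => //; rewrite ge_min lexx.
Qed.

(** Off O positions move by at most eta, so F at time s is compared with F at time u over a window
    of width 2 eta, and the small-ball bound controls that window. Times stay above theta because
    the initial law may have atoms. *)
Lemma limit_modulus theta e : 0 < theta -> 0 < e ->
  exists2 dl : R, 0 < dl & exists O : set Omega, [/\ measurable O, (P O <= e%:E)%E &
    forall w, ~ O w -> forall u s, theta <= u <= T -> theta <= s <= T -> `|s - u| <= dl ->
      `|F s (X s w) - F u (X u w)| <= e].
Proof.
move=> th0 e0; have e20 : 0 < e / 2 by rewrite divr_gt0.
have [eta0 he0 hQ] := ballQ_small e20.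
pose eta := Num.min eta0 theta.
have eta_gt0 : 0 < eta by rewrite lt_min he0.
have [dl d0 [Ob [mO PO hO]]] := small_oscillation T_gt0 mX (limit_continuous Hsol) eta_gt0 e20.
exists dl => //; exists Ob; split => //.
  by apply: le_trans PO _; rewrite lee_fin ler_pdivrMr// ler_peMr ?(ltW e0)// ler1n.
have half w u s : ~ Ob w -> theta <= u <= T -> theta <= s <= T -> `|s - u| <= dl ->
    F s (X s w) - F u (X u w) <= e.
  move=> nO /andP[tu uT] /andP[ts sT] su.
  have sT' : 0 <= s <= T by rewrite sT (le_trans (ltW th0)).
  have uT' : 0 <= u <= T by rewrite uT (le_trans (ltW th0)).
  set x := X s w; set x' := X u w.
  have xx' : `|x - x'| <= eta by apply: hO.
  have bO : bm (fun w => \1_Ob w : R) by exact: bm_indic.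
  have b1 := bmD (bm_indX (@mX u) (x' + 2 * eta)) bO.
  (* Off O, X s <= x forces X u <= x + eta <= x' + 2 eta; one eta is the motion of the path under
     the mean, the other that of the fixed path w. *)
  have h1 : F s x <= F u (x' + 2 * eta) + fine (P Ob).
    rewrite -(Ex_indic P mO) -(ExD P (bm_indX (@mX u) (x' + 2 * eta)) bO).
    apply: (Ex_le P (bm_indX (@mX s) x) b1) => w'.
    rewrite indicE; case: (boolP (w' \in Ob)) => [_|].
      by rewrite (le_trans (ind_le1 _ _))// lerDr ind_ge0.
    rewrite notin_setE => nO'; rewrite addr0 /ind ler_nat; case: (leP (X s w') x) => // h.
    rewrite (_ : (_ <= _)%R = true)//.
    by have := hO w' nO' s u sT' uT' su; move: xx'; rewrite !ler_norml => /andP[k1 k2] /andP[k3 k4]; lra.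
  have h2 : F u (x' + 2 * eta) - F u x' <= e / 2.
    apply: le_trans (ler_norm _) _.
    apply: le_trans (Ex_ind_diff P (@mX u) (_ : `|x' + 2 * eta - x'| <= 2 * eta)) _.
      by rewrite addrAC subrr add0r ger0_norm// mulr_ge0// ltW.
    apply: le_trans (ball2 _ eta_gt0 _ uT) _; first by rewrite ge_min tu orbT.
    by apply: hQ => //; rewrite ge_min lexx.
  have h3 : fine (P Ob) <= e / 2 by rewrite -lee_fin fineK// fin_num_measure.
  by rewrite [e]splitr; lra.
move=> w nO u s uT sT su; rewrite ler_norml lerNl opprB; apply/andP; split; last exact: half.
by apply: half => //; rewrite distrC.
Qed.

Notation Xg delta t n := (fun k w => X (tk delta t n k) w).
Notation cg delta t n := (fun k w => drift (tk delta t n k) w).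
Notation Bg delta t n := (fun k w => sigma * (W (tk delta t n k.+1) w - W (tk delta t n k) w)).

(** A step that starts before theta, or any step on O, costs at most 2 B times its length. On the
    other steps [limit_modulus] keeps the drift within e1 of its frozen value. *)
Lemma limit_grid_error e : 0 < e ->
  exists2 dl : R, 0 < dl & exists O : set Omega, [/\ measurable O, (P O <= e%:E)%E &
    forall delta t n, 0 < delta -> n%:R * delta < t -> t <= n.+1%:R * delta -> t <= T -> delta <= dl ->
    {ae P, forall w, \sum_(k < n.+1) `|Xg delta t n k.+1 w -
       (Xg delta t n k w + dtk delta t n k * cg delta t n k w + Bg delta t n k w)| <= e + 2 * B * T * \1_O w}].
Proof.
move=> e0; pose e1 := e / (2 * T); have e10 : 0 < e1 by rewrite divr_gt0// mulr_gt0.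
have [dl1 d10 hlam] := cliplam_unif HC1 e10.
(* The early steps last at most theta + delta <= 2 theta, so they cost at most 4 B theta <= e / 2;
   e1 leaves the other half. *)
pose theta := e / (8 * (B + 1)).
have B1 : 0 < B + 1 by rewrite ltr_wpDl.
have th0 : 0 < theta by rewrite divr_gt0// mulr_gt0.
have e20 : 0 < Num.min e dl1 by rewrite lt_min e0.
have [dl2 d20 [Ob [mO PO hO]]] := limit_modulus th0 e20.
exists (Num.min dl2 theta); first by rewrite lt_min d20.
exists Ob; split => //.
  by apply: le_trans PO _; rewrite lee_fin ge_min lexx.
move=> delta t n d0 nt tn tT; rewrite le_min => /andP[dd2 dth].
apply: filterS2 inc incN => w h1 h2.
have i0 : 0 <= \1_Ob w :> R by rewrite indicE.
have tkT k : tk delta t n k <= T by apply: le_trans tT; exact: (tk_let d0 nt).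
have term k : `|Xg delta t n k.+1 w - (Xg delta t n k w + dtk delta t n k * cg delta t n k w + Bg delta t n k w)|
    <= dtk delta t n k * (e1 + 2 * B * \1_Ob w) + 2 * B * (dtk delta t n k * ((tk delta t n k < theta)%R : bool)%:R).
  have tk0' := tk_ge0 d0 nt k; have tkk := tk_le d0 nt (leqnSn k).
  have dk0 := dtk_ge0 d0 nt k; have dkd := dtk_le d0 tn k.
  set u := tk delta t n k in tk0' tkk *; set s := tk delta t n k.+1 in tkk *.
  have dE : dtk delta t n k = s - u by [].
  rewrite dE in dk0 dkd *.
  have -> : X s w - (X u w + (s - u) * drift u w + sigma * (W s w - W u w)) =
     X s w - X u w - sigma * (W s w - W u w) - drift u w * (s - u) by ring.
  have crude : `|X s w - X u w - sigma * (W s w - W u w) - drift u w * (s - u)| <= (s - u) * (2 * B).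
    apply: le_trans (ler_normB _ _) _; rewrite normrM (ger0_norm dk0).
    have := h2 u s tk0' tkk (tkT _); have := ler_wpM2r dk0 (driftB u w); lra.
  have e1s : 0 <= (s - u) * e1 by rewrite mulr_ge0// ltW.
  have Bs : 0 <= 2 * B * (s - u) by rewrite mulr_ge0// mulr_ge0.
  case: (ltP u theta) => uth.
    apply: le_trans crude _; rewrite mulr1 mulrDr.
    have := mulr_ge0 Bs i0; lra.
  rewrite mulr0 mulr0 addr0; case: (boolP (w \in Ob)) => wO.
    by apply: le_trans crude _; rewrite indicE wO mulr1; apply: ler_wpM2l => //; rewrite lerDr ltW.
  have nO : ~ Ob w by move: wO; rewrite notin_setE.
  rewrite indicE (negbTE wO) mulr0 addr0.
  have := h1 u s (drift u w - e1) (drift u w + e1) tk0' tkk (tkT _).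
  rewrite ler_norml !mulrBl mulrDl => H.
  have /H/andP[H1 H2] : forall r, u < r <= s -> drift u w - e1 <= drift r w <= drift u w + e1.
    move=> r /andP[ur rs]; rewrite -ler_distlC distrC /drift; apply: hlam.
    have -> : F r (X r w) - F u (X u w) = F r (X r w) - F u (X u w) by [].
    apply: le_trans (hO w nO u r _ _ _) _; rewrite ?ge_min ?lexx ?orbT//.
    - by rewrite uth tkT.
    - by rewrite (le_trans uth (ltW ur)) (le_trans rs)// tkT.
    - rewrite ger0_norm ?subr_ge0 ?(ltW ur)//; apply: le_trans dd2; apply: le_trans dkd; lra.
  by apply/andP; split; lra.
apply: (@le_trans _ _ (\sum_(k < n.+1) (dtk delta t n k * (e1 + 2 * B * \1_Ob w) +
    2 * B * (dtk delta t n k * ((tk delta t n k < theta)%R : bool)%:R)))); first by apply: ler_sum => k _; exact: term.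
rewrite big_split/= -mulr_suml -mulr_sumr sum_dtk.
have t0 : 0 <= t by apply: ltW; apply: le_lt_trans nt; rewrite mulr_ge0// ltW.
have B20 : 0 <= 2 * B by rewrite mulr_ge0.
have hs := ler_wpM2l B20 (sum_dtk_before d0 nt tn (ltW th0)).
have h4 : t * (e1 + 2 * B * \1_Ob w) <= T * (e1 + 2 * B * \1_Ob w).
  by rewrite ler_wpM2r// addr_ge0 ?(ltW e10)// mulr_ge0.
have h5 : 2 * B * (theta + delta) <= e / 2.
  apply: (@le_trans _ _ (2 * B * (theta + theta))); first by rewrite ler_wpM2l// lerD2l.
  have -> : 2 * B * (theta + theta) = e / 2 * (B / (B + 1)) by rewrite /theta; field; rewrite gt_eqF.
  by rewrite ler_piMr ?divr_ge0 ?(ltW e0)// ler_pdivrMr// mul1r lerDl.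
have h6 : T * e1 = e / 2 by rewrite /e1; field; rewrite gt_eqF.
apply: le_trans (lerD h4 hs) _; apply: le_trans (lerD (lexx _) h5) _.
by rewrite mulrDr h6; rewrite [e in X in _ <= X]splitr; lra.
Qed.

(** Defect of the discrete mild equation of the limit; the sum omits k = 0 and k = n, like
    [path_remainder]. *)
Definition mild delta t n (x : R) : R :=
  F t x - heat (sigma * Num.sqrt t) (F 0) x +
  \sum_(1 <= k < n) delta * dconv (sigma * Num.sqrt (t - k%:R * delta)) (fun y => L (F (k%:R * delta) y) - L 0) x.

(** Under the mean the martingale increments vanish by [heat_step], the initial term becomes the
    heat flow of F 0, and the drift terms become convolutions by [dconv_weighted_cdf], where
    [Ex_level] identifies the convolved function with Lambda at F. *)
Lemma Ex_path_remainder delta t n x : 0 < delta -> n%:R * delta < t -> t <= n.+1%:R * delta -> t <= T ->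
  \int[P]_w path_remainder n (ak sigma delta t n) (dtk delta t n) ((Xg delta t n)^~ w) ((cg delta t n)^~ w) ((Bg delta t n)^~ w) x
  = mild delta t n x.
Proof.
move=> d0 nt tn tT.
pose Xk := Xg delta t n; pose ck := cg delta t n; pose Bk := Bg delta t n.
have tkT k : 0 <= tk delta t n k <= T by rewrite (tk_ge0 d0 nt)/= (le_trans (tk_let d0 nt _)).
have bc k : bm (ck k) by exact: bm_drift.
have mB k : measurable_fun setT (Bk k).
  by apply: measurable_funM => //; apply: measurable_funB; exact: measurable_funPT.
have mZ k : measurable_fun setT (fun w => Xk k w + dtk delta t n k * ck k w).
  by apply: measurable_funD => //; apply: measurable_funM => //; case: (bc k).
have b1 : bm (fun w => ind (Xk n.+1 w) x) by exact: bm_indX.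
have b2 : bm (fun w => Phi (ak sigma delta t n 0) (x - Xk 0%N w)) by exact: bm_Phi_sub.
pose f3 k w := if (0 < k < n)%N then dtk delta t n k * (ck k w * gk (ak sigma delta t n k) (x - Xk k w)) else 0.
have b3' k : (0 < k < n)%N -> bm (fun w => ck k w * gk (ak sigma delta t n k) (x - Xk k w)).
  move=> /andP[_ kn]; apply: bmM => //; apply: bm_gk; first exact: (ak_gt0 sigma_gt0 d0 nt).
  by apply: measurable_funB => //; exact: mX.
have b3 (k : 'I_n.+1) : bm (f3 k).
  rewrite /f3; case: (boolP (0 < k < n)%N) => [kn|_]; last exact: bm_cst.
  by apply: bmM; [exact: bm_cst|exact: b3'].
pose f4 k w := Phi (ak sigma delta t n k.+1) (x - (Xk k w + dtk delta t n k * ck k w) - Bk k w).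
pose f5 k w := Phi (ak sigma delta t n k) (x - (Xk k w + dtk delta t n k * ck k w)).
have b5 (k : 'I_n.+1) : bm (f5 k) by exact: bm_Phi_sub.
have b4 (k : 'I_n.+1) : bm (f4 k) by apply: bm_Phi; apply: measurable_funB => //; exact: measurable_funB.
transitivity (\int[P]_w (ind (Xk n.+1 w) x - Phi (ak sigma delta t n 0) (x - Xk 0%N w) + \sum_(k < n.+1) f3 k w - \sum_(k < n.+1) (f4 k w - f5 k w))).
  by apply: eq_Rintegral => w _; rewrite /path_remainder sum_inner_nat.
have bs3 := bm_sum (index_enum 'I_n.+1) b3.
have bs4 := bm_sum (index_enum 'I_n.+1) (fun k => bmB (b4 k) (b5 k)).
rewrite (ExB P (bmD (bmB b1 b2) bs3) bs4) (ExD P (bmB b1 b2) bs3) (ExB P b1 b2).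
rewrite (Ex_sum P _ b3) (Ex_sum P _ (fun k => bmB (b4 k) (b5 k))).
rewrite [X in _ - X]big1 ?subr0; last first.
  move=> k _; rewrite (ExB P (b4 k) (b5 k)); apply/eqP; rewrite subr_eq0; apply/eqP.
  have kn := ltn_ord k.
  have dk : tk delta t n k < tk delta t n k.+1 by rewrite -subr_gt0; exact: (dtk_gt0 d0 nt).
  have tk0' : 0 <= tk delta t n k by exact: (tk_ge0 d0 nt).
  have tTk : 0 <= tk delta t n k <= T by exact: tkT.
  have gX := gmeas_limit Hsol tTk.
  have gZ : gmeas (limit_generators X0 W (tk delta t n k)) (fun w => x - (Xk k w + dtk delta t n k * ck k w)).
    apply: measurable_funB => //; apply: measurable_funD; first exact: gX.
    by apply: measurable_funM => //; exact: gmeas_drift.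
  have gU : gmeas (limit_generators X0 W (tk delta t n k)) (fun=> 1 : R) by exact: measurable_cst.
  have lB := brownian_gauss_law sigma (limit_noise Hsol) tk0' dk.
  have a0 := @ak_ge0 R sigma delta t n sigma_gt0 k.+1; have bk0 := @bk_ge0 R sigma delta t n sigma_gt0 k.
  have U1 (w : Omega) : `|1 : R| <= 1 by rewrite normr1.
  have := heat_step (@limit_generators_measurable _ _ _ _ X0 W _) (mB k) (indep_limit_noise Hsol tk0' dk) lB a0 bk0 gU gZ U1.
  rewrite -(akE sigma_gt0 d0 nt k) => hs.
  transitivity (\int[P]_w (1 * Phi (ak sigma delta t n k.+1) (x - (Xk k w + dtk delta t n k * ck k w) - Bk k w))).
    by apply: eq_Rintegral => w _; rewrite mul1r.
  by rewrite hs; apply: eq_Rintegral => w _; rewrite mul1r.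
rewrite /mild; congr (_ - _ + _).
- by rewrite /Xk/= tkt.
- transitivity (\int[P]_w (1 * Phi (ak sigma delta t n 0) (x - Xk 0%N w))).
    by apply: eq_Rintegral => w _; rewrite mul1r.
  rewrite (heat_weighted_cdf P _ x (bm_cst Omega 1) (@mX _)) /ak tk0 subr0.
  by rewrite /heat; apply: eq_Rintegral => v _; apply: eq_Rintegral => w _; rewrite mul1r.
rewrite sum_inner_nat; apply: eq_bigr => k _; rewrite /f3.
case: ifPn => [kn|_]; last by rewrite Rintegral_cst// mul0r.
have /andP[k0 kn'] := kn.
have tE : tk delta t n k = k%:R * delta by rewrite tkE// ltnW.
have tk0' : 0 < tk delta t n k by rewrite tE mulr_gt0// ltr0n.
have tkT' : tk delta t n k <= T by case/andP: (tkT k).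
have kd : 0 < k%:R * delta by rewrite -tE.
rewrite (ExZ P _ (b3' k kn)) (dtkE _ _ kn'); congr (_ * _).
rewrite -(dconv_weighted_cdf P x (ak_gt0 sigma_gt0 d0 nt kn') (bc k) (@mX _)) /ak tE.
congr dconv; apply/funext => y.
(* Continuity holds at positive times only; here k >= 1. *)
have cF : continuous (fun y => \int[P]_w ind (X (k%:R * delta) w) y).
  by apply: continuous_marginal_cdf => //; rewrite -tE.
rewrite /ck/= tE.
by rewrite -(@Ex_level _ _ _ P lam L B (X (k%:R * delta)) mlam lamB (fun e e0 => cliplam_unif HC1 e0) (clipLam_mvt HC1) (@mX _) cF (fun e e0 => @marginal_cdf_Ny _ e e0)).
Qed.

Lemma limit_mild e : 0 < e -> exists2 dl : R, 0 < dl &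
  forall delta t n, 0 < delta -> n%:R * delta < t -> t <= n.+1%:R * delta -> t <= T -> delta <= dl ->
  (L1 mu (mild delta t n) <= (e + path_cst sigma T B * delta)%:E)%E.
Proof.
move=> e0; pose C := 2 * B * T.
have C0 : 0 <= C by rewrite mulr_ge0 ?(ltW T_gt0)// mulr_ge0.
have C2 : 0 < 2 + 2 * C by rewrite ltr_pwDl// mulr_ge0.
(* The grid error enters with a factor 2, once directly and once as C times the probability of O;
   hence the division by 2 + 2 C. *)
have e10 : 0 < e / (2 + 2 * C) by rewrite divr_gt0.
have [dl d0 [Ob [mO PO hO]]] := limit_grid_error e10.
exists dl => // delta t n dt0 nt tn tT ddl.
have {}hO := hO delta t n dt0 nt tn tT ddl.
pose rem w x := path_remainder n (ak sigma delta t n) (dtk delta t n) ((Xg delta t n)^~ w) ((cg delta t n)^~ w) ((Bg delta t n)^~ w) x.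
pose q w := 2 * (e / (2 + 2 * C) + C * \1_Ob w) + path_cst sigma T B * delta.
have pc0 : 0 <= path_cst sigma T B by exact: path_cst_ge0.
have bO : bm (fun w => \1_Ob w : R) by exact: bm_indic.
have bCO : bm (fun w => e / (2 + 2 * C) + C * \1_Ob w) by apply: bmD; [exact: bm_cst|apply: bmM => //; exact: bm_cst].
have b2CO := bmM (bm_cst Omega 2) bCO.
have bq : bm q by apply: bmD; [exact: b2CO|exact: bm_cst].
have i0 w : 0 <= \1_Ob w :> R by rewrite indicE.
have q0 w : 0 <= q w.
  have h1 : 0 <= e / (2 + 2 * C) + C * \1_Ob w by rewrite addr_ge0 ?(ltW e10)// mulr_ge0.
  by apply: addr_ge0; apply: mulr_ge0 => //; exact: ltW.
have Eq : \int[P]_w q w <= e + path_cst sigma T B * delta.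
  rewrite (ExD P b2CO (bm_cst Omega _)) Ex_cst lerD2r (ExZ P _ bCO).
  rewrite (ExD P (bm_cst Omega _) (bmM (bm_cst Omega C) bO)) Ex_cst (ExZ P _ bO) (Ex_indic P mO).
  have PO' : fine (P Ob) <= e / (2 + 2 * C) by rewrite -lee_fin fineK// fin_num_measure.
  have := ler_wpM2l C0 PO'.
  have : e = 2 * (e / (2 + 2 * C) + C * (e / (2 + 2 * C))) by field; rewrite gt_eqF.
  by lra.
have bc k : bm (cg delta t n k) by exact: bm_drift.
have mBg k : measurable_fun setT (Bg delta t n k).
  by apply: measurable_funM => //; apply: measurable_funB; exact: measurable_funPT.
have ag k : (0 < k < n)%N -> 0 < ak sigma delta t n k.
  by move=> /andP[_ kn]; exact: (ak_gt0 sigma_gt0 dt0 nt).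
have bremx x : bm (fun w => rem w x).
  by apply: (bm_path_remainder (x := fun=> x) _ ag) => // k; exact: mX.
pose h (z : measurableTypeR R * Omega) := `|rem z.2 z.1|.
have mh : measurable_fun setT h.
  have [] // : bm h; apply: bm_norm.
  apply: (@bm_path_remainder _ (measurableTypeR R * Omega)%type R n (ak sigma delta t n) (dtk delta t n) fst
    (fun k z => Xg delta t n k z.2) (fun k z => cg delta t n k z.2) (fun k z => Bg delta t n k z.2) ag) => //.
  - by move=> k; apply: (measurableT_comp (@mX _)).
  - move=> k; have [mc _] := bc k; split; first exact: (measurableT_comp mc).
    by exists B => z; exact: driftB.
  - by move=> k; exact: (measurableT_comp (mBg k)).
apply: (@le_trans _ _ (L1 mu (fun x => (\int[P]_w h (x, w))%R))).
  apply: le_L1 => x; rewrite -(Ex_path_remainder x dt0 nt tn tT).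
  by apply: le_trans (Ex_norm P (bremx x)) _; exact: ler_norm.
apply: le_trans (@swap_bound _ _ _ P h q mh _ _ _ q0 _) _.
- by move=> z; exact: normr_ge0.
- by move=> x; exact: (bm_norm (bremx x)).
- by case: bq.
- apply: filterS hO => w hw.
  have hh := L1_path_remainder_grid sigma_gt0 dt0 nt tn tT ((Xg delta t n)^~ w) ((Bg delta t n)^~ w) (fun k => driftB (tk delta t n k) w).
  apply: (le_trans hh); rewrite lee_fin lerD2r; apply: ler_wpM2l; [exact: ler0n|exact: hw].
by rewrite (ExE P bq) lee_fin.
Qed.

End limit_process.

(** * Lipschitz drift: the limit on a coarse grid *)

Section kernel_shift.
Variable R : realType.
Notation mu := (@lebesgue_measure R).

Lemma dconv_shift a (f : R -> R) x z : measurable_fun [set: R] f ->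
  dconv a f (x + z) = dconv a (fun y => f (y + z)) x.
Proof.
move=> mf; rewrite /dconv -(@integral_shift _ z (fun y => dgk a (x + z - y) * f y)); last first.
  by apply: measurable_funM => //; apply: measurableT_comp; [exact: measurable_dgk|exact: measurable_funB].
by apply: eq_Rintegral => y _; congr (dgk a _ * _); ring.
Qed.

Lemma dconv_increment a (f : R -> R) C x z : 0 < a -> bm (f : measurableTypeR R -> R) ->
  (forall y, `|f (y + z) - f y| <= C) -> `|dconv a f (x + z) - dconv a f x| <= 256 / a * C.
Proof.
move=> a0 bf fC; have [mf [K fK]] := bf; rewrite (dconv_shift _ _ _ mf).
have bfz : bm ((fun y => f (y + z)) : measurableTypeR R -> R).
  by split; [apply: measurableT_comp => //; exact: measurable_funD|exists K].
rewrite -(dconvB x a0 bfz bf); apply: (dconv_le x a0 (bmB bfz bf)); exact: fC.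
Qed.

(** The heat flow turns the distribution function into a mixture of translates of [Phi b], whose
    slope is at most 1 / b. *)
Lemma heat_cdf_increment d (T : measurableType d) (P : probability T R) (X : T -> R) b x z :
  measurable_fun setT X -> 0 < b -> 0 <= z ->
  `|heat b (fun y => \int[P]_w ind (X w) y) (x + z) - heat b (fun y => \int[P]_w ind (X w) y) x| <= z / b.
Proof.
move=> mX b0 z0.
have E y : heat b (fun y => \int[P]_w ind (X w) y) y = \int[P]_w Phi b (y - X w).
  transitivity (\int[P]_w (1 * Phi b (y - X w))); last by apply: eq_Rintegral => w _; rewrite mul1r.
  rewrite (heat_weighted_cdf P _ y (bm_cst T 1) mX) /heat.
  by apply: eq_Rintegral => v _; apply: eq_Rintegral => w _; rewrite mul1r.
have bP y : bm (fun w => Phi b (y - X w)) by exact: bm_Phi_sub.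
rewrite !E -(ExB P (bP _) (bP _)).
apply: le_trans (Ex_norm P (bmB (bP _) (bP _))) _.
rewrite -[leRHS](Ex_cst P).
apply: (Ex_le P (bm_norm (bmB (bP _) (bP _))) (bm_cst T (z / b))) => w.
have zz : x - X w <= x + z - X w by rewrite lerD2r lerDl.
rewrite ger0_norm ?subr_ge0 ?le_Phi//.
by apply: le_trans (Phi_lipschitz b0 zz) _; rewrite (_ : _ - _ = z)//; ring.
Qed.

Lemma grid_exists (dl t : R) : 0 < dl -> 0 < t -> exists n, n%:R * dl < t /\ t <= n.+1%:R * dl.
Proof.
move=> d0 t0.
have [n] : exists n, t <= n.+1%:R * dl.
  by exists (Num.truncn (t / dl)); rewrite -ler_pdivrMr//; apply/ltW; exact: truncnS_gt.
elim: n => [|n ih] h; first by exists 0%N; rewrite mul0r.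
by case: (leP t (n.+1%:R * dl)) => [/ih//|h1]; exists n.+1.
Qed.

Lemma small_step (t dl : R) : 0 < t -> 0 < dl -> exists n, t / n.+1%:R <= dl.
Proof.
move=> t0 d0; exists (Num.truncn (t / dl)).
rewrite ler_pdivrMr ?ltr0n// mulrC -ler_pdivrMr//; apply/ltW; exact: truncnS_gt.
Qed.

Lemma gronwall_cst_ge0 (c T : R) : 0 <= c -> 0 <= T -> 0 <= gronwall_cst c T.
Proof.
move=> c0 T0; rewrite /gronwall_cst.
have E0 := expR_ge0 (4 * c ^+ 2 * T).
move: (expR _) (Num.sqrt T) (sqrtr_ge0 T) E0 => E s s0 E0.
have cc : 0 <= c ^+ 2 by exact: sqr_ge0.
have h1 := mulr_ge0 c0 s0; have h2 := mulr_ge0 (mulr_ge0 cc T0) E0; have h3 := mulr_ge0 (mulr_ge0 cc s0) E0.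
have k1 : 0 <= 1 + 2 * c * s + 4 * c by rewrite -mulrA; lra.
have k2 : 0 <= 1 + 4 * c ^+ 2 * T * E by rewrite -!mulrA mulrA; move: h2; rewrite -!mulrA; lra.
have := mulr_ge0 k1 k2; move: h3; rewrite -!mulrA; lra.
Qed.

End kernel_shift.

Lemma increment_sum_le (R : realType) (a b h k s r K1 K2 : R) : `|h - k| <= K1 -> `|s - r| <= K2 ->
  a + h - s - (b + k - r) <= `|a| + `|b| + (K1 + K2).
Proof.
move=> hk sr; have -> : a + h - s - (b + k - r) = a - b + ((h - k) - (s - r)) by ring.
apply: le_trans (ler_norm _) _; apply: le_trans (ler_normD _ _) _; apply: lerD; first exact: ler_normB.
by apply: le_trans (ler_normB _ _) _; exact: lerD.
Qed.

(** * A density bound of order 1 / sqrt t for the limit *)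

Section density_bound.
Context d (Omega : measurableType d) (R : realType) (P : probability Omega R).
Variables (T sigma B : R) (Lambda lambda : R -> R) (m : probability (measurableTypeR R) R).
Variables (X0 : {RV P >-> R}) (W X : R -> {RV P >-> R}).
Hypothesis T_gt0 : 0 < T.
Hypothesis sigma_gt0 : 0 < sigma.
Hypothesis HC1 : C1_on01 Lambda lambda.
Hypothesis lamB : forall x, `|cliplam lambda x| <= B.
Hypothesis Hsol : limit_solution T sigma lambda m X0 W X.

Notation lam := (cliplam lambda).
Notation L := (clipLam Lambda).
Notation mu := (@lebesgue_measure R).
Notation F := (marginal_cdf X).

Let B_ge0 : 0 <= B. Proof. exact: le_trans (lamB 0). Qed.

Lemma bm_Lcdf s : bm ((fun y => L (F s y) - L 0) : measurableTypeR R -> R).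
Proof.
split.
  apply: measurable_funB => //; apply: (@measurableT_comp _ _ _ _ _ _ L).
    by apply: continuous_measurable_fun; exact: (continuous_clipLam HC1).
  exact: measurable_marginal_cdf.
exists B => y; apply: le_trans (clipLam_lipschitz HC1 lamB _ _) _.
rewrite subr0; case/andP: (marginal_cdf01 X s y) => h0 h1.
by rewrite ger0_norm// ler_piMr.
Qed.

Lemma measurable_mild delta t n : measurable_fun [set: R] (mild sigma Lambda X delta t n).
Proof.
apply: measurable_funD.
  apply: measurable_funB; first exact: measurable_marginal_cdf.
  by have [] := bm_heat (sigma * Num.sqrt t) (bm_marginal_cdf X 0).
apply: measurable_sum => k; apply: measurable_funM => //; apply: measurable_dconv.
by have [] := bm_Lcdf (k%:R * delta).
Qed.

(** For fixed z, a singular Gronwall inequality in s holds for this largest increment; a bound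
    linear in z is then a Lipschitz bound on F s, with no density having to be constructed. *)
Definition cdf_osc z s : R := sup [set F s (x + z) - F s x | x in [set: R]].

Let osc_sup z s : has_sup [set F s (x + z) - F s x | x in [set: R]].
Proof.
split; first by exists (F s (0 + z) - F s 0), 0.
exists 1 => _ [x _ <-]; have /andP[_] := marginal_cdf01 X s (x + z).
by have /andP[+ _] := marginal_cdf01 X s x; lra.
Qed.

Lemma cdf_osc_ge z s x : F s (x + z) - F s x <= cdf_osc z s.
Proof. by apply: ub_le_sup; [case: (osc_sup z s)|exists x]. Qed.

Lemma cdf_osc_le z s C : (forall x, F s (x + z) - F s x <= C) -> cdf_osc z s <= C.
Proof. by move=> h; apply: ge_sup; [case: (osc_sup z s)|move=> _ [x _ <-]]. Qed.

Lemma cdf_osc_ge0 z s : 0 <= z -> 0 <= cdf_osc z s.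
Proof.
move=> z0; apply: le_trans (cdf_osc_ge z s 0).
by rewrite subr_ge0; apply: le_marginal_cdf; rewrite lerDl.
Qed.

(** The averaging argument of [osc_step] doubles the width of the increments; this returns to width
    z and closes the inequality. *)
Lemma cdf_osc_double z s : cdf_osc (2 * z) s <= 2 * cdf_osc z s.
Proof.
apply: cdf_osc_le => x; have := cdf_osc_ge z s x; have := cdf_osc_ge z s (x + z).
by rewrite (_ : x + z + z = x + 2 * z); [lra|ring].
Qed.

(* Monotonicity of [F t] turns the L1 smallness of [mild] into a pointwise bound: the increment over [x, x + z] is dominated by the average over [y] in [x - z, x] of the increments over [y, y + 2 z]. *)
Let osc_step delta t n z M : 0 < delta -> n%:R * delta < t -> t <= n.+1%:R * delta -> 0 < z ->
  (L1 mu (mild sigma Lambda X delta t n) <= M%:E)%E ->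
  cdf_osc z t <= 2 * M / z + 2 * z / (sigma * Num.sqrt t) +
    \sum_(1 <= k < n) delta * (256 / (sigma * Num.sqrt (t - k%:R * delta)) * (B * (2 * cdf_osc z (k%:R * delta)))).
Proof.
move=> d0 nt tn z0 hM.
set K1 := 2 * z / _; set K2 := \sum_(1 <= k < n) _.
have z20 : 0 <= 2 * z by rewrite mulr_ge0// ltW.
have t0 : 0 < t by apply: le_lt_trans nt; rewrite mulr_ge0// ltW.
pose g := mild sigma Lambda X delta t n.
pose S x := \sum_(1 <= k < n) delta * dconv (sigma * Num.sqrt (t - k%:R * delta)) (fun y => L (F (k%:R * delta) y) - L 0) x.
have hS y : `|S (y + 2 * z) - S y| <= K2.
  rewrite -sumrB; apply: le_trans (ler_norm_sum _ _ _) _; apply: ler_sum_nat => k /andP[k1 kn].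
  rewrite -mulrBr normrM (ger0_norm (ltW d0)) ler_wpM2l ?(ltW d0)//.
  apply: dconv_increment; last 1 first.
  - move=> x; rewrite opprB addrA addrNK; apply: le_trans (clipLam_lipschitz HC1 lamB _ _) _.
    rewrite ler_wpM2l// ger0_norm; last by rewrite subr_ge0; apply: le_marginal_cdf; rewrite lerDl.
    exact: le_trans (cdf_osc_ge _ _ _) (cdf_osc_double _ _).
  - rewrite mulr_gt0// sqrtr_gt0 subr_gt0; apply: lt_trans nt.
    by rewrite ltr_pM2r// ltr_nat.
  - exact: bm_Lcdf.
have hH y : `|heat (sigma * Num.sqrt t) (F 0) (y + 2 * z) - heat (sigma * Num.sqrt t) (F 0) y| <= K1.
  by apply: heat_cdf_increment => //; rewrite mulr_gt0// sqrtr_gt0.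
have hF y : F t (y + 2 * z) - F t y <= `|g (y + 2 * z)| + `|g y| + (K1 + K2).
  have E x : F t x = g x + heat (sigma * Num.sqrt t) (F 0) x - S x by rewrite /g /mild -/(S x); ring.
  rewrite !E; apply: (@increment_sum_le R); [exact: hH|exact: hS].
have mg : measurable_fun [set: R] (fun y => `|g y|%:E).
  by apply/measurable_EFinP; apply: measurableT_comp => //; exact: measurable_mild.
have mgz : measurable_fun [set: R] (fun y => `|g (y + 2 * z)|%:E).
  apply/measurable_EFinP; apply: measurableT_comp => //; apply: measurableT_comp; first exact: measurable_mild.
  exact: measurable_funD.
apply: cdf_osc_le => x; rewrite -addrA -lerBlDr; set D := _ - _ - _.
case: (leP D 0) => [D0|D0].
  apply: le_trans D0 _; rewrite divr_ge0 ?(ltW z0)// mulr_ge0//.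
  by rewrite -lee_fin; apply: le_trans hM; exact: L1_ge0.
rewrite ler_pdivlMr// -lee_fin.
have len : mu `[x - z, x]%classic = z%:E.
  apply: (etrans (lebesgue_measure_itv _)) => /=; rewrite lte_fin gtrBl z0 -EFinD; congr EFin; ring.
have -> : ((D * z)%:E = \int[mu]_(y in `[(x - z)%R, x]) D%:E)%E.
  by rewrite integral_cst//= len EFinM.
have p0 y : (0 <= `|g y|%:E)%E by rewrite lee_fin.
apply: (@le_trans _ _ (\int[mu]_(y in `[(x - z)%R, x]) (`|g (y + 2 * z)|%:E + `|g y|%:E))%E).
  apply: ge0_le_integral => //.
  - by move=> y _; rewrite lee_fin ltW.
  - exact: (emeasurable_funD (measurable_funTS mgz) (measurable_funTS mg)).
  move=> y; rewrite /= in_itv/= => /andP[y1 y2]; rewrite -EFinD lee_fin /D lerBlDr.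
  apply: le_trans (hF y); apply: lerB; apply: le_marginal_cdf => //; lra.
rewrite (ge0_integralD mu (measurable_itv _) (fun y _ => p0 (y + 2 * z)) (measurable_funTS mgz) (fun y _ => p0 y) (measurable_funTS mg)).
have -> : (2 * M)%:E = (M%:E + M%:E)%E by rewrite -EFinD; congr EFin; ring.
apply: leeD.
  apply: le_trans (_ : _ <= \int[mu]_y `|g (y + 2 * z)|%:E)%E _.
    exact: (@ge0_subset_integral _ _ _ mu _ _ (measurable_itv _) measurableT (fun y => `|g (y + 2 * z)|%:E) mgz (fun y _ => p0 (y + 2 * z)) (@subsetT _ _)).
  by rewrite (ge0_integral_shift (2 * z) mg).
apply: le_trans hM.
exact: (@ge0_subset_integral _ _ _ mu _ _ (measurable_itv _) measurableT (fun y => `|g y|%:E) mg (fun y _ => p0 y) (@subsetT _ _)).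
Qed.

(** 2 / sigma is the heat term for increments of width 2 z; 512 is 256 doubled for the same reason.
    The factor sqrt T absorbs the regular part of the Gronwall bound into 1 / sqrt t. *)
Definition density_cst : R := 2 / sigma * (1 + gronwall_cst (512 * B / sigma) T * Num.sqrt T).

(** The grid is refined with z fixed, so the term 2 M / z coming from the L^1 defect disappears in
    the limit. *)
Lemma cdf_osc_bound z t : 0 < z -> 0 < t -> t <= T -> cdf_osc z t <= density_cst * z / Num.sqrt t.
Proof.
move=> z0 t0 tT; pose c := 512 * B / sigma; pose gc := gronwall_cst c T.
have c0 : 0 <= c by apply: divr_ge0; [apply: mulr_ge0; [exact: ler0n|exact: B_ge0]|exact: ltW].
have gc0 : 0 <= gc.
  by apply: gronwall_cst_ge0 => //; exact: ltW.
pose A := 2 * z / sigma; have A0 : 0 <= A by rewrite divr_ge0 ?(ltW sigma_gt0)// mulr_ge0// ltW.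
have rt : 0 < Num.sqrt t by rewrite sqrtr_gt0.
suff H : cdf_osc z t <= A / Num.sqrt t + gc * A.
  apply: le_trans H _; rewrite /density_cst -/c -/gc.
  have -> : 2 / sigma * (1 + gc * Num.sqrt T) * z / Num.sqrt t = A / Num.sqrt t + gc * A * (Num.sqrt T / Num.sqrt t).
    by rewrite /A; field; rewrite !gt_eqF.
  have h1 : 1 <= Num.sqrt T / Num.sqrt t by rewrite ler_pdivlMr// mul1r; exact: ler_wsqrtr.
  by rewrite lerD2l; apply: ler_peMr => //; exact: mulr_ge0.
apply/ler_addgt0Pr => e e0.
pose e1 := e / (gc + 1) * z / 4.
have gc1 : 0 < gc + 1 by rewrite ltr_wpDl.
have e10 : 0 < e1 by rewrite !mulr_gt0// invr_gt0.
have [dl dl0 hdl] := limit_mild T_gt0 sigma_gt0 HC1 lamB Hsol e10.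
pose pc := path_cst sigma T B.
have pc0 : 0 <= pc by exact: path_cst_ge0.
have dl1 : 0 < Num.min dl (e1 / (pc + 1)) by rewrite lt_min dl0 divr_gt0// ltr_wpDl.
(* A uniform grid with t as its last point, so that Gronwall reaches t itself. *)
have [n] := small_step t0 dl1; rewrite le_min; set de := t / n.+1%:R => /andP[hde1 hde2].
have de0 : 0 < de by rewrite divr_gt0// ltr0n.
have hpc : pc * de <= e1.
  apply: (@le_trans _ _ (pc * (e1 / (pc + 1)))); first by rewrite ler_wpM2l.
  rewrite mulrA ler_pdivrMr ?ltr_wpDl// mulrC ler_wpM2l ?(ltW e10)// lerDl//.
have tE : n.+1%:R * de = t by rewrite mulrC divfK// pnatr_eq0.
pose u k := cdf_osc z (k%:R * de).
pose M := e1 + pc * de.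
have hu k : (0 < k <= n.+1)%N -> u k <= A / Num.sqrt (k%:R * de) + 2 * M / z
    + c * \sum_(1 <= j < k) de / Num.sqrt ((k - j)%:R * de) * u j.
  case: k => // k /andP[_ kn]; rewrite /u.
  have kt : k.+1%:R * de <= T by apply: le_trans tT; rewrite -tE ler_wpM2r ?(ltW de0)// ler_nat.
  have kk : k%:R * de < k.+1%:R * de by rewrite ltr_pM2r// ltr_nat.
  apply: le_trans (osc_step de0 kk (lexx _) z0 (hdl _ _ _ de0 kk (lexx _) kt hde1)) _.
  rewrite -/pc -/M [X in X + _ <= _]addrC.
  apply: lerD; first by rewrite lerD2r /A invfM mulrA.
  have u0 j : 0 <= u j by apply: cdf_osc_ge0; exact: ltW.
  have s0 j : 0 <= Num.sqrt ((k.+1 - j)%:R * de) by exact: sqrtr_ge0.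
  rewrite mulr_sumr; apply: (@le_trans _ _ (\sum_(1 <= j < k) c * (de / Num.sqrt ((k.+1 - j)%:R * de) * u j))).
    apply: ler_sum_nat => j /andP[j1 jk]; rewrite -mulrBl -natrB ?(leq_trans (ltnW jk))// -/(u j).
    have s1 : 0 < Num.sqrt ((k.+1 - j)%:R * de) by rewrite sqrtr_gt0 mulr_gt0// ltr0n subn_gt0 ltnS ltnW.
    rewrite le_eqVlt; apply/orP; left; apply/eqP; rewrite /c; field.
    by rewrite !gt_eqF.
  (* The mild equation at index k + 1 stops its sum before k; the term j = k that the Gronwall
     inequality allows is nonnegative. *)
  have [k0|k0] := posnP k; first by rewrite k0 !big_geq.
  rewrite [leRHS]big_nat_recr//= lerDl; apply: mulr_ge0; [exact: c0|apply: mulr_ge0; [|exact: u0]].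
  by apply: divr_ge0; [exact: ltW|exact: sqrtr_ge0].
have M0 : 0 <= 2 * M / z by rewrite divr_ge0 ?(ltW z0)// mulr_ge0// addr_ge0 ?(ltW e10)// mulr_ge0// ltW.
have ndT : n.+1%:R * de <= T by rewrite tE.
have u0 k : 0 <= u k by apply: cdf_osc_ge0; exact: ltW.
have nn : (0 < n.+1 <= n.+1)%N by rewrite leqnn.
have := gronwall c0 A0 M0 de0 ndT u0 hu nn.
rewrite /u tE -/gc mulrDr addrA => h; apply: le_trans h _; rewrite lerD2l.
have hM : M <= 2 * e1 by rewrite /M mulr_natl mulr2n lerD2l.
apply: (@le_trans _ _ (gc * (2 * (2 * e1) / z))).
  by rewrite ler_wpM2l// ler_pM2r ?invr_gt0// ler_wpM2l.
have -> : gc * (2 * (2 * e1) / z) = e * (gc / (gc + 1)) by rewrite /e1; field; rewrite !gt_eqF.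
by rewrite ler_piMr ?(ltW e0)// ler_pdivrMr// mul1r lerDl.
Qed.

Lemma cdf_lipschitz t x y : 0 < t -> t <= T -> `|F t x - F t y| <= density_cst / Num.sqrt t * `|x - y|.
Proof.
move=> t0 tT; wlog xy : x y / x <= y.
  move=> H; have /orP[/H//|/H] := le_total x y; by rewrite distrC (distrC y).
have Fxy := le_marginal_cdf X t xy.
rewrite distrC (distrC x) (@ger0_norm _ (y - x)) ?subr_ge0// ger0_norm ?subr_ge0//.
move: xy; rewrite le_eqVlt => /predU1P[->|xy]; first by rewrite !subrr mulr0.
have := cdf_osc_ge (y - x) t x; rewrite (_ : x + (y - x) = y); last ring.
move=> h; apply: le_trans h _.
rewrite mulrAC; apply: cdf_osc_bound => //; by rewrite subr_gt0.
Qed.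

End density_bound.

(** * Commutator of the heat flow with Lambda *)

Section heat_commutator.
Variable R : realType.
Notation mu := (@lebesgue_measure R).
Variables (f L lam : R -> R) (K Q b : R).
Hypotheses (K0 : 0 <= K) (Q0 : 0 <= Q) (b0 : 0 <= b).
Hypothesis mf : measurable_fun [set: R] f.
Hypothesis f01 : forall x, 0 <= f x <= 1.
Hypothesis fQ : forall x y, `|f x - f y| <= Q * `|x - y|.
Hypothesis f_shift : forall z, (L1 mu (fun x => (f (x - z) - f x)%R) <= (2 * `|z|)%:E)%E.
Hypothesis bL : bm ((fun x => L (f x)) : measurableTypeR R -> R).
Hypothesis L_taylor : forall u v, 0 <= u <= 1 -> 0 <= v <= 1 -> `|L u - L v - lam v * (u - v)| <= K * (u - v) ^+ 2.

Let bmf : bm (f : measurableTypeR R -> R).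
Proof. by split => //; exists 1 => x; case/andP: (f01 x) => h0 h1; rewrite ger0_norm. Qed.

Let bmg x : bm ((fun v => f (x - b * v)) : measurableTypeR R -> R).
Proof.
have [_ [C fC]] := bmf; split; last by exists C.
by apply: measurableT_comp => //; apply: measurable_funB => //; exact: measurable_funM.
Qed.

Let bmLg x : bm ((fun v => L (f (x - b * v))) : measurableTypeR R -> R).
Proof.
have [mL [C hC]] := bL; split; last by exists C => v; exact: hC.
apply: (@measurableT_comp _ _ _ _ _ _ (fun x => L (f x))) => //.
by apply: measurable_funB => //; exact: measurable_funM.
Qed.

Let Ex_sqrB (g : measurableTypeR R -> R) c : bm g ->
  \int[@gam R]_v ((g v - c) ^+ 2) = \int[@gam R]_v (g v ^+ 2) - 2 * c * \int[@gam R]_v g v + c ^+ 2.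
Proof.
move=> bg; have bc := bm_cst (measurableTypeR R) (c ^+ 2); have b2 := bmX 2 bg.
have b3 := bmM (bm_cst (measurableTypeR R) (2 * c)) bg.
rewrite -(ExZ _ _ bg) -(ExB _ b2 b3) -[X in _ + X](Ex_cst (@gam R)) -(ExD _ (bmB b2 b3) bc).
by apply: eq_Rintegral => v _; ring.
Qed.

(* The mean minimizes the quadratic deviation, so [heat b f x] may be replaced by [f x] in the second-order term. *)
Let pointwise x : `|heat b (fun y => L (f y)) x - L (heat b f x)| <= K * \int[@gam R]_v ((f (x - b * v) - f x) ^+ 2).
Proof.
set v0 := heat b f x.
have v01 : 0 <= v0 <= 1.
  apply/andP; split; first by apply: Rintegral_ge0 => v _; case/andP: (f01 (x - b * v)).
  rewrite -(Ex_cst (@gam R) 1); apply: (Ex_le _ (bmg x) (bm_cst _ 1)) => v.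
  by case/andP: (f01 (x - b * v)).
have bL1 := bmLg x.
have bD1 := bmB (bmg x) (bm_cst (measurableTypeR R) v0).
have bD := bmM (bm_cst (measurableTypeR R) (lam v0)) bD1.
have bLv := bmB bL1 (bm_cst (measurableTypeR R) (L v0)).
have E0 : \int[@gam R]_v (f (x - b * v) - v0) = 0.
  by rewrite (ExB _ (bmg x) (bm_cst _ v0)) Ex_cst /v0 /heat subrr.
have -> : heat b (fun y => L (f y)) x - L v0 =
    \int[@gam R]_v (L (f (x - b * v)) - L v0 - lam v0 * (f (x - b * v) - v0)).
  by rewrite (ExB _ bLv bD) (ExZ _ _ bD1) E0 mulr0 subr0 (ExB _ bL1 (bm_cst _ _)) Ex_cst.
apply: le_trans (Ex_norm _ (bmB bLv bD)) _.
have bS := bmX 2 bD1.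
apply: (@le_trans _ _ (K * \int[@gam R]_v ((f (x - b * v) - v0) ^+ 2))).
  rewrite -(ExZ _ _ bS); apply: (Ex_le _ (bm_norm (bmB bLv bD)) (bmM (bm_cst _ K) bS)) => v.
  by apply: L_taylor => //; exact: f01.
rewrite ler_wpM2l// !(Ex_sqrB _ (bmg x)) -/(heat b f x) -/v0.
by have := sqr_ge0 (v0 - f x); rewrite -subr_ge0 => h; rewrite -subr_ge0; apply: le_trans h _;
  rewrite le_eqVlt; apply/orP; left; apply/eqP; ring.
Qed.

(** In the squared difference of f at x - b v and x, one factor is bounded by the Lipschitz
    constant, Q b |v|, and the other is integrated in x, at most 2 b |v|. This gains b^2 with a
    single factor Q; 512 is 2 times the Gaussian moment bound 256. *)
Lemma L1_heat_commutator :
  (L1 mu (fun x => (heat b (fun y => L (f y)) x - L (heat b f x))%R) <= (512 * (K * Q * b ^+ 2))%:E)%E.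
Proof.
pose k : R := K * Q * b.
have k0 : 0 <= k by apply: mulr_ge0 => //; exact: mulr_ge0.
pose h (z : measurableTypeR R * measurableTypeR R) : R := k * (`|z.2| * `|f (z.1 - b * z.2) - f z.1|).
have mh : measurable_fun setT (EFin \o h).
  apply/measurable_EFinP; apply: measurable_funM => //; apply: measurable_funM.
    by apply: measurableT_comp => //; exact: measurable_snd.
  apply: measurableT_comp => //; apply: measurable_funB; apply: (measurableT_comp mf); last exact: measurable_fst.
  by apply: measurable_funB => //; exact: measurable_funM.
have h0 z : (0 <= (EFin \o h) z)%E by rewrite /= lee_fin; apply: mulr_ge0 => //; apply: mulr_ge0.
apply: (@le_trans _ _ (\int[mu]_x \int[@gam R]_v (EFin \o h) (x, v))%E).
  apply: ge0_le_integral_nomeas => x; first by rewrite lee_fin.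
  have bS := bmX 2 (bmB (bmg x) (bm_cst (measurableTypeR R) (f x))).
  apply: (@le_trans _ _ (K * \int[@gam R]_v ((f (x - b * v) - f x) ^+ 2))%:E); first by rewrite lee_fin.
  rewrite -(ExZ _ _ bS) -(ExE _ (bmM (bm_cst _ K) bS)).
  apply: ge0_le_integral_nomeas => v /=; first by rewrite lee_fin mulr_ge0// sqr_ge0.
  rewrite lee_fin /h/= /k -!mulrA ler_wpM2l// -real_normK ?num_real// expr2 !mulrA ler_wpM2r//.
  apply: le_trans (fQ _ _) _; rewrite addrAC subrr add0r normrN normrM (ger0_norm b0) -!mulrA; exact: lexx.
rewrite (@fubini_tonelli _ _ _ _ _ mu (@gam R) _ mh h0)/=.
pose g v : R := (1 + `|v|) * weight v.
have mg : measurable_fun [set: measurableTypeR R] g.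
  apply: measurable_funM; last exact: measurable_weight.
  by apply: measurable_funD => //; exact: measurableT_comp.
have g0 v : 0 <= g v by rewrite mulr_ge0 ?addr_ge0 ?weight_ge0.
have kb0 : 0 <= 2 * (K * Q * b ^+ 2) by apply: mulr_ge0; [exact: ler0n|apply: mulr_ge0; [exact: mulr_ge0|exact: sqr_ge0]].
apply: (@le_trans _ _ (\int[@gam R]_v (2 * (K * Q * b ^+ 2) * g v)%:E)%E).
  apply: ge0_le_integral_nomeas => v /=; first by apply: integral_ge0 => x _; exact: (h0 (x, v)).
  have md : measurable_fun [set: R] (fun x => `|f (x - b * v) - f x|).
    by apply: measurableT_comp => //; apply: measurable_funB => //; apply: measurableT_comp => //; exact: measurable_funB.
  have kv : 0 <= k * `|v| by exact: mulr_ge0.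
  rewrite /h/=; under eq_integral do rewrite mulrA.
  rewrite (ge0_integral_cmul mu kv md)//.
  apply: le_trans (lee_wpmul2l _ (f_shift (b * v))) _; first by rewrite lee_fin.
  rewrite -EFinM lee_fin /k normrM (ger0_norm b0).
  have -> : K * Q * b * `|v| * (2 * (b * `|v|)) = 2 * (K * Q * b ^+ 2) * (`|v| * `|v|) by ring.
  rewrite ler_wpM2l//; apply: ler_pM => //; first by rewrite lerDr.
  rewrite /weight; apply: (@le_trans _ _ (1 + `|v|)); first by rewrite lerDr.
  rewrite ler_peMr ?addr_ge0// -[leLHS]sqrtr1; apply: ler_wsqrtr; by rewrite lerDl.
rewrite (ge0_integral_cmul (@gam R) kb0 mg g0).
apply: le_trans (lee_wpmul2l _ (gam_moment R)) _; first by rewrite lee_fin.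
rewrite -EFinM lee_fin le_eqVlt; apply/orP; left; apply/eqP.
move: (K * Q * b ^+ 2) => y; ring.
Qed.

End heat_commutator.

Section lipschitz_drift.
Context d (Omega : measurableType d) (R : realType) (P : probability Omega R).
Variables (T sigma B : R) (Lambda lambda : R -> R) (m : probability (measurableTypeR R) R).
Variables (X0 : {RV P >-> R}) (W X : R -> {RV P >-> R}).
Hypothesis T_gt0 : 0 < T.
Hypothesis sigma_gt0 : 0 < sigma.
Hypothesis HC1 : C1_on01 Lambda lambda.
Hypothesis lamB : forall x, `|cliplam lambda x| <= B.
Hypothesis Hsol : limit_solution T sigma lambda m X0 W X.

Notation lam := (cliplam lambda).
Notation L := (clipLam Lambda).
Notation mu := (@lebesgue_measure R).
Notation F := (marginal_cdf X).

Let B_ge0 : 0 <= B. Proof. exact: le_trans (lamB 0). Qed.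

Lemma L1_cdf_shift (Y : {RV P >-> R}) z : (L1 mu (fun x => (\int[P]_w ind (Y w) (x - z) - \int[P]_w ind (Y w) x)%R) <= (2 * `|z|)%:E)%E.
Proof.
have mY : measurable_fun setT Y by exact: measurable_funPT.
have bi x : bm (fun w => ind (Y w) x) by exact: bm_indX.
pose h (u : measurableTypeR R * Omega) : R := `|ind (Y u.2) (u.1 - z) - ind (Y u.2) u.1|.
apply: (@le_trans _ _ (L1 mu (fun x => (\int[P]_w h (x, w))%R))).
  apply: le_L1 => x; rewrite -(ExB P (bi _) (bi _)).
  by apply: le_trans (Ex_norm P (bmB (bi _) (bi _))) _; exact: ler_norm.
have mh : measurable_fun setT h.
  apply: measurableT_comp => //; apply: measurable_funB; apply: measurable_ind => //;
  try exact: (measurableT_comp mY).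
  exact: measurable_funB.
apply: le_trans (@swap_bound _ _ _ P h (fun=> 2 * `|z|) mh _ _ _ _ _) _ => //.
- by move=> u; exact: normr_ge0.
- by move=> x; rewrite /h/=; exact: (bm_norm (bmB (bi (x - z)) (bi x))).
- apply: aeW => w; rewrite /h/=.
  have := @weighted_ind_diff R (fun=> 1) (z + Y w) (Y w) (measurable_cst _) (fun _ => ler01) _.
  rewrite addrK; under eq_integral do rewrite mul1r -indB.
  move=> hh; apply: le_trans (hh _) _ => //; first by move=> *; rewrite lerDl.
  by rewrite mulrC lee_fin.
by rewrite integral_cst//= probability_setT mule1.
Qed.

(* Over [tau, s] the limit is a Gaussian shift of [X tau] up to a drift of size at most [B (s - tau)]. *)
Lemma L1_cdf_heat u s : 0 <= u -> u < s -> s <= T ->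
  (L1 mu (fun x => (heat (sigma * Num.sqrt (s - u)) (F u) x - F s x)%R) <= (2 * B * (s - u))%:E)%E.
Proof.
move=> u0 us sT; have uT : 0 <= u <= T by rewrite u0 (le_trans (ltW us)).
pose Bn w := sigma * (W s w - W u w).
have mX r : measurable_fun setT (X r) by exact: measurable_funPT.
have mBn : measurable_fun setT Bn by apply: measurable_funM => //; apply: measurable_funB; exact: measurable_funPT.
have lB := brownian_gauss_law sigma (limit_noise Hsol) u0 us.
set b := sigma * Num.sqrt (s - u).
have b0 : 0 <= b by rewrite mulr_ge0// ltW.
have mXB : measurable_fun setT (fun w => X u w + Bn w) by exact: measurable_funD.
have HE x : heat b (F u) x = \int[P]_w Phi 0 (x - (X u w + Bn w)).
  transitivity (\int[P]_w (1 * Phi b (x - X u w))).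
    rewrite (heat_weighted_cdf P _ x (bm_cst Omega 1) (mX _)) /heat.
    by apply: eq_Rintegral => v _; apply: eq_Rintegral => w _; rewrite mul1r.
  have gZ : gmeas (limit_generators X0 W u) (fun w => x - X u w).
    by apply: measurable_funB => //; exact: (gmeas_limit Hsol).
  have gU : gmeas (limit_generators X0 W u) (fun=> 1 : R) by exact: measurable_cst.
  have U1 (w : Omega) : `|1 : R| <= 1 by rewrite normr1.
  have := heat_step (@limit_generators_measurable _ _ _ _ X0 W _) mBn (indep_limit_noise Hsol u0 us) lB (lexx 0) b0 gU gZ U1.
  rewrite expr0n/= add0r sqrtr_sqr (ger0_norm b0) => <-.
  by apply: eq_Rintegral => w _; rewrite mul1r; congr (Phi 0 _); rewrite opprD addrA.
have FE x : F s x = \int[P]_w Phi 0 (x - X s w).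
  by apply: eq_Rintegral => w _; rewrite Phi0 indB addr0.
pose h (z : measurableTypeR R * Omega) : R := `|Phi 0 (z.1 - (X u z.2 + Bn z.2)) - Phi 0 (z.1 - X s z.2)|.
have b1 x : bm (fun w => Phi 0 (x - (X u w + Bn w))) by exact: bm_Phi_sub.
have b2 x : bm (fun w => Phi 0 (x - X s w)) by exact: bm_Phi_sub.
apply: (@le_trans _ _ (L1 mu (fun x => (\int[P]_w h (x, w))%R))).
  apply: le_L1 => x; rewrite HE FE -(ExB P (b1 x) (b2 x)).
  by apply: le_trans (Ex_norm P (bmB (b1 x) (b2 x))) _; exact: ler_norm.
have mh : measurable_fun setT h.
  have mP (V : Omega -> R) : measurable_fun setT V -> measurable_fun setT (fun z : measurableTypeR R * Omega => Phi 0 (z.1 - V z.2)).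
    move=> mV; apply: measurableT_comp; first exact: measurable_Phi.
    by apply: measurable_funB => //; exact: (measurableT_comp mV).
  by apply: measurableT_comp => //; apply: measurable_funB; [exact: (mP (fun w => X u w + Bn w))|exact: (mP (X s))].
have su0 : 0 <= s - u by rewrite subr_ge0 ltW.
apply: le_trans (@swap_bound _ _ _ P h (fun=> 2 * B * (s - u)) mh _ _ _ _ _) _ => //.
- by move=> z; exact: normr_ge0.
- by move=> x; exact: (bm_norm (bmB (b1 x) (b2 x))).
- by move=> w; apply: mulr_ge0 => //; exact: mulr_ge0.
- have eqX : {ae P, forall w, forall t, 0 <= t <= T ->
      X t w = X0 w + sigma * W t w + \int[mu]_(s in `[0, t]) lam (F s (X s w))}.
    apply: filterS (limit_eq Hsol) => w H t tT; rewrite H//; congr (_ + _).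
    by apply: eq_Rintegral => r _; rewrite marginal_cdfE /cliplam clip_id ?marginal_cdf01.
  apply: filterS (drift_increment_norm (fun r w _ => lamB (F r (X r w))) eqX) => w Hw.
  rewrite /h/=; apply: (le_trans (@L1_Phi_diff R 0 (X u w + Bn w) (X s w))).
  rewrite lee_fin -mulrA ler_wpM2l// distrC.
  by have := Hw u s u0 (ltW us) sT; rewrite /Bn opprD addrA.
by rewrite integral_cst//= probability_setT mule1.
Qed.

End lipschitz_drift.

Lemma eq_L1 d (T : measurableType d) (R : realType) (m : {measure set T -> \bar R}) (f g : T -> R) :
  f =1 g -> L1 m f = L1 m g.
Proof. by move=> /funext ->. Qed.

Lemma L1N d (T : measurableType d) (R : realType) (m : {measure set T -> \bar R}) (f : T -> R) :
  L1 m (fun x => (- f x)%R) = L1 m f.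
Proof. by apply: eq_integral => x _; rewrite normrN. Qed.

(** * Grouping fine steps into coarse ones *)

Section blocks.
Variable R : realType.

Lemma sum_nat_sub (a b n : nat) (g : nat -> R) : (0 < a)%N -> (a <= b)%N -> (b <= n)%N ->
  \sum_(1 <= j < n) (if (a <= j < b)%N then g j else 0) = \sum_(a <= j < b) g j.
Proof.
move=> a0 ab bn.
rewrite (big_cat_nat a0 (leq_trans ab bn))/= (big_cat_nat ab bn)/= big_nat big1; last first.
  by move=> j /andP[_ ja]; rewrite leqNgt ja.
rewrite [X in _ + (_ + X)]big_nat [X in _ + (_ + X)]big1; last first.
  by move=> j /andP[bj _]; rewrite [(j < b)%N]ltnNge bj andbF.
by rewrite add0r addr0; apply: eq_big_nat => j ->.
Qed.

(** Block k consists of the fine indices from k M to (k + 1) M - 1; those of block 0 and those from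
    n M on have no coarse counterpart and get 0. *)
Lemma sum_blocks (M n n' : nat) (f : nat -> R) : (0 < M)%N -> (n * M <= n')%N ->
  \sum_(1 <= k < n) M%:R * f k = \sum_(1 <= j < n') (if (M <= j < n * M)%N then f (j %/ M)%N else 0).
Proof.
move=> M0 nn; case: n nn => [|n] nn.
  by rewrite big_geq// big1// => j _; rewrite mul0n ltn0 andbF.
rewrite sum_nat_sub ?leq_pmull//; elim: n {nn} => [|n ih]; first by rewrite mul1n !big_geq.
rewrite big_nat_recr//= ih [RHS](@big_cat_nat _ _ _ (n.+1 * M)) ?leq_pmull ?leq_pmul2r//=.
congr (_ + _); rewrite (@eq_big_nat _ _ _ _ _ _ (fun=> f n.+1)); last first.
  move=> j /andP[j1 j2]; congr f; apply/eqP; rewrite eqn_leq leq_divRL// j1 andbT.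
  by rewrite -ltnS ltn_divLR.
by rewrite sumr_const_nat -mulnBl subSnn mul1n mulr_natl.
Qed.

(** All fine steps last at most t <= (n + 1) h and the matched ones, when n >= 1, exactly (n - 1) h:
    at most 2 h remains unmatched. *)
Lemma sum_outside_block (M n n' : nat) (h dl t c : R) : (0 < M)%N -> 0 <= c -> 0 <= dl -> h = M%:R * dl ->
  (n * M <= n')%N -> n'%:R * dl <= t -> t <= n.+1%:R * h ->
  \sum_(1 <= j < n') dl * (if (M <= j < n * M)%N then 0 else c) <= 2 * c * h.
Proof.
move=> M0 c0 d0 hE nn n't tn.
have -> : \sum_(1 <= j < n') dl * (if (M <= j < n * M)%N then 0 else c) =
    dl * c * (n'.-1%:R - \sum_(1 <= j < n') (if (M <= j < n * M)%N then 1 else 0)).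
  have -> : n'.-1%:R = \sum_(1 <= j < n') (1 : R) by rewrite sumr_const_nat subn1.
  rewrite -sumrB mulr_sumr.
  by apply: eq_bigr => j _; case: ifP => _; rewrite ?subrr ?subr0 ?mulr0 ?mulr1.
have n1 : n'.-1%:R <= n'%:R :> R by rewrite ler_nat leq_pred.
have dc : 0 <= dl * c by exact: mulr_ge0.
have ch : 0 <= c * h by rewrite hE !mulr_ge0.
have n1t : dl * c * n'.-1%:R <= c * t.
  by rewrite mulrC mulrA mulrC ler_wpM2l//; apply: le_trans n't; rewrite ler_wpM2r.
case: n nn tn => [|n] nn tn.
  rewrite big1 ?subr0; last by move=> j _; rewrite mul0n ltn0 andbF.
  apply: le_trans n1t _; rewrite mul1r in tn; have := ler_wpM2l c0 tn; lra.
rewrite (sum_nat_sub (fun=> 1)) ?leq_pmull// sumr_const_nat.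
have -> : (n.+1 * M - M)%N = (n * M)%N by rewrite mulSn addKn.
rewrite mulrBr natrM.
have -> : dl * c * (n%:R * M%:R) = c * (n%:R * h) by rewrite hE; ring.
have := ler_wpM2l c0 tn; rewrite -[n.+2]addn2 natrD mulrDl mulrDr; lra.
Qed.

End blocks.

Section coarse_grid.
Context d (Omega : measurableType d) (R : realType) (P : probability Omega R).
Variables (T sigma B K : R) (Lambda lambda : R -> R) (m : probability (measurableTypeR R) R).
Variables (X0 : {RV P >-> R}) (W X : R -> {RV P >-> R}).
Hypothesis T_gt0 : 0 < T.
Hypothesis sigma_gt0 : 0 < sigma.
Hypothesis HC1 : C1_on01 Lambda lambda.
Hypothesis lamB : forall x, `|cliplam lambda x| <= B.
Hypothesis Hsol : limit_solution T sigma lambda m X0 W X.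
Hypothesis K_ge0 : 0 <= K.
Hypothesis lamK : forall x y, `|cliplam lambda x - cliplam lambda y| <= K * `|x - y|.

Notation lam := (cliplam lambda).
Notation L := (clipLam Lambda).
Notation mu := (@lebesgue_measure R).
Notation F := (marginal_cdf X).

Let B_ge0 : 0 <= B. Proof. exact: le_trans (lamB 0). Qed.

Let mX s : measurable_fun setT (X s). Proof. exact: measurable_funPT. Qed.

Lemma clipLam_taylor u v : 0 <= u <= 1 -> 0 <= v <= 1 -> `|L u - L v - lam v * (u - v)| <= K * (u - v) ^+ 2.
Proof.
move=> /andP[u0 u1] /andP[v0 v1]; have E c : `|lam c - lam v| <= K * `|u - v| -> `|lam c * (u - v) - lam v * (u - v)| <= K * (u - v) ^+ 2.
  by move=> h; rewrite -mulrBl normrM -real_normK ?num_real// expr2 mulrA ler_wpM2r.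
have /orP[uv|vu] := le_total u v.
  have [c /andP[uc cv] h] := clipLam_mvt HC1 u0 uv v1.
  have -> : L u - L v = lam c * (u - v) by rewrite -opprB h; ring.
  apply: E; apply: le_trans (lamK _ _) _; rewrite ler_wpM2l// !ler0_norm ?subr_le0//; lra.
have [c /andP[vc cu] ->] := clipLam_mvt HC1 v0 vu u1.
apply: E; apply: le_trans (lamK _ _) _; rewrite ler_wpM2l// !ger0_norm ?subr_ge0//; lra.
Qed.

Definition conv_drift t s (x : R) := dconv (sigma * Num.sqrt (t - s)) (fun y => L (F s y) - L 0) x.

Lemma measurable_conv_drift t s : measurable_fun [set: R] (conv_drift t s).
Proof. by apply: measurable_dconv; have [] := bm_Lcdf X HC1 lamB s. Qed.

Let mlam : measurable_fun [set: R] lam.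
Proof. by apply: continuous_measurable_fun; exact: (continuous_cliplam HC1). Qed.

Let drift s w := lam (F s (X s w)).

Let bm_drift s : bm (drift s).
Proof.
split; last by exists B => w; exact: lamB.
apply: (@measurableT_comp _ _ _ _ _ _ lam) => //.
by apply: (@measurableT_comp _ _ _ _ _ _ (F s)) => //; exact: measurable_marginal_cdf.
Qed.

Let levelE s : 0 < s -> s <= T -> (fun y => L (F s y) - L 0) = (fun y => \int[P]_w (drift s w * ind (X s w) y)).
Proof.
move=> s0 sT; apply/funext => y.
have cF : continuous (fun y => \int[P]_w ind (X s w) y) by move=> z; exact: (continuous_marginal_cdf sigma_gt0 lamB Hsol s0 sT).
by rewrite -(@Ex_level _ _ _ P lam L B (X s) mlam lamB (fun e e0 => cliplam_unif HC1 e0) (clipLam_mvt HC1) (@mX _) cF (fun e e0 => @marginal_cdf_Ny _ _ _ P X _ e e0)).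
Qed.

(** By [Ex_level] the convolved function is a weighted distribution function, and the derivative
    kernel becomes a Gaussian density of mass 1: the unmatched fine steps are therefore bounded
    without any singularity in t - s. *)
Lemma L1_conv_drift t s : 0 < s -> s < t -> t <= T -> (L1 mu (conv_drift t s) <= B%:E)%E.
Proof.
move=> s0 st tT; have sT : s <= T by exact: le_trans (ltW st) tT.
set a := sigma * Num.sqrt (t - s).
have a0 : 0 < a by rewrite mulr_gt0// sqrtr_gt0 subr_gt0.
pose h (z : measurableTypeR R * Omega) : R := B * gk a (z.1 - X s z.2).
have bg x : bm (fun w => drift s w * gk a (x - X s w)).
  by apply: bmM => //; apply: bm_gk => //; exact: measurable_funB.
have bh x : bm (fun w => h (x, w)).
  by apply: bmM; [exact: bm_cst|apply: bm_gk => //; exact: measurable_funB].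
have h0 z : 0 <= h z by rewrite mulr_ge0// gk_ge0// ltW.
have mgk (w : R) : measurable_fun [set: R] (fun x : R => gk a (x - w)).
  by apply: measurableT_comp; [exact: measurable_gk|exact: measurable_funB].
apply: (@le_trans _ _ (L1 mu (fun x => (\int[P]_w h (x, w))%R))).
  apply: le_L1 => x; rewrite /conv_drift -/a levelE// (dconv_weighted_cdf P x a0 (bm_drift s) (@mX s)).
  apply: le_trans (Ex_norm P (bg x)) _; apply: le_trans (ler_norm _).
  apply: (Ex_le P (bm_norm (bg x)) (bh x)) => w.
  rewrite normrM (@ger0_norm _ (gk _ _)) ?gk_ge0 ?(ltW a0)// ler_wpM2r ?gk_ge0 ?(ltW a0)//; exact: lamB.
have mh : measurable_fun setT h.
  apply: measurable_funM => //; apply: measurableT_comp; first exact: measurable_gk.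
  by apply: measurable_funB => //; exact: (measurableT_comp (@mX s)).
apply: le_trans (@swap_bound _ _ _ P h (fun=> B) mh h0 bh _ _ _) _ => //.
  apply: aeW => w; rewrite /h/= (ge0_integral_cmul mu B_ge0 (mgk _)); last by move=> x; rewrite gk_ge0// ltW.
  rewrite (@ge0_integral_shift _ (- X s w) (fun x => (gk a x)%:E)).
  - by rewrite integral_gk// mule1.
  - by apply/measurable_EFinP; exact: measurable_gk.
  - by move=> x; rewrite lee_fin gk_ge0// ltW.
by rewrite integral_cst//= probability_setT mule1.
Qed.

Definition commutator_cst : R := 512 * (K * density_cst T sigma B * sigma ^+ 2).

Lemma density_cst_ge0 : 0 <= density_cst T sigma B.
Proof.
have c0 : 0 <= 512 * B / sigma by apply: divr_ge0; [apply: mulr_ge0; [exact: ler0n|exact: B_ge0]|exact: ltW].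
have := gronwall_cst_ge0 c0 (ltW T_gt0); rewrite /density_cst => g0.
apply: mulr_ge0; first by rewrite divr_ge0// ltW.
by rewrite addr_ge0// mulr_ge0.
Qed.

Let Q0 := density_cst_ge0.

Lemma commutator_cst_ge0 : 0 <= commutator_cst.
Proof.
by apply: mulr_ge0; [exact: ler0n|apply: mulr_ge0; [exact: mulr_ge0|exact: sqr_ge0]].
Qed.

(** The kernel over t - u is the kernel over t - s after a heat flow over s - u. What is left to
    compare is the heat flow of Lambda at F u with Lambda at F s: the commutator, with Q of order 1
    / sqrt u, and [L1_cdf_heat] multiplied by the Lipschitz constant B. *)
Lemma L1_conv_drift_diff t u s : 0 < u -> u <= s -> s < t -> t <= T ->
  (L1 mu (fun x => (conv_drift t u x - conv_drift t s x)%R) <=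
   (256 / (sigma * Num.sqrt (t - s)) * ((commutator_cst / Num.sqrt u + 2 * B ^+ 2) * (s - u)))%:E)%E.
Proof.
move=> u0; rewrite le_eqVlt => /predU1P[<-|us] st tT.
  rewrite subrr !mulr0 /L1; under eq_integral do rewrite subrr normr0.
  by rewrite integral_cst//= mul0e.
have sT : s <= T by exact: le_trans (ltW st) tT.
have uT : u <= T by exact: le_trans (ltW us) sT.
set a := sigma * Num.sqrt (t - s); set b := sigma * Num.sqrt (s - u).
have a0 : 0 < a by rewrite mulr_gt0// sqrtr_gt0 subr_gt0.
have b0 : 0 <= b by rewrite mulr_ge0// ltW.
have b2 : b ^+ 2 = sigma ^+ 2 * (s - u) by rewrite exprMn sqr_sqrtr// subr_ge0 ltW.
have abE : sigma * Num.sqrt (t - u) = Num.sqrt (a ^+ 2 + b ^+ 2).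
  rewrite b2 exprMn sqr_sqrtr ?subr_ge0 ?(ltW st)// -mulrDr addrA subrK.
  by rewrite sqrtrM ?sqr_ge0// sqrtr_sqr ger0_norm// ltW.
have bLu := bm_Lcdf X HC1 lamB u; have bLs := bm_Lcdf X HC1 lamB s.
have bHu := bm_heat b bLu.
pose D x := heat b (fun y => L (F u y) - L 0) x - (L (F s x) - L 0).
have bD : bm (D : measurableTypeR R -> R) by exact: bmB.
have E x : conv_drift t u x - conv_drift t s x = dconv a D x.
  rewrite /conv_drift abE -/a (levelE u0 uT) (dconv_semigroup P b x a0 (bm_drift u) (@mX u)) -(levelE u0 uT).
  by rewrite -(dconvB x a0 bHu bLs).
under eq_L1 do rewrite E.
apply: le_trans (L1_dconv a0 bD) _.
have ca : 0 <= 256 / a by apply: divr_ge0; [exact: ler0n|exact: ltW].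
rewrite [leRHS]EFinM; apply: lee_wpmul2l; first by rewrite lee_fin.
have bLc : bm ((fun x => L (F u x)) : measurableTypeR R -> R).
  have := bmD bLu (bm_cst (measurableTypeR R) (L 0)).
  by rewrite (_ : (fun x => _) = (fun x => L (F u x)))//; apply/funext => x; rewrite subrK.
have mL : measurable_fun [set: R] L by apply: continuous_measurable_fun; exact: (continuous_clipLam HC1).
have bHF := bm_heat b (bm_marginal_cdf X u).
have DE x : D x = (heat b (fun y => L (F u y)) x - L (heat b (F u) x)) + (L (heat b (F u) x) - L (F s x)).
  rewrite /D (heatB b x bLc (bm_cst _ (L 0))) {2}/heat Ex_cst; ring.
under eq_L1 do rewrite DE.
have [mHF _] := bHF; have [mHL _] := bm_heat b bLc.
apply: le_trans (L1D _ _ _) _.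
- by apply: measurable_funB => //; exact: measurableT_comp.
- by apply: measurable_funB; apply: measurableT_comp => //; exact: measurable_marginal_cdf.
rewrite mulrDl EFinD; apply: leeD.
  have Qu : 0 <= density_cst T sigma B / Num.sqrt u by rewrite divr_ge0.
  apply: le_trans (L1_heat_commutator K_ge0 Qu b0 (measurable_marginal_cdf X u) (marginal_cdf01 X u) _ _ bLc clipLam_taylor) _.
  - by move=> x y; exact: (cdf_lipschitz T_gt0 sigma_gt0 HC1 lamB Hsol).
  - by move=> z; exact: L1_cdf_shift.
  rewrite b2 lee_fin le_eqVlt; apply/orP; left; apply/eqP; rewrite /commutator_cst.
  move: (density_cst _ _ _) (Num.sqrt u)^-1 => q r; ring.
apply: (@le_trans _ _ (L1 mu (fun x => (B * (heat b (F u) x - F s x))%R))).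
  apply: le_L1 => x; rewrite normrM (ger0_norm B_ge0); exact: (clipLam_lipschitz HC1 lamB).
rewrite L1Z; last by apply: measurable_funB => //; exact: measurable_marginal_cdf.
rewrite (ger0_norm B_ge0).
have us' := L1_cdf_heat sigma_gt0 lamB Hsol (ltW u0) us sT.
apply: le_trans (lee_wpmul2l _ us') _; first by rewrite lee_fin.
rewrite -EFinM lee_fin le_eqVlt; apply/orP; left; apply/eqP; ring.
Qed.

(** 8 is the 2 lost when u is replaced by the fine time, times the 4 of [beta_sum]; 4 is the 2 of
    [L1_cdf_heat] times that of [sum_singular]; 2 B pays for the unmatched fine steps. *)
Definition coarse_cst : R := 256 / sigma * (8 * commutator_cst + 4 * B ^+ 2 * Num.sqrt T) + 2 * B.

(* A coarse step is compared with the fine steps it contains; the fine grid itself carries a vanishing error. *)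
Lemma L1_mild_coarse h t n : 0 < h -> n%:R * h < t -> t <= n.+1%:R * h -> t <= T ->
  (L1 mu (mild sigma Lambda X h t n) <= (coarse_cst * h)%:E)%E.
Proof.
move=> h0 nt tn tT; apply/lee_addgt0Pr => e e0; rewrite -EFinD.
have t0 : 0 < t by apply: le_lt_trans nt; rewrite mulr_ge0// ltW.
have e20 : 0 < e / 2 by rewrite divr_gt0.
have [dl dl0 hdl] := limit_mild T_gt0 sigma_gt0 HC1 lamB Hsol e20.
pose pc := path_cst sigma T B.
have pc0 : 0 <= pc by exact: path_cst_ge0.
have dl1 : 0 < Num.min dl (e / 2 / (pc + 1)) by rewrite lt_min dl0 divr_gt0// ltr_wpDl.
have [M'] := small_step h0 dl1; rewrite le_min; set M := M'.+1; set de := h / M%:R => /andP[hde1 hde2].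
have M0 : (0 < M)%N by [].
have de0 : 0 < de by rewrite divr_gt0// ltr0n.
have hE : h = M%:R * de by rewrite mulrC divfK// pnatr_eq0.
have hpc : pc * de <= e / 2.
  apply: (@le_trans _ _ (pc * (e / 2 / (pc + 1)))); first by rewrite ler_wpM2l.
  rewrite mulrA ler_pdivrMr ?ltr_wpDl// mulrC ler_wpM2l ?(ltW e20)// lerDl//.
have [n' [n't tn']] := grid_exists de0 t0.
have nn' : (n * M <= n')%N.
  rewrite -ltnS -(ltr_nat R) natrM -(ltr_pM2r de0) -mulrA -hE; exact: lt_le_trans nt tn'.
have hfine := hdl de t n' de0 n't tn' tT hde1.
pose c j : R := if (M <= j < n * M)%N then 0 else B.
pose g j x : R := de * ((if (M <= j < n * M)%N then conv_drift t ((j %/ M)%:R * h) x else 0) - conv_drift t (j%:R * de) x).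
have mg j : measurable_fun [set: R] (g j).
  apply: measurable_funM => //; apply: measurable_funB; last exact: measurable_conv_drift.
  by case: (boolP (M <= j < n * M)%N) => _ //; exact: measurable_conv_drift.
have E x : mild sigma Lambda X h t n x = mild sigma Lambda X de t n' x + \sum_(1 <= j < n') g j x.
  rewrite /mild -[RHS]addrA; congr (_ + _).
  have -> : \sum_(1 <= j < n') g j x = \sum_(1 <= j < n') de * (if (M <= j < n * M)%N then conv_drift t ((j %/ M)%:R * h) x else 0)
      - \sum_(1 <= j < n') de * conv_drift t (j%:R * de) x.
    by rewrite -sumrB; apply: eq_bigr => j _; rewrite /g mulrBr.
  rewrite -[X in _ = X + _]/(\sum_(1 <= k < n') de * conv_drift t (k%:R * de) x).
  rewrite [RHS]addrCA subrr addr0.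
  transitivity (de * \sum_(1 <= k < n) M%:R * conv_drift t (k%:R * h) x).
    by rewrite mulr_sumr; apply: eq_bigr => k _; rewrite -/(conv_drift t (k%:R * h) x) mulrA [de * _]mulrC -hE.
  by rewrite (sum_blocks (fun k => conv_drift t (k%:R * h) x) M0 nn') mulr_sumr.
under eq_L1 do rewrite E.
apply: le_trans (L1D _ _ _) _; [exact: (measurable_mild sigma X HC1 lamB)|exact: measurable_sum|].
have A0 := commutator_cst_ge0.
pose bnd j : R := de * (256 / (sigma * Num.sqrt (t - j%:R * de)) * ((2 * commutator_cst / Num.sqrt (j%:R * de) + 2 * B ^+ 2) * h)).
have bnd0 j : 0 <= bnd j.
  apply: mulr_ge0; first exact: ltW.
  apply: mulr_ge0; first by apply: divr_ge0; [exact: ler0n|rewrite mulr_ge0// ltW].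
  apply: mulr_ge0; last exact: ltW.
  by apply: addr_ge0; [apply: divr_ge0 => //; apply: mulr_ge0|apply: mulr_ge0 => //; exact: sqr_ge0].
have term j : (1 <= j < n')%N -> (L1 mu (g j) <= (bnd j + de * c j)%:E)%E.
  move=> /andP[j1 jn].
  have s0 : 0 < j%:R * de by rewrite mulr_gt0// ltr0n.
  have st : j%:R * de < t by apply: lt_trans n't; rewrite ltr_pM2r// ltr_nat.
  rewrite /g L1Z; last first.
    apply: measurable_funB; last exact: measurable_conv_drift.
    by case: (boolP (M <= j < n * M)%N) => _ //; exact: measurable_conv_drift.
  rewrite (ger0_norm (ltW de0)) /c; case: ifP => [/andP[Mj jnM]|_].
    rewrite mulr0 addr0 /bnd [leRHS]EFinM; apply: lee_wpmul2l; first by rewrite lee_fin ltW.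
    set u := (j %/ M)%:R * h.
    have k1 : (1 <= j %/ M)%N by rewrite divn_gt0.
    have uE : u = (j %/ M * M)%:R * de by rewrite /u hE mulrA natrM.
    have us : u <= j%:R * de by rewrite uE ler_wpM2r ?(ltW de0)// ler_nat leq_divM.
    have su : j%:R * de - u <= h.
      rewrite uE -mulrBl -natrB ?leq_divM// hE ler_wpM2r ?(ltW de0)// ler_nat.
      by rewrite {1}(divn_eq j M) addKn ltnW// ltn_mod.
    have hu : h <= u by rewrite /u ler_peMl ?(ltW h0)// ler1n.
    have u0 : 0 < u by exact: lt_le_trans hu.
    apply: le_trans (L1_conv_drift_diff u0 us st tT) _; rewrite lee_fin.
    apply: ler_wpM2l; first by apply: divr_ge0; [exact: ler0n|rewrite mulr_ge0// ltW].
    (* Matched blocks start at k >= 1, so u >= h and j de <= u + h <= 2 u: the singularity may be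
       moved from u to the fine time j de. *)
    have r1 : (Num.sqrt u)^-1 <= 2 / Num.sqrt (j%:R * de).
      have q1 : 0 < Num.sqrt (j%:R * de) by rewrite sqrtr_gt0.
      have q2 : 0 < Num.sqrt u by rewrite sqrtr_gt0.
      rewrite ler_pdivlMr// mulrC ler_pdivrMr//.
      have -> : 2 * Num.sqrt u = Num.sqrt (4 * u).
        have f4 : 4 = 2 ^+ 2 :> R by ring.
        by rewrite f4 (sqrtrM u (sqr_ge0 2)) sqrtr_sqr ger0_norm.
      apply: ler_wsqrtr; lra.
    apply: ler_pM.
    - by apply: addr_ge0; [exact: divr_ge0|apply: mulr_ge0 => //; exact: sqr_ge0].
    - by rewrite subr_ge0.
    - rewrite lerD2r; have := ler_wpM2l A0 r1; by rewrite [commutator_cst * (2 / _)]mulrA [commutator_cst * 2]mulrC.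
    - exact: su.
  apply: (@le_trans _ _ (de * B)%:E); last by rewrite lee_fin lerDr.
  rewrite [leRHS]EFinM; apply: lee_wpmul2l; first by rewrite lee_fin ltW.
  by under eq_L1 do rewrite sub0r; rewrite L1N; exact: L1_conv_drift.
apply: (@le_trans _ _ ((e / 2 + pc * de)%:E + (\sum_(1 <= j < n') (bnd j + de * c j))%:E)%E).
  apply: leeD => //; apply: le_trans (L1_sum mu _ mg) _.
  rewrite -sumEFin big_nat [leRHS]big_nat; apply: lee_sum => j jn; exact: term.
rewrite -EFinD lee_fin big_split/=.
have hc : \sum_(1 <= j < n') de * c j <= 2 * B * h by exact: (sum_outside_block M0 B_ge0 (ltW de0) hE nn' (ltW n't) tn).
suff hb : \sum_(1 <= j < n') bnd j <= 256 / sigma * (8 * commutator_cst + 4 * B ^+ 2 * Num.sqrt T) * h.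
  rewrite /coarse_cst; lra.
pose s1 j : R := de / Num.sqrt ((n' - j)%:R * de).
pose s2 j : R := (Num.sqrt (n' - j)%:R)^-1 * (Num.sqrt j%:R)^-1.
have S1 : \sum_(1 <= j < n') s1 j <= 2 * Num.sqrt T by exact: (sum_singular de0 n't tT).
have S2 : \sum_(1 <= j < n') s2 j <= 4 by exact: beta_sum.
have c1 : 0 <= 256 / sigma * h by apply: mulr_ge0; [apply: divr_ge0; [exact: ler0n|exact: ltW]|exact: ltW].
apply: (@le_trans _ _ (\sum_(1 <= j < n') (256 / sigma * h * (2 * commutator_cst * s2 j + 2 * B ^+ 2 * s1 j)))).
  apply: ler_sum_nat => j /andP[j1 jn].
  have nj : 0 < (n' - j)%:R * de by rewrite mulr_gt0// ltr0n subn_gt0.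
  have njt : (n' - j)%:R * de <= t - j%:R * de by rewrite natrB ?(ltnW jn)// mulrBl lerD2r ltW.
  have jd : 0 < j%:R * de by rewrite mulr_gt0// ltr0n.
  have r0 : 0 < Num.sqrt ((n' - j)%:R * de) by rewrite sqrtr_gt0.
  have rr : (Num.sqrt (t - j%:R * de))^-1 <= (Num.sqrt ((n' - j)%:R * de))^-1.
    by rewrite lef_pV2 ?posrE ?sqrtr_gt0 ?(lt_le_trans nj)// ler_wsqrtr.
  have s2E : s2 j = de / (Num.sqrt ((n' - j)%:R * de) * Num.sqrt (j%:R * de)).
    rewrite /s2 (sqrtrM de (ler0n R (n' - j))) (sqrtrM de (ler0n R j)).
    have dd : de = Num.sqrt de * Num.sqrt de by rewrite -expr2 sqr_sqrtr// ltW.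
    have y0 : Num.sqrt de != 0 by rewrite gt_eqF// sqrtr_gt0.
    have y1 : Num.sqrt (n' - j)%:R != 0 :> R by rewrite gt_eqF// sqrtr_gt0 ltr0n subn_gt0.
    have y2 : Num.sqrt j%:R != 0 :> R by rewrite gt_eqF// sqrtr_gt0 ltr0n.
    rewrite {1}dd; move: (Num.sqrt de) (Num.sqrt (n' - j)%:R) (Num.sqrt j%:R) y0 y1 y2 => z0 z1 z2 y0 y1 y2.
    by field; rewrite y0 y1 y2.
  rewrite s2E /s1 /bnd.
  clear s2E; move: (Num.sqrt (t - _)) (Num.sqrt ((n' - j)%:R * de)) r0 rr => q r r0 rr.
  have p0 : 0 <= 256 / sigma * h * (de * (2 * commutator_cst / Num.sqrt (j%:R * de) + 2 * B ^+ 2)).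
    apply: mulr_ge0 => //; apply: mulr_ge0; first exact: ltW.
    by apply: addr_ge0; [apply: divr_ge0 => //; apply: mulr_ge0|apply: mulr_ge0 => //; exact: sqr_ge0].
  have := ler_wpM2l p0 rr; rewrite !invfM.
  move: (Num.sqrt (j%:R * de))^-1 sigma^-1 q^-1 r^-1 commutator_cst => x1 x2 x3 x4 x5.
  have <- : 256 * x2 * h * (de * (2 * x5 * x1 + 2 * B ^+ 2)) * x3 = de * (256 * (x2 * x3) * ((2 * x5 * x1 + 2 * B ^+ 2) * h)) by ring.
  by have -> : 256 * x2 * h * (de * (2 * x5 * x1 + 2 * B ^+ 2)) * x4 = 256 * x2 * h * (2 * x5 * (de * (x4 * x1)) + 2 * B ^+ 2 * (de * x4)) by ring.
rewrite -mulr_sumr big_split/= [leRHS]mulrAC.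
have -> : \sum_(1 <= j < n') 2 * commutator_cst * s2 j = 2 * commutator_cst * \sum_(1 <= j < n') s2 j by rewrite mulr_sumr.
have -> : \sum_(1 <= j < n') 2 * B ^+ 2 * s1 j = 2 * B ^+ 2 * \sum_(1 <= j < n') s1 j by rewrite mulr_sumr.
apply: ler_wpM2l; first exact: c1.
have b2 : 0 <= 2 * B ^+ 2 by apply: mulr_ge0 => //; exact: sqr_ge0.
have a2 : 0 <= 2 * commutator_cst by exact: mulr_ge0.
have := ler_wpM2l a2 S2; have := ler_wpM2l b2 S1; lra.
Qed.

End coarse_grid.

(** * The particle system *)

Section rank_functions.
Context d (T : measurableType d) (R : realType).

(** Summation by parts writes an arbitrary function of a rank as a finite combination of indicators,
    whence its measurability. *)
Lemma rank_function_expand (f : nat -> R) (N n : nat) : (n <= N)%N ->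
  f n = f 0%N + \sum_(k < N) (f k.+1 - f k) * ind k.+1%:R (n%:R : R).
Proof.
move=> nN; have tel : \sum_(0 <= k < n) (f k.+1 - f k) = f n - f 0%N by rewrite telescope_sumr.
rewrite -(big_mkord xpredT (fun k => (f k.+1 - f k) * ind k.+1%:R n%:R)) (big_cat_nat (leq0n n) nN)/=.
rewrite [X in _ + (_ + X)]big_nat [X in _ + (_ + X)]big1 ?addr0.
  rewrite (@eq_big_nat _ _ _ _ _ _ (fun k => f k.+1 - f k)); first by rewrite tel addrC subrK.
  by move=> k /andP[_ kn]; rewrite /ind ler_nat kn mulr1.
by move=> k /andP[nk _]; rewrite /ind ler_nat leqNgt ltnS nk mulr0.
Qed.

Lemma measurable_rank_function (f : nat -> R) N (X : 'I_N -> T -> R) (i : 'I_N) :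
  (forall j, measurable_fun setT (X j)) ->
  measurable_fun setT (fun w => f (\sum_(j < N) (X j w <= X i w)%R)%N).
Proof.
move=> mX.
have le_N w : (\sum_(j < N) (X j w <= X i w)%R <= N)%N.
  by rewrite -[leqRHS]card_ord -sum1_card; apply: leq_sum => j _; case: (_ <= _).
rewrite (_ : (fun w => _) = (fun w => f 0%N + \sum_(k < N) (f k.+1 - f k) * ind k.+1%:R (\sum_(j < N) ind (X j w) (X i w)))).
  apply: measurable_funD => //; apply: measurable_sum => k; apply: measurable_funM => //.
  by apply: measurable_ind => //; apply: measurable_sum => j; exact: measurable_ind.
apply/funext => w; rewrite (rank_function_expand f (le_N w)); congr (_ + _).
by apply: eq_bigr => k _; rewrite natr_sum.
Qed.

End rank_functions.

Lemma rank_pos (R : realType) N (x : 'I_N -> R) i : (0 < \sum_(j < N) (x j <= x i)%R <= N)%N.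
Proof.
apply/andP; split; first by rewrite (bigD1 i)//= lexx.
by rewrite -[leqRHS]card_ord -sum1_card; apply: leq_sum => j _; case: (_ <= _).
Qed.

Section rank_drift.
Variables (R : realType) (Lambda lambda : R -> R) (B : R).
Hypothesis HC1 : C1_on01 Lambda lambda.
Hypothesis lamB : forall x, `|cliplam lambda x| <= B.

(** By the mean value theorem [lambdaN] is a value of lambda inside the k-th cell. *)
Lemma lambdaN_bound N k : (0 < N)%N -> (0 < k <= N)%N -> `|lambdaN Lambda N k| <= B.
Proof.
move=> N0 /andP[k0 kN]; have NR : 0 < N%:R :> R by rewrite ltr0n.
have u0 : 0 <= (k%:R - 1) / N%:R :> R by rewrite divr_ge0 ?(ltW NR)// subr_ge0 ler1n.
have uv : (k%:R - 1) / N%:R <= k%:R / N%:R :> R by rewrite ler_pM2r ?invr_gt0// gerBl.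
have v1 : k%:R / N%:R <= 1 :> R by rewrite ler_pdivrMr// mul1r ler_nat.
have [c _] := clipLam_mvt HC1 u0 uv v1.
rewrite /clipLam !clip_id ?v1 ?(le_trans u0)// ?u0 ?(le_trans uv)// => h.
rewrite /lambdaN h -mulrBl (_ : k%:R - (k%:R - 1) = 1); last by ring.
rewrite mulrCA mul1r mulfV ?gt_eqF// mulr1; exact: lamB.
Qed.

Lemma lambdaN_clip N k : (0 < k <= N)%N -> lambdaN (clipLam Lambda) N k = lambdaN Lambda N k.
Proof.
move=> /andP[k0 kN]; have NR : 0 < N%:R :> R by rewrite ltr0n (leq_trans k0).
have v1 : k%:R / N%:R <= 1 :> R by rewrite ler_pdivrMr// mul1r ler_nat.
have u0 : 0 <= (k%:R - 1) / N%:R :> R by rewrite divr_ge0 ?(ltW NR)// subr_ge0 ler1n.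
have uv : (k%:R - 1) / N%:R <= k%:R / N%:R :> R by rewrite ler_pM2r ?invr_gt0// gerBl.
by rewrite /lambdaN /clipLam !clip_id ?v1 ?(le_trans u0)// ?u0 ?(le_trans uv).
Qed.

End rank_drift.

Section particles.
Context d (Omega : measurableType d) (R : realType) (P : probability Omega R).
Variables (T sigma B : R) (Lambda lambda : R -> R) (N : nat) (h : R) (G : R -> set (set Omega)).
Variables (xi : 'I_N -> {RV P >-> R}) (W X : 'I_N -> R -> {RV P >-> R}).
Hypothesis sigma_gt0 : 0 < sigma.
Hypothesis HC1 : C1_on01 Lambda lambda.
Hypothesis lamB : forall x, `|cliplam lambda x| <= B.
Hypothesis N_gt0 : (0 < N)%N.
Hypothesis Hsol : particle_solution T sigma Lambda h G xi W X.
Hypothesis Wbm : forall i, standard_brownian_motion (W i).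
Hypothesis Wind : forall i j, i != j ->
  independent2 P (sigma_family `[0, +oo[ (fun t => W i t)) (sigma_family `[0, +oo[ (fun t => W j t)).

Notation mu := (@lebesgue_measure R).

Let B_ge0 : 0 <= B. Proof. exact: le_trans (lamB 0). Qed.

Let mX i s : measurable_fun setT (X i s). Proof. exact: measurable_funPT. Qed.
Let mW i s : measurable_fun setT (W i s). Proof. exact: measurable_funPT. Qed.

Definition rank_drift s i w : R := lambdaN Lambda N (\sum_(j < N) (X j s w <= X i s w)%R)%N.

Lemma rank_drift_bound s i w : `|rank_drift s i w| <= B.
Proof. by apply: (lambdaN_bound HC1 lamB N_gt0); exact: (rank_pos (fun j => X j s w)). Qed.

Lemma bm_rank_drift s i : bm (rank_drift s i).
Proof.
split; last by exists B => w; exact: rank_drift_bound.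
by apply: (@measurable_rank_function _ _ _ (lambdaN Lambda N) N (fun j => X j s)) => j; exact: mX.
Qed.

Let Gs s : 0 <= s -> <<s G s >> = G s.
Proof. by move=> s0; apply: sigma_algebra_id; have [h1 _ _] := particle_filtration Hsol; exact: h1. Qed.

Lemma particle_filtration_measurable s : 0 <= s -> <<s G s >> `<=` measurable.
Proof. by move=> s0; rewrite Gs//; have [_ h2 _] := particle_filtration Hsol; exact: h2. Qed.

Lemma particle_filtration_mono u s : 0 <= u -> u <= s -> <<s G u >> `<=` <<s G s >>.
Proof.
move=> u0 us; rewrite !Gs//; last exact: le_trans us.
by have [_ _ h3] := particle_filtration Hsol; exact: h3.
Qed.

Lemma gmeas_particle s i : 0 <= s <= T -> gmeas (G s) (X i s).
Proof.
by move=> sT; apply: gmeas_sigma_rv => A /(particle_adapted Hsol sT) hA; exact: sub_sigma_algebra.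
Qed.

Lemma gmeas_rank_drift s i : 0 <= s <= T -> gmeas (G s) (rank_drift s i).
Proof.
move=> sT; apply: (@measurable_rank_function _ (g_sigma_algebraType (G s)) _ (lambdaN Lambda N) N (fun j => X j s)) => j.
exact: gmeas_particle.
Qed.

Lemma gmeas_particle_noise u s i : 0 <= u -> u <= s -> gmeas (G s) (W i u).
Proof.
move=> u0 us; apply: (gmeas_sub (particle_filtration_mono u0 us)).
by apply: gmeas_sigma_rv => A /(particle_noise_adapted Hsol u0) hA; exact: sub_sigma_algebra.
Qed.

Definition scaled_noise u s i w : R := sigma * (W i s w - W i u w).

Lemma measurable_scaled_noise u s i : measurable_fun setT (scaled_noise u s i).
Proof. by apply: measurable_funM => //; exact: measurable_funB. Qed.

Lemma scaled_noise_law u s i : 0 <= u -> u < s -> gauss_law P (scaled_noise u s i) (sigma * Num.sqrt (s - u)).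
Proof. by move=> u0 us; apply: brownian_gauss_law. Qed.

Let noise_family u s i (C : set (measurableTypeR R)) : measurable C ->
  sigma_family [set: 'I_N] (fun i w => W i s w - W i u w) (scaled_noise u s i @^-1` C).
Proof.
move=> mC; apply: (sub_sigma_family (G := generators [set: 'I_N] (fun i w => W i s w - W i u w)) (D := [set: unit]) (Z := fun=> (fun w => W i s w - W i u w))).
  by move=> _ _; exact: (@gmeas_generators _ _ _ _ [set: 'I_N] (fun i w => W i s w - W i u w)).
exact: scaled_preimage_sigma_rv.
Qed.

Lemma indep_scaled_noise u s i : 0 <= u -> u < s -> indep_of P (G u) (scaled_noise u s i).
Proof.
move=> u0 us S C GS mC; rewrite Gs// in GS.
by have := particle_noise_increments Hsol u0 us (@noise_family u s i C mC) GS; rewrite setIC muleC.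
Qed.

Let noise_whole u s i (C : set (measurableTypeR R)) : 0 <= u -> u < s -> measurable C ->
  sigma_family `[0, +oo[ (fun t => W i t) (scaled_noise u s i @^-1` C).
Proof.
move=> u0 us mC.
apply: (sub_sigma_family (G := generators `[0, +oo[ (fun t => W i t)) (D := [set: unit]) (Z := fun=> (fun w => W i s w - W i u w))).
  have gW v : 0 <= v -> gmeas (generators `[0, +oo[ (fun t => W i t)) (W i v).
    by move=> v0; apply: (@gmeas_generators _ _ _ _ `[0, +oo[ (fun t => W i t)); rewrite /= in_itv/= v0.
  by move=> _ _; apply: measurable_funB; apply: gW => //; exact: le_trans (ltW us).
exact: scaled_preimage_sigma_rv.
Qed.

(** The filtration makes the family of increments jointly independent of G u; the independence of
    the two Brownian motions then separates i from j. *)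
Lemma indep_scaled_noise2 u s i j : 0 <= u -> u < s -> i != j ->
  indep_of P (G u `|` preimage_set_system setT (scaled_noise u s i : Omega -> measurableTypeR R) measurable)
    (scaled_noise u s j).
Proof.
move=> u0 us ij S C GS mC.
have mC' k (D : set (measurableTypeR R)) : measurable D -> measurable (scaled_noise u s k @^-1` D).
  by move=> mD; rewrite -[_ @^-1` _]setTI; exact: measurable_scaled_noise.
have Gu : sigma_algebra setT (G u) by have [h1 _ _] := particle_filtration Hsol; exact: h1.
apply: (@indep_join _ _ _ P (G u) (preimage_set_system setT (scaled_noise u s i : Omega -> measurableTypeR R) measurable)) => //.
- by rewrite -(Gs u0); exact: sigma_algebra_setI_closed.
- move=> _ _ [D1 mD1 <-] [D2 mD2 <-]; exists (D1 `&` D2); first exact: measurableI.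
  by rewrite !setTI preimage_setI.
- by rewrite -(Gs u0); exact: sigma_algebra_setT.
- by exists setT => //; rewrite preimage_setT setIT.
- by rewrite -{1}(Gs u0); exact: particle_filtration_measurable.
- by move=> _ [D mD <-]; rewrite setTI; exact: mC'.
- exact: mC'.
move=> S1 _ GS1 [D mD <-]; rewrite setTI.
have ninc := particle_noise_increments Hsol u0 us.
have nD := @noise_family u s i D mD; have nC := @noise_family u s j C mC.
have nDC := sigma_algebra_setI_closed nD nC.
have e1 := ninc _ _ nDC GS1; have e2 := ninc _ _ nD GS1.
have e3 := Wind ij (@noise_whole u s i D u0 us mD) (@noise_whole u s j C u0 us mC).
by rewrite -setIA setIC e1 e3 [in RHS]setIC e2 muleAC.
Qed.

Let drift i s w := rank_drift (tau h s) i w.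

Lemma particle_increment i : {ae P, forall w, forall u s l r, 0 <= u -> u <= s -> s <= T ->
  (forall v, u < v <= s -> l <= rank_drift (tau h v) i w <= r) ->
  l * (s - u) <= X i s w - X i u w - scaled_noise u s i w <= r * (s - u)}.
Proof. exact: (drift_increment (fun s w _ => rank_drift_bound (tau h s) i w) (particle_eq Hsol i)). Qed.

Lemma particle_increment_norm i : {ae P, forall w, forall u s, 0 <= u -> u <= s -> s <= T ->
  `|X i s w - X i u w - scaled_noise u s i w| <= B * (s - u)}.
Proof. exact: (drift_increment_norm (fun s w _ => rank_drift_bound (tau h s) i w) (particle_eq Hsol i)). Qed.

Lemma particle_start i : 0 <= T -> {ae P, forall w, X i 0 w = xi i w}.
Proof.
move=> T0; have [W0 _ _ _] := Wbm i.
apply: filterS2 (particle_eq Hsol i) W0 => w -> //; last by rewrite lexx.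
by move=> ->; rewrite mulr0 addr0 set_itv1 /Rintegral integral_set1 addr0.
Qed.

(** Given the past and the noise of j, the difference still contains the independent Gaussian
    increment of i; the two drifts enlarge the radius by 2 B dl. *)
Lemma particle_small_ball i j s r dl : i != j -> 0 < dl -> dl <= s -> s <= T -> 0 < r ->
  \int[P]_w ind `|X i s w - X j s w| r <= 3 * (r + 2 * B * dl) / (sigma * Num.sqrt dl).
Proof.
move=> ij d0 ds sT r0; set u := s - dl.
have u0 : 0 <= u by rewrite subr_ge0.
have us : u < s by rewrite gtrBl.
have sdl : s - u = dl by rewrite /u; ring.
have uT : 0 <= u <= T by rewrite u0 (le_trans (ltW us)).
pose H := G u `|` preimage_set_system setT (scaled_noise u s j : Omega -> measurableTypeR R) measurable.
have Hm : <<s H >> `<=` measurable.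
  apply: smallest_sub; first exact: sigma_algebra_measurable.
  move=> A [GA|[C mC <-]]; first by apply: (particle_filtration_measurable u0); exact: sub_sigma_algebra.
  exact: measurable_scaled_noise.
have sub : <<s G u >> `<=` <<s H >> by apply: g_sigma_sub => A GA; apply: sub_sigma_algebra; left.
have gA : gmeas H (fun w => X i u w - X j u w - scaled_noise u s j w).
  apply: measurable_funB; first by apply: measurable_funB; apply: (gmeas_sub sub); exact: gmeas_particle.
  by move=> _ C mC; apply: sub_sigma_algebra; right; exists C.
have b0 : 0 < sigma * Num.sqrt dl by rewrite mulr_gt0// sqrtr_gt0.
have rB0 : 0 < r + 2 * B * dl by rewrite ltr_pwDl// !mulr_ge0// ltW.
have lB := scaled_noise_law i u0 us; rewrite sdl in lB.
have ji : j != i by rewrite eq_sym.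
have := small_ball Hm (@measurable_scaled_noise u s i) (indep_scaled_noise2 u0 us ji) lB gA b0 rB0.
apply: le_trans.
apply: Ex_le_ae => [| | | |]; try (by move=> w; exact: ind_ge0).
- by apply: bm_ind; [apply: measurableT_comp => //; exact: measurable_funB|exact: measurable_cst].
- apply: bm_ind; last exact: measurable_cst.
  apply: measurableT_comp => //; apply: measurable_funD; last exact: measurable_scaled_noise.
  by apply: measurable_funB; [exact: measurable_funB|exact: measurable_scaled_noise].
apply: filterS2 (particle_increment_norm i) (particle_increment_norm j) => w /(_ u s u0 (ltW us) sT) hi /(_ u s u0 (ltW us) sT) hj.
rewrite sdl in hi hj; rewrite /ind ler_nat; case: (leP `|X i s w - X j s w| r) => // h1.
rewrite (_ : (_ <= _)%R = true)//.
have -> : X i u w - X j u w - scaled_noise u s j w + scaled_noise u s i w =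
  (X i s w - X j s w) - ((X i s w - X i u w - scaled_noise u s i w) - (X j s w - X j u w - scaled_noise u s j w)) by ring.
apply: le_trans (ler_normB _ _) _; apply: lerD => //.
by apply: le_trans (ler_normB _ _) _; apply: le_trans (lerD hi hj) _; lra.
Qed.

(* [particle_small_ball] with [dl = eta] and [r = 2 eta]. *)
Lemma particle_small_gap i j s eta : i != j -> 0 < eta -> eta <= s -> s <= T ->
  \int[P]_w ind `|X i s w - X j s w| (2 * eta) <= 6 * (1 + B) / sigma * Num.sqrt eta.
Proof.
move=> ij e0 es sT; have e20 : 0 < 2 * eta by rewrite mulr_gt0.
apply: le_trans (particle_small_ball ij e0 es sT e20) _.
rewrite le_eqVlt; apply/orP; left; apply/eqP.
have q0 : Num.sqrt eta != 0 by rewrite gt_eqF// sqrtr_gt0.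
have qq : eta = Num.sqrt eta * Num.sqrt eta by rewrite -expr2 sqr_sqrtr// ltW.
rewrite {1 2}qq; move: (Num.sqrt eta) q0 => q q0.
by field; rewrite q0 gt_eqF.
Qed.

Lemma small_gap_limit e : 0 < e -> exists2 eta0 : R, 0 < eta0 &
  forall eta, 0 < eta -> eta <= eta0 -> 6 * (1 + B) / sigma * Num.sqrt eta <= e.
Proof.
move=> e0; have k0 : 0 < 6 * (1 + B) / sigma.
  by apply: divr_gt0 => //; apply: mulr_gt0; [rewrite ltr0n|rewrite ltr_pwDl].
exists ((e / (6 * (1 + B) / sigma)) ^+ 2); first by rewrite exprn_gt0// divr_gt0.
move=> eta h0 h1; rewrite -ler_pdivlMl// mulrC.
rewrite -[leRHS]ger0_norm; last by rewrite divr_ge0// ltW.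
by rewrite -sqrtr_sqr; exact: ler_wsqrtr.
Qed.

Lemma particle_no_ties i j s : i != j -> 0 < s -> s <= T -> {ae P, forall w, X i s w != X j s w}.
Proof.
move=> ij s0 sT; pose D := (fun w => X i s w - X j s w) @^-1` [set 0].
have mD : measurable D.
  by rewrite -[D]setTI; apply: measurable_funB.
exists D; split => //; last first.
  by move=> w /= /negP; rewrite negbK => /eqP e; rewrite /D/= e subrr.
apply/eqP; rewrite eq_le measure_ge0 andbT; apply/lee_addgt0Pr => e e0; rewrite add0e.
have [eta0 h0 hQ] := small_gap_limit e0.
have m0 : 0 < Num.min eta0 s by rewrite lt_min h0.
have ms : Num.min eta0 s <= s by rewrite ge_min lexx orbT.
have := le_trans (particle_small_gap ij m0 ms sT) (hQ _ m0 _); rewrite ge_min lexx => /(_ isT) he.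
have bi : bm (fun w => ind `|X i s w - X j s w| (2 * Num.min eta0 s)).
  by apply: bm_ind; [apply: measurableT_comp => //; exact: measurable_funB|exact: measurable_cst].
rewrite -(@fineK _ (P D)) ?fin_num_measure// lee_fin; apply: le_trans he; rewrite -(Ex_indic P mD).
apply: (Ex_le P (bm_indic R mD) bi) => w; rewrite indicE; case: (boolP (w \in D)) => [|_]; last exact: ind_ge0.
rewrite inE /D/= => ->; rewrite normr0 /ind; have -> : 0 <= 2 * Num.min eta0 s by rewrite mulr_ge0// ltW.
by [].
Qed.

Lemma particle_injective s : 0 < s -> s <= T -> {ae P, forall w, injective (fun i => X i s w)}.
Proof.
move=> s0 sT.
have : {ae P, forall w, forall p : 'I_N * 'I_N, p.1 != p.2 -> X p.1 s w != X p.2 s w}.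
  apply: filter_forall => -[i j]/=; case: (eqVneq i j) => [_|ij]; first exact: aeW.
  by apply: filterS (particle_no_ties ij s0 sT) => w hw _.
by apply: filterS => w hw i j /eqP e; apply/eqP; apply/negP => /negP ij; have := hw (i, j) ij; rewrite e.
Qed.

End particles.

(** * Freezing errors of the rank drift *)

Section particle_grid_errors.
Context d (Omega : measurableType d) (R : realType) (P : probability Omega R).
Variables (T sigma B : R) (Lambda lambda : R -> R) (N : nat) (h : R) (G : R -> set (set Omega)).
Variables (xi : 'I_N -> {RV P >-> R}) (W X : 'I_N -> R -> {RV P >-> R}).
Hypothesis T_gt0 : 0 < T.
Hypothesis sigma_gt0 : 0 < sigma.
Hypothesis HC1 : C1_on01 Lambda lambda.
Hypothesis lamB : forall x, `|cliplam lambda x| <= B.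
Hypothesis N_gt0 : (0 < N)%N.
Hypothesis Hsol : particle_solution T sigma Lambda h G xi W X.
Hypothesis Wbm : forall i, standard_brownian_motion (W i).
Hypothesis Wind : forall i j, i != j ->
  independent2 P (sigma_family `[0, +oo[ (fun t => W i t)) (sigma_family `[0, +oo[ (fun t => W j t)).

Let B_ge0 : 0 <= B. Proof. exact: le_trans (lamB 0). Qed.
Let mX i s : measurable_fun setT (X i s). Proof. exact: measurable_funPT. Qed.

Definition step_error delta t n i k w : R :=
  X i (tk delta t n k.+1) w - (X i (tk delta t n k) w +
    dtk delta t n k * rank_drift Lambda X (tk delta t n k) i w +
    scaled_noise sigma W (tk delta t n k) (tk delta t n k.+1) i w).

Let crude delta t n i k w : 0 < delta -> n%:R * delta < t -> t <= T ->
  (forall u s, 0 <= u -> u <= s -> s <= T -> `|X i s w - X i u w - scaled_noise sigma W u s i w| <= B * (s - u)) ->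
  `|step_error delta t n i k w| <= 2 * B * dtk delta t n k.
Proof.
move=> d0 nt tT H; have u0 := tk_ge0 d0 nt k.
have us := tk_le d0 nt (leqnSn k); have sT := le_trans (tk_let d0 nt k.+1) tT.
have := H _ _ u0 us sT; rewrite -/(dtk delta t n k) => h1.
have dk := dtk_ge0 d0 nt k.
have hb := rank_drift_bound X HC1 lamB N_gt0 (tk delta t n k) i w.
rewrite (_ : step_error _ _ _ _ _ _ = (X i (tk delta t n k.+1) w - X i (tk delta t n k) w - scaled_noise sigma W (tk delta t n k) (tk delta t n k.+1) i w) -
  dtk delta t n k * rank_drift Lambda X (tk delta t n k) i w); last by rewrite /step_error; ring.
apply: le_trans (ler_normB _ _) _; rewrite (normrM (dtk delta t n k)) (ger0_norm dk).
by have := ler_wpM2l dk hb; lra.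
Qed.

Lemma step_error_crude delta t n i : 0 < delta -> n%:R * delta < t -> t <= T ->
  {ae P, forall w, forall k, `|step_error delta t n i k w| <= 2 * B * dtk delta t n k}.
Proof.
move=> d0 nt tT.
by apply: filterS (particle_increment_norm HC1 lamB N_gt0 Hsol i) => w H k; exact: crude.
Qed.

(* The frozen drift changes at the right endpoint of the step, hence the detour through times [s' < s]. *)
Lemma step_error_euler t n i : 0 < h -> n%:R * h < t -> t <= n.+1%:R * h -> t <= T ->
  {ae P, forall w, forall k : 'I_n.+1, step_error h t n i k w = 0}.
Proof.
move=> h0 nt tn tT.
apply: filterS2 (particle_increment HC1 lamB N_gt0 Hsol i) (particle_increment_norm HC1 lamB N_gt0 Hsol i) => w H1 H2 k.
apply/eqP; rewrite -normr_le0; apply/ler_addgt0Pr => e e0; rewrite add0r.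
have kn : (k <= n)%N by rewrite -ltnS.
have u0 := tk_ge0 h0 nt k; have us : tk h t n k < tk h t n k.+1.
  by rewrite -subr_gt0; exact: (dtk_gt0 h0 nt).
have sT := le_trans (tk_let h0 nt k.+1) tT.
have uE := tkE h t kn.
have sk : tk h t n k.+1 <= k.+1%:R * h.
  rewrite /tk; case: ifP => // kn'; move: kn; rewrite leq_eqVlt kn' orbF => /eqP ->; exact: tn.
rewrite /step_error /dtk; set u := tk h t n k in uE u0 us *; set s := tk h t n k.+1 in us sT sk *.
have B1 : 0 < 2 * B + 1 by rewrite ltr_wpDl// mulr_ge0.
pose s' := Num.max u (s - e / (2 * B + 1)).
have us' : u <= s' by rewrite le_max lexx.
have s's : s' < s by rewrite gt_max us gtrBl divr_gt0.
have ss' : s - s' <= e / (2 * B + 1).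
  have : s - e / (2 * B + 1) <= s' by rewrite /s' le_max lexx orbT.
  lra.
set c := rank_drift Lambda X u i w.
(* Since v <= s' < s <= (k + 1) h, the last scheme time before v is k h. *)
have tauE v : u < v <= s' -> rank_drift Lambda X (tau h v) i w = c.
  move=> /andP[uv vs]; rewrite /c /tau gt_eqF// (@floor_def _ _ k%:Z) -?uE//.
  rewrite ler_pdivlMr// ltr_pdivrMr// -pmulrn -uE (ltW uv)/= intrD -pmulrn natr1.
  by apply: lt_le_trans sk; exact: le_lt_trans s's.
have Hc v : u < v <= s' -> c <= rank_drift Lambda X (tau h v) i w <= c by move=> uv; rewrite (tauE v uv) lexx.
have /andP[h1 h2] := H1 u s' c c u0 us' (le_trans (ltW s's) sT) Hc.
have s'0 : 0 <= s' by exact: le_trans us'.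
have := H2 s' s s'0 (ltW s's) sT.
have cB : `|c| <= B by exact: (rank_drift_bound X HC1 lamB N_gt0).
have E : X i s w - (X i u w + (s - u) * c + scaled_noise sigma W u s i w) =
  (X i s w - X i s' w - scaled_noise sigma W s' s i w) - c * (s - s').
  have h3 : X i s' w - X i u w - scaled_noise sigma W u s' i w = c * (s' - u) by apply/eqP; rewrite eq_le h1 h2.
  have -> : X i s' w = c * (s' - u) + X i u w + scaled_noise sigma W u s' i w by rewrite -h3; ring.
  by rewrite /scaled_noise; ring.
move=> h3; rewrite E; apply: le_trans (ler_normB _ _) _.
have ss0 : 0 <= s - s' by rewrite subr_ge0 ltW.
rewrite normrM (ger0_norm ss0); have := ler_wpM2r ss0 cB => h4.
apply: le_trans (lerD h3 h4) _.
rewrite -mulrDl -mulr2n -mulr_natl.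
apply: le_trans (ler_wpM2l _ ss') _; first by rewrite mulr_ge0.
rewrite mulrCA ler_piMr ?(ltW e0)// ler_pdivrMr// mul1r lerDl//.
Qed.

(** During a step the rank of i can change only if the step starts before e1, some path oscillates
    by more than eta, or another particle starts within 2 eta of i. The majorant q charges 2 B times
    the step length to each of these events. The threshold dl may depend on N, which is fixed when
    the grid is refined. *)
Lemma step_error_continuous i e : h = 0 -> 0 < e -> exists2 dl : R, 0 < dl &
  forall delta t n, 0 < delta -> n%:R * delta < t -> t <= n.+1%:R * delta -> t <= T -> delta <= dl ->
  exists q : Omega -> R, [/\ bm q, forall w, 0 <= q w, \int[P]_w q w <= e &
    {ae P, forall w, \sum_(k < n.+1) `|step_error delta t n i k w| <= q w}].
Proof.
(* 2 N T pays for the oscillations and the small gaps, 2 for the steps starting before e1; the last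
   1 keeps C positive. *)
move=> h0 e0; pose C := 2 * B * (2 * T * N%:R + 2) + 1.
have C0 : 0 < C by rewrite ltr_wpDl// !mulr_ge0// addr_ge0// !mulr_ge0// ltW.
pose e1 := e / C; have e10 : 0 < e1 by rewrite divr_gt0.
have [eta0 he0 hQ] := small_gap_limit sigma_gt0 lamB e10.
pose eta := Num.min eta0 e1.
have eta_gt0 : 0 < eta by rewrite lt_min he0.
have hosc j := small_oscillation T_gt0 (@mX j) (particle_continuous Hsol j) eta_gt0 e10.
have /choice[dlO hdlO] : forall j, exists p : R * set Omega, [/\ 0 < p.1, measurable p.2, (P p.2 <= e1%:E)%E &
    forall w, ~ p.2 w -> forall s s' : R, 0 <= s <= T -> 0 <= s' <= T -> `|s - s'| <= p.1 -> `|X j s w - X j s' w| <= eta].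
  by move=> j; have [dl d0 [Ob [m1 m2 m3]]] := hosc j; exists (dl, Ob).
(* All particles count, since any of them may cross i; the default e1 also enforces delta <= e1. *)
pose dl0 := \big[Num.min/e1]_(j < N) (dlO j).1.
exists dl0.
  by rewrite /dl0; elim/big_ind: _ => // [x y x0 y0|j _]; [rewrite lt_min x0|case: (hdlO j)].
move=> delta t n d0 nt tn tT ddl.
have de1 : delta <= e1 by apply: le_trans ddl _; exact: bigmin_le_id.
have dej j : delta <= (dlO j).1 by apply: le_trans ddl _; exact: bigmin_le_cond.
have tkT k : tk delta t n k <= T by apply: le_trans tT; exact: (tk_let d0 nt).
pose gap k j w : R := if (e1 <= tk delta t n k) && (j != i) then ind `|X i (tk delta t n k) w - X j (tk delta t n k) w| (2 * eta) else 0.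
pose bad w : R := \sum_(j < N) \1_((dlO j).2) w.
pose term k w : R := bad w + ((tk delta t n k < e1)%R : bool)%:R + \sum_(j < N) gap k j w.
pose q w := 2 * B * \sum_(k < n.+1) dtk delta t n k * term k w.
have bgap k j : bm (gap k j).
  rewrite /gap; case: (boolP ((e1 <= tk delta t n k) && (j != i))) => _; last exact: bm_cst.
  by apply: bm_ind; [apply: measurableT_comp => //; exact: measurable_funB|exact: measurable_cst].
have bind j : bm (fun w => \1_((dlO j).2) w : R) by apply: bm_indic; case: (hdlO j).
have bbad : bm bad by apply: bm_sum => j.
have bgaps k : bm (fun w => \sum_(j < N) gap k j w) by apply: bm_sum.
have bcst (c : R) := bm_cst Omega c.
have bt1 k : bm (fun w => bad w + ((tk delta t n k < e1)%R : bool)%:R) by exact: bmD.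
have bterm k : bm (term k) by exact: bmD.
have bdt k : bm (fun w => dtk delta t n k * term k w) by exact: bmM.
have bs : bm (fun w => \sum_(k < n.+1) dtk delta t n k * term k w) by apply: bm_sum => k.
have gap0 k j w : 0 <= gap k j w by rewrite /gap; case: ifP => // _; exact: ind_ge0.
have bad0 w : 0 <= bad w by apply: sumr_ge0 => j _; rewrite indicE.
have term0 k w : 0 <= term k w by rewrite !addr_ge0// sumr_ge0.
have B20 : 0 <= 2 * B by rewrite mulr_ge0.
exists q; split.
- exact: bmM.
- by move=> w; apply: mulr_ge0 => //; apply: sumr_ge0 => k _; apply: mulr_ge0 => //; exact: (dtk_ge0 d0 nt).
- rewrite /q (ExZ P _ bs) (Ex_sum P _ (fun k : 'I_n.+1 => bdt k)).
  have sumc : N%:R * e1 = \sum_(j < N) e1 by rewrite sumr_const card_ord mulr_natl.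
  have Ebad : \int[P]_w bad w <= N%:R * e1.
    rewrite (Ex_sum P _ bind) sumc.
    apply: ler_sum => j _; have [_ mO PO _] := hdlO j.
    by rewrite (Ex_indic P mO) -lee_fin fineK// fin_num_measure.
  have Egap k : \int[P]_w (\sum_(j < N) gap k j w) <= N%:R * e1.
    rewrite (Ex_sum P _ (bgap k)) sumc.
    apply: ler_sum => j _; rewrite /gap; case: (boolP (_ && _)) => [/andP[k1 k2]|_]; last by rewrite Ex_cst ltW.
    apply: le_trans (hQ eta eta_gt0 _); last by rewrite ge_min lexx.
    apply: (particle_small_gap sigma_gt0 HC1 lamB N_gt0 Hsol Wbm Wind _ eta_gt0) => //; first by rewrite eq_sym.
    by apply: le_trans k1; rewrite ge_min lexx orbT.
  have Eterm k : \int[P]_w (dtk delta t n k * term k w) <= dtk delta t n k * (2 * N%:R * e1) + dtk delta t n k * ((tk delta t n k < e1)%R : bool)%:R.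
    rewrite (ExZ P _ (bterm k)) (ExD P (bt1 k) (bgaps k)) (ExD P bbad (bcst _)) Ex_cst -mulrDr.
    by rewrite ler_wpM2l ?(dtk_ge0 d0 nt)//; have := Egap k; lra.
  apply: (@le_trans _ _ (2 * B * (T * (2 * N%:R * e1) + (e1 + delta)))).
    rewrite ler_wpM2l//; apply: (@le_trans _ _ (\sum_(k < n.+1) (dtk delta t n k * (2 * N%:R * e1) + dtk delta t n k * ((tk delta t n k < e1)%R : bool)%:R))).
      by apply: ler_sum => k _; exact: Eterm.
    rewrite big_split/= -mulr_suml sum_dtk; apply: lerD; last exact: (sum_dtk_before d0 nt tn (ltW e10)).
    by apply: ler_wpM2r => //; apply: mulr_ge0; [apply: mulr_ge0|exact: ltW].
  apply: (@le_trans _ _ (C * e1)); last by rewrite /e1 mulrC divfK// gt_eqF.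
  have h1 : 2 * B * (e1 + delta) <= 2 * B * (2 * e1) by rewrite ler_wpM2l//; lra.
  rewrite /C; move: h1 (ltW e10); lra.
have hall : {ae P, forall w, forall j, forall u s l r, 0 <= u -> u <= s -> s <= T ->
    (forall v, u < v <= s -> l <= rank_drift Lambda X (tau h v) j w <= r) ->
    l * (s - u) <= X j s w - X j u w - scaled_noise sigma W u s j w <= r * (s - u)}.
  by apply: filter_forall => j; exact: (particle_increment HC1 lamB N_gt0 Hsol j).
apply: filterS2 hall (step_error_crude i d0 nt tT) => w H1 H2.
rewrite /q mulr_sumr; apply: ler_sum => k _.
set u := tk delta t n k.
have cr : 1 <= term k w -> `|step_error delta t n i k w| <= 2 * B * (dtk delta t n k * term k w).
  move=> t1; apply: le_trans (H2 k) _; rewrite mulrA ler_peMr//.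
  by rewrite mulr_ge0// (dtk_ge0 d0 nt).
have gs0 : 0 <= \sum_(j < N) gap k j w by apply: sumr_ge0 => j _; exact: gap0.
case: (ltP u e1) => ue.
  by apply: cr; rewrite /term -/u ue /= mulr1n; have := bad0 w; have := gs0; lra.
have [[j wO]|nO] := pselect (exists j, (dlO j).2 w).
  have : 1 <= bad w.
    rewrite /bad (bigD1 j)//= indicE mem_set// lerDl; apply: sumr_ge0 => j' _; by rewrite indicE.
  move=> b1; apply: cr; rewrite /term; have := gs0.
  have : 0 <= ((tk delta t n k < e1)%R : bool)%:R :> R by [].
  lra.
have [[j [ji jgap]]|ngap] := pselect (exists j, j != i /\ `|X i u w - X j u w| <= 2 * eta).
  have : 1 <= \sum_(j < N) gap k j w.
    have gj : gap k j w = 1 by rewrite /gap ue ji/= /ind jgap.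
    rewrite (bigD1 j)//= gj lerDl; apply: sumr_ge0 => j' _; exact: gap0.
  move=> g1; apply: cr; rewrite /term; have := bad0 w.
  have : 0 <= ((tk delta t n k < e1)%R : bool)%:R :> R by [].
  lra.
have u0 := tk_ge0 d0 nt k; have us := tk_le d0 nt (leqnSn k).
rewrite -/u in u0 us; set s := tk delta t n k.+1 in us.
have close j v : u < v <= s -> `|X j v w - X j u w| <= eta.
  move=> /andP[uv vs]; have [_ _ _ hj] := hdlO j; apply: hj.
  - by move=> wO; apply: nO; exists j.
  - by rewrite (le_trans u0 (ltW uv)) (le_trans vs)// tkT.
  - by rewrite u0 tkT.
  - rewrite ger0_norm ?subr_ge0 ?(ltW uv)//; apply: le_trans (dej j).
    by apply: le_trans (dtk_le d0 tn k); rewrite /dtk -/u -/s lerD2r.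
have same v : u < v <= s -> rank_drift Lambda X (tau h v) i w = rank_drift Lambda X u i w.
  move=> uvs; rewrite /rank_drift h0 /tau eqxx; congr (lambdaN _ _ _).
  apply: eq_bigr => j _; congr nat_of_bool.
  have [->|ji] := eqVneq j i; first by rewrite !lexx.
  (* Two particles more than 2 eta apart that each move by at most eta keep their order. *)
  have hg : 2 * eta < `|X i u w - X j u w|.
    by rewrite ltNge; apply/negP => hle; apply: ngap; exists j.
  have := close i v uvs; have := close j v uvs; rewrite !ler_norml => /andP[c1 c2] /andP[c3 c4].
  case: (leP (X j u w) (X i u w)) => hu.
    by move: hg; rewrite ger0_norm ?subr_ge0// => hg; apply/idP; lra.
  by move: hg; rewrite ltr0_norm ?subr_lt0// => hg; apply/negbTE; rewrite -ltNge; lra.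
have Hc v : u < v <= s -> rank_drift Lambda X u i w <= rank_drift Lambda X (tau h v) i w <= rank_drift Lambda X u i w.
  by move=> uv; rewrite (same v uv) lexx.
have /andP[h1 h2] := H1 i u s _ _ u0 us (tkT _) Hc.
have -> : step_error delta t n i k w = 0.
  have h3 : X i s w - X i u w - scaled_noise sigma W u s i w = rank_drift Lambda X u i w * (s - u) by apply/eqP; rewrite eq_le h1 h2.
  rewrite /step_error -/u -/s /dtk -/u -/s.
  transitivity ((X i s w - X i u w - scaled_noise sigma W u s i w) - rank_drift Lambda X u i w * (s - u)); first by ring.
  by rewrite h3 subrr.
rewrite normr0; apply: mulr_ge0 => //; apply: mulr_ge0 => //; exact: (dtk_ge0 d0 nt).
Qed.

End particle_grid_errors.

(** * The mild equation of the empirical distribution function *)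

Section empirical_convolution.
Variable R : realType.
Notation mu := (@lebesgue_measure R).

(** The formula of [mild] for an arbitrary family F, so that the limit and each realization of the
    particles are instances of one expression. *)
Definition mild_residual (sigma : R) (L : R -> R) (F : R -> R -> R) delta t n (x : R) : R :=
  F t x - heat (sigma * Num.sqrt t) (F 0) x +
  \sum_(1 <= k < n) delta * dconv (sigma * Num.sqrt (t - k%:R * delta)) (fun y => L (F (k%:R * delta) y) - L 0) x.

Lemma bm_weighted_ind N (c x : 'I_N -> R) (s : seq 'I_N) :
  bm ((fun y => \sum_(i <- s) c i * ind (x i) y) : measurableTypeR R -> R).
Proof. by apply: bm_sum => i; apply: bmM; [exact: bm_cst|apply: bm_ind => //; exact: measurable_cst]. Qed.

Lemma dconv_weighted_ind N (c x : 'I_N -> R) s z : 0 < s ->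
  dconv s (fun y => \sum_(i < N) c i * ind (x i) y) z = \sum_(i < N) c i * gk s (z - x i).
Proof.
move=> s0; rewrite /dconv; elim: (index_enum _) => [|i r ih].
  rewrite big_nil; under eq_Rintegral do rewrite big_nil mulr0.
  by rewrite /Rintegral integral0.
rewrite big_cons -ih -(Rintegral_dgk_ind z (x i) s0).
rewrite -RintegralZl//; last exact: integrable_dgk_ind.
rewrite -RintegralD//.
- by apply: eq_Rintegral => y _; rewrite big_cons mulrDr mulrCA.
- have bi : bm ((fun y => c i * ind (x i) y) : measurableTypeR R -> R).
    by apply: bmM; [exact: bm_cst|apply: bm_ind => //; exact: measurable_cst].
  have := integrable_dgk_mul z s0 bi; apply: eq_integrable => // y _ /=; by rewrite mulrCA.
- exact: (integrable_dgk_mul z s0 (bm_weighted_ind c x r)).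
Qed.

Lemma heat_weighted_ind N (c x : 'I_N -> R) b z :
  heat b (fun y => \sum_(i < N) c i * ind (x i) y) z = \sum_(i < N) c i * Phi b (z - x i).
Proof.
have bi (i : 'I_N) : bm ((fun v => ind (x i) (z - b * v)) : measurableTypeR R -> R).
  by apply: bm_ind; [exact: measurable_cst|apply: measurable_funB => //; exact: measurable_funM].
rewrite /heat (Ex_sum (@gam R) _ (fun i => bmM (bm_cst _ (c i)) (bi i))).
apply: eq_bigr => i _; rewrite (ExZ _ _ (bi i)); congr (_ * _).
by apply: eq_Rintegral => v _; rewrite /ind !lerBrDr addrC.
Qed.

End empirical_convolution.

Section particle_mild.
Context d (Omega : measurableType d) (R : realType) (P : probability Omega R).
Variables (T sigma B : R) (Lambda lambda : R -> R) (N : nat) (h : R) (G : R -> set (set Omega)).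
Variables (xi : 'I_N -> {RV P >-> R}) (W X : 'I_N -> R -> {RV P >-> R}).
Hypothesis T_gt0 : 0 < T.
Hypothesis sigma_gt0 : 0 < sigma.
Hypothesis HC1 : C1_on01 Lambda lambda.
Hypothesis lamB : forall x, `|cliplam lambda x| <= B.
Hypothesis N_gt0 : (0 < N)%N.
Hypothesis Hsol : particle_solution T sigma Lambda h G xi W X.
Hypothesis Wbm : forall i, standard_brownian_motion (W i).
Hypothesis Wind : forall i j, i != j ->
  independent2 P (sigma_family `[0, +oo[ (fun t => W i t)) (sigma_family `[0, +oo[ (fun t => W j t)).
Variables (mi : 'I_N -> R) (M0 : R).
Hypothesis xi_moment : forall i, (\int[P]_w (weight (xi i w))%:E <= (mi i)%:E)%E.
Hypothesis mi_sum : \sum_(i < N) mi i <= N%:R * M0.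

Notation mu := (@lebesgue_measure R).
Notation L := (clipLam Lambda).

Let B_ge0 : 0 <= B. Proof. exact: le_trans (lamB 0). Qed.
Let mX i s : measurable_fun setT (X i s). Proof. exact: measurable_funPT. Qed.

Definition empirical_cdf w s y : R := N%:R^-1 * \sum_(i < N) ind (X i s w) y.

Notation Xg delta t n := (fun i k w => X i (tk delta t n k) w).
Notation cg delta t n := (fun i k w => rank_drift Lambda X (tk delta t n k) i w).
Notation Bg delta t n := (fun i k w => scaled_noise sigma W (tk delta t n k) (tk delta t n k.+1) i w).

Definition frozen_step delta t n i k w : R := Xg delta t n i k w + dtk delta t n k * cg delta t n i k w.

Definition particle_incr delta t n i k x w : R :=
  incr (ak sigma delta t n) (frozen_step delta t n) (Bg delta t n) i k x w.

Definition particle_remainder delta t n i x w : R :=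
  path_remainder n (ak sigma delta t n) (dtk delta t n) ((Xg delta t n i)^~ w) ((cg delta t n i)^~ w) ((Bg delta t n i)^~ w) x.

(** In the average over i, [sum_rank] turns the rank drifts below y into the sum of [lambdaN] over
    1, ..., n, which telescopes to Lambda at the empirical distribution function. The sum starts at
    k = 1, so ties at time 0 are harmless. *)
Lemma mild_residual_empirical delta t n w x : 0 < delta -> n%:R * delta < t ->
  (forall k, (0 < k < n)%N -> injective (fun i => X i (tk delta t n k) w)) ->
  mild_residual sigma L (empirical_cdf w) delta t n x =
  N%:R^-1 * \sum_(i < N) (particle_remainder delta t n i x w + \sum_(k < n.+1) particle_incr delta t n i k x w).
Proof.
move=> d0 nt inj.
transitivity (N%:R^-1 * \sum_(i < N) (ind (X i t w) x - Phi (sigma * Num.sqrt t) (x - X i 0 w) +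
    \sum_(1 <= k < n) dtk delta t n k * (cg delta t n i k w * gk (ak sigma delta t n k) (x - Xg delta t n i k w)))); last first.
  congr (_ * _); apply: eq_bigr => i _.
  rewrite /particle_remainder /path_remainder /particle_incr/= tkt// tk0 /ak tk0 subr0 /incr /frozen_step/=.
  by move: (\sum_(_ < _) _) => S; ring.
rewrite big_split sumrB/= mulrDr mulrBr; congr (_ - _ + _).
  rewrite /empirical_cdf (_ : (fun y => _) = (fun y => \sum_(i < N) N%:R^-1 * ind (X i 0 w) y)).
    by rewrite heat_weighted_ind mulr_sumr.
  by apply/funext => y; rewrite mulr_sumr.
rewrite exchange_big/= mulr_sumr; apply: eq_big_nat => k /andP[k1 kn].
have tE : tk delta t n k = k%:R * delta by rewrite tkE// ltnW.
rewrite -mulr_sumr mulrCA (dtkE _ _ kn); congr (_ * _).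
have s0 : 0 < ak sigma delta t n k by exact: (ak_gt0 sigma_gt0 d0 nt).
have -> : sigma * Num.sqrt (t - k%:R * delta) = ak sigma delta t n k by rewrite /ak tE.
rewrite mulr_sumr; under [RHS]eq_bigr do rewrite mulrA.
rewrite -(dconv_weighted_ind (fun i => N%:R^-1 * cg delta t n i k w) (fun i => Xg delta t n i k w) x s0).
congr (dconv _ _ x); apply/funext => y; rewrite -tE /empirical_cdf.
have -> : \sum_(i < N) ind (X i (tk delta t n k) w) y = (\sum_(j < N) (X j (tk delta t n k) w <= y)%R)%N%:R.
  by rewrite natr_sum.
rewrite mulrC -(sum_lambdaN L _ N_gt0).
have kn0 : (0 < k < n)%N by rewrite k1.
rewrite -(@sum_rank R N (fun j => X j (tk delta t n k) w) (lambdaN L N) y (inj k kn0)).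
rewrite mulr_sumr; apply: eq_bigr => i _; rewrite mulrA; congr (_ * _ * _).
by rewrite lambdaN_clip//; exact: (rank_pos (fun j => X j (tk delta t n k) w)).
Qed.

(** Initial position, noise and drift, separated by two uses of [weightD], whence 16; 256 comes from
    [gam_weight]. *)
Definition moment i : R := 16 * (mi i + 256 * weight (sigma * Num.sqrt T) + weight (2 * B * T)).

Lemma weight_moment (Y : Omega -> R) i s : measurable_fun setT Y -> 0 <= s -> s <= T ->
  {ae P, forall w, `|Y w - xi i w - scaled_noise sigma W 0 s i w| <= 2 * B * T} ->
  (\int[P]_w (weight (Y w))%:E <= (moment i)%:E)%E.
Proof.
move=> mY s0 sT hY; set Z := scaled_noise sigma W 0 s i in hY *.
have mZ : measurable_fun setT Z by exact: measurable_scaled_noise.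
have mw (f : Omega -> R) : measurable_fun setT f -> measurable_fun setT (fun w => weight (f w)).
  by move=> mf; exact: measurable_weight_comp.
have EZ : (\int[P]_w (weight (Z w))%:E <= (256 * weight (sigma * Num.sqrt T))%:E)%E.
  have w1 := weight_ge1 (sigma * Num.sqrt T).
  move: s0; rewrite le_eqVlt => /predU1P[s0|s0].
    have Z0 w : Z w = 0 by rewrite /Z /scaled_noise -s0 subrr mulr0.
    under eq_integral do rewrite Z0.
    rewrite integral_cst//= probability_setT mule1 lee_fin /weight normr0 addr0 sqrtr1 mulr1.
    apply: le_trans w1 _; rewrite ler_peMl ?weight_ge0//; by rewrite ler1n.
  have lZ := scaled_noise_law sigma Wbm i (lexx 0) s0; rewrite subr0 in lZ.
  have mwE : measurable_fun [set: R] (fun x : R => (weight x)%:E) by apply/measurable_EFinP; exact: measurable_weight.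
  rewrite (gauss_law_integral mZ lZ mwE); last by move=> x; rewrite lee_fin weight_ge0.
  set b := sigma * Num.sqrt s.
  have bT : weight b <= weight (sigma * Num.sqrt T).
    have b0 : 0 <= b by rewrite mulr_ge0// ltW.
    have bT : b <= sigma * Num.sqrt T by rewrite ler_wpM2l ?(ltW sigma_gt0)//; exact: ler_wsqrtr.
    by apply: le_weight; rewrite !ger0_norm// (le_trans b0).
  apply: (@le_trans _ _ (\int[@gam R]_v (weight b * weight v)%:E)%E).
    apply: ge0_le_integral_nomeas => v; first by rewrite lee_fin weight_ge0.
    by rewrite lee_fin weightM.
  rewrite (ge0_integral_cmul (@gam R) (weight_ge0 b) (@measurable_weight R) (@weight_ge0 R)).
  apply: le_trans (lee_wpmul2l _ (gam_weight R)) _; first by rewrite lee_fin weight_ge0.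
  rewrite -EFinM lee_fin [leLHS]mulrC; exact: (ler_wpM2l (ler0n R 256) bT).
pose c := weight (2 * B * T).
have c0 : 0 <= c by exact: weight_ge0.
have mxi : measurable_fun setT (xi i) by exact: measurable_funPT.
have m1 := measurable_funD (mw _ mxi) (mw _ mZ).
have m2 : measurable_fun setT (fun w => weight (xi i w) + weight (Z w) + c) by exact: (measurable_funD m1 (measurable_cst _)).
have p1 w : 0 <= weight (xi i w) + weight (Z w) by rewrite addr_ge0 ?weight_ge0.
have p2 w : 0 <= weight (xi i w) + weight (Z w) + c by rewrite addr_ge0.
have k16 : 0 <= 16 :> R by exact: ler0n.
apply: (@le_trans _ _ (\int[P]_w (16 * (weight (xi i w) + weight (Z w) + c))%:E)%E).
  apply: ae_ge0_le_integral => //.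
  - by move=> w _; rewrite lee_fin weight_ge0.
  - by apply/measurable_EFinP; exact: mw.
  - by move=> w _; rewrite lee_fin; apply: mulr_ge0.
  - by apply/measurable_EFinP; exact: measurable_funM.
  apply: filterS hY => w hw _; rewrite lee_fin.
  have -> : Y w = xi i w + (Z w + (Y w - xi i w - Z w)) by ring.
  have h1 := weightD (xi i w) (Z w + (Y w - xi i w - Z w)).
  have h2 := weightD (Z w) (Y w - xi i w - Z w).
  have h3 : weight (Y w - xi i w - Z w) <= c.
    by apply: le_weight; rewrite [leRHS]ger0_norm//; apply: mulr_ge0; [exact: mulr_ge0|exact: ltW].
  have := weight_ge0 (xi i w); move: h1 h2 h3 c0; lra.
rewrite (ge0_integral_cmul P k16 m2 p2) (ge0_integral_add P m1 p1 (measurable_cst _) (fun _ => c0)).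
rewrite (ge0_integral_add P (mw _ mxi) (fun w => weight_ge0 _) (mw _ mZ) (fun w => weight_ge0 _)).
have Ec : (\int[P]_x (cst c x)%:E = c%:E)%E.
  by apply: (etrans (integral_cst P measurableT c%:E)) => /=; rewrite probability_setT mule1.
rewrite Ec /moment [leRHS]EFinM; apply: lee_wpmul2l => //.
by rewrite !EFinD; apply: leeD => //; apply: leeD.
Qed.

Definition mild_martingale_cst : R :=
  (martingale_cst B T (sigma * Num.sqrt T) * (16 * (M0 + 256 * weight (sigma * Num.sqrt T) + weight (2 * B * T))) + 4) / 2.

Lemma L1_particle_martingale delta t n : 0 < delta -> n%:R * delta < t -> t <= n.+1%:R * delta -> t <= T ->
  (L1 (P \x mu)%E (fun z : Omega * measurableTypeR R =>
      (N%:R^-1 * \sum_(i < N) \sum_(k < n.+1) particle_incr delta t n i k z.2 z.1)%R)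
    <= (mild_martingale_cst / Num.sqrt N%:R)%:E)%E.
Proof.
move=> d0 nt tn tT.
pose tau k := tk delta t n k.
have tau0 k : 0 <= tau k by exact: (tk_ge0 d0 nt).
have tauT k : tau k <= T by apply: le_trans tT; exact: (tk_let d0 nt).
have tau0T k : 0 <= tau k <= T by rewrite tau0 tauT.
have tauS k : tau k <= tau k.+1 by exact: (tk_le d0 nt).
have tau_lt k : (k < n.+1)%N -> tau k < tau k.+1 by move=> kn; rewrite -subr_gt0; exact: (dtk_gt0 d0 nt).
have dk0 k := dtk_ge0 d0 nt k.
have dtc k i w : `|dtk delta t n k * rank_drift Lambda X (tau k) i w| <= B * dtk delta t n k.
  by rewrite normrM ger0_norm// mulrC ler_wpM2r//; exact: (rank_drift_bound X HC1 lamB N_gt0).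
have dkT k : dtk delta t n k <= T by rewrite /dtk -/(tau _) lerBlDr (le_trans (tauT k.+1))// lerDl.
have dBT k : B * dtk delta t n k <= B * T by rewrite ler_wpM2l.
have near0 i k : {ae P, forall w, `|X i (tau k) w - xi i w - scaled_noise sigma W 0 (tau k) i w| <= B * T}.
  apply: filterS2 (particle_increment_norm HC1 lamB N_gt0 Hsol i) (particle_start Hsol Wbm i (ltW T_gt0)) => w H1 H2.
  have := H1 0 (tau k) (lexx 0) (tau0 k) (tauT k); rewrite H2 subr0 => hh; apply: le_trans hh _.
  by rewrite ler_wpM2l.
(* Grid positions need only B T; a frozen step adds one more drift displacement, whence the common
   allowance 2 B T. *)
have mB2 : B * T <= 2 * B * T by rewrite -mulrA ler_peMl ?ler1n// mulr_ge0// ltW.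
have mfz i k : measurable_fun setT (frozen_step delta t n i k).
  by apply: measurable_funD => //; apply: measurable_funM => //; case: (bm_rank_drift X HC1 lamB N_gt0 (tau k) i).
refine (le_trans (@L1_martingale _ _ _ P N n.+1 (bk sigma delta t n) (ak sigma delta t n) (fun k => G (tau k)) (Xg delta t n) (frozen_step delta t n) (Bg delta t n)
  _ _ _ _ _ _ _ _ _ _ _ B T (sigma * Num.sqrt T) (dtk delta t n) moment _ _ _ _ _ _ _ _ _ (16 * (M0 + 256 * weight (sigma * Num.sqrt T) + weight (2 * B * T))) _ N_gt0) (lexx _)).
- by move=> k; exact: (ak_ge0 delta t n sigma_gt0).
- by move=> k; exact: (bk_ge0 delta t n sigma_gt0).
- by move=> k _; exact: (akE sigma_gt0 d0 nt).
- by move=> k; exact: (particle_filtration_measurable Hsol).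
- by move=> k l kl; apply: (particle_filtration_mono Hsol) => //; exact: (tk_le d0 nt).
- by move=> i k; exact: mX.
- move=> i k; apply: measurable_funD; first exact: (gmeas_particle Hsol i (tau0T k)).
  by apply: measurable_funM => //; exact: (gmeas_rank_drift Hsol i (tau0T k)).
- move=> i k; apply: measurable_funM => //; apply: measurable_funB; exact: (gmeas_particle_noise Hsol).
- by move=> i k kn; apply: (indep_scaled_noise Hsol) => //; exact: tau_lt.
- by move=> i j k kn ij; apply: (indep_scaled_noise2 Hsol Wind) => //; exact: tau_lt.
- by move=> i k kn; apply: (scaled_noise_law sigma Wbm) => //; exact: tau_lt.
- exact: B_ge0.
- exact: dk0.
- by rewrite sum_dtk.
- by move=> k; exact: (ak_le sigma_gt0 d0 nt tT).
- by move=> i k _; apply: aeW => w; rewrite /frozen_step/= opprD addrA subrr add0r normrN.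
- move=> i k _; apply: filterS (step_error_crude HC1 lamB N_gt0 Hsol i d0 nt tT) => w /(_ k).
  by rewrite /step_error /frozen_step/= distrC.
- move=> i k _; apply: (weight_moment (mX i (tau k)) (tau0 k) (tauT k)).
  by apply: filterS (near0 i k) => w hw; exact: le_trans mB2.
- move=> i k _; apply: (weight_moment (mfz i k) (tau0 k) (tauT k)).
  apply: filterS (near0 i k) => w hw; rewrite /frozen_step/= -/(tau k).
  have -> : X i (tau k) w + dtk delta t n k * rank_drift Lambda X (tau k) i w - xi i w - scaled_noise sigma W 0 (tau k) i w =
    (X i (tau k) w - xi i w - scaled_noise sigma W 0 (tau k) i w) + dtk delta t n k * rank_drift Lambda X (tau k) i w by ring.
  apply: le_trans (ler_normD _ _) _; have := dtc k i w; have := dBT k; lra.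
- move=> i k _; apply: (@weight_moment _ i (tau k.+1) _ (tau0 k.+1) (tauT k.+1)).
    by apply: measurable_funD => //; exact: measurable_scaled_noise.
  apply: filterS (near0 i k) => w hw; rewrite /frozen_step/= -!/(tau _).
  have -> : X i (tau k) w + dtk delta t n k * rank_drift Lambda X (tau k) i w + scaled_noise sigma W (tau k) (tau k.+1) i w - xi i w - scaled_noise sigma W 0 (tau k.+1) i w =
    (X i (tau k) w - xi i w - scaled_noise sigma W 0 (tau k) i w) + dtk delta t n k * rank_drift Lambda X (tau k) i w by rewrite /scaled_noise; ring.
  apply: le_trans (ler_normD _ _) _; have := dtc k i w; have := dBT k; lra.
- have sumc (c : R) : \sum_(i < N) c = N%:R * c by rewrite sumr_const card_ord mulr_natl.
  rewrite /moment -mulr_sumr big_split/= big_split/= !sumc.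
  have := mi_sum; move: (weight _) (weight _) => x y; lra.
Qed.

(** The identity behind the residual holds off the null event of ties; V is an everywhere defined
    measurable majorant: the dx-norm of the martingale term plus the averaged pathwise bounds. *)
Lemma particle_mild delta t n e (q : 'I_N -> Omega -> R) :
  0 < delta -> n%:R * delta < t -> t <= n.+1%:R * delta -> t <= T ->
  (forall i, bm (q i)) -> (forall i w, 0 <= q i w) -> (forall i, \int[P]_w q i w <= e) ->
  (forall i, {ae P, forall w, \sum_(k < n.+1) `|step_error sigma Lambda W X delta t n i k w| <= q i w}) ->
  exists V : Omega -> \bar R, [/\ measurable_fun setT V, forall w, (0 <= V w)%E,
    {ae P, forall w, (L1 mu (mild_residual sigma L (empirical_cdf w) delta t n) <= V w)%E} &
    (\int[P]_w V w <= (mild_martingale_cst / Num.sqrt N%:R + 2 * e + path_cst sigma T B * delta)%:E)%E].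
Proof.
move=> d0 nt tn tT bq q0 Eq hq.
pose f (z : Omega * measurableTypeR R) : R := N%:R^-1 * \sum_(i < N) \sum_(k < n.+1) particle_incr delta t n i k z.2 z.1.
have mB i k : measurable_fun setT (Bg delta t n i k) by exact: measurable_scaled_noise.
have mZ i k : measurable_fun setT (frozen_step delta t n i k).
  by apply: measurable_funD => //; apply: measurable_funM => //; case: (bm_rank_drift X HC1 lamB N_gt0 (tk delta t n k) i).
have mP s (V : Omega -> R) : measurable_fun setT V -> measurable_fun setT (fun z : Omega * measurableTypeR R => Phi s (z.2 - V z.1)).
  move=> mV; apply: measurableT_comp; first exact: measurable_Phi.
  by apply: measurable_funB => //; exact: (measurableT_comp mV).
have minc i k : measurable_fun setT (fun z : Omega * measurableTypeR R => particle_incr delta t n i k z.2 z.1).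
  apply: measurable_funB; last exact: mP.
  rewrite (_ : (fun z => _) = (fun z => Phi (ak sigma delta t n k.+1) (z.2 - (frozen_step delta t n i k z.1 + Bg delta t n i k z.1)))).
    by apply: (mP _ (fun w => frozen_step delta t n i k w + Bg delta t n i k w)); exact: measurable_funD.
  by apply/funext => z; congr (Phi _ _); ring.
have mf : measurable_fun setT f.
  by apply: measurable_funM => //; apply: measurable_sum => i; apply: measurable_sum => k.
have mfa : measurable_fun setT (fun z : Omega * measurableTypeR R => `|f z|%:E) by apply/measurable_EFinP; exact: measurableT_comp.
have fa0 (z : Omega * measurableTypeR R) : (0 <= `|f z|%:E)%E by rewrite lee_fin.
have hM := L1_particle_martingale d0 nt tn tT.
pose V1 w := L1 mu (fun x => f (w, x)).
have mV1 : measurable_fun setT V1 by exact: (measurable_fun_fubini_tonelli_F _ mfa fa0).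
have EV1 : (\int[P]_w V1 w <= (mild_martingale_cst / Num.sqrt N%:R)%:E)%E.
  apply: le_trans hM; rewrite /L1 (fubini_tonelli1 _ mfa fa0); exact: lexx.
have N0R : 0 <= N%:R^-1 :> R by rewrite invr_ge0.
have pc0 : 0 <= path_cst sigma T B * delta by rewrite mulr_ge0 ?(ltW d0)//; exact: path_cst_ge0.
pose q2 w : R := N%:R^-1 * \sum_(i < N) (2 * q i w + path_cst sigma T B * delta).
have b2 i : bm (fun w => 2 * q i w + path_cst sigma T B * delta).
  by apply: bmD; [apply: bmM; [exact: bm_cst|exact: bq]|exact: bm_cst].
have bs : bm (fun w => \sum_(i < N) (2 * q i w + path_cst sigma T B * delta)) by apply: bm_sum.
have bq2 : bm q2 by apply: bmM; [exact: bm_cst|exact: bs].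
have q20 w : 0 <= q2 w by apply: mulr_ge0 => //; apply: sumr_ge0 => i _; apply: addr_ge0 => //; exact: mulr_ge0.
have V10 w : (0 <= V1 w)%E by exact: L1_ge0.
have mq2 : measurable_fun setT (fun w => (q2 w)%:E) by apply/measurable_EFinP; case: bq2.
exists (fun w => V1 w + (q2 w)%:E)%E; split.
- exact: emeasurable_funD.
- by move=> w; apply: adde_ge0 => //; rewrite lee_fin.
- have hinj : {ae P, forall w, forall k : 'I_n, (0 < k)%N -> injective (fun i => X i (tk delta t n k) w)}.
    apply: filter_forall => k; have [k0|k0] := posnP k; first by apply: aeW => w; rewrite k0.
    have kt : 0 < tk delta t n k by rewrite tkE ?mulr_gt0 ?ltr0n// ltnW.
    have kT : tk delta t n k <= T by apply: le_trans tT; exact: (tk_let d0 nt).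
    by apply: filterS (particle_injective sigma_gt0 HC1 lamB N_gt0 Hsol Wbm Wind kt kT).
  have hq' : {ae P, forall w, forall i, \sum_(k < n.+1) `|step_error sigma Lambda W X delta t n i k w| <= q i w}.
    by apply: filter_forall.
  apply: filterS2 hinj hq' => w inj hqw.
  have inj' k : (0 < k < n)%N -> injective (fun i => X i (tk delta t n k) w).
    by move=> /andP[k0 kn]; exact: (inj (Ordinal kn)).
  pose rem i x : R := particle_remainder delta t n i x w.
  have mrem i : measurable_fun [set: R] (rem i).
    have ag k : (0 < k < n)%N -> 0 < ak sigma delta t n k by move=> /andP[_ kn]; exact: (ak_gt0 sigma_gt0 d0 nt).
    by have [] := @bm_path_remainder _ (measurableTypeR R) R n (ak sigma delta t n) (dtk delta t n) id
      (fun k _ => Xg delta t n i k w) (fun k _ => cg delta t n i k w) (fun k _ => Bg delta t n i k w) ag (@measurable_id _ _ setT)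
      (fun k => measurable_cst _) (fun k => bm_cst _ _) (fun k => measurable_cst _).
  have mfw : measurable_fun [set: R] (fun x => f (w, x)) by exact: measurable_fun_curry1.
  have E x : mild_residual sigma L (empirical_cdf w) delta t n x = f (w, x) + N%:R^-1 * \sum_(i < N) rem i x.
    by rewrite (mild_residual_empirical x d0 nt inj') big_split/= mulrDr addrC.
  have msr : measurable_fun [set: R] (fun x => \sum_(i < N) rem i x) by apply: measurable_sum.
  under eq_L1 do rewrite E.
  apply: le_trans (L1D mu mfw _) _; first exact: measurable_funM.
  apply: leeD => //; rewrite (L1Z mu _ msr) ger0_norm// /q2 EFinM; apply: lee_wpmul2l; first by rewrite lee_fin.
  apply: le_trans (L1_sum_ord mu mrem) _; rewrite -sumEFin; apply: lee_sum => i _.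
  apply: le_trans (L1_path_remainder_grid sigma_gt0 d0 nt tn tT _ _ (fun k => rank_drift_bound X HC1 lamB N_gt0 (tk delta t n k) i w)) _.
  by rewrite lee_fin lerD2r ler_wpM2l//; exact: hqw.
- rewrite ge0_integralD//; last by move=> w _; rewrite lee_fin.
  have -> : (mild_martingale_cst / Num.sqrt N%:R + 2 * e + path_cst sigma T B * delta)%:E =
    ((mild_martingale_cst / Num.sqrt N%:R)%:E + (2 * e + path_cst sigma T B * delta)%:E)%E by rewrite -EFinD addrA.
  apply: leeD; first exact: EV1.
  rewrite (ExE P bq2) lee_fin /q2 (ExZ P _ bs) (Ex_sum P _ b2).
  rewrite ler_pdivrMl ?ltr0n//.
  have -> : N%:R * (2 * e + path_cst sigma T B * delta) = \sum_(i < N) (2 * e + path_cst sigma T B * delta).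
    by rewrite sumr_const card_ord mulr_natl.
  apply: ler_sum => i _; rewrite (ExD P (bmM (bm_cst _ 2) (bq i)) (bm_cst _ _)) (ExZ P _ (bq i)) Ex_cst lerD2r.
  by rewrite ler_wpM2l.
Qed.

End particle_mild.

(** * Initial positions *)

Section tail_moments.
Context d (Omega : measurableType d) (R : realType) (P : probability Omega R).
Notation mu := (@lebesgue_measure R).

(* Half of [1, |x|] lies above |x| / 2, where the square root is at least sqrt (|x| / 2). *)
Lemma weight_tail_integral (x : R) :
  ((weight x)%:E <= (weight 2)%:E + 6%:E * \int[mu]_y (ind 1 y * Num.sqrt y * (ind x (- y) + 1 - ind x y))%:E)%E.
Proof.
have h0 y : 0 <= ind 1 y * Num.sqrt y * (ind x (- y) + 1 - ind x y).
  apply: mulr_ge0; first by rewrite mulr_ge0 ?ind_ge0.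
  by have := ind_ge0 x (- y); have := ind_le1 x y; lra.
have i0 : (0 <= \int[mu]_y (ind 1 y * Num.sqrt y * (ind x (- y) + 1 - ind x y))%:E)%E.
  by apply: integral_ge0 => y _; rewrite lee_fin.
have [x2|x2] := leP `|x| 2.
  apply: (@le_trans _ _ (weight 2)%:E); last by rewrite leeDl// mule_ge0.
  by rewrite lee_fin; apply: le_weight; rewrite (ger0_norm (ler0n R 2)).
pose a : R := `|x|; rewrite -/a in x2.
have a0 : 0 < a by apply: lt_trans x2.
have a20 : 0 <= a / 2 by rewrite divr_ge0// ltW.
have len : mu `]a / 2, a[%classic = (a / 2)%:E.
  apply: (etrans (lebesgue_measure_itv _)) => /=; rewrite lte_fin ltr_pdivrMr// mulr_natr mulr2n ltrDl a0 -EFinD.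
  congr EFin; lra.
apply: (@le_trans _ _ (6%:E * (\int[mu]_(y in `](a / 2)%R, a[) (Num.sqrt (a / 2))%:E))%E).
  rewrite integral_cst//= len -!EFinM lee_fin /weight -/a.
  have s2 : Num.sqrt (1 + a) <= 2 * Num.sqrt (a / 2).
    have f4 : 4 = 2 ^+ 2 :> R by ring.
    have -> : 2 * Num.sqrt (a / 2) = Num.sqrt (4 * (a / 2)).
      by rewrite f4 (sqrtrM _ (sqr_ge0 2)) sqrtr_sqr ger0_norm.
    apply: ler_wsqrtr; lra.
  have a1 : 0 <= 1 + a by lra.
  apply: le_trans (ler_wpM2l a1 s2) _.
  have h3 : (1 + a) <= 3 * (a / 2) by lra.
  have q0 : 0 <= 2 * Num.sqrt (a / 2) by rewrite mulr_ge0.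
  apply: le_trans (ler_wpM2r q0 h3) _; move: (Num.sqrt _) => q.
  by rewrite le_eqVlt; apply/orP; left; apply/eqP; ring.
rewrite -[leLHS]add0e; apply: leeD; first by rewrite lee_fin weight_ge0.
apply: lee_wpmul2l => //.
rewrite integral_mkcond; apply: ge0_le_integral_nomeas => y; rewrite patchE; case: ifPn => // yin; rewrite ?lee_fin//.
move: yin; rewrite inE/= in_itv/= => /andP[y1 y2].
have iy : ind 1 y = 1.
  rewrite /ind (_ : (1 <= y)%R = true)//; apply/idP; lra.
have -> : ind x (- y) + 1 - ind x y = 1.
  rewrite /ind; move: y2; rewrite /a; case: (leP 0 x) => x0 yx.
    rewrite (ger0_norm x0) in yx.
    have -> : (x <= - y) = false by apply/negbTE; rewrite -ltNge; lra.
    have -> : (x <= y) = false by apply/negbTE; rewrite -ltNge; lra.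
    by rewrite add0r subr0.
  rewrite (ltr0_norm x0) in yx.
  have -> : (x <= - y) = true by apply/idP; lra.
  have -> : (x <= y) = true by apply/idP; lra.
  by rewrite addrK.
by rewrite iy mul1r mulr1 ler_wsqrtr// ltW.
Qed.

Lemma sqrt_div_sqr_le (y : R) : 1 <= y -> Num.sqrt y / y ^+ 2 <= 3 * (weight y)^-1.
Proof.
move=> y1; have y0 : 0 < y by exact: lt_le_trans y1.
have q0 : 0 < Num.sqrt y by rewrite sqrtr_gt0.
have q2 : Num.sqrt y ^+ 2 = y by rewrite sqr_sqrtr// ltW.
rewrite ler_pdivlMr ?weight_gt0//.
have hw : weight y <= 3 * (y * Num.sqrt y).
  rewrite /weight ger0_norm ?(ltW y0)//.
  have h1 : Num.sqrt (1 + y) <= 3 / 2 * Num.sqrt y.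
    have -> : 3 / 2 * Num.sqrt y = Num.sqrt ((3 / 2) ^+ 2 * y).
      by rewrite (sqrtrM _ (sqr_ge0 _)) sqrtr_sqr ger0_norm.
    apply: ler_wsqrtr; rewrite expr2; lra.
  have h2 : 1 + y <= 2 * y by lra.
  have h3 : 0 <= 1 + y by lra.
  apply: le_trans (ler_wpM2l h3 h1) _.
  have h4 : 0 <= 3 / 2 * Num.sqrt y by apply: mulr_ge0; [|exact: ltW].
  apply: le_trans (ler_wpM2r h4 h2) _; rewrite le_eqVlt; apply/orP; left; apply/eqP; by field.
have c0 : 0 <= Num.sqrt y / y ^+ 2 by rewrite divr_ge0// sqr_ge0.
apply: le_trans (ler_wpM2l c0 hw) _.
have -> : Num.sqrt y / y ^+ 2 * (3 * (y * Num.sqrt y)) = 3 * (Num.sqrt y ^+ 2 / y).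
  by move: (Num.sqrt y) => q; field; rewrite gt_eqF.
by rewrite q2 divff ?gt_eqF// mulr1.
Qed.

(** Tail-integral formula for the moment of order 3/2, with sqrt y / y^2 integrable at infinity.
    Only the tails averaged over the particles enter, which suits deterministic positions. 72 is 6 *
    3 * 4, from [weight_tail_integral], [sqrt_div_sqr_le] and [integral_inv_weight]. *)
Lemma weight_moment_tail N (x : 'I_N -> {RV P >-> R}) (C : R) : 0 <= C ->
  (forall y, 1 <= y -> \sum_(i < N) \int[P]_w (ind (x i w) (- y) + 1 - ind (x i w) y) <= N%:R * (C / y ^+ 2)) ->
  (\sum_(i < N) \int[P]_w (weight (x i w))%:E <= (N%:R * (weight 2 + 72 * C))%:E)%E.
Proof.
move=> C0 hC.
have mx i : measurable_fun setT (x i) by exact: measurable_funPT.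
pose t i (z : measurableTypeR R * Omega) : R := ind (x i z.2) (- z.1) + 1 - ind (x i z.2) z.1.
pose h i (z : measurableTypeR R * Omega) : R := ind 1 z.1 * Num.sqrt z.1 * t i z.
have t0 i z : 0 <= t i z by rewrite /t; have := ind_ge0 (x i z.2) (- z.1); have := ind_le1 (x i z.2) z.1; lra.
have h0 i z : 0 <= h i z by apply: mulr_ge0 => //; rewrite mulr_ge0 ?ind_ge0.
have mt i : measurable_fun setT (t i).
  have mxi : measurable_fun setT (fun z : measurableTypeR R * Omega => x i z.2) by exact: (measurableT_comp (mx i)).
  apply: measurable_funB; last by apply: measurable_ind => //; exact: measurable_fst.
  by apply: measurable_funD => //; apply: measurable_ind => //; apply: measurableT_comp => //; exact: measurable_fst.
have ms : measurable_fun [set: R] (fun y : R => ind 1 y * Num.sqrt y).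
  by apply: measurable_funM; [exact: measurable_ind|apply: continuous_measurable_fun; exact: sqrt_continuous].
have mh i : measurable_fun setT (h i).
  by apply: measurable_funM => //; apply: (@measurableT_comp _ _ _ _ _ _ (fun y : R => ind 1 y * Num.sqrt y)) => //; exact: measurable_fst.
pose p i y : R := \int[P]_w t i (y, w).
have mp i : measurable_fun [set: R] (p i) by exact: (@measurable_fun_Rintegral _ _ (measurableTypeR R) Omega R P _ (mt i)).
have bt i y : bm (fun w => t i (y, w)).
  by rewrite /t/=; exact: (bmB (bmD (bm_indX (mx i) (- y)) (bm_cst _ 1)) (bm_indX (mx i) y)).
have p0 i y : 0 <= p i y by apply: Rintegral_ge0 => w _; exact: t0.
have c0 y : 0 <= ind 1 y * Num.sqrt y :> R by rewrite mulr_ge0 ?ind_ge0.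
have mip i : measurable_fun [set: R] (fun y : R => (ind 1 y * Num.sqrt y * p i y)%:E).
  by apply/measurable_EFinP; exact: (measurable_funM ms (mp i)).
have one i : (\int[P]_w (weight (x i w))%:E <= (weight 2)%:E + 6%:E * \int[mu]_y (ind 1 y * Num.sqrt y * p i y)%:E)%E.
  have mhE : measurable_fun setT (fun z => (h i z)%:E) by exact/measurable_EFinP.
  have h0E z : (0 <= (h i z)%:E)%E by rewrite lee_fin.
  apply: (@le_trans _ _ (\int[P]_w ((cst (weight 2)%:E w) + 6%:E * \int[mu]_y (h i (y, w))%:E))%E).
    apply: ge0_le_integral_nomeas => w; first by rewrite lee_fin weight_ge0.
    exact: weight_tail_integral.
  have mG : measurable_fun setT (fun w => \int[mu]_y (h i (y, w))%:E)%E by exact: (measurable_fun_fubini_tonelli_G _ mhE h0E).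
  have G0 w : (0 <= \int[mu]_y (h i (y, w))%:E)%E by apply: integral_ge0 => y _.
  rewrite ge0_integralD//; last 3 first.
  - by move=> w _; rewrite lee_fin weight_ge0.
  - by move=> w _; apply: mule_ge0.
  - exact: measurable_funeM.
  rewrite integral_cst//= probability_setT mule1; apply: leeD => //.
  rewrite ge0_integralZl_EFin//; apply: lee_wpmul2l => //.
  rewrite -(@fubini_tonelli _ _ _ _ _ mu P _ mhE h0E).
  apply: ge0_le_integral_nomeas => y; first by apply: integral_ge0 => w _.
  by rewrite (ge0_integral_cmul P (c0 y)) ?(ExE P (bt i y))//; case: (bt i y).
apply: le_trans (lee_sum _ (fun i _ => one i)) _.
have -> : (N%:R * (weight 2 + 72 * C))%:E = ((weight (2 : R) *+ N)%:E + (N%:R * (72 * C))%:E)%E.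
  by rewrite -EFinD; congr EFin; rewrite mulrDr; congr (_ + _); exact: mulr_natl.
rewrite big_split/= sumEFin sumr_const card_ord; apply: leeD => //.
rewrite -ge0_sume_distrr; last by move=> i _; apply: integral_ge0 => y _; rewrite lee_fin mulr_ge0.
rewrite -ge0_integral_sum//; last by move=> i y _; rewrite lee_fin mulr_ge0.
have k0 : 0 <= 3 * (N%:R * C) by apply: mulr_ge0; [exact: ler0n|exact: mulr_ge0].
have w0 (y : R) : 0 <= (weight y)^-1 by rewrite invr_ge0 weight_ge0.
have mw : measurable_fun [set: R] (fun y : R => (weight y)^-1).
  by apply: continuous_measurable_fun => z; apply: cvgV; [rewrite gt_eqF ?weight_gt0|exact: continuous_weight].
apply: (@le_trans _ _ (6%:E * \int[mu]_y (3 * (N%:R * C) * (weight y)^-1)%:E)%E).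
  apply: lee_wpmul2l => //; apply: ge0_le_integral_nomeas => y.
    by apply: sume_ge0 => i _; rewrite lee_fin mulr_ge0.
  rewrite sumEFin lee_fin -mulr_sumr; case: (leP 1 y) => y1; last first.
    have -> : ind 1 y = 0 :> R by rewrite /ind leNgt y1.
    by rewrite !mul0r mulr_ge0.
  have -> : ind 1 y = 1 :> R by rewrite /ind y1.
  rewrite mul1r; apply: le_trans (ler_wpM2l (sqrtr_ge0 y) (hC y y1)) _.
  have := ler_wpM2l (mulr_ge0 (ler0n R N) C0) (sqrt_div_sqr_le y1).
  have -> : N%:R * C * (Num.sqrt y / y ^+ 2) = Num.sqrt y * (N%:R * (C / y ^+ 2)) by ring.
  by have -> : N%:R * C * (3 * (weight y)^-1) = 3 * (N%:R * C) * (weight y)^-1 by ring.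
rewrite (ge0_integral_cmul mu k0 mw w0).
apply: (@le_trans _ _ (6%:E * ((3 * (N%:R * C))%:E * 4%:E))%E).
  by apply: lee_wpmul2l => //; apply: lee_wpmul2l; [rewrite lee_fin|exact: integral_inv_weight].
rewrite -!EFinM lee_fin le_eqVlt; apply/orP; left; apply/eqP; ring.
Qed.

End tail_moments.

(** * Mean L^1 error and weighted moments at time 0 *)

Section initial_error.
Context d (Omega : measurableType d) (R : realType) (P : probability Omega R).
Variable m : probability (measurableTypeR R) R.
Notation mu := (@lebesgue_measure R).
Notation F := (cdf_of m).

Definition init_cdf N (x : 'I_N -> {RV P >-> R}) w y : R := N%:R^-1 * \sum_(i < N) ind (x i w) y.

(* Integrability of sqrt (F (1 - F)) forces quadratic decay of both tails, by monotonicity on [y / 2, y]. *)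
Lemma iid_tail : (\int[mu]_x (Num.sqrt (F x * (1 - F x)))%:E < +oo)%E ->
  exists2 C : R, 0 <= C & forall y, 1 <= y -> F (- y) + 1 - F y <= C / y ^+ 2.
Proof.
set J := (\int[mu]_x _)%E => Joo.
have J0 : (0 <= J)%E by apply: integral_ge0 => x _; rewrite lee_fin.
have Jf : J \is a fin_num by rewrite ge0_fin_numE.
have h2 : 0 < 2^-1 :> R by rewrite invr_gt0.
have h21 : 2^-1 < 1 :> R by rewrite invf_lt1// ltr1n.
have [y1 hy1] : exists y1 : R, 2^-1 < F y1.
  have := @cdf_of_y1 R m; move/cvgr_gt => /(_ _ h21) [M [_ hM]].
  by exists (M + 1); apply: hM; rewrite ltrDl.
have [y2 hy2] : exists y2 : R, F y2 < 2^-1.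
  have := @cdf_of_Ny0 R m; move/cvgr_lt => /(_ _ h2) [M [_ hM]].
  by exists (M - 1); apply: hM; rewrite gtrBl.
(* Beyond y0 on the right F >= 1/2, and below - y0 on the left F <= 1/2, so there F (1 - F) is at
   least half of the tail. *)
pose y0 := Num.max 1 (Num.max y1 (- y2)).
have y01 : 1 <= y0 by rewrite le_max lexx.
have Fy0 y : y0 <= y -> 2^-1 <= F y.
  move=> yy; apply: le_trans (ltW hy1) _; apply: le_cdf_of; apply: le_trans yy.
  by rewrite /y0 !le_max lexx orbT.
have FNy0 y : y <= - y0 -> F y <= 2^-1.
  move=> yy; apply: le_trans (ltW hy2); apply: le_cdf_of; apply: le_trans yy _.
  by rewrite lerNl /y0 !le_max lexx !orbT.
have key (a b t : R) : a < b -> 0 <= t -> (forall y, a < y < b -> t / 2 <= F y * (1 - F y)) ->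
    ((b - a) * Num.sqrt (t / 2) <= fine J).
  move=> ab t0 H; rewrite -lee_fin fineK//.
  have len : mu `]a, b[%classic = (b - a)%:E.
    by apply: (etrans (lebesgue_measure_itv _)) => /=; rewrite lte_fin ab -EFinD.
  apply: (@le_trans _ _ (\int[mu]_(y in `]a, b[) (Num.sqrt (t / 2))%:E)%E).
    by rewrite integral_cst//= len -EFinM lee_fin mulrC.
  rewrite integral_mkcond; apply: ge0_le_integral_nomeas => y; rewrite patchE; case: ifPn => // yin; rewrite ?lee_fin//.
  by apply: ler_wsqrtr; apply: H; move: yin; rewrite inE/= in_itv.
have quad (y t : R) : 0 < y -> 0 <= t -> y / 2 * Num.sqrt (t / 2) <= fine J -> t <= 8 * fine J ^+ 2 / y ^+ 2.
  move=> yp t0 hJ; have yy : 0 < y ^+ 2 by rewrite exprn_gt0.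
  rewrite ler_pdivlMr//.
  have s0 : 0 <= y / 2 * Num.sqrt (t / 2) by rewrite mulr_ge0// divr_ge0// ltW.
  have := ler_pM s0 s0 hJ hJ; rewrite -!expr2 exprMn sqr_sqrtr ?divr_ge0//.
  have -> : (y / 2) ^+ 2 * (t / 2) = t * y ^+ 2 / 8 by field.
  by rewrite ler_pdivrMr ?ltr0n// mulrC [leRHS]mulrC mulrC.
have f0 : 0 <= fine J by rewrite fine_ge0.
have C0 : 0 <= 16 * fine J ^+ 2 + 8 * y0 ^+ 2.
  by rewrite addr_ge0// mulr_ge0// ?sqr_ge0// ler0n.
exists (16 * fine J ^+ 2 + 8 * y0 ^+ 2) => // y yge1.
have yp : 0 < y by exact: lt_le_trans yge1.
have yy : 0 < y ^+ 2 by rewrite exprn_gt0.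
have /andP[a0 a1] := cdf_of01 m y; have /andP[b0 b1] := cdf_of01 m (- y).
have [ysmall|ybig] := leP y (2 * y0).
  rewrite ler_pdivlMr//.
  have h : y ^+ 2 <= 4 * y0 ^+ 2.
    have -> : 4 * y0 ^+ 2 = (2 * y0) ^+ 2 by ring.
    by rewrite ler_pXn2r// nnegrE ?(ltW yp)// mulr_ge0// (le_trans _ y01).
  have h3 : F (- y) + 1 - F y <= 2 by lra.
  apply: le_trans (ler_wpM2r (ltW yy) h3) _; have := sqr_ge0 (fine J); lra.
have y2y : y / 2 < y by rewrite ltr_pdivrMr// mulr_natr mulr2n ltrDl.
have yh : y - y / 2 = y / 2 by lra.
have t1 : 1 - F y <= 8 * fine J ^+ 2 / y ^+ 2.
  apply: quad => //; first by rewrite subr_ge0.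
  rewrite -yh; apply: key => //; first by rewrite subr_ge0.
  move=> z /andP[z1 z2]; have hz := Fy0 z (ltW (le_lt_trans _ z1)).
  have {}hz : 2^-1 <= F z by apply: hz; lra.
  have h1 := le_cdf_of m (ltW z2).
  have s1 : 0 <= 1 - F y by rewrite subr_ge0.
  have s2 : 1 - F y <= 1 - F z by rewrite lerD2l lerN2.
  by rewrite [leLHS]mulrC; apply: ler_pM => //; exact: ltW.
have t2 : F (- y) <= 8 * fine J ^+ 2 / y ^+ 2.
  apply: quad => //.
  have -> : y / 2 = - (y / 2) - (- y) by lra.
  apply: key => //; first by rewrite ltrN2.
  move=> z /andP[z1 z2]; have hz : F z <= 2^-1 by apply: FNy0; lra.
  have h1 := le_cdf_of m (ltW z1).
  by apply: ler_pM => //; lra.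
have -> : (16 * fine J ^+ 2 + 8 * y0 ^+ 2) / y ^+ 2 = 8 * fine J ^+ 2 / y ^+ 2 + 8 * fine J ^+ 2 / y ^+ 2 + 8 * y0 ^+ 2 / y ^+ 2.
  by field; rewrite gt_eqF.
have : 0 <= 8 * y0 ^+ 2 / y ^+ 2 by rewrite divr_ge0 ?sqr_ge0// mulr_ge0 ?sqr_ge0// ler0n.
lra.
Qed.

Lemma Ex_ind_law (Y : {RV P >-> R}) y : (forall A, measurable A -> distribution P Y A = m A) ->
  \int[P]_w ind (Y w) y = F y.
Proof.
move=> H; apply: EFin_inj; rewrite -(Ex_indE P y (measurable_funPT Y)).
have := H `]-oo, y]%classic (measurable_itv _); rewrite /distribution/= => e.
by rewrite /cdf_of fineK ?fin_num_measure//; exact: e.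
Qed.

Section iid.
Variables (N : nat) (x : 'I_N -> {RV P >-> R}).
Hypothesis N_gt0 : (0 < N)%N.
Hypothesis xlaw : forall i A, measurable A -> distribution P (x i) A = m A.
Hypothesis xind : forall i j, i != j -> independent2 P (sigma_rv (x i)) (sigma_rv (x j)).

Let mx i : measurable_fun setT (x i). Proof. exact: measurable_funPT. Qed.

Let M y i w : R := ind (x i w) y - F y.

Let bM y i : bm (M y i). Proof. by apply: bmB; [exact: bm_indX|exact: bm_cst]. Qed.

Let EMM y i j : i != j -> \int[P]_w (M y i w * M y j w) = 0.
Proof.
move=> ij; have bi k := bm_indX (mx k) y.
have bij := bmM (bi i) (bi j).
have bc := bm_cst Omega (F y).
have b1 := bmM bc (bi i); have b2 := bmM bc (bi j).
transitivity (\int[P]_w (ind (x i w) y * ind (x j w) y - F y * ind (x i w) y - F y * ind (x j w) y + F y * F y)).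
  by apply: eq_Rintegral => w _; rewrite /M; ring.
rewrite (ExD P (bmB (bmB bij b1) b2) (bm_cst _ (F y * F y))) Ex_cst (ExB P (bmB bij b1) b2) (ExB P bij b1).
rewrite (ExZ P _ (bi i)) (ExZ P _ (bi j)) !(Ex_ind_law _ (xlaw _)).
suff -> : \int[P]_w (ind (x i w) y * ind (x j w) y) = F y * F y by ring.
pose A k := x k @^-1` `]-oo, y]%classic.
have mA k : measurable (A k) by rewrite -[A k]setTI; apply: mx => //; exact: measurable_itv.
have sA k : sigma_rv (x k) (A k).
  by apply: sub_sigma_algebra; exists tt => //; exists `]-oo, y]%classic; [exact: measurable_itv|rewrite setTI].
have PA k : P (A k) = (F y)%:E by rewrite /A (Ex_indE P y (mx k)) (Ex_ind_law _ (xlaw k)).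
transitivity (\int[P]_w (\1_(A i `&` A j) w : R)); last first.
  by rewrite (Ex_indic P (measurableI _ _ (mA i) (mA j))) (xind ij (sA i) (sA j)) !PA.
apply: eq_Rintegral => w _; rewrite indicI/=.
have e k : \1_(A k) w = ind (x k w) y.
  have e1 : (w \in A k) = (x k w <= y) by apply/idP/idP; rewrite inE /A/= in_itv.
  by rewrite indicE e1.
by rewrite !e.
Qed.

Let bS y : bm (fun w => \sum_(i < N) M y i w). Proof. by apply: bm_sum => i; exact: bM. Qed.

(** Pairwise independence gives the variance F (1 - F) / N of the deviation D; the passage to the
    mean of |D| is read off from the nonnegative variance of |D|. *)
Lemma iid_variance y : \int[P]_w `|init_cdf x w y - F y| <= Num.sqrt (F y * (1 - F y)) / Num.sqrt N%:R.
Proof.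
have NR : 0 < N%:R :> R by rewrite ltr0n.
pose D w := N%:R^-1 * \sum_(i < N) M y i w.
have bD : bm D by apply: bmM; [exact: bm_cst|exact: bS].
have DE w : init_cdf x w y - F y = D w.
  have sM : \sum_(i < N) M y i w = \sum_(i < N) ind (x i w) y - N%:R * F y.
    by rewrite sumrB sumr_const card_ord mulr_natl.
  by rewrite /D /init_cdf sM mulrBr mulKf ?gt_eqF.
under eq_Rintegral do rewrite DE.
have E2 : \int[P]_w (D w ^+ 2) = N%:R^-1 * (F y * (1 - F y)).
  transitivity (\int[P]_w (N%:R^-1 ^+ 2 * (\sum_(i < N) M y i w) ^+ 2)).
    by apply: eq_Rintegral => w _; rewrite /D exprMn.
  rewrite (ExZ P _ (bmX 2 (bS y))) (@Ex_sqr_sum _ _ _ P _ (M y) (bM y) (fun i j => @EMM y i j)).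
  have -> : \sum_i \int[P]_w (M y i w ^+ 2) = N%:R * (F y * (1 - F y)).
    rewrite mulr_natl -[X in _ *+ X]card_ord -sumr_const; apply: eq_bigr => i _.
    have bi := bm_indX (mx i) y; have b1 := bmM (bm_cst _ (1 - 2 * F y)) bi.
    transitivity (\int[P]_w ((1 - 2 * F y) * ind (x i w) y + F y * F y)).
      apply: eq_Rintegral => w _; rewrite /M /ind; case: (x i w <= y)%R => /=; rewrite ?mulr1n ?mulr0n; ring.
    by rewrite (ExD P b1 (bm_cst _ _)) Ex_cst (ExZ P _ bi) (Ex_ind_law _ (xlaw i)); ring.
  by rewrite expr2 -mulrA mulKf ?gt_eqF.
set c := \int[P]_w `|D w|.
have c0 : 0 <= c by apply: Rintegral_ge0 => w _.
have bDa := bm_norm bD.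
have c2 : c ^+ 2 <= N%:R^-1 * (F y * (1 - F y)).
  have h : 0 <= \int[P]_w ((`|D w| - c) ^+ 2) by apply: Rintegral_ge0 => w _; exact: sqr_ge0.
  have b2 := bmX 2 bD; have b3 := bmM (bm_cst _ (2 * c)) bDa.
  have : \int[P]_w ((`|D w| - c) ^+ 2) = N%:R^-1 * (F y * (1 - F y)) - 2 * c * c + c ^+ 2.
    rewrite -E2 -{4}/c -(ExZ P _ bDa) -(ExB P b2 b3) -[X in _ + X](Ex_cst P) -(ExD P (bmB b2 b3) (bm_cst _ _)).
    by apply: eq_Rintegral => w _; rewrite sqrrB real_normK ?num_real//; ring.
  by move=> E; move: h; rewrite E expr2; lra.
have F0 : 0 <= F y * (1 - F y) by have /andP[a0 a1] := cdf_of01 m y; rewrite mulr_ge0// subr_ge0.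
have -> : Num.sqrt (F y * (1 - F y)) / Num.sqrt N%:R = Num.sqrt (N%:R^-1 * (F y * (1 - F y))).
  have n0 : 0 <= N%:R^-1 :> R by rewrite invr_ge0.
  by rewrite [RHS](sqrtrM _ n0) sqrtrV// mulrC.
by rewrite -[c]ger0_norm// -sqrtr_sqr; exact: ler_wsqrtr.
Qed.

End iid.

(** The number of odd integers up to a rounds a / 2 to a nearest integer, except where it is cut off
    at 0 or N. *)
Lemma optimal_count (a : R) N : let c := (\sum_(i < N) (((2 * i + 1)%N%:R <= a)%R : bool))%N in
  [/\ (c <= N)%N, (0 < c)%N -> 2 * c%:R - 1 <= a & (c < N)%N -> a < 2 * c%:R + 1].
Proof.
elim: N => [|N [cN c1 c2]] /=; first by rewrite big_ord0.
rewrite big_ord_recr/=; set c := (\sum_(i < N) _)%N in cN c1 c2 *.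
case: (leP ((2 * N + 1)%N%:R : R) a) => h.
  have cE : c = N.
    apply/eqP; rewrite eqn_leq cN leqNgt; apply/negP => cl; have := c2 cl.
    have : 2 * c%:R + 1 <= (2 * N + 1)%N%:R :> R by rewrite natrD natrM lerD2r ler_wpM2l// ler_nat.
    lra.
  rewrite addn1 cE; split => //; last by rewrite ltnn.
  by move=> _; apply: le_trans h; rewrite natrD natrM -natr1; lra.
rewrite addn0; split => //; first exact: leqW.
move=> _; move: cN; rewrite leq_eqVlt => /predU1P[cE|/c2//].
by move: h; rewrite cE natrD natrM.
Qed.

Section optimal.
Variables (N : nat) (x : 'I_N -> {RV P >-> R}).
Hypothesis N_gt0 : (0 < N)%N.
Hypothesis xE : forall i w, x i w = quantile m ((2 * i + 1)%N%:R / (2 * N)%N%:R).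

(** N F y is rounded to a nearest integer. The first bound is the rounding error; the other two say
    that rounding at most doubles either tail, and give integrability at infinity. *)
Lemma optimal_error w y :
  [/\ `|init_cdf x w y - F y| <= (2 * N%:R)^-1, `|init_cdf x w y - F y| <= F y & `|init_cdf x w y - F y| <= 1 - F y].
Proof.
have NR : 0 < N%:R :> R by rewrite ltr0n.
have N1 : 1 <= N%:R :> R by rewrite ler1n.
have /andP[F0 F1] := cdf_of01 m y.
pose c := (\sum_(i < N) (((2 * i + 1)%N%:R <= 2 * N%:R * F y)%R : bool))%N.
have -> : init_cdf x w y = c%:R / N%:R.
  rewrite /init_cdf mulrC /c natr_sum; congr (_ / _); apply: eq_bigr => i _.
  rewrite /ind xE quantile_galois; last first.
    rewrite divr_gt0 ?ltr0n ?muln_gt0 ?addn1//= ltr_pdivrMr ?ltr0n ?muln_gt0// mul1r ltr_nat.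
    by have := ltn_ord i; lia.
  by rewrite ler_pdivrMr ?ltr0n ?muln_gt0// mulrC natrM.
have [cN c1 c2] := optimal_count (2 * N%:R * F y) N; rewrite -/c in cN c1 c2.
have cN' : c%:R <= N%:R :> R by rewrite ler_nat.
have c0 : 0 <= c%:R :> R by [].
have NF0 : 0 <= N%:R * F y by rewrite mulr_ge0// ltW.
have NF1 : N%:R * F y <= N%:R by rewrite ler_piMr// ltW.
have u1 : c%:R <= N%:R * F y + 2^-1.
  have [c0'|/c1 h] := posnP c; last by lra.
  by rewrite c0' addr_ge0// invr_ge0.
have l1 : N%:R * F y - 2^-1 <= c%:R.
  case: (ltnP c N) => [/c2 h|Nc]; first by lra.
  have : N%:R <= c%:R :> R by rewrite ler_nat.
  have : 0 <= 2^-1 :> R by rewrite invr_ge0.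
  lra.
have u2 : c%:R <= 2 * (N%:R * F y).
  have [c0'|c_gt0] := posnP c; first by rewrite c0' mulr_ge0.
  have h := c1 c_gt0; have : 1 <= c%:R :> R by rewrite ler1n.
  lra.
have l2 : 2 * (N%:R * F y) - N%:R <= c%:R.
  case: (ltnP c N) => [cl|Nc].
    have h := c2 cl; have : c%:R + 1 <= N%:R :> R by rewrite natr1 ler_nat.
    lra.
  have : N%:R <= c%:R :> R by rewrite ler_nat.
  lra.
have E : c%:R / N%:R - F y = (c%:R - N%:R * F y) / N%:R by field; rewrite gt_eqF.
have nE (b : R) : `|c%:R - N%:R * F y| <= N%:R * b -> `|c%:R / N%:R - F y| <= b.
  by move=> h; rewrite E normrM normfV (gtr0_norm NR) ler_pdivrMr// [leRHS]mulrC.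
split; apply: nE.
- have -> : N%:R * (2 * N%:R)^-1 = 2^-1 :> R by field; rewrite gt_eqF.
  by rewrite ler_norml; apply/andP; split; lra.
- by rewrite ler_norml; apply/andP; split; lra.
- by rewrite ler_norml mulrBr mulr1; apply/andP; split; lra.
Qed.

End optimal.

Let F01 y : 0 <= F y /\ F y <= 1. Proof. by have /andP[] := cdf_of01 m y. Qed.

Let mF : measurable_fun [set: R] F. Proof. exact: measurable_cdf_of. Qed.

Lemma measurable_init_error N (x : 'I_N -> {RV P >-> R}) :
  measurable_fun setT (fun z : Omega * measurableTypeR R => init_cdf x z.1 z.2 - F z.2).
Proof.
have mx i : measurable_fun setT (x i) by exact: measurable_funPT.
apply: measurable_funB; last by apply: (measurableT_comp mF); exact: measurable_snd.
apply: measurable_funM => //; apply: measurable_sum => i; apply: measurable_ind; last exact: measurable_snd.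
exact: (measurableT_comp (mx i)).
Qed.

Lemma iid_init_bounds (xi : forall N, 'I_N -> {RV P >-> R}) : iid_init m xi ->
  (\int[mu]_x (Num.sqrt (F x * (1 - F x)))%:E < +oo)%E ->
  exists C M0 : R, forall N, (0 < N)%N ->
    (\int[P]_w L1 mu (fun y => (init_cdf (@xi N) w y - F y)%R) <= (C / Num.sqrt N%:R)%:E)%E /\
    (\sum_(i < N) \int[P]_w (weight (xi N i w))%:E <= (N%:R * M0)%:E)%E.
Proof.
move=> [Z [Zind Zlaw xiE]] Joo; have [C C0 hC] := iid_tail Joo.
set J := (\int[mu]_x _)%E in Joo.
have J0 : (0 <= J)%E by apply: integral_ge0 => x _; rewrite lee_fin.
have Jf : J \is a fin_num by rewrite ge0_fin_numE.
exists (fine J), (weight 2 + 72 * C) => N N_gt0.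
have xlaw i A : measurable A -> distribution P (xi N i) A = m A.
  move=> mA; rewrite -(Zlaw i A mA) /distribution/=; congr (P _).
  by apply/seteqP; split => w /=; rewrite xiE.
have xind i j : i != j -> independent2 P (sigma_rv (xi N i)) (sigma_rv (xi N j)).
  move=> ij A1 A2 h1 h2.
  have e k : (xi N k : Omega -> R) = Z k by apply/funext => w; exact: xiE.
  rewrite e in h1; rewrite e in h2.
  have ij' : (i : nat) != j by [].
  pose E k := if k == i :> nat then A1 else A2.
  have := Zind [fset (i : nat); (j : nat)]%fset E.
  have Ei : E i = A1 by rewrite /E eqxx.
  have Ej : E j = A2 by rewrite /E eq_sym (negbTE ij').
  rewrite big_fsetU1 ?inE//= big_seq_fset1 Ei Ej => <-; last first.
    by move=> k; rewrite !inE => /orP[]/eqP ->; rewrite ?Ei ?Ej.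
  congr (P _); apply/seteqP; split => w.
    by move=> [a1 a2] k /=; rewrite !inE => /orP[]/eqP ->; rewrite ?Ei ?Ej.
  move=> h; split; first by have := h (i : nat); rewrite /= !inE eqxx Ei; exact.
  by have := h (j : nat); rewrite /= !inE eqxx orbT Ej; exact.
split.
  have mD := measurable_init_error (@xi N).
  have mDa : measurable_fun setT (fun z : Omega * measurableTypeR R => `|init_cdf (@xi N) z.1 z.2 - F z.2|%:E).
    by apply/measurable_EFinP; exact: measurableT_comp.
  have D0 (z : Omega * measurableTypeR R) : (0 <= `|init_cdf (@xi N) z.1 z.2 - F z.2|%:E)%E by rewrite lee_fin.
  rewrite /L1 (@fubini_tonelli _ _ _ _ _ P mu _ mDa D0)/=.
  have r0 : 0 <= (Num.sqrt N%:R)^-1 :> R by rewrite invr_ge0.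
  have msq : measurable_fun [set: R] (fun y => Num.sqrt (F y * (1 - F y))).
    apply: measurableT_comp; first by apply: continuous_measurable_fun; exact: sqrt_continuous.
    by apply: measurable_funM => //; exact: measurable_funB.
  apply: (@le_trans _ _ (\int[mu]_y ((Num.sqrt N%:R)^-1 * Num.sqrt (F y * (1 - F y)))%:E)%E).
    apply: ge0_le_integral_nomeas => y; first by apply: integral_ge0 => w _.
    have bD : bm (fun w => `|init_cdf (@xi N) w y - F y|).
      apply: bm_norm; apply: bmB; last exact: bm_cst.
      by apply: bmM; [exact: bm_cst|apply: bm_sum => i; apply: bm_indX; exact: measurable_funPT].
    by rewrite (ExE P bD) lee_fin mulrC; exact: (iid_variance N_gt0 xlaw xind).
  by rewrite (ge0_integral_cmul mu r0 msq)// -/J mulrC EFinM fineK.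
apply: weight_moment_tail => // y y1.
rewrite (eq_bigr (fun=> F (- y) + 1 - F y)); last first.
  move=> i _; have mx : measurable_fun setT (xi N i) by exact: measurable_funPT.
  rewrite (ExB P (bmD (bm_indX mx _) (bm_cst _ 1)) (bm_indX mx _)) (ExD P (bm_indX mx _) (bm_cst _ 1)) Ex_cst.
  by rewrite !(Ex_ind_law _ (xlaw i)).
have -> : \sum_(i < N) (F (- y) + 1 - F y) = N%:R * (F (- y) + 1 - F y) by rewrite sumr_const card_ord mulr_natl.
by rewrite ler_wpM2l//; exact: hC.
Qed.

Lemma optimal_init_bounds (xi : forall N, 'I_N -> {RV P >-> R}) : optimal_init m xi ->
  (ereal_sup [set x%:E * \int[mu]_(y in `[x, +oo[) (F (- y) + 1 - F y)%:E | x in `[1%R, +oo[] < +oo)%E ->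
  exists C M0 : R, forall N, (0 < N)%N ->
    (\int[P]_w L1 mu (fun y => (init_cdf (@xi N) w y - F y)%R) <= (C / Num.sqrt N%:R)%:E)%E /\
    (\sum_(i < N) \int[P]_w (weight (xi N i w))%:E <= (N%:R * M0)%:E)%E.
Proof.
move=> xiE; set S := ereal_sup _ => Soo.
pose tl y : R := F (- y) + 1 - F y.
have tl0 y : 0 <= tl y by rewrite /tl; have [a0 a1] := F01 y; have [b0 b1] := F01 (- y); lra.
have tlmono y z : y <= z -> tl z <= tl y.
  move=> yz; have h1 := le_cdf_of m yz; have h2 : F (- z) <= F (- y) by apply: le_cdf_of; rewrite lerN2.
  by rewrite /tl; lra.
have I0 x : (0 <= \int[mu]_(y in `[x, +oo[) (tl y)%:E)%E by apply: integral_ge0 => y _; rewrite lee_fin.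
have hS x : 1 <= x -> (x%:E * \int[mu]_(y in `[x, +oo[) (tl y)%:E <= S)%E.
  by move=> x1; apply: ereal_sup_ubound; exists x => //=; rewrite in_itv/= x1.
have S0 : (0 <= S)%E.
  apply: le_trans (hS 1 (lexx 1)); exact: mule_ge0.
have Sf : S \is a fin_num by rewrite ge0_fin_numE.
pose C := fine S; have C0 : 0 <= C by rewrite /C fine_ge0.
have hC x : 1 <= x -> (\int[mu]_(y in `[x, +oo[) (tl y)%:E <= (C / x)%:E)%E.
  move=> x1; have x0 : 0 < x by exact: lt_le_trans x1.
  have := hS x x1; rewrite -[S]fineK// -/C => h.
  by rewrite mulrC EFinM -(@lee_pdivlMl R) in h *; rewrite // lee_pdivlMl.
(* [tl] decreases, so y times its value at 2 y is at most its integral over [y, 2 y], itself at most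
   C / y. *)
have tail2 y : 1 <= y -> tl (2 * y) <= C / y ^+ 2.
  move=> y1; have y0 : 0 < y by exact: lt_le_trans y1.
  have len : mu `[y, 2 * y]%classic = y%:E.
    apply: (etrans (lebesgue_measure_itv _)) => /=; rewrite lte_fin mulr_natl mulr2n ltrDl y0 -EFinD.
    by congr EFin; lra.
  have : ((tl (2 * y) * y)%:E <= (C / y)%:E)%E.
    apply: le_trans (hC y y1).
    apply: (@le_trans _ _ (\int[mu]_(z in `[y, (2 * y)%R]) (tl (2 * y))%:E)%E).
      by rewrite integral_cst//= len -EFinM.
    rewrite integral_mkcond [leRHS]integral_mkcond; apply: ge0_le_integral_nomeas => z; rewrite !patchE.
      by case: ifP => // _; rewrite lee_fin.
    case: ifPn => [zin|_]; last by case: ifP => // _; rewrite lee_fin.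
    have /andP[z1 z2] : y <= z <= 2 * y by move: zin; rewrite inE/= in_itv.
    rewrite ifT; last by rewrite inE/= in_itv/= z1.
    by rewrite lee_fin; exact: tlmono.
  by rewrite lee_fin -ler_pdivlMr// -mulrA -invfM -expr2.
(* The line is cut at plus or minus sqrt N: the centre costs 2 sqrt N / (2 N), each tail C / sqrt N.
   In the moment bound the 2 is the doubling of tails in [optimal_error]; 4 C comes from [tail2] for
   y >= 2, and 8 from the trivial bound 2 on [tl] for y < 2. *)
exists (1 + 2 * C), (weight 2 + 72 * (2 * (4 * C + 8))) => N N_gt0.
have NR : 0 < N%:R :> R by rewrite ltr0n.
have err w y := optimal_error N_gt0 (xiE N) w y.
split.
  pose r : R := Num.sqrt N%:R.
  have r1 : 1 <= r by rewrite -[leLHS]sqrtr1; apply: ler_wsqrtr; rewrite ler1n.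
  have r0 : 0 < r by exact: lt_le_trans r1.
  have r2 : r ^+ 2 = N%:R by rewrite sqr_sqrtr// ltW.
  have mtl : measurable_fun [set: R] tl.
    apply: measurable_funB => //; apply: measurable_funD => //.
    by apply: (@measurableT_comp _ _ _ _ _ _ F) => //; exact: measurable_funN.
  pose g1 y : R := \1_(`[- r, r]%classic) y * (2 * N%:R)^-1.
  pose g2 y : R := \1_(`[r, +oo[%classic) y * tl y.
  have i0 (A : set R) y : 0 <= \1_A y :> R by rewrite indicE.
  have g10 y : 0 <= g1 y by rewrite mulr_ge0// invr_ge0 mulr_ge0.
  have g20 y : 0 <= g2 y by rewrite mulr_ge0.
  have mi (A : set R) : measurable A -> measurable_fun [set: R] (\1_A : R -> R) by move=> mA; exact: measurable_indic.
  have mg1 : measurable_fun [set: R] g1 by apply: measurable_funM => //; apply: mi; exact: measurable_itv.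
  have mg2 : measurable_fun [set: R] g2 by apply: measurable_funM => //; apply: mi; exact: measurable_itv.
  have mg2N : measurable_fun [set: R] (fun y => g2 (- y)) by apply: measurableT_comp => //; exact: measurable_funN.
  have e2 : (\int[mu]_y (g2 y)%:E <= (C / r)%:E)%E.
    apply: le_trans (hC r r1); rewrite [leRHS]integral_mkcond; apply: ge0_le_integral_nomeas => y; first by rewrite lee_fin.
    by rewrite patchE; case: ifPn => yin; rewrite /g2 indicE ?yin ?(negbTE yin) lee_fin ?mul1r ?mul0r.
  have e1 : (\int[mu]_y (g1 y)%:E <= (1 / r)%:E)%E.
    have k0 : 0 <= (2 * N%:R)^-1 :> R by rewrite invr_ge0 mulr_ge0.
    rewrite /g1; under eq_integral do rewrite mulrC.
    rewrite (ge0_integral_cmul mu k0 (mi _ (measurable_itv _)) (i0 _)).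
    rewrite (integral_indic mu measurableT (measurable_itv _)) setIT.
    have len : mu `[- r, r]%classic = (2 * r)%:E.
      apply: (etrans (lebesgue_measure_itv _)) => /=; rewrite lte_fin gtrN// -EFinD; congr EFin; ring.
    apply: (@le_trans _ _ (((2 * N%:R)^-1)%:E * (2 * r)%:E)%E); first by rewrite -len; exact: lexx.
    rewrite -EFinM lee_fin -r2 le_eqVlt; apply/orP; left; apply/eqP; field; by rewrite gt_eqF.
  have pw w : (L1 mu (fun y => (init_cdf (@xi N) w y - F y)%R) <= ((1 + 2 * C) / r)%:E)%E.
    apply: (@le_trans _ _ (\int[mu]_y (g1 y + (g2 y + g2 (- y)))%:E)%E).
      apply: ge0_le_integral_nomeas => y; first by rewrite lee_fin.
      rewrite lee_fin; have [h1 h2 h3] := err w y.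
      have [b0 b1] := F01 y; have [b2 b3] := F01 (- y).
      case: (leP y r) => yr; last first.
        have -> : g2 y = tl y by rewrite /g2 indicE mem_set ?mul1r//= in_itv/= (ltW yr).
        have := g10 y; have := g20 (- y); rewrite /tl; lra.
      case: (leP (- r) y) => ry.
        have -> : g1 y = (2 * N%:R)^-1 by rewrite /g1 indicE mem_set ?mul1r//= in_itv/= ry.
        have := g20 y; have := g20 (- y); lra.
      have -> : g2 (- y) = tl (- y).
        by rewrite /g2 indicE mem_set ?mul1r//= in_itv/= andbT; lra.
      have := g10 y; have := g20 y; rewrite /tl opprK; lra.
    have g22 y : 0 <= g2 y + g2 (- y) by rewrite addr_ge0.
    have mg22 : measurable_fun [set: R] (fun y => g2 y + g2 (- y)) by exact: measurable_funD.
    rewrite (ge0_integral_add mu mg1 g10 mg22 g22) (ge0_integral_add mu mg2 g20 mg2N (fun y => g20 (- y))).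
    rewrite (@ge0_integral_reflect R (fun y => (g2 y)%:E)); last 2 first.
    - exact/measurable_EFinP.
    - by move=> y; rewrite lee_fin.
    have -> : ((1 + 2 * C) / r)%:E = ((1 / r)%:E + ((C / r)%:E + (C / r)%:E))%E by rewrite -!EFinD; congr EFin; field; rewrite gt_eqF.
    by apply: leeD => //; apply: leeD.
  apply: (@le_trans _ _ (\int[P]_w (cst ((1 + 2 * C) / r)%:E w))%E); last by rewrite integral_cst//= probability_setT mule1.
  by apply: ge0_le_integral_nomeas => w //; exact: L1_ge0.
have C80 : 0 <= 2 * (4 * C + 8) by rewrite mulr_ge0// addr_ge0// mulr_ge0.
have tailA y : 1 <= y -> tl y <= (4 * C + 8) / y ^+ 2.
  move=> y1; have y0 : 0 < y by exact: lt_le_trans y1.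
  have yy : 0 < y ^+ 2 by rewrite exprn_gt0.
  case: (leP 2 y) => y2.
    have y21 : 1 <= y / 2 by rewrite ler_pdivlMr// mul1r.
    have := tail2 (y / 2) y21; rewrite (_ : 2 * (y / 2) = y); last by field.
    have -> : C / (y / 2) ^+ 2 = 4 * C / y ^+ 2 by field; rewrite gt_eqF.
    move=> h; apply: le_trans h _; rewrite ler_wpM2r ?invr_ge0 ?(ltW yy)// lerDl; exact: ler0n.
  rewrite ler_pdivlMr//.
  have h : y ^+ 2 <= 4 by rewrite expr2; have := ler_pM (ltW y0) (ltW y0) (ltW y2) (ltW y2); lra.
  have t2 : tl y <= 2 by rewrite /tl; have [a0 a1] := F01 y; have [b0 b1] := F01 (- y); lra.
  apply: le_trans (ler_wpM2r (ltW yy) t2) _; lra.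
apply: weight_moment_tail => // y y1.
have mx i : measurable_fun setT (xi N i) by exact: measurable_funPT.
have bt i : bm (fun w => ind (xi N i w) (- y) + 1 - ind (xi N i w) y).
  exact: (bmB (bmD (bm_indX (mx i) (- y)) (bm_cst _ 1)) (bm_indX (mx i) y)).
rewrite -(Ex_sum P _ bt) -[leRHS](Ex_cst P).
have bs : bm (fun w => \sum_(i < N) (ind (xi N i w) (- y) + 1 - ind (xi N i w) y)) by apply: bm_sum.
apply: (Ex_le P bs (bm_cst _ _)) => w.
have -> : \sum_(i < N) (ind (xi N i w) (- y) + 1 - ind (xi N i w) y) = N%:R * (init_cdf (@xi N) w (- y) + 1 - init_cdf (@xi N) w y).
  rewrite sumrB big_split/= sumr_const card_ord /init_cdf mulrBr mulrDr mulr1 !mulrA mulfV ?gt_eqF// !mul1r; exact: erefl.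
rewrite ler_wpM2l//; have [_ h2 _] := err w (- y); have [_ _ h3] := err w y.
have h4 := tailA y y1; rewrite /tl in h4.
have -> : 2 * (4 * C + 8) / y ^+ 2 = 2 * ((4 * C + 8) / y ^+ 2) by rewrite mulrA.
move: h2 h3; rewrite !ler_norml => /andP[c1 c2] /andP[c3 c4]; lra.
Qed.

End initial_error.

(** * Stability and conclusion *)

Section ereal_gronwall.
Variable R : realType.

(** Finiteness of the mean distances is not known beforehand; it propagates along the grid, since
    the inequality at k involves only earlier indices. *)
Lemma gronwall_ereal (c E dl T : R) n (u : nat -> \bar R) :
  0 <= c -> 0 <= E -> 0 < dl -> n%:R * dl <= T -> (forall k, (0 <= u k)%E) ->
  (forall k, (0 < k <= n)%N ->
    (u k <= E%:E + \sum_(1 <= j < k) (c * (dl / Num.sqrt ((k - j)%:R * dl)))%:E * u j)%E) ->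
  forall k, (0 < k <= n)%N -> (u k <= (gronwall_cst c T * E)%:E)%E.
Proof.
move=> c0 E0 d0 nT u0 hu.
have fin k : (0 < k <= n)%N -> u k \is a fin_num.
  elim/ltn_ind: k => k ih kn; rewrite ge0_fin_numE//.
  apply: le_lt_trans (hu k kn) _; rewrite -ge0_fin_numE; last first.
    apply: adde_ge0; first by rewrite lee_fin.
    apply: sume_ge0 => j _; apply: mule_ge0 => //.
    by rewrite lee_fin; apply: mulr_ge0 => //; apply: divr_ge0; [exact: ltW|exact: sqrtr_ge0].
  rewrite fin_numD/=; rewrite big_nat_cond; apply/sum_fin_numP => j jin.
  case/andP=> /andP[j1 jk] _; rewrite fin_numM//; apply: ih => //.
  by case/andP: kn => _ kn; rewrite j1 (leq_trans (ltnW jk)).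
pose a k := if (0 < k <= n)%N then fine (u k) else 0.
have a0 k : 0 <= a k by rewrite /a; case: ifP => // _; exact: fine_ge0.
have aE k : (0 < k <= n)%N -> (a k)%:E = u k by move=> kn; rewrite /a kn fineK// fin.
have ha k : (0 < k <= n)%N -> a k <= 0 / Num.sqrt (k%:R * dl) + E + c * \sum_(1 <= j < k) dl / Num.sqrt ((k - j)%:R * dl) * a j.
  move=> kn; rewrite mul0r add0r -lee_fin aE//; apply: le_trans (hu k kn) _.
  rewrite EFinD; apply: leeD => //; rewrite mulr_sumr -sumEFin.
  rewrite big_nat [leRHS]big_nat; apply: lee_sum => j /andP[j1 jk].
  rewrite -aE ?j1 ?(leq_trans (ltnW jk))//; last by case/andP: kn.
  by rewrite -EFinM lee_fin -[leLHS]mulrA.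
move=> k kn; rewrite -aE// lee_fin.
by have := gronwall c0 (lexx 0) E0 d0 nT a0 ha kn; rewrite mul0r !add0r.
Qed.

End ereal_gronwall.

Section mild_stability.
Variables (R : realType) (sigma B T : R) (L : R -> R).
Notation mu := (@lebesgue_measure R).
Hypothesis sigma_gt0 : 0 < sigma.
Hypothesis B_ge0 : 0 <= B.
Hypothesis mL : measurable_fun [set: R] L.
Hypothesis L_lip : forall x y, `|L x - L y| <= B * `|x - y|.

Let bmL (f : R -> R) : measurable_fun [set: R] f -> (forall y, 0 <= f y <= 1) ->
  bm ((fun y => L (f y) - L 0) : measurableTypeR R -> R).
Proof.
move=> mf f01; split; first by apply: measurable_funB => //; exact: measurableT_comp.
exists B => y; apply: le_trans (L_lip _ _) _; case/andP: (f01 y) => h0 h1.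
by rewrite subr0 ger0_norm// ler_piMr.
Qed.

Let bm01 (f : R -> R) : measurable_fun [set: R] f -> (forall y, 0 <= f y <= 1) -> bm (f : measurableTypeR R -> R).
Proof. by move=> mf f01; split => //; exists 1 => y; case/andP: (f01 y) => h0 h1; rewrite ger0_norm. Qed.

Definition kernel_cst : R := 256 * B / sigma.

Lemma kernel_cst_ge0 : 0 <= kernel_cst.
Proof. by apply: divr_ge0; [apply: mulr_ge0; [exact: ler0n|exact: B_ge0]|exact: ltW]. Qed.

(** The two mild equations are subtracted: the heat flow contracts L^1, and each convolution costs
    256 / (sigma sqrt (t - s)) times the Lipschitz constant B of Lambda. *)
Lemma L1_mild_stability (F1 F2 : R -> R -> R) dl t n :
  (forall s, measurable_fun [set: R] (F1 s)) -> (forall s, measurable_fun [set: R] (F2 s)) ->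
  (forall s y, 0 <= F1 s y <= 1) -> (forall s y, 0 <= F2 s y <= 1) -> 0 < dl -> n%:R * dl < t ->
  (L1 mu (fun y => (F1 t y - F2 t y)%R) <=
   L1 mu (mild_residual sigma L F1 dl t n) + L1 mu (mild_residual sigma L F2 dl t n) +
   L1 mu (fun y => (F1 0 y - F2 0 y)%R) +
   \sum_(1 <= k < n) (kernel_cst * (dl / Num.sqrt (t - k%:R * dl)))%:E * L1 mu (fun y => (F1 (k%:R * dl) y - F2 (k%:R * dl) y)%R))%E.
Proof.
move=> m1 m2 F1b F2b d0 nt.
have b1 s := bm01 (m1 s) (F1b s); have b2 s := bm01 (m2 s) (F2b s).
have bL1 s := bmL (m1 s) (F1b s); have bL2 s := bmL (m2 s) (F2b s).
pose a k := sigma * Num.sqrt (t - k%:R * dl).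
have a0 k : (k < n)%N -> 0 < a k.
  move=> kn; rewrite mulr_gt0// sqrtr_gt0 subr_gt0; apply: lt_trans nt.
  by rewrite ltr_pM2r// ltr_nat.
pose r1 := mild_residual sigma L F1 dl t n; pose r2 := mild_residual sigma L F2 dl t n.
pose g k y := dl * dconv (a k) (fun y => L (F1 (k%:R * dl) y) - L (F2 (k%:R * dl) y)) y.
pose h := heat (sigma * Num.sqrt t) (fun y => F1 0 y - F2 0 y).
have mr (F : R -> R -> R) : (forall s, measurable_fun [set: R] (F s)) -> (forall s y, 0 <= F s y <= 1) ->
    measurable_fun [set: R] (mild_residual sigma L F dl t n).
  move=> mF F01; apply: measurable_funD.
    by apply: measurable_funB => //; have [] := bm_heat (sigma * Num.sqrt t) (bm01 (mF 0) (F01 0)).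
  apply: measurable_sum => k; apply: measurable_funM => //; apply: measurable_dconv.
  by have [] := bmL (mF (k%:R * dl)) (F01 (k%:R * dl)).
have bD k : bm ((fun y => L (F1 (k%:R * dl) y) - L (F2 (k%:R * dl) y)) : measurableTypeR R -> R).
  have := bmB (bL1 (k%:R * dl)) (bL2 (k%:R * dl)).
  rewrite (_ : (fun x => _) = (fun y => L (F1 (k%:R * dl) y) - L (F2 (k%:R * dl) y)))//.
  by apply/funext => y; ring.
have mg k : measurable_fun [set: R] (g k).
  by apply: measurable_funM => //; apply: measurable_dconv; have [] := bD k.
have bh : bm (h : measurableTypeR R -> R) by apply: bm_heat; exact: bmB.
have [mh _] := bh.
have E y : F1 t y - F2 t y = (r1 y - r2 y + h y) - \sum_(1 <= k < n) g k y.
  have -> : \sum_(1 <= k < n) g k y = \sum_(1 <= k < n) dl * dconv (a k) (fun y => L (F1 (k%:R * dl) y) - L 0) y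
      - \sum_(1 <= k < n) dl * dconv (a k) (fun y => L (F2 (k%:R * dl) y) - L 0) y.
    rewrite -sumrB; apply: eq_big_nat => k /andP[_ kn].
    rewrite /g -mulrBr -(dconvB y (a0 k kn) (bL1 _) (bL2 _)); congr (_ * dconv _ _ _).
    by apply/funext => z; ring.
  rewrite /h (heatB _ _ (b1 0) (b2 0)) /r1 /r2 /mild_residual -/a.
  move: (\sum_(1 <= k < n) _) (\sum_(1 <= k < n) _) (heat _ _ _) (heat _ _ _) => s1 s2 h1 h2; ring.
under eq_L1 do rewrite E.
have mr1 : measurable_fun [set: R] r1 by exact: mr.
have mr2 : measurable_fun [set: R] r2 by exact: mr.
have mr12 : measurable_fun [set: R] (fun y => r1 y - r2 y) by exact: measurable_funB.
apply: le_trans (L1B mu (measurable_funD mr12 mh) (measurable_sum _ mg)) _.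
apply: leeD.
  apply: le_trans (L1D mu mr12 mh) _; apply: leeD; first exact: L1B.
  by apply: L1_heat; exact: bmB.
apply: le_trans (L1_sum mu _ mg) _.
rewrite big_nat [leRHS]big_nat; apply: lee_sum => k /andP[_ kn].
have mdc : measurable_fun [set: R] (dconv (a k) (fun y => L (F1 (k%:R * dl) y) - L (F2 (k%:R * dl) y))).
  by apply: measurable_dconv; have [] := bD k.
rewrite /g (L1Z mu _ mdc) (ger0_norm (ltW d0)).
apply: le_trans (lee_wpmul2l _ (L1_dconv (a0 k kn) (bD k))) _; first by rewrite lee_fin ltW.
have ca : 0 <= 256 / a k by apply: divr_ge0; [exact: ler0n|exact: ltW (a0 k kn)].
have mF12 : measurable_fun [set: R] (fun y => F1 (k%:R * dl) y - F2 (k%:R * dl) y) by exact: measurable_funB.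
have hl : (L1 mu (fun y => (L (F1 (k%:R * dl) y) - L (F2 (k%:R * dl) y))%R) <=
    B%:E * L1 mu (fun y => (F1 (k%:R * dl) y - F2 (k%:R * dl) y)%R))%E.
  rewrite -{1}(ger0_norm B_ge0) -(L1Z mu _ mF12); apply: le_L1 => y.
  by rewrite normrM (ger0_norm B_ge0); exact: L_lip.
apply: (@le_trans _ _ (dl%:E * ((256 / a k)%:E * (B%:E * L1 mu (fun y => (F1 (k%:R * dl) y - F2 (k%:R * dl) y)%R))))%E).
  apply: lee_wpmul2l; first by rewrite lee_fin ltW.
  by apply: lee_wpmul2l => //; rewrite lee_fin.
rewrite !muleA -!EFinM le_eqVlt; apply/orP; left; apply/eqP; congr (_%:E * _)%E.
rewrite /kernel_cst /a; move: (Num.sqrt _) => q; rewrite !invfM; ring.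
Qed.

Context d (Omega : measurableType d) (P : probability Omega R).
Variables (FN : Omega -> R -> R -> R) (F : R -> R -> R).
Hypothesis T_gt0 : 0 < T.
Hypothesis mFN : forall s, measurable_fun setT (fun z : Omega * measurableTypeR R => FN z.1 s z.2).
Hypothesis FN01 : forall w s y, 0 <= FN w s y <= 1.
Hypothesis mF : forall s, measurable_fun [set: R] (F s).
Hypothesis F01 : forall s y, 0 <= F s y <= 1.

Definition mean_L1 s : \bar R := (\int[P]_w L1 mu (fun y => (FN w s y - F s y)%R))%E.

Let mFNw w s : measurable_fun [set: R] (FN w s).
Proof. exact: (measurable_fun_curry1 w (mFN s)). Qed.

Lemma measurable_L1_diff s : measurable_fun setT (fun w => L1 mu (fun y => (FN w s y - F s y)%R)).
Proof.
have mD : measurable_fun setT (fun z : Omega * measurableTypeR R => `|FN z.1 s z.2 - F s z.2|%:E).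
  apply/measurable_EFinP; apply: measurableT_comp => //; apply: measurable_funB => //.
  by apply: (measurableT_comp (mF s)); exact: measurable_snd.
have D0 (z : Omega * measurableTypeR R) : (0 <= `|FN z.1 s z.2 - F s z.2|%:E)%E by rewrite lee_fin.
exact: (measurable_fun_fubini_tonelli_F _ mD D0).
Qed.

Lemma mean_L1_ge0 s : (0 <= mean_L1 s)%E.
Proof. by apply: integral_ge0 => w _; exact: L1_ge0. Qed.

(** The grid times cost [gronwall_cst]; one more application of the inequality, at a time off the
    grid, sums the kernel to 2 sqrt T. *)
Definition stability_cst : R := 1 + 2 * kernel_cst * Num.sqrt T * gronwall_cst kernel_cst T.

Lemma stability_cst_ge1 : 1 <= stability_cst.
Proof.
rewrite lerDl; apply: mulr_ge0; last by apply: gronwall_cst_ge0; [exact: kernel_cst_ge0|exact: ltW].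
by apply: mulr_ge0 => //; apply: mulr_ge0 => //; exact: kernel_cst_ge0.
Qed.

(** The residual bounds V and M may change with the time; only their sum with the initial error has
    to be uniformly below E. The bound is proved at the grid times first, then at t through the grid
    points below it. *)
Lemma mean_L1_bound dl E : 0 < dl ->
  (forall t n, n%:R * dl < t -> t <= n.+1%:R * dl -> t <= T -> exists V : Omega -> \bar R, exists M : R,
    [/\ measurable_fun setT V, forall w, (0 <= V w)%E,
        {ae P, forall w, (L1 mu (mild_residual sigma L (FN w) dl t n) <= V w)%E},
        (L1 mu (mild_residual sigma L F dl t n) <= M%:E)%E &
        (\int[P]_w V w + M%:E + mean_L1 0 <= E%:E)%E]) ->
  forall t, 0 < t -> t <= T -> (mean_L1 t <= (stability_cst * E)%:E)%E.
Proof.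
move=> d0 H.
have c0 := kernel_cst_ge0.
have step t n : n%:R * dl < t -> t <= n.+1%:R * dl -> t <= T ->
    (mean_L1 t <= E%:E + \sum_(1 <= k < n) (kernel_cst * (dl / Num.sqrt (t - k%:R * dl)))%:E * mean_L1 (k%:R * dl))%E.
  move=> nt tn tT; have [V [M [mV V0 hV hM hE]]] := H t n nt tn tT.
  have kt0 k : 0 <= kernel_cst * (dl / Num.sqrt (t - k%:R * dl)).
    by apply: mulr_ge0 => //; apply: divr_ge0; [exact: ltW|exact: sqrtr_ge0].
  have M0 : (0 <= M%:E)%E by apply: le_trans hM; exact: L1_ge0.
  pose U s w := L1 mu (fun y => (FN w s y - F s y)%R).
  have U0 s w : (0 <= U s w)%E by exact: L1_ge0.
  have mS : measurable_fun setT (fun w => \sum_(1 <= k < n) (kernel_cst * (dl / Num.sqrt (t - k%:R * dl)))%:E * U (k%:R * dl)%R w)%E.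
    by apply: emeasurable_sum => k; apply: measurable_funeM; exact: measurable_L1_diff.
  have S0 w : (0 <= \sum_(1 <= k < n) (kernel_cst * (dl / Num.sqrt (t - k%:R * dl)))%:E * U (k%:R * dl)%R w)%E.
    by apply: sume_ge0 => k _; apply: mule_ge0; rewrite // lee_fin.
  have mV2 : measurable_fun setT (fun w => V w + M%:E)%E by exact: emeasurable_funD.
  have mV3 : measurable_fun setT (fun w => V w + M%:E + U 0%R w)%E by apply: emeasurable_funD => //; exact: measurable_L1_diff.
  have V20 w : (0 <= V w + M%:E)%E by exact: adde_ge0.
  have V30 w : (0 <= V w + M%:E + U 0%R w)%E by exact: adde_ge0.
  apply: (@le_trans _ _ (\int[P]_w ((V w + M%:E + U 0%R w) + \sum_(1 <= k < n) (kernel_cst * (dl / Num.sqrt (t - k%:R * dl)))%:E * U (k%:R * dl)%R w))%E).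
    apply: ae_ge0_le_integral => //.
    - by move=> w _; exact: L1_ge0.
    - exact: measurable_L1_diff.
    - by move=> w _; exact: adde_ge0.
    - exact: emeasurable_funD.
    apply: filterS hV => w hw _.
    apply: le_trans (L1_mild_stability (mFNw w) mF (FN01 w) F01 d0 nt) _.
    by apply: leeD => //; apply: leeD => //; exact: leeD.
  rewrite ge0_integralD//; apply: leeD.
    apply: le_trans hE; rewrite ge0_integralD//; last exact: measurable_L1_diff.
    by rewrite ge0_integralD// integral_cst//= probability_setT mule1.
  rewrite ge0_integral_sum//; last first.
  - by move=> k w _; apply: mule_ge0; rewrite // lee_fin.
  - by move=> k; apply: measurable_funeM; exact: measurable_L1_diff.
  apply: lee_sum => k _; rewrite ge0_integralZl_EFin//; exact: measurable_L1_diff.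
move=> t t0 tT; have [n [nt tn]] := grid_exists d0 t0.
have E0 : 0 <= E.
  have [V [M [_ V0 _ hM hE]]] := H t n nt tn tT; rewrite -lee_fin; apply: le_trans hE.
  apply: adde_ge0; last exact: mean_L1_ge0.
  by apply: adde_ge0; [exact: integral_ge0|apply: le_trans hM; exact: L1_ge0].
have ndT : n%:R * dl <= T by exact: le_trans (ltW nt) tT.
have gr k : (0 < k <= n)%N -> (mean_L1 (k%:R * dl) <= (gronwall_cst kernel_cst T * E)%:E)%E.
  apply: (@gronwall_ereal R kernel_cst E dl T n (fun k => mean_L1 (k%:R * dl))) => //.
    by move=> j; exact: mean_L1_ge0.
  case=> // j /andP[_ jn].
  have jk : j%:R * dl < j.+1%:R * dl by rewrite ltr_pM2r// ltr_nat.
  have jT : j.+1%:R * dl <= T by apply: le_trans ndT; rewrite ler_wpM2r ?(ltW d0)// ler_nat.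
  apply: le_trans (step _ _ jk (lexx _) jT) _; apply: leeD => //.
  have [j0|j0] := posnP j; first by rewrite j0 !big_geq.
  rewrite [leRHS]big_nat_recr//=.
  rewrite (eq_big_nat _ _ (F2 := fun k => (kernel_cst * (dl / Num.sqrt ((j.+1 - k)%:R * dl)))%:E * mean_L1 (k%:R * dl))%E); last first.
    by move=> i /andP[i1 ij]; rewrite -mulrBl -natrB// ltnW// ltnW.
  rewrite leeDl//; apply: mule_ge0; last exact: mean_L1_ge0.
  by rewrite lee_fin; apply: mulr_ge0 => //; apply: divr_ge0; [exact: ltW|exact: sqrtr_ge0].
have g0 : 0 <= gronwall_cst kernel_cst T by apply: gronwall_cst_ge0 => //; exact: ltW.
apply: le_trans (step t n nt tn tT) _.
have -> : (stability_cst * E)%:E = (E%:E + (kernel_cst * (gronwall_cst kernel_cst T * E) * (2 * Num.sqrt T))%:E)%E.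
  by rewrite -EFinD /stability_cst; congr EFin; ring.
apply: leeD => //.
have gE0 : 0 <= gronwall_cst kernel_cst T * E by exact: mulr_ge0.
apply: (@le_trans _ _ (\sum_(1 <= k < n) (kernel_cst * (gronwall_cst kernel_cst T * E) * (dl / Num.sqrt ((n - k)%:R * dl))))%R%:E).
  rewrite -sumEFin big_nat [leRHS]big_nat; apply: lee_sum => k /andP[k1 kn].
  have kk : (0 < k <= n)%N by rewrite k1 ltnW.
  have kt0 : 0 <= kernel_cst * (dl / Num.sqrt (t - k%:R * dl)).
    by apply: mulr_ge0 => //; apply: divr_ge0; [exact: ltW|exact: sqrtr_ge0].
  apply: le_trans (lee_wpmul2l _ (gr k kk)) _; first by rewrite lee_fin.
  rewrite -EFinM lee_fin -[leLHS]mulrA -[leRHS]mulrA; apply: ler_wpM2l => //.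
  rewrite [leRHS]mulrC; apply: ler_wpM2r => //; apply: ler_wpM2l; first exact: ltW.
  have nk : 0 < (n - k)%:R * dl by rewrite mulr_gt0// ltr0n subn_gt0.
  have nkt : (n - k)%:R * dl <= t - k%:R * dl by rewrite natrB ?(ltnW kn)// mulrBl lerD2r ltW.
  by rewrite lef_pV2 ?posrE ?sqrtr_gt0 ?(lt_le_trans nk)// ler_wsqrtr.
rewrite lee_fin -mulr_sumr; apply: ler_wpM2l; first exact: mulr_ge0.
exact: (sum_singular d0 nt tT).
Qed.

End mild_stability.

Section convergence.
Variables (R : realType) (T sigma B : R) (Lambda lambda : R -> R) (m : probability (measurableTypeR R) R).
Context d' (Omega' : measurableType d') (P' : probability Omega' R).
Variables (X0 : {RV P' >-> R}) (W' X : R -> {RV P' >-> R}).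
Context d (Omega : measurableType d) (P : probability Omega R).
Variables (N : nat) (h : R) (G : R -> set (set Omega)).
Variables (xi : 'I_N -> {RV P >-> R}) (W Y : 'I_N -> R -> {RV P >-> R}).
Variables (C0 M0 : R).
Hypothesis T_gt0 : 0 < T.
Hypothesis sigma_gt0 : 0 < sigma.
Hypothesis HC1 : C1_on01 Lambda lambda.
Hypothesis lamB : forall x, `|cliplam lambda x| <= B.
Hypothesis Hlim : limit_solution T sigma lambda m X0 W' X.
Hypothesis N_gt0 : (0 < N)%N.
Hypothesis Hsol : particle_solution T sigma Lambda h G xi W Y.
Hypothesis Wbm : forall i, standard_brownian_motion (W i).
Hypothesis Wind : forall i j, i != j ->
  independent2 P (sigma_family `[0, +oo[ (fun t => W i t)) (sigma_family `[0, +oo[ (fun t => W j t)).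
Hypothesis init_L1 : (\int[P]_w L1 (@lebesgue_measure R) (fun y => (init_cdf xi w y - cdf_of m y)%R) <= (C0 / Num.sqrt N%:R)%:E)%E.
Hypothesis init_moment : (\sum_(i < N) \int[P]_w (weight (xi i w))%:E <= (N%:R * M0)%:E)%E.

Notation mu := (@lebesgue_measure R).
Notation L := (clipLam Lambda).
Notation F := (marginal_cdf X).
Notation FN := (empirical_cdf Y).

Let B_ge0 : 0 <= B. Proof. exact: le_trans (lamB 0). Qed.

Let mL : measurable_fun [set: R] L.
Proof. by apply: continuous_measurable_fun; exact: (continuous_clipLam HC1). Qed.

Let L_lip := clipLam_lipschitz HC1 lamB.

Let mFN s : measurable_fun setT (fun z : Omega * measurableTypeR R => FN z.1 s z.2).
Proof.
apply: measurable_funM => //; apply: measurable_sum => i; apply: measurable_ind; last exact: measurable_snd.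
exact: (measurableT_comp (measurable_funPT (Y i s))).
Qed.

Let FN01 w s y : 0 <= FN w s y <= 1.
Proof.
have NR : 0 < N%:R :> R by rewrite ltr0n.
apply/andP; split.
  by rewrite mulr_ge0 ?invr_ge0//; apply: sumr_ge0 => i _; exact: ind_ge0.
rewrite ler_pdivrMl// mulr1 -[leRHS](_ : \sum_(i < N) 1 = N%:R); last by rewrite sumr_const card_ord.
by apply: ler_sum => i _; exact: ind_le1.
Qed.

Let mF s : measurable_fun [set: R] (F s). Proof. exact: measurable_marginal_cdf. Qed.
Let F01 s y : 0 <= F s y <= 1. Proof. exact: marginal_cdf01. Qed.

Notation U := (mean_L1 P FN F).

Lemma limit_start y : F 0 y = cdf_of m y.
Proof.
rewrite -(Ex_ind_law y (limit_init Hlim)).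
have T0 : 0 <= T by exact: ltW.
have [W0 _ _ _] := limit_noise Hlim.
have X00 : {ae P', forall w, X 0 w = X0 w}.
  apply: filterS2 (limit_eq Hlim) W0 => w -> //; last by rewrite lexx.
  by move=> ->; rewrite mulr0 addr0 set_itv1 /Rintegral integral_set1 addr0.
have b1 := bm_indX (measurable_funPT (X 0)) y; have b2 := bm_indX (measurable_funPT X0) y.
apply/eqP; rewrite eq_le; apply/andP; split; apply: Ex_le_ae => //; try by move=> w; exact: ind_ge0.
  by apply: filterS X00 => w ->.
by apply: filterS X00 => w ->.
Qed.

Lemma mean_L1_start : (U 0 <= (C0 / Num.sqrt N%:R)%:E)%E.
Proof.
apply: le_trans init_L1.
have mI : measurable_fun setT (fun w => L1 mu (fun y => (init_cdf xi w y - cdf_of m y)%R)).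
  have mDa : measurable_fun setT (fun z : Omega * measurableTypeR R => `|init_cdf xi z.1 z.2 - cdf_of m z.2|%:E).
    by apply/measurable_EFinP; apply: measurableT_comp => //; exact: measurable_init_error.
  exact: (measurable_fun_fubini_tonelli_F _ mDa (fun z => normr_ge0 _)).
have hstart : {ae P, forall w, forall i, Y i 0 w = xi i w}.
  by apply: filter_forall => i; exact: (particle_start Hsol Wbm i (ltW T_gt0)).
apply: ae_ge0_le_integral => //.
- by move=> w _; exact: L1_ge0.
- exact: (measurable_L1_diff mFN mF).
- by move=> w _; exact: L1_ge0.
apply: filterS hstart => w hw _; rewrite le_eqVlt; apply/orP; left; apply/eqP; apply: eq_L1 => y.
by rewrite limit_start /empirical_cdf /init_cdf; congr (_ * _ - _); apply: eq_bigr => i _; rewrite hw.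
Qed.

Let mi i : R := fine (\int[P]_w (weight (xi i w))%:E)%E.

Let w0 i : (0 <= \int[P]_w (weight (xi i w))%:E)%E.
Proof. by apply: integral_ge0 => w _; rewrite lee_fin weight_ge0. Qed.

Let mi_fin i : (\int[P]_w (weight (xi i w))%:E)%E \is a fin_num.
Proof.
rewrite ge0_fin_numE//; apply: le_lt_trans (ltry (N%:R * M0)); apply: le_trans init_moment.
by rewrite (bigD1 i)//= leeDl// sume_ge0.
Qed.

Let xi_moment i : (\int[P]_w (weight (xi i w))%:E <= (mi i)%:E)%E.
Proof. by rewrite /mi fineK. Qed.

Let mi_sum : \sum_(i < N) mi i <= N%:R * M0.
Proof.
rewrite -lee_fin -sumEFin; apply: le_trans init_moment.
by apply: lee_sum => i _; rewrite /mi fineK.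
Qed.

Definition convergence_cst : R := `|mild_martingale_cst T sigma B M0| + `|C0|.

Let a : R := convergence_cst / Num.sqrt N%:R.

Let rN : 0 < Num.sqrt N%:R :> R. Proof. by rewrite sqrtr_gt0 ltr0n. Qed.

Let aE : mild_martingale_cst T sigma B M0 / Num.sqrt N%:R + C0 / Num.sqrt N%:R <= a.
Proof. by rewrite /a -mulrDl ler_pM2r ?invr_gt0// lerD ?ler_norm. Qed.

Lemma convergence_cst_ge0 : 0 <= convergence_cst.
Proof. by rewrite addr_ge0. Qed.

Let S := stability_cst sigma B T.

Let S1 : 1 <= S. Proof. exact: stability_cst_ge1. Qed.

Let at_zero : (U 0 <= (S * a)%:E)%E.
Proof.
apply: le_trans mean_L1_start _; rewrite lee_fin.
have a0 : 0 <= a by rewrite divr_ge0 ?convergence_cst_ge0.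
apply: (@le_trans _ _ a); last by rewrite ler_peMl.
by rewrite ler_pM2r ?invr_gt0// (le_trans (ler_norm _))// lerDr.
Qed.

(** N stays fixed while the grid step tends to 0, which removes every error except the martingale
    and the initial one. *)
Lemma mean_L1_continuous t : h = 0 -> 0 <= t <= T -> (U t <= (S * a)%:E)%E.
Proof.
move=> h0 /andP[]; rewrite le_eqVlt => /predU1P[<- _|t0 tT]; first exact: at_zero.
apply/lee_addgt0Pr => e e0; rewrite -EFinD.
(* The errors add up to 5 e1: 2 e1 for freezing the particle drifts, e1 for the limit and path_cst
   dl <= e1 on each side. *)
pose e1 := e / S / 8.
have S0 : 0 < S by exact: lt_le_trans S1.
have e10 : 0 < e1 by rewrite !divr_gt0.
have [dl1 dl10 hl] := limit_mild T_gt0 sigma_gt0 HC1 lamB Hlim e10.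
have /choice[dl2 hdl2] i : exists dl : R, 0 < dl /\
    forall delta t n, 0 < delta -> n%:R * delta < t -> t <= n.+1%:R * delta -> t <= T -> delta <= dl ->
    exists q : Omega -> R, [/\ bm q, forall w, 0 <= q w, \int[P]_w q w <= e1 &
      {ae P, forall w, \sum_(k < n.+1) `|step_error sigma Lambda W Y delta t n i k w| <= q w}].
  by have [dl dl0 hdl] := step_error_continuous T_gt0 sigma_gt0 HC1 lamB N_gt0 Hsol Wbm Wind i h0 e10; exists dl.
pose pc := path_cst sigma T B.
have pc0 : 0 <= pc by exact: path_cst_ge0.
have pc1 : 0 < pc + 1 by rewrite ltr_wpDl.
pose dl := \big[Num.min/Num.min dl1 (e1 / (pc + 1))]_(i < N) dl2 i.
have dl0 : 0 < dl.
  rewrite /dl; elim/big_ind: _ => [|x y x0 y0|i _]; first by rewrite lt_min dl10 divr_gt0.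
    by rewrite lt_min x0.
  by have [] := hdl2 i.
have dlm : dl <= Num.min dl1 (e1 / (pc + 1)) by exact: bigmin_le_id.
have dldl1 : dl <= dl1 by apply: le_trans dlm _; rewrite ge_min lexx.
have pcdl : pc * dl <= e1.
  apply: (@le_trans _ _ (pc * (e1 / (pc + 1)))).
    by rewrite ler_wpM2l//; apply: le_trans dlm _; rewrite ge_min lexx orbT.
  by rewrite mulrA ler_pdivrMr// mulrC ler_wpM2l ?(ltW e10)// lerDl.
have dldl2 i : dl <= dl2 i by exact: bigmin_le_cond.
have -> : S * a + e = S * (a + 8 * e1) by rewrite /e1; field; rewrite gt_eqF.
apply: (@mean_L1_bound R sigma B T L sigma_gt0 B_ge0 mL L_lip _ _ P FN F T_gt0 mFN FN01 mF F01 dl _ dl0 _ t t0 tT).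
move=> s n ns sn sT.
have /choice[q hq] i : exists q : Omega -> R, [/\ bm q, forall w, 0 <= q w, \int[P]_w q w <= e1 &
      {ae P, forall w, \sum_(k < n.+1) `|step_error sigma Lambda W Y dl s n i k w| <= q w}].
  by have [_] := hdl2 i; apply.
have [V [mV V0 hV EV]] := particle_mild T_gt0 sigma_gt0 HC1 lamB N_gt0 Hsol Wbm Wind xi_moment mi_sum dl0 ns sn sT
  (fun i => let: And4 x _ _ _ := hq i in x) (fun i => let: And4 _ x _ _ := hq i in x)
  (fun i => let: And4 _ _ x _ := hq i in x) (fun i => let: And4 _ _ _ x := hq i in x).
exists V, (e1 + pc * dl); split => //; first exact: hl.
apply: le_trans (leeD (leeD EV (lexx _)) mean_L1_start) _.
rewrite -!EFinD lee_fin -/pc; have := aE; move: (mild_martingale_cst _ _ _ _ / _) (C0 / _) => x1 x2; lra.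
Qed.

(** The grid is that of the scheme, so the step errors vanish and q = 0; the residual of the limit
    is bounded by [L1_mild_coarse]. *)
Lemma mean_L1_euler K t : 0 <= K -> (forall x y, `|cliplam lambda x - cliplam lambda y| <= K * `|x - y|) ->
  0 < h -> 0 <= t <= T ->
  (U t <= (S * (a + (path_cst sigma T B + `|coarse_cst T sigma B K|) * h))%:E)%E.
Proof.
move=> K0 lamK h0.
have pc0 : 0 <= path_cst sigma T B by exact: path_cst_ge0.
have alg (x1 x2 p c cn b : R) : c * h <= cn * h -> x1 + x2 <= b -> x1 + p * h + c * h + x2 <= b + (p + cn) * h by lra.
have ch : 0 <= (path_cst sigma T B + `|coarse_cst T sigma B K|) * h by apply: mulr_ge0; [apply: addr_ge0; [exact: pc0|exact: normr_ge0]|exact: ltW].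
have S0 : 0 < S by exact: lt_le_trans S1.
move=> /andP[]; rewrite le_eqVlt => /predU1P[<- _|t0 tT].
  by apply: le_trans at_zero _; rewrite lee_fin ler_pM2l// lerDl.
apply: (@mean_L1_bound R sigma B T L sigma_gt0 B_ge0 mL L_lip _ _ P FN F T_gt0 mFN FN01 mF F01 h _ h0 _ t t0 tT).
move=> s n ns sn sT.
have q0 (i : 'I_N) : bm (fun _ : Omega => 0 : R) by exact: bm_cst.
have Eq (i : 'I_N) : \int[P]_w (0 : R) <= 0 by rewrite Ex_cst.
have hq (i : 'I_N) : {ae P, forall w, \sum_(k < n.+1) `|step_error sigma Lambda W Y h s n i k w| <= 0}.
  have he := step_error_euler HC1 lamB N_gt0 Hsol i h0 ns sn sT.
  apply: filterS he => w hw.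
  by rewrite big1// => k _; rewrite hw normr0.
have [V [mV V0 hV EV]] := particle_mild T_gt0 sigma_gt0 HC1 lamB N_gt0 Hsol Wbm Wind xi_moment mi_sum h0 ns sn sT
  q0 (fun i w => lexx 0) Eq hq.
exists V, (coarse_cst T sigma B K * h); split => //.
  exact: (L1_mild_coarse T_gt0 sigma_gt0 HC1 lamB Hlim K0 lamK h0 ns sn sT).
apply: le_trans (leeD (leeD EV (lexx _)) mean_L1_start) _.
rewrite -!EFinD lee_fin mulr0 addr0; apply: alg; last exact: aE.
by apply: ler_wpM2r; [exact: ltW|exact: ler_norm].
Qed.

Lemma sup_error_le E : (forall t, 0 <= t <= T -> (U t <= E%:E)%E) -> (sup_error T X Y <= (2 * E)%:E)%E.
Proof.
move=> H; apply: ge_ereal_sup => _ [t /= tT <-]; rewrite in_itv/= in tT.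
apply: (@le_trans _ _ (\int[P]_w (2%:E * L1 mu (fun y => (FN w t y - F t y)%R)))%E).
  (* The distance is not known to be measurable in w; its mean is a supremum over simple minorants
     and is still monotone. *)
  apply: ge0_le_integral_nomeas => w.
    apply: le_ereal_inf_tmp => _ [pi _ <-]; by apply: integral_ge0 => z _; rewrite lee_fin.
  apply: le_trans (@wasserstein1_empirical R N (fun i => Y i t w) (law (X t)) N_gt0) _.
  rewrite le_eqVlt; apply/orP; left; apply/eqP; congr (_ * _)%E; apply: eq_L1 => y.
  by rewrite cdf_of_law.
rewrite ge0_integralZl_EFin//; first last.
- exact: (measurable_L1_diff mFN mF).
- by move=> w _; exact: L1_ge0.
by rewrite EFinM; apply: lee_wpmul2l => //; exact: H.
Qed.

End convergence.

Lemma independent_noise_pair (R : realType) d (Omega : measurableType d) (P : probability Omega R)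
    (xi : forall N, 'I_N -> {RV P >-> R}) (W : nat -> R -> {RV P >-> R}) (i j : nat) :
  independent_noise xi W -> i != j ->
  independent2 P (sigma_family `[0, +oo[ (fun t => W i t)) (sigma_family `[0, +oo[ (fun t => W j t)).
Proof.
move=> [_ H] ij A1 A2 h1 h2.
pose E (k : option nat) := if k == Some i then A1 else A2.
have Ei : E (Some i) = A1 by rewrite /E eqxx.
have Ej : E (Some j) = A2 by rewrite /E (inj_eq Some_inj) eq_sym (negbTE ij).
have := H [fset (Some i); (Some j)]%fset E.
rewrite big_fsetU1 ?inE//= ?(inj_eq Some_inj)// big_seq_fset1 Ei Ej => <-; last first.
  by move=> k; rewrite !inE => /orP[]/eqP ->; rewrite ?Ei ?Ej.
congr (P _); apply/seteqP; split => w.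
  by move=> [a1 a2] k /=; rewrite !inE => /orP[]/eqP ->; rewrite ?Ei ?Ej.
move=> hw; split; first by have := hw (Some i); rewrite /= !inE eqxx Ei; exact.
by have := hw (Some j); rewrite /= !inE eqxx orbT Ej; exact.
Qed.

Lemma cliplam_lipschitz (R : realType) (lambda : R -> R) K : K.-lipschitz_(`[0, 1]) lambda ->
  forall x y, `|cliplam lambda x - cliplam lambda y| <= `|K| * `|x - y|.
Proof.
move=> H x y; have := H (clip x, clip y).
rewrite /= !in_itv/= !clip01 => /(_ (conj isT isT)) h; apply: le_trans h _.
apply: (@le_trans _ _ (`|K| * `|clip x - clip y|)); first by rewrite ler_wpM2r// ler_norm.
by rewrite ler_wpM2l// clip_nonexpansive.
Qed.

Theorem corollary2p7 (R : realType) (T sigma : R) (Lambda lambda : R -> R)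
    (m : probability (measurableTypeR R) R)
    (* the limit process *)
    (d' : measure_display) (Omega' : measurableType d')
    (P' : probability Omega' R) (X0 : {RV P' >-> R})
    (W' X : R -> {RV P' >-> R})
    (* the particles: noises, initial positions, and the system [Y N h] *)
    (d : measure_display) (Omega : measurableType d)
    (P : probability Omega R) (W : nat -> R -> {RV P >-> R})
    (xi : forall N : nat, 'I_N -> {RV P >-> R})
    (Y : forall N : nat, R -> 'I_N -> R -> {RV P >-> R}) :
  0 < T -> 0 < sigma -> C1_on01 Lambda lambda ->
  limit_solution T sigma lambda m X0 W' X ->
  independent_noise xi W ->
  (forall (N : nat) (h : R), (0 < N)%N -> 0 <= h <= T ->
    exists G, particle_solution T sigma Lambda h G (xi N)
                (fun i : 'I_N => W i) (Y N h)) ->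
  (iid_init m xi /\
    (\int[lebesgue_measure]_x
       (Num.sqrt (cdf_of m x * (1 - cdf_of m x)))%:E < +oo)%E) \/
  (optimal_init m xi /\
    (ereal_sup [set x%:E *
         \int[lebesgue_measure]_(y in `[x, +oo[)
           (cdf_of m (- y) + 1 - cdf_of m y)%:E
       | x in `[1%R, +oo[] < +oo)%E) ->
  (exists C : R, forall N : nat, (0 < N)%N ->
    (sup_error T X (Y N 0%R) <= (C / Num.sqrt N%:R)%R%:E)%E) /\
  ((exists K : R, K.-lipschitz_(`[0, 1]) lambda) ->
   exists C : R, forall (N : nat) (h : R), (0 < N)%N -> 0 < h <= T ->
    (sup_error T X (Y N h) <= (C * ((Num.sqrt N%:R)^-1 + h))%R%:E)%E).
Proof.
move=> T0 s0 HC1 Hlim Hnoise Hpart Hinit.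
have [B B0 lamB] := cliplam_bounded HC1.
have [C0 [M0 hinit]] : exists C M0 : R, forall N, (0 < N)%N ->
    (\int[P]_w L1 (@lebesgue_measure R) (fun y => (init_cdf (@xi N) w y - cdf_of m y)%R) <= (C / Num.sqrt N%:R)%:E)%E /\
    (\sum_(i < N) \int[P]_w (weight (xi N i w))%:E <= (N%:R * M0)%:E)%E.
  by case: Hinit => -[h1 h2]; [exact: iid_init_bounds h1 h2|exact: optimal_init_bounds h1 h2].
have [Wbm _] := Hnoise.
have Wbm' N (i : 'I_N) : standard_brownian_motion (W i) by exact: Wbm.
have Wind N (i j : 'I_N) : i != j ->
    independent2 P (sigma_family `[0, +oo[ (fun t => W i t)) (sigma_family `[0, +oo[ (fun t => W j t)).
  by move=> ij; exact: (independent_noise_pair Hnoise).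
pose S := stability_cst sigma B T; pose A := convergence_cst T sigma B C0 M0.
have S1 : 1 <= S by exact: (stability_cst_ge1 s0 B0 T0).
have A0 : 0 <= A by exact: convergence_cst_ge0.
split.
  exists (2 * (S * A)) => N N0.
  have T00 : 0 <= (0 : R) <= T by rewrite lexx ltW.
  have [G Hsol] := Hpart N 0 N0 T00; have [i1 i2] := hinit N N0.
  have -> : 2 * (S * A) / Num.sqrt N%:R = 2 * (S * (A / Num.sqrt N%:R)) by rewrite !mulrA.
  apply: (sup_error_le N0) => t tT.
  exact: (mean_L1_continuous T0 s0 HC1 lamB Hlim N0 Hsol (@Wbm' N) (@Wind N) i1 i2 (erefl 0) tT).
move=> [K HK].
have K0 : 0 <= `|K| by [].
pose pc := path_cst sigma T B + `|coarse_cst T sigma B `|K| |.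
have pc0 : 0 <= pc by apply: addr_ge0; [exact: path_cst_ge0|exact: normr_ge0].
exists (2 * (S * (A + pc))) => N h N0 /andP[h0 hT].
have h0T : 0 <= h <= T by rewrite ltW.
have [G Hsol] := Hpart N h N0 h0T; have [i1 i2] := hinit N N0.
apply: (@le_trans _ _ (2 * (S * (A / Num.sqrt N%:R + pc * h)))%:E).
  apply: (sup_error_le N0) => t tT.
  exact: (mean_L1_euler T0 s0 HC1 lamB Hlim N0 Hsol (@Wbm' N) (@Wind N) i1 i2 K0 (cliplam_lipschitz HK) h0 tT).
rewrite lee_fin -!mulrA ler_wpM2l// ler_wpM2l ?(le_trans ler01)//.
have r0 : 0 <= (Num.sqrt N%:R)^-1 :> R by rewrite invr_ge0.
(* A single constant for both rates: the two cross terms are nonnegative. *)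
have -> : (A + pc) * ((Num.sqrt N%:R)^-1 + h) = A / Num.sqrt N%:R + pc * h + (A * h + pc / Num.sqrt N%:R).
  by move: (Num.sqrt _)^-1 => r; ring.
by rewrite lerDl; apply: addr_ge0; apply: mulr_ge0 => //; exact: ltW.
Qed.
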